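(* Let $\eta\in(0,\eta_0)$. Let $\rho^0\in C^3(\mathbb{T}^d)$ be an initial density with $\rho^0\ge\sigma>0$ for some $\sigma>0$, and let $\mathbf{u}^0_\varepsilon$ be initial velocities satisfying $\|\mathbf{u}^0_\varepsilon\|_{L^2(\mathbb{T}^d)}\to0$ as $\varepsilon\to0$. Let $(\rho_{\eta,\varepsilon},\overline{\sqrt{\rho_{\eta,\varepsilon}}\mathbf{u}_{\eta,\varepsilon}},\nu^{\eta,\varepsilon},m_{\eta,\varepsilon})$ be a dissipative measure-valued solution of the nonlocal Euler-Korteweg system on $(0,T)\times\mathbb{T}^d$ with parameters $\varepsilon,\eta$ and initial condition $(\rho^0,\mathbf{u}^0_\varepsilon)$, satisfying the nonlocal Poincaré inequality. Let $\rho_\eta$ be the (classical) solution of the nonlocal Cahn-Hilliard equation $\partial_t\rho=\mathrm{div}(\rho\nabla\mu)$, $\mu=B_\eta[\rho]+F'(\rho)$, with initial condition $\rho^0$. Then, as $\varepsilon\to0$: (i) $\displaystyle\operatorname*{ess\,sup}_{t\in(0,T)}\int_{\mathbb{T}^d}\big|\overline{\sqrt{\rho_{\eta,\varepsilon}}\mathbf{u}_{\eta,\varepsilon}}\big|^2\,dx\to0$; (ii) $\displaystyle\operatorname*{ess\,sup}_{t\in(0,T)}\int_{\mathbb{T}^d}\big[\mathcal{W}_2(\nu^{\eta,\varepsilon}_{t,x},\delta_{\rho_\eta(t,x)}\otimes\delta_{\mathbf{0}})\big]^2\,dx\to0$; (iii) $\displaystyle\operatorname*{ess\,sup}_{t\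in(0,T)}\|m_{\eta,\varepsilon}(t,\cdot)\|_{TV}\to0$.
   Context: **Setting.** $\mathbb{T}^d$ is the $d$-dimensional flat torus, $T>0$ is a final time, $(f)_{\mathbb{T}^d}$ is the average of $f$ over $\mathbb{T}^d$. $\omega$ is a usual (smooth, nonnegative) radial mollification kernel, compactly supported in the unit ball of $\mathbb{R}^d$, with $\int\omega=1$, $\int y\,\omega(y)\,dy=0$, $\int y_iy_j\omega(y)\,dy=\delta_{i,j}\frac{2D}{d}<\infty$; $\omega_\eta(x)=\eta^{-d}\omega(x/\eta)$ (viewed on $\mathbb{T}^d$ for small $\eta$), and $B_\eta[\rho]=\eta^{-2}(\rho-\omega_\eta*\rho)$. The parameter $\eta>0$ is small. **Poincaré constants.** $\eta_0>0$ and $C_P>0$ are fixed constants such that for all $\eta\in(0,\eta_0)$ and $f\in L^2(\mathbb{T}^d)$: $\|f-(f)_{\mathbb{T}^d}\|_{L^2}^2\le C_P\int_{\mathbb{T}^d}\int_{\mathbb{T}^d}\frac{|f(x)-f(y)|^2}{4\eta^2}\omega_\eta(|x-y|)\,dx\,dy$. **Assumption on $F$.** There are $k\ge2$ and $C>0$ such that $F=F_1+F_2$, where: (1) $F_1\in C^4(\mathbb{R})$ is convex, nonnegative, $\frac1C|u|^k-C\le F_1(u)\le C|u|^k+C$, $\frac1C|u|^{k-2}-C\le F_1''(u)\le C|u|^{k-2}+C$, $|uF_1'(u)|\le C(F_1(u)+1)$, $|uF_1^{(3)}(u)|\le C(F_1''(u)+1)$; (2) $F_2\in C^4(\mathbb{R})$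 with $F_2,F_2',F_2'',sF_2^{(3)}(s)$ bounded on $\mathbb{R}$ and $\|F_2''\|_\infty<1/C_P$. $C_F$ denotes a constant with $|\rho F'(\rho)|\le C_FF(\rho)+C_F\rho^2+C_F$. **Nonlocal Euler-Korteweg system** with parameters $\varepsilon,\eta>0$: $\partial_t\rho+\frac1\varepsilon\mathrm{div}(\rho\mathbf{u})=0$, $\ \partial_t(\rho\mathbf{u})+\frac1\varepsilon\mathrm{div}(\rho\mathbf{u}\otimes\mathbf{u})=-\frac1{\varepsilon^2}\rho\mathbf{u}-\frac1\varepsilon\rho\nabla(F'(\rho)+B_\eta[\rho])$. **Measure-valued solution.** A tuple $(\rho,\overline{\sqrt\rho\mathbf{u}},\nu,m)$ with $\nu=\{\nu_{t,x}\}\in L^\infty_{weak}((0,T)\times\mathbb{T}^d;\mathcal{P}([0,\infty)\times\mathbb{R}^d))$ (variables $(\lambda_1,\lambda')\in[0,\infty)\times\mathbb{R}^d$, $\langle\cdot,\nu\rangle$ denotes integration), $\rho=\langle\lambda_1,\nu\rangle\in L^\infty(0,T;L^2)$, $\overline{\sqrt\rho\mathbf{u}}=\langle\lambda',\nu\rangle\in L^\infty(0,T;L^2)$, $m=(m^{\rho^2},m^{\rho\mathbf{u}\otimes\mathbf{u}},m^{\rho|\mathbf{u}|^2},m^{F(\rho)},m^{\rho F'(\rho)})$ with $m^{\rho^2},m^{\rho|\mathbf{u}|^2},m^{F(\rho)}\in L^\infty(0,T;\mathcal{M}^+(\mathbb{T}^d))$, $m^{\rho F'(\rho)}\in L^\infty(0,T;\mathcal{M}(\mathbb{T}^d))$,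 $m^{\rho\mathbf{u}\otimes\mathbf{u}}\in L^\infty(0,T;\mathcal{M}(\mathbb{T}^d)^{d\times d})$, $|m^{\rho\mathbf{u}\otimes\mathbf{u}}|\le m^{\rho|\mathbf{u}|^2}$ and $|m^{\rho F'(\rho)}|\le C_Fm^{F(\rho)}+C_Fm^{\rho^2}$. Set $\overline{\rho^2}=\langle\lambda_1^2,\nu\rangle+m^{\rho^2}$, $\overline{\rho\mathbf{u}}=\langle\sqrt{\lambda_1}\lambda',\nu\rangle$, $\overline{\rho\mathbf{u}\otimes\mathbf{u}}=\langle\lambda'\otimes\lambda',\nu\rangle+m^{\rho\mathbf{u}\otimes\mathbf{u}}$, $\overline{\rho|\mathbf{u}|^2}=\langle|\lambda'|^2,\nu\rangle+m^{\rho|\mathbf{u}|^2}$, $\overline{F(\rho)}=\langle F(\lambda_1),\nu\rangle+m^{F(\rho)}$, $\overline{\rho F'(\rho)}=\langle\lambda_1F'(\lambda_1),\nu\rangle+m^{\rho F'(\rho)}$, $\overline{p(\rho)}=\overline{\rho F'(\rho)}-\overline{F(\rho)}+\frac1{2\eta^2}\overline{\rho^2}$. (Barred quantities are measures; $\int\cdot\,dx$ of them means integration against the measure, which is defined for a.e. $t$.) It is a measure-valued solution with initial data $(\rho^0,\mathbf{u}^0)$ if for all $\psi\in C_c^1([0,T)\times\mathbb{T}^d;\mathbb{R})$, $\phi\in C^1_c([0,T)\times\mathbb{T}^d;\mathbb{R}^d)$: $$\int_0^T\!\!\int_{\mathbb{T}^d}\partial_t\psi\,\rho+\tfrac1\varepsilon\nabla\psi\cdot\overline{\rho\mathbf{u}}\,dx\,dt+\int_{\mathbb{T}^d}\psi(x,0)\rho^0\,dx=0,$$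 $$\int_0^T\!\!\int_{\mathbb{T}^d}\partial_t\phi\cdot\overline{\rho\mathbf{u}}+\tfrac1\varepsilon\nabla\phi:\overline{\rho\mathbf{u}\otimes\mathbf{u}}-\tfrac1{\varepsilon^2}\phi\cdot\overline{\rho\mathbf{u}}+\tfrac1\varepsilon\mathrm{div}\phi\,\overline{p(\rho)}+\tfrac1{\varepsilon\eta^2}\phi\cdot\rho\,\nabla\omega_\eta*\rho\,dx\,dt+\int_{\mathbb{T}^d}\phi(x,0)\cdot\rho^0\mathbf{u}^0\,dx=0.$$ **Nonlinear quantities.** For bounded $P:(0,T)\times\mathbb{T}^d\to[0,\infty)$: $\overline{\int\omega_\eta(y)|\rho(x)-\rho(x-y)|^2dy}:=\overline{\rho^2}+\overline{\rho^2}*\omega_\eta-2\rho\,\omega_\eta*\rho$; $\overline{|\rho-P|^2}:=\overline{\rho^2}+P^2-2\rho P$; $\overline{\int\omega_\eta(y)|(\rho-P)(x)-(\rho-P)(x-y)|^2dy}:=\overline{\int\omega_\eta(y)|\rho(x)-\rho(x-y)|^2dy}+\int\omega_\eta(y)|P(x)-P(x-y)|^2dy-2\int\omega_\eta(y)(P(x)-P(x-y))(\rho(x)-\rho(x-y))dy$. **Dissipative.** With $E_{mvs}(t)=\int_{\mathbb{T}^d}\frac12\overline{\rho|\mathbf{u}|^2}+\overline{F(\rho)}\,dx+\frac1{4\eta^2}\int_{\mathbb{T}^d}\overline{\int\omega_\eta(y)|\rho(x)-\rho(x-y)|^2dy}\,dx$ and $E_0=\int_{\mathbb{T}^d}\frac12\rho^0|\mathbf{u}^0|^2+F(\rho^0)\,dx+\frac1{4\eta^2}\iint\omega_\eta(y)|\rho^0(x)-\rho^0(x-y)|^2dx\,dy$,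 the solution is dissipative if $E_{mvs}(t)+\frac1{\varepsilon^2}\int_0^t\int_{\mathbb{T}^d}\overline{\rho|\mathbf{u}|^2}\,dx\,d\tau\le E_0$ for a.e. $t\in(0,T)$. **Nonlocal Poincaré inequality.** The solution satisfies it if for a.e. $t\in(0,T)$ and all bounded $P:(0,T)\times\mathbb{T}^d\to[0,\infty)$ with $(P)_{\mathbb{T}^d}=(\rho^0)_{\mathbb{T}^d}$: $\int_{\mathbb{T}^d}\overline{|\rho-P|^2}\,dx\le\frac{C_P}{4\eta^2}\int_{\mathbb{T}^d}\overline{\int\omega_\eta(y)|(\rho-P)(x)-(\rho-P)(x-y)|^2dy}\,dx$. **Metrics.** $\mathcal{W}_2$ is the 2-Wasserstein distance on probability measures with finite second moment on $[0,\infty)\times\mathbb{R}^d$ with cost $|\lambda_1-\widetilde\lambda_1|^2+|\lambda'-\widetilde{\lambda'}|^2$. $\|\cdot\|_{TV}$ is the total variation norm; for the vector $m_{\eta,\varepsilon}$ the convergence means that of each of its five components. *)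

(* Defs.v *)
From HB Require Import structures.
From mathcomp Require Import all_boot all_order all_algebra.
From mathcomp Require Import all_classical all_reals all_analysis.
From mathcomp Require Import measurable_realfun ess_sup_inf.
Set Implicit Arguments.
Unset Strict Implicit.
Unset Printing Implicit Defensive.
Import Order.TTheory GRing.Theory Num.Theory.
Import numFieldNormedType.Exports.
Local Open Scope classical_set_scope.
Local Open Scope ring_scope.

Local Notation "f ^` ()" := (derive1 f) : ring_scope.
Local Notation "f ^` ( n )" := (derive1n n f) : ring_scope.

Definition measure_row_display : measure_display -> measure_display.
Proof. exact. Qed.

Section measurable_row.
Context {d} {T : sigmaRingType d} (n : nat).

Let coors : 'I_n -> 'rV[T]_n -> T := fun i x => x ord0 i.

Let row_set0 : g_sigma_preimage coors set0.
Proof. exact: sigma_algebra0. Qed.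

Let row_setC A : g_sigma_preimage coors A -> g_sigma_preimage coors (~` A).
Proof. exact: sigma_algebraC. Qed.

Let row_bigcup (F : (set 'rV[T]_n)^nat) :
  (forall i, g_sigma_preimage coors (F i)) ->
  g_sigma_preimage coors (\bigcup_i (F i)).
Proof. exact: sigma_algebra_bigcup. Qed.

(* The product sigma-algebra on T^n; for T = R it is the Borel one. *)
HB.instance Definition _ := @isMeasurable.Build (measure_row_display d)
  'rV[T]_n (g_sigma_preimage coors) row_set0 row_setC row_bigcup.

End measurable_row.

Lemma measurable_coord d (T : sigmaRingType d) n (i : 'I_n) :
  measurable_fun [set: 'rV[T]_n] (fun x => x ord0 i).
Proof.
move=> _ Y mY; rewrite setTI; apply: sub_sigma_algebra => /=.
rewrite -bigcup_seq/=; exists i => /=; first by rewrite mem_index_enum.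
by exists Y => //; rewrite setTI.
Qed.

Lemma measurable_rowP d1 d2 (T1 : measurableType d1) (T2 : measurableType d2)
    n (f : T1 -> 'rV[T2]_n) :
  (forall i, measurable_fun [set: T1] (fun x => f x ord0 i)) ->
  measurable_fun [set: T1] f.
Proof.
move=> mf _ A mA; rewrite setTI.
pose coors := fun (i : 'I_n) (x : 'rV[T2]_n) => x ord0 i.
have : preimage_set_system setT f (g_sigma_preimage coors) (f @^-1` A).
  by exists A => //; rewrite setTI.
rewrite -g_sigma_preimage_comp; apply: smallest_sub => //.
  exact: sigma_algebra_measurable.
case: n => [|n] in f mf coors A mA *; first by rewrite big_ord0.
rewrite -bigcup_mkord_ord; apply: bigcup_sub => i Ii.
by move=> B [C mC <-]; exact: mf.
Qed.

Section lebesgue_row.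
Context {R : realType}.

Definition row_cons n (z : R * 'rV[R]_n) : 'rV[R]_n.+1 :=
  \row_j oapp (fun k => z.2 ord0 k) z.1 (unlift ord0 j).

Definition row_uncons n (x : 'rV[R]_n.+1) : R * 'rV[R]_n :=
  (x ord0 ord0, \row_k x ord0 (lift ord0 k)).

Lemma row_consK n : cancel (@row_cons n) (@row_uncons n).
Proof.
move=> [a v]; congr pair; first by rewrite mxE unlift_none.
by apply/rowP => k; rewrite !mxE liftK.
Qed.

Lemma measurable_row_cons n : measurable_fun setT (@row_cons n).
Proof.
apply: measurable_rowP => j; rewrite /row_cons.
under eq_fun do rewrite mxE.
case: (unliftP ord0 j) => [k _|_] /=; last exact: measurable_fst.
apply: (@measurableT_comp _ _ _ _ _ _ (fun v : 'rV[R]_n => v ord0 k)).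
  exact: measurable_coord.
exact: measurable_snd.
Qed.

Lemma measurable_row_uncons n : measurable_fun setT (@row_uncons n).
Proof.
apply/measurable_fun_pairP; split; first exact: measurable_coord.
apply: measurable_rowP => k; rewrite /comp /=.
under eq_fun do rewrite mxE.
exact: measurable_coord.
Qed.

Section lebesgue_cons.
Variables (n : nat) (m : {sigma_finite_measure set 'rV[R]_n -> \bar R}).

Definition lebesgue_cons : set 'rV[R]_n.+1 -> \bar R :=
  pushforward (lebesgue_measure \x m)%E (@row_cons n).

Let pm : {measure set 'rV[R]_n.+1 -> \bar R} :=
  measure_function_pushforward__canonical__measure_function_Measure
    (lebesgue_measure \x m)%E (@measurable_row_cons n).

HB.instance Definition _ := isMeasure.Build _ _ _ lebesgue_cons
  (measure0 pm) (measure_ge0 pm) (@measure_semi_sigma_additive _ _ _ pm).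

Let lebesgue_cons_sigma_finite : sigma_finite setT lebesgue_cons.
Proof.
have /sigma_finiteP[F [TF ndF Foo]] := sigma_finiteT (@lebesgue_measure R).
have /sigma_finiteP[G [TG ndG Goo]] := sigma_finiteT m.
exists (fun k => @row_uncons n @^-1` (F k `*` G k)).
  rewrite -preimage_bigcup (_ : \bigcup_k _ = setT) ?preimage_setT//.
  rewrite -subTset => -[x y] _.
  have [i _ Fix] : (\bigcup_k F k) x by rewrite -TF.
  have [j _ Gjy] : (\bigcup_k G k) y by rewrite -TG.
  exists (maxn i j) => //; split.
  - by move: x Fix; exact/subsetPset/ndF/leq_maxl.
  - by move: y Gjy; exact/subsetPset/ndG/leq_maxr.
move=> k; have [mF Fk] := Foo k; have [mG Gk] := Goo k; split.
  rewrite -[X in measurable X]setTI; apply: measurable_row_uncons => //.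
  exact: measurableX.
rewrite /lebesgue_cons /pushforward -comp_preimage.
rewrite (_ : @row_uncons n \o @row_cons n = id) ?preimage_id.
  by rewrite product_measure1E// lte_mul_pinfty// ge0_fin_numE.
by apply/funext => z /=; rewrite row_consK.
Qed.

HB.instance Definition _ := Measure_isSigmaFinite.Build _ _ _ lebesgue_cons
  lebesgue_cons_sigma_finite.

End lebesgue_cons.

Fixpoint lebesgue_row n : {sigma_finite_measure set 'rV[R]_n -> \bar R} :=
  if n is m.+1 then lebesgue_cons (lebesgue_row m) else \d_(0 : 'rV[R]_0).

End lebesgue_row.
Arguments lebesgue_row {R} n.

(* T^d is R^d / Z^d: a function on T^d is a Z^d-periodic function on R^d,
   a measure on T^d is a measure on the fundamental domain [0, 1[^d. *)
Section torus.
Context {R : realType} {d : nat}.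
Local Notation E := 'rV[R]_d.

Definition cube : set E := [set x | forall i, 0 <= x ord0 i < 1].

Lemma measurable_cube : measurable cube.
Proof.
rewrite (_ : cube = \bigcap_(k in [set: nat]) \bigcap_(i in [set i : 'I_d | i = k :> nat])
    ((fun x : E => x ord0 i) @^-1` [set` `[0, 1[%R])).
  apply: bigcap_measurable => //.
  move=> k _; have [kd|dk] := ltnP k d.
    rewrite (_ : [set i : 'I_d | _] = [set Ordinal kd]).
      rewrite bigcap_set1 -[X in measurable X]setTI.
      by apply: measurable_coord => //; exact: measurable_itv.
    by apply/seteqP; split => i /= ?; [exact/val_inj|subst i].
  rewrite (_ : [set i : 'I_d | _] = set0) ?bigcap_set0//.
  by rewrite -subset0 => i /= ik; move: (ltn_ord i); rewrite ik ltnNge dk.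
apply/seteqP; split => x /= h.
  by move=> k _ i _ /=; rewrite in_itv; exact: h.
by move=> i; have := h i Logic.I i erefl; rewrite /= in_itv.
Qed.

Definition torus_measure : {measure set E -> \bar R} :=
  mrestr (lebesgue_row d) measurable_cube.

Definition basis_vec (i : 'I_d) : E := delta_mx ord0 i.

Definition Zd_periodic (V : Type) (f : E -> V) :=
  forall x i, f (x + basis_vec i) = f x.

Definition enorm (x : E) : R := Num.sqrt (\sum_i x ord0 i ^+ 2).

Definition partial (i : 'I_d) (f : E -> R) : E -> R :=
  fun x => 'D_(basis_vec i) f x.

Fixpoint Ck (n : nat) (f : E -> R) : Prop :=
  continuous f /\
  if n is m.+1 then
    forall i, (forall x, derivable f x (basis_vec i)) /\ Ck m (partial i f)
  else True.

Definition average (f : E -> R) : R := \int[torus_measure]_x f x.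

Definition L2norm (f : E -> R) : \bar R :=
  ('N[torus_measure]_2%:E [EFin \o f])%E.

Definition convol (k f : E -> R) (x : E) : R :=
  \int[lebesgue_row d]_y (k y * f (x - y)).

End torus.

Section time.
Context {R : realType}.

Definition time_measure (T : R) : {measure set (measurableTypeR R) -> \bar R} :=
  mrestr lebesgue_measure (measurable_itv `]0, T[).

Definition Ck1 (n : nat) (f : R -> R) : Prop :=
  (forall m, (m < n)%N -> forall x, derivable (f^`(m)) x 1) /\
  (forall m, (m <= n)%N -> continuous (f^`(m))).

Definition bounded_real (f : R -> R) : Prop := exists M, forall x, `|f x| <= M.

End time.

Section kernel_and_potential.
Context {R : realType} {d : nat}.
Local Notation E := 'rV[R]_d.

Definition mollifier (D : R) (omega : E -> R) : Prop :=
  [/\ forall n, Ck n omega,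
      forall x, 0 <= omega x,
      forall x y, enorm x = enorm y -> omega x = omega y &
      forall x, omega x != 0 -> enorm x <= 1] /\
  [/\ \int[lebesgue_row d]_y omega y = 1,
      forall i, \int[lebesgue_row d]_y (y ord0 i * omega y) = 0 &
      forall i j, \int[lebesgue_row d]_y (y ord0 i * y ord0 j * omega y)
        = (i == j)%:R * (2 * D / d%:R)].

Definition scaled (omega : E -> R) (eta : R) : E -> R :=
  fun x => eta ^- d * omega (eta^-1 *: x).

Definition B_op (omega : E -> R) (eta : R) (rho : E -> R) : E -> R :=
  fun x => eta ^- 2 * (rho x - convol (scaled omega eta) rho x).

(* The inner integral over T^d of the periodized kernel is unfolded to R^d. *)
Definition poincare_constants (omega : E -> R) (eta0 CP : R) : Prop :=
  forall eta, 0 < eta < eta0 -> forall f : E -> R,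
    Zd_periodic f -> measurable_fun setT f -> (L2norm f < +oo)%E ->
    (L2norm (fun x => (f x - average f)%R) ^+ 2 <=
     CP%:E * \int[torus_measure]_x \int[lebesgue_row d]_y
       (`|f x - f y| ^+ 2 / (4 * eta ^+ 2) * scaled omega eta (x - y))%:E)%E.

Definition potential_assumption (CP : R) (F : R -> R) : Prop :=
  exists (k C : R) (F1 F2 : R -> R),
  [/\ 2 <= k, 0 < C, (forall u, F u = F1 u + F2 u),
      [/\ Ck1 4 F1, convex_function setT (F1 : convex_lmodType R^o -> R^o),
          (forall u, 0 <= F1 u) &
          [/\ forall u, C^-1 * `|u| `^ k - C <= F1 u <= C * `|u| `^ k + C,
              forall u, C^-1 * `|u| `^ (k - 2) - C <= F1^`(2) u
                          <= C * `|u| `^ (k - 2) + C,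
              forall u, `|u * F1^`() u| <= C * (F1 u + 1) &
              forall u, `|u * F1^`(3) u| <= C * (F1^`(2) u + 1)]] &
      [/\ Ck1 4 F2,
          [/\ bounded_real F2, bounded_real F2^`(), bounded_real F2^`(2) &
              bounded_real (fun s => s * F2^`(3) s)] &
          sup [set `|F2^`(2) s| | s in setT] < CP^-1]].

(* r stands for a density, hence 0 <= r. *)
Definition CF_bound (F : R -> R) (CF : R) : Prop :=
  forall r, 0 <= r -> `|r * F^`() r| <= CF * F r + CF * r ^+ 2 + CF.

End kernel_and_potential.

Section measures.
Context {R : realType} {d : nat}.
Local Notation E := 'rV[R]_d.

(* Total variation on A of the I-indexed vector of set functions mu, for the
   Euclidean norm on R^I; I is unit for scalar measures and 'I_d * 'I_d,
   giving the Frobenius norm, for matrix-valued ones. *)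
Definition vec_variation (I : finType) (mu : I -> set E -> \bar R) (A : set E)
    : \bar R :=
  ereal_sup [set s | exists n (B : 'I_n -> set E),
    [/\ forall k, measurable (B k), trivIset setT B, \bigcup_k B k = A &
        s = (\sum_(k < n) (Num.sqrt (\sum_i fine (mu i (B k)) ^+ 2))%:E)%E]].

Definition tv_norm (mu : set E -> \bar R) : \bar R :=
  vec_variation (fun _ : unit => mu) cube.

Definition tv_norm_mx (mu : 'I_d -> 'I_d -> set E -> \bar R) : \bar R :=
  vec_variation (fun ij : 'I_d * 'I_d => mu ij.1 ij.2) cube.

Definition charge_integral (nu : {charge set E -> \bar R}) (f : E -> R) : R :=
  let: exist P hP := cid (Hahn_decomposition nu) in
  let: exist N hPN := cid hP in
  \int[jordan_pos hPN]_(x in cube) f x - \int[jordan_neg hPN]_(x in cube) f x.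

Definition essentially_bounded (T : R) (f : R -> \bar R) : Prop :=
  (ess_sup (time_measure T) f < +oo)%E.

Definition weakly_measurable (T : R) (mu : R -> set E -> \bar R) : Prop :=
  forall A, measurable A -> A `<=` cube ->
    measurable_fun `]0, T[ (fun t => mu t A).

End measures.

Section wasserstein.
Context {R : realType} {d : nat}.
Local Notation Y := (R * 'rV[R]_d)%type.

Definition coupling (mu nu : set Y -> \bar R) : set (probability (Y * Y)%type R) :=
  [set pi | forall A : set Y, measurable A ->
    pi (A `*` setT) = mu A /\ pi (setT `*` A) = nu A].

Definition W2 (mu nu : set Y -> \bar R) : \bar R :=
  sqrte (ereal_inf [set (\int[pi]_z
    (`|z.1.1 - z.2.1| ^+ 2 + enorm (z.1.2 - z.2.2) ^+ 2)%:E)%E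
    | pi in coupling mu nu]).

End wasserstein.

(* The data (nu, m). The remaining entries of the tuple, rho and
   sqrt(rho) u, are the barycenters of nu, defined below. *)
Record mv_data (R : realType) (d : nat) := MVData {
  young : R.-pker (R * 'rV[R]_d)%type ~> (R * 'rV[R]_d)%type ;
  m_rho2 : R -> {finite_measure set 'rV[R]_d -> \bar R} ;
  m_ruu : 'I_d -> 'I_d -> R -> {charge set 'rV[R]_d -> \bar R} ;
  m_ru2 : R -> {finite_measure set 'rV[R]_d -> \bar R} ;
  m_F : R -> {finite_measure set 'rV[R]_d -> \bar R} ;
  m_rF' : R -> {charge set 'rV[R]_d -> \bar R} }.

Section measure_valued.
Context {R : realType} {d : nat}.
Local Notation E := 'rV[R]_d.
Variables (omega : E -> R) (F : R -> R) (T eps eta : R) (s : mv_data R d).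

Definition ymean (f : R * E -> R) (t : R) (x : E) : R :=
  \int[young s (t, x)]_l f l.

Definition mv_rho : R -> E -> R := ymean (fun l => l.1).
Definition mv_sru (t : R) (x : E) : E :=
  \row_i ymean (fun l => l.2 ord0 i) t x.
Definition mv_ru (t : R) (x : E) : E :=
  \row_i ymean (fun l => Num.sqrt l.1 * l.2 ord0 i) t x.

(* Each barred measure at time t is given by its action
   phi |-> \int_{T^d} phi d(bar) on functions on the torus. *)
Definition bar_rho2 (t : R) (phi : E -> R) : R :=
  \int[torus_measure]_x (phi x * ymean (fun l => l.1 ^+ 2) t x)
  + \int[m_rho2 s t]_(x in cube) phi x.

Definition bar_ruu (i j : 'I_d) (t : R) (phi : E -> R) : R :=
  \int[torus_measure]_x
    (phi x * ymean (fun l => l.2 ord0 i * l.2 ord0 j) t x)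
  + charge_integral (m_ruu s i j t) phi.

Definition bar_ru2 (t : R) (phi : E -> R) : R :=
  \int[torus_measure]_x (phi x * ymean (fun l => enorm l.2 ^+ 2) t x)
  + \int[m_ru2 s t]_(x in cube) phi x.

Definition bar_F (t : R) (phi : E -> R) : R :=
  \int[torus_measure]_x (phi x * ymean (fun l => F l.1) t x)
  + \int[m_F s t]_(x in cube) phi x.

Definition bar_rF' (t : R) (phi : E -> R) : R :=
  \int[torus_measure]_x (phi x * ymean (fun l => l.1 * F^`() l.1) t x)
  + charge_integral (m_rF' s t) phi.

Definition bar_p (t : R) (phi : E -> R) : R :=
  bar_rF' t phi - bar_F t phi + (2 * eta ^+ 2)^-1 * bar_rho2 t phi.

(* mu * omega_eta acts on phi by integrating
   x |-> \int omega_eta(y) phi(x + y) dy against mu. *)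
Definition bar_rho2_conv (t : R) (phi : E -> R) : R :=
  bar_rho2 t (fun x => \int[lebesgue_row d]_y (scaled omega eta y * phi (x + y))).

Definition bar_nonlocal (t : R) (phi : E -> R) : R :=
  bar_rho2 t phi + bar_rho2_conv t phi
  - 2 * \int[torus_measure]_x
      (phi x * (mv_rho t x * convol (scaled omega eta) (mv_rho t) x)).

Definition bar_diff2 (P : R -> E -> R) (t : R) (phi : E -> R) : R :=
  bar_rho2 t phi + \int[torus_measure]_x (phi x * P t x ^+ 2)
  - 2 * \int[torus_measure]_x (phi x * (mv_rho t x * P t x)).

Definition bar_nonlocal_diff (P : R -> E -> R) (t : R) (phi : E -> R) : R :=
  bar_nonlocal t phi
  + \int[torus_measure]_x (phi x * \int[lebesgue_row d]_y
      (scaled omega eta y * `|P t x - P t (x - y)| ^+ 2))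
  - 2 * \int[torus_measure]_x (phi x * \int[lebesgue_row d]_y
      (scaled omega eta y * (P t x - P t (x - y))
         * (mv_rho t x - mv_rho t (x - y)))).

(* Makes the barred quantities finite measures on ]0, T[ x T^d. *)
Definition time_space_integrable (f : R * E -> R) : Prop :=
  (\int[time_measure T]_t \int[torus_measure]_x \int[young s (t, x)]_l
     `|f l|%:E < +oo)%E.

Definition young_class : Prop :=
  [/\ forall A, measurable A -> forall t, Zd_periodic (fun x => young s (t, x) A),
      {ae time_measure T, forall t, {ae torus_measure, forall x,
        young s (t, x) [set l | l.1 < 0] = 0%E}},
      essentially_bounded T (fun t => L2norm (mv_rho t)),
      essentially_bounded T (fun t => L2norm (fun x => enorm (mv_sru t x))) &
      [/\ time_space_integrable (fun l => l.1 ^+ 2),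
          time_space_integrable (fun l => enorm l.2 ^+ 2),
          time_space_integrable (fun l => F l.1) &
          time_space_integrable (fun l => l.1 * F^`() l.1)]].

Definition concentration_class (CF : R) : Prop :=
  [/\ [/\ weakly_measurable T (m_rho2 s),
          forall i j, weakly_measurable T (m_ruu s i j),
          weakly_measurable T (m_ru2 s),
          weakly_measurable T (m_F s) &
          weakly_measurable T (m_rF' s)],
      [/\ essentially_bounded T (fun t => tv_norm (m_rho2 s t)),
          essentially_bounded T (fun t => tv_norm_mx (fun i j => m_ruu s i j t)),
          essentially_bounded T (fun t => tv_norm (m_ru2 s t)),
          essentially_bounded T (fun t => tv_norm (m_F s t)) &
          essentially_bounded T (fun t => tv_norm (m_rF' s t))],
      {ae time_measure T, forall t, forall A, measurable A -> A `<=` cube ->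
        (vec_variation (fun ij : 'I_d * 'I_d => m_ruu s ij.1 ij.2 t) A
         <= m_ru2 s t A)%E} &
      {ae time_measure T, forall t, forall A, measurable A -> A `<=` cube ->
        (vec_variation (fun _ : unit => m_rF' s t) A
         <= CF%:E * m_F s t A + CF%:E * m_rho2 s t A)%E}].

(* C^1_c([0, T) x T^d), as restrictions to t >= 0 of C^1 functions on R x T^d. *)
Definition test_function (psi : R -> E -> R) : Prop :=
  [/\ forall t, Zd_periodic (psi t),
      (forall t x, derivable (psi ^~ x) t 1) /\
      (forall t x i, derivable (psi t) x (basis_vec i)),
      continuous (fun z : R * E => (psi ^~ z.2)^`() z.1) /\
      (forall i, continuous (fun z : R * E => partial i (psi z.1) z.2)) &
      exists2 tau, tau < T & forall t x, tau <= t -> psi t x = 0].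

Definition weak_continuity (rho0 : E -> R) : Prop :=
  forall psi, test_function psi ->
  \int[time_measure T]_t \int[torus_measure]_x
    ((psi ^~ x)^`() t * mv_rho t x
     + eps^-1 * \sum_i partial i (psi t) x * mv_ru t x ord0 i)
  + \int[torus_measure]_x (psi 0 x * rho0 x) = 0.

(* Convention: (grad phi)_ij = d_j phi_i. *)
Definition weak_momentum (rho0 : E -> R) (u0 : E -> E) : Prop :=
  forall phi : 'I_d -> R -> E -> R, (forall i, test_function (phi i)) ->
  \int[time_measure T]_t
    (\int[torus_measure]_x (\sum_i (phi i ^~ x)^`() t * mv_ru t x ord0 i)
     + eps^-1 * \sum_i \sum_j bar_ruu i j t (partial j (phi i t))
     - eps ^- 2 * \int[torus_measure]_x (\sum_i phi i t x * mv_ru t x ord0 i)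
     + eps^-1 * bar_p t (fun x => \sum_i partial i (phi i t) x)
     + (eps * eta ^+ 2)^-1 * \int[torus_measure]_x (\sum_i phi i t x *
         (mv_rho t x * convol (partial i (scaled omega eta)) (mv_rho t) x)))
  + \int[torus_measure]_x (\sum_i phi i 0 x * (rho0 x * u0 x ord0 i)) = 0.

Definition mv_solution (CF : R) (rho0 : E -> R) (u0 : E -> E) : Prop :=
  [/\ young_class, concentration_class CF, weak_continuity rho0 &
      weak_momentum rho0 u0].

Definition E_mvs (t : R) : R :=
  2^-1 * bar_ru2 t (cst 1) + bar_F t (cst 1)
  + (4 * eta ^+ 2)^-1 * bar_nonlocal t (cst 1).

Definition E_0 (rho0 : E -> R) (u0 : E -> E) : R :=
  \int[torus_measure]_x (2^-1 * (rho0 x * enorm (u0 x) ^+ 2) + F (rho0 x))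
  + (4 * eta ^+ 2)^-1 * \int[torus_measure]_x \int[lebesgue_row d]_y
      (scaled omega eta y * `|rho0 x - rho0 (x - y)| ^+ 2).

Definition dissipative (rho0 : E -> R) (u0 : E -> E) : Prop :=
  {ae time_measure T, forall t,
    E_mvs t + eps ^- 2 * \int[time_measure t]_tau bar_ru2 tau (cst 1)
    <= E_0 rho0 u0}.

Definition nonlocal_poincare (CP : R) (rho0 : E -> R) : Prop :=
  {ae time_measure T, forall t, forall P : R -> E -> R,
    measurable_fun (`]0, T[ `*` setT) (fun z : R * E => P z.1 z.2) ->
    (exists M, forall t x, 0 < t < T -> 0 <= P t x <= M) ->
    (forall t, 0 < t < T -> Zd_periodic (P t)) ->
    (forall t, 0 < t < T -> average (P t) = average rho0) ->
    bar_diff2 P t (cst 1)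
      <= CP / (4 * eta ^+ 2) * bar_nonlocal_diff P t (cst 1)}.

End measure_valued.

Section nonlocal_cahn_hilliard.
Context {R : realType} {d : nat}.
Local Notation E := 'rV[R]_d.

(* Classical means C^{1,2}: the equation gives the continuity of the time
   derivative. *)
Definition classical_solution (omega : E -> R) (F : R -> R) (T eta : R)
    (rho0 : E -> R) (rho : R -> E -> R) : Prop :=
  let mu t x := B_op omega eta (rho t) x + F^`() (rho t x) in
  let slab := `[0, T] `*` [set: E] in
  [/\ forall t, 0 <= t <= T -> Zd_periodic (rho t) /\ Ck 2 (rho t),
      [/\ {within slab, continuous (fun z : R * E => rho z.1 z.2)},
          forall i, {within slab, continuous
            (fun z : R * E => partial i (rho z.1) z.2)} &
          forall i j, {within slab, continuous
            (fun z : R * E => partial j (partial i (rho z.1)) z.2)}],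
      forall t x, 0 < t < T ->
        derivable (rho ^~ x) t 1 /\
        (rho ^~ x)^`() t =
          \sum_i partial i (fun y => rho t y * partial i (mu t) y) x &
      forall x, rho 0 x = rho0 x].

End nonlocal_cahn_hilliard.

(* Main.v *)
Require Import Defs.
From mathcomp Require Import all_boot all_order all_algebra.
From mathcomp Require Import all_classical all_reals all_analysis.
From mathcomp Require Import measurable_realfun ess_sup_inf ring lra.
From HB Require Import structures.
Set Implicit Arguments.
Unset Strict Implicit.
Unset Printing Implicit Defensive.
Import Order.TTheory GRing.Theory Num.Theory.
Import numFieldNormedType.Exports.
Local Open Scope classical_set_scope.
Local Open Scope ring_scope.

(** The proof compares the measure-valued solution with the classical solution
    P of the nonlocal Cahn-Hilliard equation by means of a relative energy.
    Let mu = B_eta[P] + F'(P) be the derivative of the energy at P, let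
    a = grad mu and let

      Theta(t) = E_mvs(t) - int rho mu dx - K(t),

    where K(t) = int F(P) - P F'(P) - P B_eta[P] / 2 dx. This is the energy
    minus its affine approximation at P: it consists of the kinetic energy, of
    the Bregman divergence of F between the microscopic density and P, of half
    the nonlocal quadratic form of rho - P, and of the concentration masses.
    The potential is not convex, but the Poincare inequality bounds the
    quadratic form from below by 1 / C_P times the squared deviation, and this
    absorbs the Bregman divergence of F_2 because |F_2''| <= M2 < 1 / C_P.
    Hence Theta controls all the quantities of the conclusion ([coercive]).
    At the initial time the density is P, and Theta reduces to
    int rho^0 |u^0|^2 / 2 dx, which tends to 0 ([initial_gapE]). It remains to
    prove a Gronwall inequality for Theta.

    Three equations give the evolution of Theta ([theta_evolution]): the
    dissipation inequality for the energy, the weak continuity equation tested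
    with mu ([density_evolution]), and K' = - int P mu_t. The result is

      Theta' <= - eps^-2 int rho |u|^2 dx - eps^-1 int a . (rho u) dx
                - int mu_t rho dx + int P mu_t dx.

    The cross term is singular in eps. Since |lambda' / eps + sqrt(lambda_1) a|^2
    is nonnegative, the damping allows it to be replaced by
    + eps^-1 int a . (rho u) dx + int rho |a|^2 dx ([damping_young]). The weak
    momentum balance tested with a computes this new cross term: it equals the
    stress, pressure and interaction terms, up to eps times the time derivative
    of int a . (rho u) dx ([rate_bound]). The stress is bounded by the kinetic
    energy, whose time integral is of order eps^2. In what is left, the terms
    of order 0 and 1 in the deviation rho - P cancel by the equation satisfied
    by P ([remainderE]), and the rest is bounded by a constant times Theta
    ([remainder_bound]): the assumptions on F bound the Bregman divergence of
    the pressure u F' - F by that of F_1 plus a square, and the concentration of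
    the pressure is controlled by m^F and m^{rho^2}.

    The term eps d/dt int a . (rho u) dx requires care, because a need not be
    differentiable in time. For a field that does not depend on time, the
    primitive of this term is of order eps, because the momentum is bounded
    uniformly in eps ([rate_primitive_small]). The field a is therefore frozen
    on the cells of a time grid ([grid_bound]). The error made by freezing is
    small with the mesh, uniformly in eps, and the number of cells is fixed
    before eps tends to 0. This yields Theta <= o(1) + C int_0^t Theta
    ([theta_gronwall]), and then [deviation_small].

    The conclusions follow: (i) by Jensen's inequality; (ii) because the only
    coupling of a measure with a point mass has as cost the second moment about
    this point ([W2_point]); (iii) because the masses of the concentration
    measures are part of Theta or, for m^{rho u (x) u} and m^{rho F'}, dominated
    by such masses.

    Two points of a different nature are needed. The weak formulations say
    nothing about individual times; at common Lebesgue points they are turned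
    into integrated equations by testing with C^1 cutoffs in time
    ([weak_evolution]). And the density P has to be nonnegative to be admissible
    in the Poincare inequality: this is a minimum principle ([cP_gt0]), which
    requires F'' + eta^-2 >= 0. This bound holds because the Poincare inequality
    for a function with values -1/2 and 1/2 on the two halves of the torus forces
    eta^2 <= C_P ([poincare_constant_ge]). *)

(** * Borel sets, Lebesgue measure and the torus *)

Section row_measurability.
Context {R : realType}.

Lemma measurable_row_ball n (x : 'rV[R]_n) (e : R) : measurable (ball x e).
Proof.
have [e0|e0] := ltP 0 e; last first.
  by rewrite (_ : ball x e = set0) // -subset0 => y [] /(le_lt_trans e0); rewrite ltxx.
rewrite (_ : ball x e = \bigcap_(k in [set: nat])
    \bigcap_(i in [set i : 'I_n | i = k :> nat])
    ((fun y : 'rV[R]_n => y ord0 i) @^-1` ball (x ord0 i) e)).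
  apply: bigcap_measurable => // k _; have [kd|dk] := ltnP k n.
    rewrite (_ : [set i : 'I_n | _] = [set Ordinal kd]).
      rewrite bigcap_set1 -[X in measurable X]setTI.
      by apply: measurable_coord => //; exact: measurable_ball.
    by apply/seteqP; split => i /= ?; [exact/val_inj|subst i].
  rewrite (_ : [set i : 'I_n | _] = set0) ?bigcap_set0//.
  by rewrite -subset0 => i /= ik; move: (ltn_ord i); rewrite ik ltnNge dk.
apply/seteqP; split => y /= h.
  by move=> k _ i _ /=; case: h => _; apply.
by split=> // i j; rewrite ord1; have := h j Logic.I j erefl.
Qed.

(** The product sigma-algebra on row vectors is Borel for the sup-norm
    topology: an open set is a countable union of balls with rational centres
    and radii, and balls are measurable boxes. *)
Lemma measurable_open_row n (U : set 'rV[R]_n) : open U -> measurable U.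
Proof.
move=> oU; pose c (q : 'rV[rat]_n * nat) : 'rV[R]_n := map_mx ratr q.1.
rewrite (_ : U = \bigcup_(q in [set: 'rV[rat]_n * nat])
    (if `[< ball (c q) q.2.+1%:R^-1 `<=` U >] then ball (c q) q.2.+1%:R^-1
     else set0)).
  apply: countable_bigcupT_measurable => [|q].
    exact: countableP.
  by case: ifP => // _; exact: measurable_row_ball.
apply/seteqP; split => [x Ux|x [q _]]; last by case: ifP => // /asboolP h /h.
have /nbhs_ballP[e /= e0 eU] : nbhs x U by apply: open_nbhs_nbhs.
pose k := Num.truncn (2 / e).
have ke : k.+1%:R^-1 < e / 2.
  by rewrite invf_plt ?posrE ?divr_gt0// invf_div truncnS_gt.
have k0 : 0 < k.+1%:R^-1 :> R by rewrite invr_gt0 ltr0n.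
have /choice[q0 hq0] : forall i : 'I_n, exists q : rat,
    ball (x ord0 i) k.+1%:R^-1 (ratr q).
  move=> i; have [] := @rat_in_itvoo R (x ord0 i) (x ord0 i + k.+1%:R^-1).
    by rewrite ltrDl.
  move=> q; rewrite in_itv /= => /andP[q1 q2]; exists q.
  rewrite /ball /= ltr_distlC; apply/andP; split; last by [].
  by apply: lt_trans q1; rewrite ltrBlDr ltrDl.
pose q : 'rV[rat]_n := \row_i q0 i.
have hq i : ball (x ord0 i) k.+1%:R^-1 (ratr (q ord0 i)) by rewrite mxE.
exists (q, k) => //; rewrite ifT.
  split => // i j; rewrite ord1 mxE; apply: ball_sym; exact: hq.
apply/asboolP => y [_ qy]; apply: eU; split=> // i j; rewrite ord1.
apply: (@le_ball _ _ _ (k.+1%:R^-1 + k.+1%:R^-1)).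
  by rewrite [leRHS]splitr lerD// ltW.
apply: ball_triangle (hq j) _.
by have := qy ord0 j; rewrite /c /= mxE.
Qed.

Lemma continuous_measurable_row n (f : 'rV[R]_n -> R) :
  continuous f -> measurable_fun setT f.
Proof.
move=> /continuousP cf; apply: (measurability _ (RGenOpens.measurableE R)).
move=> _ [_ [a [b ->] <-]]; rewrite setTI; apply: measurable_open_row.
exact/cf/interval_open.
Qed.

Lemma continuous_row n (T : topologicalType) (f : T -> 'rV[R]_n) :
  (forall i, continuous (fun t => f t ord0 i)) -> continuous f.
Proof.
move=> cf t; apply/cvg_ballP => e e0.
have : \forall u \near t, forall j, ball (f t ord0 j) e (f u ord0 j).
  by apply: filter_forall => j; have /cvg_ballP := cf j t; apply.
by apply: filterS => u h; split=> // i j; rewrite ord1.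
Qed.



Lemma continuous_pair (T U V : topologicalType) (f : T -> U) (g : T -> V) :
  continuous f -> continuous g -> continuous (fun t => (f t, g t)).
Proof. by move=> cf cg t; apply: cvg_pair; [exact: cf|exact: cg]. Qed.

Lemma continuous_row_uncons n : continuous (@row_uncons R n).
Proof.
apply: continuous_pair => [x|]; first exact: coord_continuous.
apply: continuous_row => k y.
under eq_fun do rewrite mxE.
exact: coord_continuous.
Qed.

Lemma continuous_measurable_prod n (f : R * 'rV[R]_n -> R) :
  continuous f -> measurable_fun setT f.
Proof.
move=> cf; rewrite (_ : f = (f \o @row_uncons R n) \o @row_cons R n).
  apply: measurableT_comp; last exact: measurable_row_cons.
  apply: continuous_measurable_row => x.
  by apply: continuous_comp; [exact: continuous_row_uncons|exact: cf].
by apply/funext => z /=; rewrite row_consK.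
Qed.

Lemma measurable_row_affine n (c : R) (v : 'rV[R]_n) :
  measurable_fun setT (fun x : 'rV[R]_n => c *: x + v).
Proof.
apply: measurable_rowP => i.
rewrite (_ : (fun _ => _) = (fun x : 'rV[R]_n => c * x ord0 i + v ord0 i)).
  apply: measurable_funD => //; apply: measurable_funM => //.
  exact: measurable_coord.
by apply/funext => x; rewrite !mxE.
Qed.

Lemma measurable_row_add n :
  measurable_fun setT (fun z : 'rV[R]_n * 'rV[R]_n => z.1 + z.2).
Proof.
apply: measurable_rowP => i.
rewrite (_ : (fun _ => _) = (fun z : 'rV[R]_n * 'rV[R]_n => z.1 ord0 i + z.2 ord0 i)).
  apply: measurable_funD => //.
    by apply: (measurableT_comp (measurable_coord i)); exact: measurable_fst.
  by apply: (measurableT_comp (measurable_coord i)); exact: measurable_snd.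
by apply/funext => x; rewrite !mxE.
Qed.

Lemma measurable_row_sub n :
  measurable_fun setT (fun z : 'rV[R]_n * 'rV[R]_n => z.1 - z.2).
Proof.
rewrite (_ : (fun _ => _) = (fun z : 'rV[R]_n * 'rV[R]_n => z.1 + z.2) \o
    (fun z => (z.1, - z.2))) //.
apply: measurableT_comp; first exact: measurable_row_add.
apply/measurable_fun_pairP; split => /=.
  exact: measurable_fst.
rewrite (_ : _ \o _ = (fun x : 'rV[R]_n => (-1) *: x + 0) \o (@snd 'rV[R]_n 'rV[R]_n)).
  apply: measurableT_comp; first exact: measurable_row_affine.
  exact: measurable_snd.
by apply/funext => z /=; rewrite scaleN1r addr0.
Qed.

Lemma measurable_row_opp n : measurable_fun setT (fun x : 'rV[R]_n => - x).
Proof.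
rewrite (_ : (fun _ => _) = (fun x : 'rV[R]_n => (-1) *: x + 0)).
  exact: measurable_row_affine.
by apply/funext => z /=; rewrite scaleN1r addr0.
Qed.

Lemma lebesgue_affine_pos (c b : R) (A : set R) : 0 < c -> measurable A ->
  (c%:E * pushforward lebesgue_measure
     ((fun a : R => c * a + b)%R : measurableTypeR R -> measurableTypeR R) A
  = lebesgue_measure A)%E.
Proof.
move=> c0 mA.
have mphi : measurable_fun setT (fun a : measurableTypeR R => c * a + b : measurableTypeR R).
  by apply: measurable_funD => //; apply: measurable_funM.
pose m := measure_function_pushforward__canonical__measure_function_Measure
  lebesgue_measure mphi.
pose m' : {measure set (measurableTypeR R) -> \bar R} := mscale (NngNum (ltW c0)) m.
apply/esym; rewrite -[RHS]/(m' A).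
apply: lebesgue_measure_unique => // _ [[u v]] _ <-.
rewrite lebesgue_measure_itv /= /mscale /= /pushforward.
rewrite (_ : _ @^-1` _ = `](u - b) / c, (v - b) / c]%classic).
  rewrite lebesgue_measure_itv /= !lte_fin ltr_pM2r ?invr_gt0// ltrD2r.
  case: ifP => _; last by rewrite mule0.
  rewrite -EFinB -EFinM -mulrBl opprD opprK addrACA addNr addr0 mulrC.
  by rewrite divfK ?gt_eqF.
apply/seteqP; split => x /=; rewrite !in_itv /= => /andP[h1 h2]; apply/andP; split.
- by rewrite ltr_pdivrMr// ltrBlDr mulrC.
- by rewrite ler_pdivlMr// lerBrDr mulrC.
- by move: h1; rewrite ltr_pdivrMr// ltrBlDr mulrC.
- by move: h2; rewrite ler_pdivlMr// lerBrDr mulrC.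
Qed.

Lemma ge0_integral_lebesgue_affine (c b : R) (f : R -> \bar R) : 0 < c ->
  measurable_fun setT f -> (forall x, 0 <= f x)%E ->
  (\int[lebesgue_measure]_a f (c * a + b)%R = c^-1%:E * \int[lebesgue_measure]_a f a)%E.
Proof.
move=> c0 mf f0.
have mphi : measurable_fun setT (fun a : measurableTypeR R => c * a + b : measurableTypeR R).
  by apply: measurable_funD => //; apply: measurable_funM.
pose m := measure_function_pushforward__canonical__measure_function_Measure
  lebesgue_measure mphi.
transitivity (\int[m]_x f x)%E.
  by rewrite (@ge0_integral_pushforward _ _ _ _ R _ mphi).
pose m' : {measure set (measurableTypeR R) -> \bar R} := mscale (NngNum (ltW c0)) m.
rewrite (_ : (\int[lebesgue_measure]_a f a)%E = (\int[m']_a f a)%E).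
  rewrite ge0_integral_mscale//= muleA -EFinM mulVf ?gt_eqF//.
  by rewrite mul1e.
by apply: eq_measure_integral => A mA _; exact/esym/lebesgue_affine_pos.
Qed.

Lemma ge0_integral_lebesgue_opp (f : R -> \bar R) :
  measurable_fun setT f -> (forall x, 0 <= f x)%E ->
  (\int[lebesgue_measure]_a f (- a)%R = \int[lebesgue_measure]_a f a)%E.
Proof.
move=> mf f0.
have mphi : measurable_fun setT (fun a : measurableTypeR R => - a : measurableTypeR R).
  exact: oppr_measurable.
pose m := measure_function_pushforward__canonical__measure_function_Measure
  lebesgue_measure mphi.
transitivity (\int[m]_x f x)%E.
  by rewrite (@ge0_integral_pushforward _ _ _ _ R _ mphi).
by apply: eq_measure_integral => A mA _; exact: lebesgue_measureN.
Qed.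

Lemma ge0_integral_lebesgue_rowS n (f : 'rV[R]_n.+1 -> \bar R) :
  measurable_fun setT f -> (forall x, 0 <= f x)%E ->
  (\int[lebesgue_row n.+1]_x f x =
   \int[lebesgue_measure]_a \int[lebesgue_row n]_v f (row_cons (a, v)))%E.
Proof.
move=> mf f0.
have mrc : measurable_fun setT (@row_cons R n : measurableTypeR R * 'rV[R]_n -> _) :=
  @measurable_row_cons R n.
pose pm := measure_function_pushforward__canonical__measure_function_Measure
  (lebesgue_measure \x lebesgue_row n)%E mrc.
transitivity (\int[pm]_x f x)%E.
  by apply: eq_measure_integral => A mA _.
rewrite (@ge0_integral_pushforward _ _ _ _ R _ mrc)//.
rewrite preimage_setT.
apply: (@fubini_tonelli1 _ _ (measurableTypeR R) 'rV[R]_n R lebesgue_measure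
  (lebesgue_row n) (f \o @row_cons R n)).
- by apply: measurableT_comp.
- by move=> z; exact: f0.
Qed.

Lemma ge0_integral_lebesgue_row0 (f : 'rV[R]_0 -> \bar R) :
  measurable_fun setT f -> (forall x, 0 <= f x)%E ->
  (\int[lebesgue_row 0]_x f x = f 0%R)%E.
Proof.
move=> mf f0; rewrite /= integral_dirac//.
by rewrite diracT mul1e.
Qed.

Local Opaque lebesgue_row.

Lemma row_cons_affine n (c a : R) (v : 'rV[R]_n) (w : 'rV[R]_n.+1) :
  c *: row_cons (a, v) + w =
  row_cons (c * a + w ord0 ord0, c *: v + (row_uncons w).2).
Proof.
apply/rowP => j; rewrite !mxE.
by case: unliftP => [k ->|->] //=; rewrite !mxE.
Qed.

Lemma measurable_row_cons2 n (f : 'rV[R]_n.+1 -> \bar R) (a : R) :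
  measurable_fun setT f -> measurable_fun setT (fun v => f (row_cons (a, v))).
Proof.
move=> mf; apply: (@measurable_fun_pair2 _ _ _ _ _ _ (f \o @row_cons R n)).
by apply: measurableT_comp => //; exact: measurable_row_cons.
Qed.

Lemma measurable_row_cons_int n (m : {sigma_finite_measure set 'rV[R]_n -> \bar R})
    (f : 'rV[R]_n.+1 -> \bar R) :
  measurable_fun setT f -> (forall x, 0 <= f x)%E ->
  measurable_fun setT (fun a : R => \int[m]_v f (row_cons (a, v)))%E.
Proof.
move=> mf f0.
apply: (measurable_fun_fubini_tonelli_F (f \o @row_cons R n)) => //; last first.
  by move=> z; exact: f0.
by apply: measurableT_comp => //; exact: measurable_row_cons.
Qed.

(** Change of variables for a homothety followed by a translation, one
    coordinate at a time: the measure on R^n.+1 is the image of a product by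
    row_cons. *)
Lemma ge0_integral_row_affine n (c : R) (w : 'rV[R]_n) (f : 'rV[R]_n -> \bar R) :
  0 < c -> measurable_fun setT f -> (forall x, 0 <= f x)%E ->
  (\int[lebesgue_row n]_x f (c *: x + w)%R = (c ^- n)%:E * \int[lebesgue_row n]_x f x)%E.
Proof.
move=> c0; elim: n w f => [|n IH] w f mf f0.
  rewrite !ge0_integral_lebesgue_row0//; last first.
    by apply: (measurableT_comp mf); exact: measurable_row_affine.
  rewrite expr0 invr1 mul1e; congr f; apply/rowP; by case.
rewrite !ge0_integral_lebesgue_rowS//; last first.
  by apply: (measurableT_comp mf); exact: measurable_row_affine.
under eq_integral => a _.
  under eq_integral do rewrite row_cons_affine.
  rewrite (IH _ (fun v => f (row_cons (c * a + w ord0 ord0, v))))//; last first.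
    exact: measurable_row_cons2.
  over.
rewrite /= ge0_integralZl; last 4 first.
- exact: measurableT.
- apply: (@measurableT_comp _ _ _ _ _ _ (fun a => \int[lebesgue_row n]_v f (row_cons (a, v)))%E).
    exact: measurable_row_cons_int.
  by apply: measurable_funD => //; apply: measurable_funM.
- by move=> a _; apply: integral_ge0.
- by rewrite lee_fin invr_ge0 exprn_ge0// ltW.
rewrite (ge0_integral_lebesgue_affine _ (f := fun a => \int[lebesgue_row n]_v f (row_cons (a, v)))%E)//; last 2 first.
- exact: measurable_row_cons_int.
- by move=> a; apply: integral_ge0.
by rewrite muleA -EFinM exprS invfM mulrC.
Qed.

Lemma ge0_integral_row_opp n (f : 'rV[R]_n -> \bar R) :
  measurable_fun setT f -> (forall x, 0 <= f x)%E ->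
  (\int[lebesgue_row n]_x f (- x)%R = \int[lebesgue_row n]_x f x)%E.
Proof.
elim: n f => [|n IH] f mf f0.
  rewrite !ge0_integral_lebesgue_row0//; last first.
    by apply: (measurableT_comp mf); exact: measurable_row_opp.
  by congr f; apply/rowP; case.
rewrite ge0_integral_lebesgue_rowS; last 2 first.
- by apply: (measurableT_comp mf); exact: measurable_row_opp.
- by move=> x; exact: f0.
rewrite ge0_integral_lebesgue_rowS; last 2 first.
- exact: mf.
- exact: f0.
rewrite -[RHS]ge0_integral_lebesgue_opp; last 2 first.
- exact: measurable_row_cons_int.
- by move=> a; apply: integral_ge0.
congr (integral _ _ _); apply/funext => a.
transitivity (\int[lebesgue_row n]_v f (row_cons (- a, - v)%R))%E.
  apply: eq_integral => v _; congr f; apply/rowP => j; rewrite !mxE.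
  by case: unliftP => [k _|_] //=; rewrite mxE.
rewrite (IH (fun v => f (row_cons (- a, v)%R)))//; exact: measurable_row_cons2.
Qed.

Lemma ge0_integral_row_shift n (w : 'rV[R]_n) (f : 'rV[R]_n -> \bar R) :
  measurable_fun setT f -> (forall x, 0 <= f x)%E ->
  (\int[lebesgue_row n]_x f (x + w)%R = \int[lebesgue_row n]_x f x)%E.
Proof.
move=> mf f0; rewrite -[RHS]mul1e -[X in X%:E]invr1 -[X in (X^-1)%:E](expr1n _ n).
rewrite -(ge0_integral_row_affine w ltr01 mf f0).
by apply: eq_integral => x _; rewrite scale1r.
Qed.


Lemma ge0_integral_mrestr d (U : measurableType d) (m : {measure set U -> \bar R})
    (D : set U) (mD : measurable D) (f : U -> \bar R) :
  measurable_fun setT f -> (forall x, 0 <= f x)%E ->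
  (\int[mrestr m mD]_x f x = \int[m]_(x in D) f x)%E.
Proof.
move=> mf f0; rewrite -(setUv D) ge0_integral_setU//=; last 3 first.
- exact: measurableC.
- exact: measurable_funTS.
- by apply/disj_setPS => x [].
rewrite [X in (_ + X)%E](_ : _ = 0)%E ?adde0; last first.
  apply: null_set_integral => //.
  - exact: measurableC.
  - exact: measurable_funTS.
  - by rewrite /= /mrestr setICl measure0.
apply: eq_measure_integral => A mA AD.
by rewrite /= /mrestr setIidl.
Qed.

(** The shift is reduced to the interval [0, 1[; the part of the interval
    pushed beyond 1 is brought back by one period. *)
Lemma ge0_integral_periodic1 (f : R -> \bar R) (s : R) :
  measurable_fun setT f -> (forall x, 0 <= f x)%E -> (forall x, f (x + 1)%R = f x) ->
  (\int[lebesgue_measure]_(a in `[0%R, 1%R[) f (a + s)%R =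
   \int[lebesgue_measure]_(a in `[0%R, 1%R[) f a)%E.
Proof.
move=> mf f0 per.
have shift (a b t : R) : (\int[lebesgue_measure]_(x in `[a, b[) f (x + t)%R =
    \int[lebesgue_measure]_(x in `[(a + t)%R, (b + t)%R[) f x)%E.
  rewrite integral_mkcond [RHS]integral_mkcond.
  have mg : measurable_fun setT (f \_ `[a + t, b + t[).
    by apply/(measurable_restrictT _ _).1 => //; exact: measurable_funTS.
  have := @ge0_integral_lebesgue_affine 1 t _ ltr01 mg.
  rewrite invr1 mul1e => <-; last first.
    by move=> x; rewrite patchE; case: ifP.
  apply: eq_integral => x _; rewrite !patchE mul1r.
  congr (if _ then _ else _); apply/idP/idP; rewrite !inE /= !in_itv /= => /andP[h1 h2];
    apply/andP; split; lra.
have perZ (z : int) x : f (x + z%:~R)%R = f x.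
  case: z => n; rewrite ?NegzE.
    elim: n => [|n IH]; first by rewrite addr0.
    by rewrite -[in RHS]IH -[in RHS]per -addrA intS [(1 + _%:Z)%R]addrC rmorphD.
  elim: n => [|n IH] in x *.
    by rewrite -(per (x + _)) addrNK.
  rewrite -(per (x + _)) -[RHS]IH; congr f; rewrite -addrA; congr (_ + _).
  by rewrite !rmorphN /= -[n.+2%:~R]/(n.+2%:R) -[n.+1%:~R]/(n.+1%:R) -[n.+2]addn1 natrD opprD addrNK.
have [z [s1 [s01 ->]]] : exists z : int, exists s1, 0 <= s1 < 1 /\ s = s1 + z%:~R.
  exists (Num.floor s), (s - (Num.floor s)%:~R); rewrite subrK; split=> //.
  have /andP[h1 h2] := floor_itv s.
  by rewrite subr_ge0 h1 /= ltrBlDl -[X in _ < _ + X]/(1%:~R) -rmorphD.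
under eq_integral do rewrite addrA perZ.
move: s01 => /andP[s10 s11].
rewrite shift add0r.
have cut (a b c : R) : (a <= b)%R -> (b <= c)%R -> (\int[lebesgue_measure]_(x in `[a, c[) f x =
  \int[lebesgue_measure]_(x in `[a, b[) f x + \int[lebesgue_measure]_(x in `[b, c[) f x)%E.
  move=> ab bc; rewrite -ge0_integral_setU//=.
  - congr (integral _ _ _); apply/seteqP; split => x /=; rewrite !in_itv /=.
      by move=> /andP[h1 h2]; have [h|h] := ltP x b; [left|right]; rewrite ?h1 ?h2.
    by case=> /andP[h1 h2]; apply/andP; split; lra.
  - exact: measurable_funTS.
  - by apply/disj_setPS => x [] /=; rewrite !in_itv /= => /andP[_ h1] /andP[h2 _]; lra.
rewrite (cut s1 1 (1 + s1)); [|lra|lra].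
rewrite (cut 0 s1 1); [|lra|lra].
rewrite [RHS]addeC; congr (_ + _)%E.
rewrite (_ : `[1, 1 + s1[%classic = `[0 + 1, s1 + 1[%classic) ?add0r 1?addrC// -[X in `[X, _[%classic]add0r [1 + s1]addrC -shift.
by apply: eq_integral => x _; rewrite per.
Qed.

End row_measurability.

Section torus_integral.
Context {R : realType}.
Local Opaque lebesgue_row.

Lemma ge0_integral_torus d (f : 'rV[R]_d -> \bar R) :
  measurable_fun setT f -> (forall x, 0 <= f x)%E ->
  (\int[torus_measure]_x f x = \int[lebesgue_row d]_(x in cube) f x)%E.
Proof. by move=> mf f0; rewrite /torus_measure ge0_integral_mrestr. Qed.

Lemma cube_row_cons n (a : R) (v : 'rV[R]_n) :
  (row_cons (a, v) \in cube) = (a \in `[0, 1[%classic) && (v \in cube).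
Proof.
apply/idP/andP => [|[]]; rewrite !inE /= /cube /=.
  move=> h; split.
    by have := h ord0; rewrite mxE unlift_none /= in_itv.
  by move=> i; have := h (lift ord0 i); rewrite mxE liftK.
rewrite in_itv /= => h1 h2 i; rewrite mxE.
by case: unliftP => [k _|_] //=.
Qed.

Lemma ge0_integral_torusS n (f : 'rV[R]_n.+1 -> \bar R) :
  measurable_fun setT f -> (forall x, 0 <= f x)%E ->
  (\int[torus_measure]_x f x = \int[lebesgue_measure]_(a in `[0%R, 1%R[)
     \int[torus_measure]_v f (row_cons (a, v)))%E.
Proof.
move=> mf f0; rewrite ge0_integral_torus// integral_mkcond.
have mg : measurable_fun setT (f \_ cube).
  by apply/(measurable_restrictT f measurable_cube); exact: measurable_funTS.
rewrite ge0_integral_lebesgue_rowS//; last by move=> x; rewrite patchE; case: ifP.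
rewrite [RHS]integral_mkcond; apply: eq_integral => a _.
rewrite patchE; case: ifPn => a01.
  rewrite ge0_integral_torus//; last exact: measurable_row_cons2.
  rewrite [RHS]integral_mkcond; apply: eq_integral => v _.
  by rewrite !patchE cube_row_cons a01.
apply: integral0_eq => v _.
by rewrite patchE cube_row_cons (negbTE a01).
Qed.

Lemma ge0_integral_torus0 (f : 'rV[R]_0 -> \bar R) :
  measurable_fun setT f -> (forall x, 0 <= f x)%E ->
  (\int[torus_measure]_x f x = f 0%R)%E.
Proof.
move=> mf f0; rewrite ge0_integral_torus// integral_mkcond.
have mg : measurable_fun setT (f \_ cube).
  by apply/(measurable_restrictT f measurable_cube); exact: measurable_funTS.
rewrite ge0_integral_lebesgue_row0//; last by move=> x; rewrite patchE; case: ifP.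
by rewrite patchE mem_set// => -[].
Qed.

Lemma torus_measureT d : torus_measure [set: 'rV[R]_d] = 1%E.
Proof.
rewrite -[LHS]mul1e -integral_cst//.
elim: d => [|n IH]; first by rewrite ge0_integral_torus0.
rewrite ge0_integral_torusS//.
under eq_integral do rewrite IH.
by rewrite integral_cst//= mul1e lebesgue_measure_itv /= lte_fin ltr01 oppr0 adde0.
Qed.

Definition torus_prob d : probability 'rV[R]_d R :=
  HB.pack_for (probability 'rV[R]_d R) (Measure.sort (@torus_measure R d))
    (Measure_isProbability.Build _ _ _ (@torus_measure R d) (torus_measureT d)).

(** Translation invariance on the torus. It is what allows integration by parts
    and the symmetry of convolutions without ever forming the quotient R^d /
    Z^d. *)
Lemma ge0_integral_periodic d (w : 'rV[R]_d) (f : 'rV[R]_d -> \bar R) :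
  measurable_fun setT f -> (forall x, 0 <= f x)%E -> Zd_periodic f ->
  (\int[torus_measure]_x f (x + w)%R = \int[torus_measure]_x f x)%E.
Proof.
elim: d w f => [|n IH] w f mf f0 per.
  rewrite !ge0_integral_torus0//; last first.
    rewrite (_ : (fun _ => _) = (fun x => f (1 *: x + w))).
      by apply: (measurableT_comp mf); exact: measurable_row_affine.
    by apply/funext => x; rewrite scale1r.
  by congr f; apply/rowP; case.
have maff m (v : 'rV[R]_m) : measurable_fun setT (fun x : 'rV[R]_m => x + v).
  rewrite (_ : (fun _ => _) = (fun x => 1 *: x + v)).
    exact: measurable_row_affine.
  by apply/funext => x; rewrite scale1r.
rewrite ge0_integral_torusS; last 2 first.
- by apply: (measurableT_comp mf); exact: maff.
- by move=> x; exact: f0.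
rewrite ge0_integral_torusS; last 2 first.
- exact: mf.
- exact: f0.
have row_consD a v : row_cons (a, v) + w = row_cons (a + w ord0 ord0, v + (row_uncons w).2).
  by rewrite -{1}[row_cons (a, v)]scale1r row_cons_affine mul1r scale1r.
under eq_integral => a _.
  under eq_integral do rewrite row_consD.
  rewrite (IH _ (fun v => f (row_cons (a + w ord0 ord0, v)))); last 3 first.
  - exact: measurable_row_cons2.
  - by move=> v; exact: f0.
  - move=> v i; rewrite -[in RHS](per _ (lift ord0 i)); congr f.
    apply/rowP => j; rewrite !mxE /=.
    by case: unliftP => [k ->|->] /=; rewrite ?addr0 // !mxE eqxx /= (inj_eq (@lift_inj _ _)).
  over.
have mh : measurable_fun setT (fun a => \int[torus_measure]_v f (row_cons (a, v)))%E.
  exact: (measurable_row_cons_int (torus_prob n) mf f0).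
rewrite (ge0_integral_periodic1 (f := fun a => \int[torus_measure]_v f (row_cons (a, v)))%E)//.
- by move=> a; apply: integral_ge0.
- move=> a; apply: eq_integral => v _; rewrite -[in RHS](per _ ord0); congr f.
  apply/rowP => j; rewrite !mxE /=.
  by case: unliftP => [k ->|->] /=; rewrite ?addr0.
Qed.

End torus_integral.

(** * Bounded uniformly continuous functions *)

Section line_calculus.
Context {R : realType} {V : normedModType R}.
Implicit Types (f : V -> R) (x v : V).

Lemma derive_lineE f x v : 'D_v f x = 'D_1 (fun h : R => f (h *: v + x)) 0.
Proof.
rewrite /derive; set g1 := fun h => h^-1 *: _; set g2 := fun h => h^-1 *: _.
suff -> : g1 = g2 by [].
by rewrite funeqE /g1 /g2 => h /=; rewrite addr0 scale0r add0r [_%:A]mulr1.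
Qed.

(** Partial derivatives are directional derivatives, so all one-dimensional
    calculus on R^d is carried out along lines. *)
Lemma is_derive_line f x v (a s : R) :
  is_derive (s *: v + x) v f a -> is_derive s 1 (fun h : R => f (h *: v + x)) a.
Proof.
move=> [df <-].
have dg : derivable (fun h : R => f (h *: v + (s *: v + x))) 0 1.
  exact: ((derivable1P f (s *: v + x) v).1 df).
rewrite (_ : (fun h => _) = (fun h => f (h *: v + (s *: v + x))) \o (fun h => h - s)).
  apply: is_derive_eq; first apply: is_derive1_comp.
    by rewrite subrr; apply/derivableP.
  by rewrite -derive_lineE subr0 mulr1.
by apply/funext => h /=; rewrite addrA -scalerDl subrK.
Qed.

Lemma is_derive_comp f (F : R -> R) x v a b :
  is_derive x v f a -> is_derive (f x) 1 F b -> is_derive x v (F \o f) (b * a).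
Proof.
move=> [df fa] dF.
have df' : is_derive (0 : R) 1 (fun h => f (h *: v + x)) a.
  by apply: is_derive_line; rewrite scale0r add0r; split.
have dF' : is_derive (f ((0 : R) *: v + x)) 1 F b by rewrite scale0r add0r.
have [h1 h2] := is_derive1_comp (f := F) (g := fun h => f (h *: v + x)) dF' df'.
split; first exact: ((derivable1P (F \o f) x v).2 h1).
by rewrite derive_lineE.
Qed.

Lemma MVT_line f f' x v (h : R) : (forall y, is_derive y v f (f' y)) ->
  exists2 s, `|s| <= `|h| & f (x + h *: v) - f x = h * f' (x + s *: v).
Proof.
move=> df.
pose g s := f (s *: v + x).
have dg (s : R) : is_derive s 1 g (f' (s *: v + x)) by exact: is_derive_line.
have cg a b : {within `[a, b], continuous g}.
  by apply: derivable_within_continuous => s _; case: (dg s).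
have [h0|h0] := leP 0 h.
  have [s + E] := MVT_segment h0 (fun s _ => dg s) (cg _ _).
  rewrite in_itv /= => /andP[s0 sh]; exists s; first by rewrite !ger0_norm.
  by move: E; rewrite /g scale0r add0r subr0 mulrC ![_ + x]addrC.
have [s + E] := MVT_segment (ltW h0) (fun s _ => dg s) (cg _ _).
rewrite in_itv /= => /andP[s0 sh]; exists s.
  by rewrite ler0_norm// ler0_norm ?lerN2// ltW.
move: E; rewrite /g scale0r add0r sub0r mulrN ![_ + x]addrC => /eqP.
by rewrite -eqr_oppLR opprB mulrC => /eqP.
Qed.

(** The quantitative form in which derivatives of integrals are established:
    the difference quotients are estimated by hand. *)
Lemma cvg_derive f x v a :
  (forall e, 0 < e -> exists2 r, 0 < r & forall h, h != 0 -> `|h| < r ->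
     `|h^-1 * (f (x + h *: v) - f x) - a| <= e) ->
  is_derive x v f a.
Proof.
move=> H.
have cv : (fun h => h^-1 *: ((f \o shift x) (h *: v) - f x)) @ (0 : R)^' --> a.
  apply/cvgrPdist_le => e e0; have [r r0 Hr] := H e e0.
  near=> h; rewrite /= distrC [X in X - a]/GRing.scale/= [h *: v + x]addrC; apply: Hr.
    by near: h; exact: nbhs_dnbhs_neq.
  by near: h; apply: dnbhs0_lt.
split; first by apply/cvg_ex; exists a.
exact: cvg_lim.
Unshelve. all: by end_near. Qed.

End line_calculus.

(** Continuity at the points of a compact set K is upgraded to a modulus that
    is uniform in a first point of K and an arbitrary second point. The second
    point need not lie in K: this is what makes periodic extension possible,
    because only one of two nearby points can be moved to the unit cube. *)
Lemma heine_cantor {R : realType} (X : pseudoMetricType R) (K : set X) (F : X -> R) :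
  compact K -> (forall x, K x -> {for x, continuous F}) ->
  forall e, 0 < e -> exists2 r, 0 < r & forall x, K x -> forall y,
    ball x r y -> `|F x - F y| <= e.
Proof.
move=> /compact_near_coveringP cK cF e e0.
have e2 : 0 < e / 2 by rewrite divr_gt0.
have := cK R (0 : R)^'+ (fun r x => forall y, ball x r y -> `|F x - F y| <= e) _.
have H : forall w, K w -> \forall x' \near w & i \near (0 : R)^'+,
    forall y, ball x' i y -> `|F x' - F y| <= e.
  move=> w Kw; have /cvgrPdist_le/(_ _ e2) := cF w Kw.
  move=> /nbhs_ballP[r /= r0 Hr].
  exists (ball w (r / 2), [set i : R | i < r / 2]) => /=.
    split; first by apply: nbhsx_ballx; rewrite divr_gt0.
    by apply: nbhs_right_lt; rewrite divr_gt0.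
  move=> [x i] /= [wx ir] y xy.
  rewrite (_ : F x - F y = (F w - F y) - (F w - F x)); last by ring.
  rewrite (le_trans (ler_normB _ _))// [leRHS]splitr lerD// Hr//.
    rewrite [r]splitr; apply: ball_triangle wx _.
    by apply: le_ball xy; exact: ltW.
  by apply: le_ball wx; rewrite ler_pdivrMr// ler_peMr ?ler1n// ltW.
move=> /(_ _ H) {}H.
near (0 : R)^'+ => r; exists r; first by near: r; exact: nbhs_right_gt.
have Hr : K `<=` (fun x => forall y, ball x r y -> `|F x - F y| <= e) by near: r.
by move=> x Kx; exact: Hr.
Unshelve. all: by end_near. Qed.

Section buc.
Context {R : realType} {d : nat}.
Local Notation E := 'rV[R]_d.
Implicit Types (Phi Psi : R -> E -> R) (f g : E -> R).

(** Periodic, bounded and uniformly continuous functions of time and space.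
    Time ranges over all of R; functions given on a bounded time interval are
    first frozen outside it. A function of x alone is regarded as the constant
    family it defines, whence the recurring hypothesis that (fun=> f) is of
    this class. The class is an algebra, is stable under composition with
    continuous functions and under convolution with integrable kernels, and its
    members are measurable and integrable on the torus, so that all regularity
    questions about the classical solution are answered by closure properties.
    *)
Definition buc Phi := [/\ forall t, Zd_periodic (Phi t),
  exists M, forall t x, `|Phi t x| <= M &
  forall e, 0 < e -> exists2 r, 0 < r & forall t t' x x',
    `|t - t'| < r -> `|x - x'| < r -> `|Phi t x - Phi t' x'| <= e].

Lemma buc_continuous Phi : buc Phi -> continuous (fun z : R * E => Phi z.1 z.2).
Proof.
move=> [_ _ uc] z; apply/cvgrPdist_le => e e0; have [r r0 H] := uc e e0.
exists (ball z.1 r, ball z.2 r).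
  by split; exact: nbhsx_ballx.
move=> y [/= b1 b2]; apply: H; first exact: b1.
by move: b2; rewrite mx_norm_ball.
Qed.

Lemma buc_continuous_at Phi t : buc Phi -> continuous (Phi t).
Proof.
move=> cPhi; rewrite (_ : Phi t = (fun z : R * E => Phi z.1 z.2) \o (fun y => (t, y)))//.
move=> x; apply: continuous_comp; last exact: buc_continuous.
have h : continuous (fun y : E => (t, y)).
  by apply: continuous_pair; [exact: cst_continuous|move=> y; exact: cvg_id].
exact: h.
Qed.

Lemma buc_measurable Phi : buc Phi ->
  measurable_fun setT (fun z : R * E => Phi z.1 z.2).
Proof. by move=> /buc_continuous; exact: continuous_measurable_prod. Qed.

Lemma buc_measurable_at Phi t : buc Phi -> measurable_fun setT (Phi t).
Proof. by move=> /(@buc_continuous_at _ t); exact: continuous_measurable_row. Qed.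

Lemma buc_bounded Phi : buc Phi -> exists2 M, 0 < M & forall t x, `|Phi t x| <= M.
Proof.
move=> [_ [M hM] _]; exists (`|M| + 1); first by rewrite ltr_wpDl.
move=> t x; rewrite (le_trans (hM t x))// (le_trans (ler_norm M))//.
by rewrite lerDl.
Qed.

Lemma buc_static Phi t : buc Phi -> buc (fun=> Phi t).
Proof.
move=> [per [M hM] uc]; split => //; first by exists M.
move=> e e0; have [r r0 H] := uc e e0; exists r => // _ _ x x' _ xx'.
by apply: H => //; rewrite subrr normr0.
Qed.

Lemma buc_cst (c : R) : buc (fun _ _ => c).
Proof.
split; [by []|by exists `|c| |].
by move=> e e0; exists 1 => // *; rewrite subrr normr0 ltW.
Qed.

Lemma bucD Phi Psi : buc Phi -> buc Psi -> buc (fun t x => Phi t x + Psi t x).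
Proof.
move=> [p1 [M1 h1] u1] [p2 [M2 h2] u2]; split.
- by move=> t x i; rewrite p1 p2.
- by exists (M1 + M2) => t x; rewrite (le_trans (ler_normD _ _))// lerD.
move=> e e0; have e2 : 0 < e / 2 by rewrite divr_gt0.
have [r1 r10 H1] := u1 _ e2; have [r2 r20 H2] := u2 _ e2.
exists (Num.min r1 r2); first by rewrite lt_min r10.
move=> t t' x x'; rewrite !lt_min => /andP[a1 a2] /andP[b1 b2].
rewrite opprD addrACA (le_trans (ler_normD _ _))// [leRHS]splitr lerD//.
  exact: H1.
exact: H2.
Qed.

(** A continuous function is uniformly continuous on the bounded range of Phi.
    *)
Lemma buc_comp (F : R -> R) Phi : continuous F -> buc Phi ->
  buc (fun t x => F (Phi t x)).
Proof.
move=> cF cPhi; have [M M0 hM] := buc_bounded cPhi; have [p _ u] := cPhi.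
have cpt : compact `[- M, M]%classic by exact: segment_compact.
have [K hK] : exists K, forall u, - M <= u <= M -> `|F u| <= K.
  have : compact (F @` `[- M, M]%classic).
    by apply: continuous_compact => //; apply: continuous_subspaceT.
  move=> /compact_bounded[K [_ hK]]; exists (K + 1) => v vM.
  by apply: (hK (K + 1)); [rewrite ltrDl|exists v => //=; rewrite in_itv].
have ucF := heine_cantor cpt (fun x _ => cF x).
split.
- by move=> t x i; rewrite p.
- by exists K => t x; apply: hK; rewrite -ler_norml.
move=> e e0; have [r r0 H] := ucF e e0.
have r2 : 0 < r / 2 by rewrite divr_gt0.
have [s s0 Hs] := u _ r2; exists s => // t t' x x' h1 h2.
apply: H => /=; first by rewrite in_itv /= -ler_norml.
rewrite /ball /=; apply: le_lt_trans (Hs _ _ _ _ h1 h2) _.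
by rewrite ltr_pdivrMr// ltr_pMr// ltr1n.
Qed.

Lemma bucN Phi : buc Phi -> buc (fun t x => - Phi t x).
Proof. by apply: (@buc_comp -%R); exact: oppr_continuous. Qed.

Lemma bucB Phi Psi : buc Phi -> buc Psi -> buc (fun t x => Phi t x - Psi t x).
Proof. by move=> h1 h2; apply: bucD => //; exact: bucN. Qed.

Lemma bucZ c Phi : buc Phi -> buc (fun t x => c * Phi t x).
Proof. by apply: (@buc_comp (fun u => c * u)) => x; exact: mulrl_continuous. Qed.

Lemma bucX n Phi : buc Phi -> buc (fun t x => Phi t x ^+ n).
Proof. by apply: (@buc_comp (fun u => u ^+ n)) => x; exact: exprn_continuous. Qed.

Lemma bucM Phi Psi : buc Phi -> buc Psi -> buc (fun t x => Phi t x * Psi t x).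
Proof.
move=> h1 h2.
rewrite (_ : (fun _ => _) = (fun t x => 2^-1 * ((Phi t x + Psi t x) ^+ 2 -
    (Phi t x ^+ 2 + Psi t x ^+ 2)))).
  by apply: bucZ; apply: bucB; [apply/bucX/bucD|apply: bucD; exact: bucX].
by apply/funext => t; apply/funext => x; field.
Qed.

Lemma buc_sum (I : Type) (r : seq I) (Phi : I -> R -> E -> R) :
  (forall i, buc (Phi i)) -> buc (fun t x => \sum_(i <- r) Phi i t x).
Proof.
move=> h; elim: r => [|i r IH].
  rewrite (_ : (fun _ => _) = (fun _ _ => 0)); first exact: buc_cst.
  by apply/funext => t; apply/funext => x; rewrite big_nil.
rewrite (_ : (fun _ => _) = (fun t x => Phi i t x + \sum_(j <- r) Phi j t x)).
  exact: bucD.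
by apply/funext => t; apply/funext => x; rewrite big_cons.
Qed.

Lemma periodicD_int (V : Type) (f : E -> V) (n : 'I_d -> int) x : Zd_periodic f ->
  f (x + \sum_i (n i)%:~R *: basis_vec i) = f x.
Proof.
move=> per.
have perN i k y : f (y + k%:R *: basis_vec i) = f y.
  elim: k => [|k IH]; first by rewrite scale0r addr0.
  by rewrite -[k.+1]addn1 natrD scalerDl scale1r addrA per.
have perZ i (z : int) y : f (y + z%:~R *: basis_vec i) = f y.
  case: z => k; first exact: perN.
  by rewrite NegzE -(perN i k.+1) -addrA -scalerDl rmorphN /= addNr scale0r addr0.
elim: (index_enum _) => [|i r IH]; first by rewrite big_nil addr0.
by rewrite big_cons [_ *: _ + _]addrC addrA perZ.
Qed.

Lemma periodic_cube (x : E) : exists n : 'I_d -> int,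
  cube (x + \sum_i (n i)%:~R *: basis_vec i).
Proof.
exists (fun i => - Num.floor (x ord0 i)) => i.
rewrite mxE summxE (bigD1 i)//= big1 ?addr0.
  rewrite !mxE !eqxx mulr1 rmorphN /=.
  have /andP[h1 h2] := floor_itv (x ord0 i).
  by rewrite subr_ge0 h1 /= ltrBlDl -[X in _ < _ + X]/(1%:~R) -rmorphD.
by move=> j ji; rewrite !mxE eqxx /= eq_sym (negbTE ji) mulr0.
Qed.

(** The projection of the line onto [0, T], used to freeze functions outside
    this interval. *)
Definition clamp (T t : R) := Num.max 0 (Num.min t T).

Lemma clamp_itv T t : 0 <= T -> 0 <= clamp T t <= T.
Proof. by move=> T0; rewrite /clamp le_max lexx /= ge_max T0 ge_min lexx orbT. Qed.

Lemma clamp_id T t : 0 <= t <= T -> clamp T t = t.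
Proof. by move=> /andP[h1 h2]; rewrite /clamp (min_idPl h2) (max_idPr h1). Qed.

Lemma clamp_lip T t t' : 0 <= T -> `|clamp T t - clamp T t'| <= `|t - t'|.
Proof.
move=> T0; rewrite /clamp /Num.max /Num.min.
have h1 := ler_norm (t - t'); have := ler_norm (t' - t); rewrite distrC => h2.
rewrite ler_norml; case: (ltP t T) => a; case: (ltP t' T) => b;
  do 2? case: ltP => ?; apply/andP; split; lra.
Qed.

(** By periodicity the values on [0, T] times the unit cube, a compact set,
    determine everything; uniform continuity there is transported to the whole
    space. *)
Lemma buc_clamp T (Phi : R -> E -> R) : 0 <= T ->
  (forall t, 0 <= t <= T -> Zd_periodic (Phi t)) ->
  {within `[0, T] `*` [set: E], continuous (fun z : R * E => Phi z.1 z.2)} ->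
  buc (fun t => Phi (clamp T t)).
Proof.
move=> T0 per cPhi; pose K : set (R * E) := `[0, T] `*` [set v : E | forall i, `[0, 1]%classic (v ord0 i)].
have cK : compact K.
  apply: compact_setX; first exact: segment_compact.
  by apply: (@rV_compact R d (fun=> `[0, 1]%classic)) => i; exact: segment_compact.
pose G (z : R * E) := Phi (clamp T z.1) z.2.
have cc : continuous (fun z : R * E => (clamp T z.1, z.2)).
  apply: continuous_pair; last by move=> z; exact: cvg_snd.
  move=> z; apply: (@continuous_comp _ _ _ (@fst R E) (clamp T)); first exact: cvg_fst.
  apply/cvgrPdist_le => e e0; apply/nbhs_ballP; exists e => // u hu.
  by rewrite (le_trans (clamp_lip _ _ T0))// ltW.
have cG : continuous G.
  move=> z; have wz : (`[0, T]%classic `*` [set: E]) (clamp T z.1, z.2).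
    by split => //=; rewrite in_itv /= clamp_itv.
  have h := (subspace_continuousP _ _).1 cPhi _ wz.
  apply: (@cvg_comp _ _ _ (fun z : R * E => (clamp T z.1, z.2))
    (fun z : R * E => Phi z.1 z.2) (nbhs z) _ _ _ h).
  move=> P /= wP; apply: (@filterS _ (nbhs z) _ _ _ _ (cc z _ wP)) => y; apply.
  by split => //=; rewrite in_itv /= clamp_itv.
have hc := heine_cantor cK (fun z _ => cG z).
have red x : exists n : 'I_d -> int, forall t, 0 <= t <= T ->
    K (t, x + \sum_i (n i)%:~R *: basis_vec i).
  have [n hn] := periodic_cube x; exists n => t t0T; split => /=.
    by rewrite in_itv.
  by move=> i; rewrite /= in_itv /=; have /andP[-> /ltW] := hn i.
split.
- by move=> t x i; rewrite per//; exact: clamp_itv.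
- have : compact (G @` K).
    by apply: continuous_compact => //; apply: continuous_subspaceT.
  move=> /compact_bounded[M [_ hM]]; exists (M + 1) => t x.
  have [n /(_ (clamp T t) (clamp_itv _ T0)) hn] := red x.
  apply: (hM (M + 1)); first by rewrite ltrDl.
  exists (clamp T t, x + \sum_i (n i)%:~R *: basis_vec i) => //.
  rewrite /G /= periodicD_int; last by apply: per; exact: clamp_itv.
  by rewrite [clamp T (clamp T t)]clamp_id// clamp_itv.
move=> e e0; have [r r0 H] := hc e e0; exists r => // t t' x x' tt' xx'.
have [n /(_ (clamp T t) (clamp_itv _ T0)) hn] := red x.
have := H _ hn (clamp T t', x' + \sum_i (n i)%:~R *: basis_vec i).
rewrite /G /= (periodicD_int _ _ (per _ (clamp_itv (clamp T t) T0))) (periodicD_int _ _ (per _ (clamp_itv (clamp T t') T0))).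
rewrite !(clamp_id (clamp_itv _ T0)); apply; split => /=.
  by apply: le_lt_trans tt'; exact: clamp_lip.
by rewrite mx_norm_ball /ball_ /= opprD addrACA subrr addr0.
Qed.

End buc.

(** * Real-valued integrals and convolution forms *)

Section real_integrals.
Context d (U : measurableType d) (R : realType) (mu : {measure set U -> \bar R}).
Implicit Types f g : U -> R.

(** Real-valued integrability over the whole space. Together with Rintegral it
    allows computations by ring and lra on integrals, which extended
    real-valued integrals do not. *)
Definition L1 f := mu.-integrable setT (EFin \o f).

Lemma L1_measurable f : L1 f -> measurable_fun setT f.
Proof. by case/integrableP => /measurable_EFinP. Qed.

Lemma L1_le f g : measurable_fun setT f -> L1 g -> (forall x, `|f x| <= g x) -> L1 f.
Proof.
move=> mf ig fg; apply: le_integrable ig => //; first exact/measurable_EFinP.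
by move=> x _ /=; rewrite lee_fin (le_trans (fg x))// ler_norm.
Qed.

Lemma L1P f : measurable_fun setT f -> (\int[mu]_x (`|f x|)%:E < +oo)%E -> L1 f.
Proof. by move=> mf h; apply/integrableP; split => //; exact/measurable_EFinP. Qed.

Lemma L1_lty f : L1 f -> (\int[mu]_x (`|f x|)%:E < +oo)%E.
Proof. by case/integrableP. Qed.

Lemma L1D f g : L1 f -> L1 g -> L1 (fun x => f x + g x).
Proof. by move=> h1 h2; have := integrableD measurableT h1 h2. Qed.

Lemma L1B f g : L1 f -> L1 g -> L1 (fun x => f x - g x).
Proof. by move=> h1 h2; have := integrableB measurableT h1 h2. Qed.

Lemma L1Z c f : L1 f -> L1 (fun x => c * f x).
Proof. by move=> h; have := integrableZl measurableT c h. Qed.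

Lemma L1_norm f : L1 f -> L1 (fun x => `|f x|).
Proof. exact: integrable_norm. Qed.

Lemma L1_0 : L1 (fun=> 0).
Proof. exact: integrable0. Qed.

Lemma L1_sum I (r : seq I) (F : I -> U -> R) :
  (forall i, L1 (F i)) -> L1 (fun x => \sum_(i <- r) F i x).
Proof.
move=> h; elim: r => [|i r IH].
  by under eq_fun do rewrite big_nil; exact: L1_0.
by under eq_fun do rewrite big_cons; exact: L1D.
Qed.

Lemma L1_bounded f M : (mu setT < +oo)%E -> measurable_fun setT f ->
  (forall x, `|f x| <= M) -> L1 f.
Proof.
move=> muoo mf fM; apply: measurable_bounded_integrable => //.
exists M; split; first exact: num_real.
by move=> x Mx y _ /=; rewrite (le_trans (fM y))// ltW.
Qed.

Lemma L1_mul_bounded f g M : measurable_fun setT f -> (forall x, `|f x| <= M) ->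
  L1 g -> L1 (fun x => f x * g x).
Proof.
move=> mf fM ig; apply: (@L1_le _ (fun x => `|M| * `|g x|)).
- by apply: measurable_funM => //; exact: L1_measurable.
- by apply: L1Z; exact: L1_norm.
- by move=> x; rewrite normrM ler_wpM2r// (le_trans (fM x))// ler_norm.
Qed.

Lemma eq_Rint f g : f =1 g -> \int[mu]_x f x = \int[mu]_x g x.
Proof. by move=> fg; apply: eq_Rintegral => x _; exact: fg. Qed.

Lemma RintD f g : L1 f -> L1 g ->
  \int[mu]_x (f x + g x) = \int[mu]_x f x + \int[mu]_x g x.
Proof. exact: RintegralD. Qed.

Lemma RintB f g : L1 f -> L1 g ->
  \int[mu]_x (f x - g x) = \int[mu]_x f x - \int[mu]_x g x.
Proof. exact: RintegralB. Qed.

Lemma RintZ c f : L1 f -> \int[mu]_x (c * f x) = c * \int[mu]_x f x.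
Proof. exact: RintegralZl. Qed.

Lemma RintN f : L1 f -> \int[mu]_x (- f x) = - \int[mu]_x f x.
Proof.
by move=> h; rewrite -mulN1r -RintZ//; apply: eq_Rint => x; rewrite mulN1r.
Qed.

Lemma Rint0 : \int[mu]_x (0 : R) = 0.
Proof. by rewrite /Rintegral integral0. Qed.

Lemma Rint_sum I (r : seq I) (F : I -> U -> R) : (forall i, L1 (F i)) ->
  \int[mu]_x \sum_(i <- r) F i x = \sum_(i <- r) \int[mu]_x F i x.
Proof.
move=> h; elim: r => [|i r IH].
  by under eq_Rintegral do rewrite big_nil; rewrite Rint0 big_nil.
under eq_Rintegral do rewrite big_cons.
by rewrite RintD ?IH ?big_cons//; exact: L1_sum.
Qed.

Lemma le_Rint f g : L1 f -> L1 g -> (forall x, f x <= g x) ->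
  \int[mu]_x f x <= \int[mu]_x g x.
Proof. by move=> h1 h2 h; apply: le_Rintegral. Qed.

Lemma Rint_ge0 f : (forall x, 0 <= f x) -> 0 <= \int[mu]_x f x.
Proof. by move=> h; apply: Rintegral_ge0. Qed.

Lemma le_norm_Rint f g : L1 f -> L1 g -> (forall x, `|f x| <= g x) ->
  `|\int[mu]_x f x| <= \int[mu]_x g x.
Proof.
move=> h1 h2 h; rewrite (le_trans (le_normr_Rintegral _ h1))//.
by apply: le_Rint => //; exact: L1_norm.
Qed.

Lemma EFin_Rint f : L1 f -> (\int[mu]_x f x)%:E = (\int[mu]_x (f x)%:E)%E.
Proof. by move=> h; rewrite /Rintegral fineK//; exact: integrable_fin_num. Qed.

Lemma ae_Rint f g : measurable_fun setT f -> measurable_fun setT g ->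
  {ae mu, forall x, f x = g x} -> \int[mu]_x f x = \int[mu]_x g x.
Proof.
move=> mf mg h; congr fine; apply: ae_eq_integral => //.
- exact/measurable_EFinP.
- exact/measurable_EFinP.
- by apply: filterS h => x /= -> _.
Qed.

Lemma ae_L1 f g : measurable_fun setT f -> L1 g -> {ae mu, forall x, f x = g x} -> L1 f.
Proof.
move=> mf hg h; apply: L1P => //; have mg := L1_measurable hg.
have E : ae_eq mu setT (fun x => (`|f x|)%:E) (fun x => (`|g x|)%:E).
  by apply: filterS h => x /= -> _.
have -> : (\int[mu]_x (`|f x|)%:E = \int[mu]_x (`|g x|)%:E)%E.
  by apply: ae_eq_integral => //; apply/measurable_EFinP; exact: measurableT_comp.
exact: L1_lty.
Qed.

Lemma ae_le_Rint f g : L1 f -> L1 g -> {ae mu, forall x, f x <= g x} ->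
  \int[mu]_x f x <= \int[mu]_x g x.
Proof.
move=> h1 h2 h.
have mf := L1_measurable h1; have mg := L1_measurable h2.
rewrite (@ae_Rint f (fun x => Num.min (f x) (g x)))//.
- apply: le_Rint => //; last by move=> x; rewrite ge_min lexx orbT.
  apply: (@L1_le _ (fun x => `|f x| + `|g x|)).
  + exact: measurable_minr.
  + by apply: L1D; exact: L1_norm.
  + by move=> x; rewrite /Num.min; case: ifP => _; rewrite ?lerDl ?lerDr.
- exact: measurable_minr.
- by apply: filterS h => x /= fg; rewrite (min_idPl fg).
Qed.

Lemma Rint_cst_prob (c : R) : mu setT = 1%E -> \int[mu]_x c = c.
Proof. by move=> h; rewrite Rintegral_cst// h mulr1. Qed.

End real_integrals.

Section real_fubini.
Context d1 d2 (U : measurableType d1) (W : measurableType d2) (R : realType).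
Variables (m1 : {sigma_finite_measure set U -> \bar R})
  (m2 : {sigma_finite_measure set W -> \bar R}).
Implicit Type f : U * W -> R.

Lemma ae_L1_section1 f : L1 (m1 \x m2)%E f ->
  {ae m1, forall x, L1 m2 (fun y => f (x, y))}.
Proof. by move=> h; have := ae_integrable1 h. Qed.

Lemma L1_section_int1 f : L1 (m1 \x m2)%E f -> L1 m1 (fun x => \int[m2]_y f (x, y)).
Proof.
move=> h; have hF := integrable_fubini_F h.
have mF : measurable_fun setT (fun x => \int[m2]_y f (x, y)).
  by apply: (measurableT_comp (@fine_measurable R setT measurableT)); exact: measurable_int hF.
apply: L1P => //; case/integrableP : (hF) => mFe; apply: le_lt_trans.
apply: ge0_le_integral => //.
- by apply/measurable_EFinP; exact: measurableT_comp.
- exact: measurableT_comp.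
- move=> x _; rewrite /Rintegral /fubini_F /=.
  by case: (integral _ _ _) => [r| |] //=; rewrite normr0 leey.
Qed.

(** Sections are integrable only almost everywhere; the inner real-valued
    integral is a total function, so the exceptional set needs no separate
    treatment. *)
Lemma Rfubini1 f : L1 (m1 \x m2)%E f ->
  \int[(m1 \x m2)%E]_z f z = \int[m1]_x \int[m2]_y f (x, y).
Proof.
move=> h; rewrite /Rintegral -(integral12_prod_meas1 h); congr fine.
have hF := integrable_fubini_F h.
have mF : measurable_fun setT (fubini_F m2 (EFin \o f)) by exact: measurable_int hF.
apply: ae_eq_integral => //.
  by apply/measurable_EFinP; apply: (measurableT_comp (@fine_measurable R setT measurableT)).
apply: filterS (ae_integrable1 h) => x /= hx _.
by rewrite fineK//; exact: integrable_fin_num.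
Qed.

Lemma L1_section_int2 f : L1 (m1 \x m2)%E f -> L1 m2 (fun y => \int[m1]_x f (x, y)).
Proof.
move=> h; have mf := L1_measurable h.
have mF := measurable_fubini_G h.
have mfa : measurable_fun setT (fun z => (`|f z|)%:E).
  by apply/measurable_EFinP; exact: measurableT_comp.
apply: L1P; first by apply: (measurableT_comp (@fine_measurable R setT measurableT)).
have /(integrable21ltyP m1 m2) := h.
have mef : measurable_fun setT (EFin \o f) by exact/measurable_EFinP.
move=> /(_ mef); apply: le_lt_trans.
apply: ge0_le_integral => //.
- by apply/measurable_EFinP; apply: measurableT_comp => //; apply: (measurableT_comp (@fine_measurable R setT measurableT)).
- exact: (measurable_fun_fubini_tonelli_G (m1 := m1) (fun z => (`|f z|)%:E)).
- move=> y _; apply: (@le_trans _ _ (`| \int[m1]_x (f (x, y))%:E |)%E).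
    by rewrite /Rintegral; case: (integral _ _ _) => [r| |] //=; rewrite normr0 leey.
  apply: le_abse_integral => //.
  exact: (@measurable_fun_pair1 _ _ _ _ _ _ (EFin \o f)).
Qed.

Lemma Rfubini2 f : L1 (m1 \x m2)%E f ->
  \int[(m1 \x m2)%E]_z f z = \int[m2]_y \int[m1]_x f (x, y).
Proof.
move=> h; rewrite /Rintegral -(integral21_prod_meas1 h); congr fine.
have mF : measurable_fun setT (fubini_G m1 (EFin \o f)) by exact: measurable_fubini_G h.
apply: ae_eq_integral => //.
  by apply/measurable_EFinP; apply: (measurableT_comp (@fine_measurable R setT measurableT)).
apply: filterS (ae_integrable2 h) => x /= hx _.
by rewrite fineK//; exact: integrable_fin_num.
Qed.

End real_fubini.

Section torus_reals.
Context {R : realType} {d : nat}.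
Local Notation E := 'rV[R]_d.
Local Notation tor := (torus_prob d : probability E R).
Local Notation leb := (@lebesgue_row R d).
Local Opaque lebesgue_row.

Lemma measurable_shiftD (w : E) : measurable_fun setT (fun x : E => x + w).
Proof.
rewrite (_ : (fun _ => _) = (fun x => 1 *: x + w)); first exact: measurable_row_affine.
by apply/funext => x; rewrite scale1r.
Qed.

Lemma measurable_subl (x : E) : measurable_fun setT (fun y : E => x - y).
Proof.
rewrite (_ : (fun _ => _) = (fun y => (-1) *: y + x)); first exact: measurable_row_affine.
by apply/funext => y; rewrite scaleN1r addrC.
Qed.

Lemma torus_measureE (f : E -> R) : \int[torus_measure]_x f x = \int[tor]_x f x.
Proof. by []. Qed.

Lemma Rint_periodic (f : E -> R) (w : E) : measurable_fun setT f -> Zd_periodic f ->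
  \int[tor]_x f (x + w) = \int[tor]_x f x.
Proof.
move=> mf per; rewrite /Rintegral; congr fine.
rewrite integralE [RHS]integralE; congr (_ - _)%E.
- have mg : measurable_fun setT (EFin \o f)^\+%E.
    by apply: measurable_funepos; exact/measurable_EFinP.
  have pg : Zd_periodic (EFin \o f)^\+%E by move=> x i; rewrite !funeposE /= per.
  have g0 x : (0 <= (EFin \o f)^\+%E x)%E by [].
  rewrite (_ : ((fun x : E => (f (x + w))%:E)^\+)%E = (fun x => (EFin \o f)^\+%E (x + w))); last first.
    by apply/funext => x; rewrite !funeposE.
  exact: (@ge0_integral_periodic R d w (EFin \o f)^\+%E mg g0 pg).
- have mg : measurable_fun setT (EFin \o f)^\-%E.
    by apply: measurable_funeneg; exact/measurable_EFinP.
  have pg : Zd_periodic (EFin \o f)^\-%E by move=> x i; rewrite !funenegE /= per.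
  have g0 x : (0 <= (EFin \o f)^\-%E x)%E by [].
  rewrite (_ : ((fun x : E => (f (x + w))%:E)^\-)%E = (fun x => (EFin \o f)^\-%E (x + w))); last first.
    by apply/funext => x; rewrite !funenegE.
  exact: (@ge0_integral_periodic R d w (EFin \o f)^\-%E mg g0 pg).
Qed.

Lemma Rint_row_opp (f : E -> R) : measurable_fun setT f ->
  \int[leb]_x f (- x) = \int[leb]_x f x.
Proof.
move=> mf; rewrite /Rintegral; congr fine.
rewrite integralE [RHS]integralE; congr (_ - _)%E.
- have mg : measurable_fun setT (EFin \o f)^\+%E.
    by apply: measurable_funepos; exact/measurable_EFinP.
  have g0 x : (0 <= (EFin \o f)^\+%E x)%E by [].
  rewrite (_ : ((fun x : E => (f (- x))%:E)^\+)%E = (fun x => (EFin \o f)^\+%E (- x))); last first.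
    by apply/funext => x; rewrite !funeposE.
  exact: (@ge0_integral_row_opp R d (EFin \o f)^\+%E mg g0).
- have mg : measurable_fun setT (EFin \o f)^\-%E.
    by apply: measurable_funeneg; exact/measurable_EFinP.
  have g0 x : (0 <= (EFin \o f)^\-%E x)%E by [].
  rewrite (_ : ((fun x : E => (f (- x))%:E)^\-)%E = (fun x => (EFin \o f)^\-%E (- x))); last first.
    by apply/funext => x; rewrite !funenegE.
  exact: (@ge0_integral_row_opp R d (EFin \o f)^\-%E mg g0).
Qed.

Lemma Rint_row_shift (f : E -> R) (w : E) : measurable_fun setT f ->
  \int[leb]_x f (x + w) = \int[leb]_x f x.
Proof.
move=> mf; rewrite /Rintegral; congr fine.
rewrite integralE [RHS]integralE; congr (_ - _)%E.
- have mg : measurable_fun setT (EFin \o f)^\+%E.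
    by apply: measurable_funepos; exact/measurable_EFinP.
  have g0 x : (0 <= (EFin \o f)^\+%E x)%E by [].
  rewrite (_ : ((fun x : E => (f (x + w))%:E)^\+)%E = (fun x => (EFin \o f)^\+%E (x + w))); last first.
    by apply/funext => x; rewrite !funeposE.
  exact: (@ge0_integral_row_shift R d w (EFin \o f)^\+%E mg g0).
- have mg : measurable_fun setT (EFin \o f)^\-%E.
    by apply: measurable_funeneg; exact/measurable_EFinP.
  have g0 x : (0 <= (EFin \o f)^\-%E x)%E by [].
  rewrite (_ : ((fun x : E => (f (x + w))%:E)^\-)%E = (fun x => (EFin \o f)^\-%E (x + w))); last first.
    by apply/funext => x; rewrite !funenegE.
  exact: (@ge0_integral_row_shift R d w (EFin \o f)^\-%E mg g0).
Qed.

Lemma tor_bounded (f : E -> R) M : measurable_fun setT f -> (forall x, `|f x| <= M) ->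
  L1 tor f.
Proof. by move=> mf; apply: L1_bounded => //; rewrite [X in (X < _)%E]probability_setT ltry. Qed.

Lemma tor_buc Phi t : buc Phi -> L1 tor (Phi t : E -> R).
Proof.
move=> h; have [M _ hM] := buc_bounded h; apply: (@tor_bounded _ M) => //.
exact: buc_measurable_at.
Qed.

Lemma Rint_tor_cst (c : R) : \int[tor]_x c = c.
Proof. by apply: Rint_cst_prob; exact: probability_setT. Qed.

(** Periodic square-integrable functions. Periodicity is part of the definition
    because a class of functions on the cube alone would not be stable under
    translation. *)
Definition pl2 (f : E -> R) := [/\ Zd_periodic f, measurable_fun setT f &
  L1 tor (fun x => f x ^+ 2)].

Definition sq (f : E -> R) := \int[tor]_x f x ^+ 2.

Lemma sq_ge0 f : 0 <= sq f.
Proof. by apply: Rint_ge0 => x; exact: sqr_ge0. Qed.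

Lemma pl2M f g : pl2 f -> pl2 g -> L1 tor (fun x => f x * g x).
Proof.
move=> [_ mf if2] [_ mg ig2]; apply: (@L1_le _ _ _ _ _ (fun x => f x ^+ 2 + g x ^+ 2)).
- exact: measurable_funM.
- exact: L1D.
- move=> x; rewrite normrM -[f x ^+ 2]real_normK ?num_real// -[g x ^+ 2]real_normK ?num_real//.
  have := sqr_ge0 (`|f x| - `|g x|); have := normr_ge0 (f x); have := normr_ge0 (g x); nra.
Qed.

Lemma pl2_buc Phi t : buc Phi -> pl2 (Phi t).
Proof.
move=> h; split; [by case: h|exact: buc_measurable_at|].
by apply: (@tor_buc (fun t x => Phi t x ^+ 2)); exact: bucX.
Qed.

Lemma pl2_mul Phi t f : buc Phi -> pl2 f -> pl2 (fun x => Phi t x * f x).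
Proof.
move=> h [pf mf if2]; have [M _ hM] := buc_bounded h; split.
- by move=> x i; case: h => [p _ _]; rewrite p pf.
- by apply: measurable_funM => //; exact: buc_measurable_at.
- have : L1 tor (fun x => Phi t x ^+ 2 * f x ^+ 2).
    apply: (@L1_mul_bounded _ _ _ _ _ _ (M ^+ 2)) => //.
      by apply: (@buc_measurable_at _ _ (fun t x => Phi t x ^+ 2)); exact: bucX.
    by move=> x; rewrite normrX lerXn2r ?nnegrE// (le_trans _ (hM t x)).
  by apply: eq_integrable => // x _ /=; rewrite exprMn.
Qed.

Lemma pl2D f g : pl2 f -> pl2 g -> pl2 (fun x => f x + g x).
Proof.
move=> hf hg; have fg := pl2M hf hg; move: hf hg => [pf mf if2] [pg mg ig2]; split.
- by move=> x i; rewrite pf pg.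
- exact: measurable_funD.
- have : L1 tor (fun x => f x ^+ 2 + (2 * (f x * g x) + g x ^+ 2)).
    by apply: L1D => //; apply: L1D => //; exact: L1Z.
  by apply: eq_integrable => // x _ /=; congr EFin; ring.
Qed.

Lemma pl2Z c f : pl2 f -> pl2 (fun x => c * f x).
Proof. by apply: (@pl2_mul (fun _ _ => c) 0); exact: buc_cst. Qed.

Lemma pl2B f g : pl2 f -> pl2 g -> pl2 (fun x => f x - g x).
Proof.
move=> hf hg; under eq_fun do rewrite -mulN1r.
by apply: pl2D => //; exact: pl2Z.
Qed.

Section bilinear.
Variables (k : E -> R) (ik : L1 leb k).

Definition knorm := \int[leb]_y `|k y|.

(** The integrand f(x) k(y) g(x - y) of the bilinear form below, as a function
    on the product space. *)
Definition conv_fun (f g : E -> R) (z : E * E) := f z.1 * k z.2 * g (z.1 - z.2).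

Lemma measurable_conv_fun f g : measurable_fun setT f -> measurable_fun setT g ->
  measurable_fun setT (conv_fun f g).
Proof.
move=> mf mg; apply: measurable_funM; first apply: measurable_funM.
- by apply: (measurableT_comp mf); exact: measurable_fst.
- by apply: (measurableT_comp (L1_measurable ik)); exact: measurable_snd.
- by apply: (measurableT_comp mg); exact: measurable_row_sub.
Qed.

(** From |f(x) k(y) g(x - y)| <= |k(y)| (f(x)^2 + g(x - y)^2) / 2 and the
    invariance of the torus under translation by y. *)
Lemma conv_fun_bound f g : pl2 f -> pl2 g ->
  (\int[leb]_y \int[tor]_x (`|conv_fun f g (x, y)|)%:E <=
   (knorm * ((sq f + sq g) / 2))%:E)%E.
Proof.
move=> [pf mf if2] [pg mg ig2].
have sg y : (\int[tor]_x (g (x - y) ^+ 2)%:E = (sq g)%:E)%E.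
  rewrite EFin_Rint// -(@ge0_integral_periodic R d (- y) (fun x => (g x ^+ 2)%:E))//.
  - by apply/measurable_EFinP; exact: measurable_funX.
  - by move=> x; rewrite lee_fin sqr_ge0.
  - by move=> x i; rewrite pg.
have mgy (y : E) : measurable_fun setT (fun x : E => g (x - y)).
  by apply: (measurableT_comp mg); exact: measurable_shiftD.
rewrite mulrC EFinM EFin_Rint; last exact: L1_norm.
rewrite -ge0_integralZl//; last 2 first.
- by apply/measurable_EFinP; apply: measurableT_comp => //; exact: L1_measurable ik.
- by rewrite lee_fin divr_ge0// addr_ge0// sq_ge0.
apply: ge0_le_integral => //.
- by move=> y _; apply: integral_ge0 => x _; rewrite lee_fin.
- apply: (measurable_fun_fubini_tonelli_G (m1 := tor) (fun z => (`|conv_fun f g z|)%:E)) => //.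
    apply/measurable_EFinP; apply: measurableT_comp => //; exact: measurable_conv_fun.
- apply: measurable_funeM; apply/measurable_EFinP.
  by apply: measurableT_comp => //; exact: L1_measurable ik.
move=> y _.
have igy : L1 tor (fun x => g (x - y) ^+ 2).
  apply: L1P; first by apply: measurable_funX; exact: mgy.
  under eq_integral => x _ do rewrite ger0_norm ?sqr_ge0//.
  by rewrite (sg y) ltry.
have sgy : \int[tor]_x (g (x - y) ^+ 2) = sq g.
  by apply: (Rint_periodic (f := fun x => g x ^+ 2)) => [|x i]; [exact: measurable_funX|rewrite pg].
rewrite -EFinM (_ : (sq f + sq g) / 2 * `|k y| = \int[tor]_x (`|k y| / 2 * (f x ^+ 2 + g (x - y) ^+ 2))); last first.
  by rewrite RintZ ?RintD ?sgy -/(sq f)//; [field|exact: L1D].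
rewrite EFin_Rint; last by apply: L1Z; exact: L1D.
apply: ge0_le_integral => //.
- apply/measurable_EFinP; apply: measurableT_comp => //.
  by apply: (@measurable_fun_pair1 _ _ _ _ _ _ (conv_fun f g)); exact: measurable_conv_fun.
- by apply/measurable_EFinP; apply: (@L1_measurable _ _ _ tor); apply: L1Z; exact: L1D.
- move=> x _; rewrite lee_fin /conv_fun /= !normrM.
  rewrite -[f x ^+ 2]real_normK ?num_real// -[g _ ^+ 2]real_normK ?num_real//.
  have : 0 <= `|k y| * (`|f x| - `|g (x - y)|) ^+ 2 by rewrite mulr_ge0// sqr_ge0.
  by rewrite sqrrB; nra.
Qed.

Lemma conv_L1 f g : pl2 f -> pl2 g -> L1 (tor \x leb)%E (conv_fun f g).
Proof.
move=> hf hg; have [_ mf _] := hf; have [_ mg _] := hg.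
apply/(integrable21ltyP tor leb).
  by apply/measurable_EFinP; exact: measurable_conv_fun.
by apply: le_lt_trans (conv_fun_bound hf hg) _; rewrite ltry.
Qed.

(** The form (f, g) |-> int f (k * g) dx, defined as an integral over the
    product space. In this shape it is bilinear and symmetric without any
    discussion of the points x at which the convolution of k with a merely
    square-integrable g converges. *)
Definition cform f g := \int[(tor \x leb)%E]_z conv_fun f g z.

Lemma knorm_ge0 : 0 <= knorm. Proof. exact: Rint_ge0. Qed.

Lemma cform_bound f g : pl2 f -> pl2 g ->
  `|cform f g| <= knorm * ((sq f + sq g) / 2).
Proof.
move=> hf hg; have h := conv_L1 hf hg.
rewrite (le_trans (le_normr_Rintegral _ h))// -lee_fin EFin_Rint; last exact: L1_norm.
apply: le_trans (conv_fun_bound hf hg).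
rewrite (fubini_tonelli2 (fun z => (`|conv_fun f g z|)%:E))//.
apply/measurable_EFinP; apply: measurableT_comp => //; exact: L1_measurable h.
Qed.

Lemma cformDl f1 f2 g : pl2 f1 -> pl2 f2 -> pl2 g ->
  cform (fun x => f1 x + f2 x) g = cform f1 g + cform f2 g.
Proof.
move=> h1 h2 h; rewrite /cform -RintD; [|exact: conv_L1..].
by apply: eq_Rint => z; rewrite /conv_fun !mulrDl.
Qed.

Lemma cformDr f g1 g2 : pl2 f -> pl2 g1 -> pl2 g2 ->
  cform f (fun x => g1 x + g2 x) = cform f g1 + cform f g2.
Proof.
move=> h h1 h2; rewrite /cform -RintD; [|exact: conv_L1..].
by apply: eq_Rint => z; rewrite /conv_fun !mulrDr.
Qed.

Lemma cformZl c f g : pl2 f -> pl2 g -> cform (fun x => c * f x) g = c * cform f g.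
Proof.
move=> h1 h2; rewrite /cform -RintZ; last exact: conv_L1.
by apply: eq_Rint => z; rewrite /conv_fun !mulrA.
Qed.

(** Fubini identifies the form with the integral of f times the pointwise
    convolution, so that it computes the nonlocal terms of the equations. *)
Lemma cform_convol f g : pl2 f -> pl2 g ->
  L1 tor (fun x => f x * convol k g x) /\
  cform f g = \int[tor]_x (f x * convol k g x).
Proof.
move=> hf hg; have h := conv_L1 hf hg; have := ae_L1_section1 h => hs.
have E0 x : L1 leb (fun y => conv_fun f g (x, y)) ->
    \int[leb]_y conv_fun f g (x, y) = f x * convol k g x.
  rewrite /conv_fun /= => hx; have [f0|f0] := eqVneq (f x) 0.
    by rewrite f0 mul0r; rewrite (_ : (fun y => _) = (fun=> 0)) ?Rint0//; apply/funext => y; rewrite !mul0r.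
  rewrite /convol -RintZ; first by apply: eq_Rint => y; rewrite mulrA.
  have := L1Z (f x)^-1 hx; apply: eq_integrable => // y _ /=.
  by rewrite -mulrA mulKf.
have mc : measurable_fun setT (convol k g).
  apply: (measurableT_comp (@fine_measurable R setT measurableT)).
  have [_ mg _] := hg.
  have mkg : measurable_fun setT (conv_fun (fun=> 1) g) by exact: measurable_conv_fun.
  have mkg' : measurable_fun setT (EFin \o conv_fun (fun=> 1) g) by exact/measurable_EFinP.
  have -> : (fun x : E => \int[leb]_y (k y * g (x - (y : E)))%:E)%E =
      (fun x : E => \int[leb]_y (EFin \o conv_fun (fun=> 1%R) g)^\+ (x, y) -
                \int[leb]_y (EFin \o conv_fun (fun=> 1%R) g)^\- (x, y))%E.
    apply/funext => x; rewrite integralE; congr (_ - _)%E;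
      by apply: eq_integral => y _; rewrite ?funeposE ?funenegE /conv_fun /= mul1r.
  by apply: emeasurable_funB;
    apply: (measurable_fun_fubini_tonelli_F (m2 := leb) (_ : E * E -> \bar R)) => //;
    [exact: measurable_funepos|exact: measurable_funeneg].
have [_ mf _] := hf.
have mfc : measurable_fun setT (fun x => f x * convol k g x) by exact: measurable_funM.
have hi := L1_section_int1 h.
split; last first.
  rewrite /cform Rfubini1//; apply: ae_Rint => //; first exact: L1_measurable hi.
  by apply: filterS hs => x /= /E0.
apply: (ae_L1 mfc hi); by apply: filterS hs => x /= /E0.
Qed.

End bilinear.

(** The substitution x = x' + y exchanges f and g and reflects the kernel. *)
Lemma cform_sym k f g : L1 leb k -> L1 leb (fun y => k (- y)) -> pl2 f -> pl2 g ->
  cform k f g = cform (fun y => k (- y)) g f.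
Proof.
move=> ik ik' hf hg; have [pf mf _] := hf; have [pg mg _] := hg.
rewrite /cform !Rfubini2; [|exact: conv_L1..].
rewrite -[RHS]Rint_row_opp; last exact: L1_measurable (L1_section_int2 (conv_L1 ik' hg hf)).
apply: eq_Rint => y; rewrite /conv_fun /= !opprK.
rewrite -[RHS](@Rint_periodic _ (- y)).
- by apply: eq_Rint => x; rewrite subrK; ring.
- apply: measurable_funM; first by apply: measurable_funM.
  by apply: (measurableT_comp mf); exact: measurable_shiftD.
- by move=> x i; rewrite pg addrAC pf.
Qed.

End torus_reals.

(** * Derivatives, convolutions and the mollification kernel *)

Section continuous_real.
Context {R : realType} {T : topologicalType}.
Implicit Types f g : T -> R.

Lemma contM f g : continuous f -> continuous g -> continuous (fun x => f x * g x).
Proof. by move=> cf cg x; apply: cvgM; [exact: cf|exact: cg]. Qed.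

Lemma contD f g : continuous f -> continuous g -> continuous (fun x => f x + g x).
Proof. by move=> cf cg x; apply: cvgD; [exact: cf|exact: cg]. Qed.

Lemma contN f : continuous f -> continuous (fun x => - f x).
Proof. by move=> cf x; apply: cvgN; exact: cf. Qed.

Lemma cont_cst (c : R) : continuous (fun _ : T => c).
Proof. by move=> x; exact: cvg_cst. Qed.

Lemma cont_comp (S : topologicalType) (h : S -> T) f :
  continuous h -> continuous f -> continuous (fun x => f (h x)).
Proof. by move=> ch cf x; apply: continuous_comp; [exact: ch|exact: cf]. Qed.

End continuous_real.

Lemma continuous_subl_normed {R : realType} (V : normedModType R) (x : V) :
  continuous (fun y : V => x - y).
Proof. by move=> y; apply: cvgB; [exact: cvg_cst|exact: cvg_id]. Qed.

Lemma continuous_scalel_normed {R : realType} (V : normedModType R) (c : R) :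
  continuous (fun y : V => c *: y).
Proof. by move=> y; apply: cvgZr; exact: cvg_id. Qed.

Section convolution_calculus.
Context {R : realType} {d : nat}.
Local Notation E := 'rV[R]_d.
Local Notation tor := (torus_prob d : probability E R).
Local Notation leb := (@lebesgue_row R d).
Local Opaque lebesgue_row.
Implicit Types (f g k : E -> R).

Lemma coord_le_norm (x : E) i : `|x ord0 i| <= `|x|.
Proof.
rewrite [leRHS]mx_normrE.
exact: (@le_bigmax _ _ _ _ (fun ij : 'I_1 * 'I_d => `|x ij.1 ij.2|) (ord0, i)).
Qed.

Lemma norm_le_coord (x : E) r : 0 <= r -> (forall i, `|x ord0 i| <= r) -> `|x| <= r.
Proof.
move=> r0 h; rewrite [leLHS]mx_normrE; apply: bigmax_le => // -[i j] _ /=.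
by rewrite ord1.
Qed.

Lemma norm_basis_vec (i : 'I_d) h : `|h *: (basis_vec i : E)| <= `|h|.
Proof.
apply: norm_le_coord => // j; rewrite !mxE eqxx /=.
by case: eqP => _; rewrite ?mulr1// mulr0 normr0.
Qed.

(** The derivative f' is an argument, so that differentiability side conditions
    need not be carried along the calculus rules. *)
Definition HD i f f' := forall x : E, is_derive x (basis_vec i) f (f' x).

Lemma HD_partial i f f' : HD i f f' -> partial i f = f'.
Proof. by move=> h; apply/funext => x; have [_ <-] := h x. Qed.

Lemma partial_HD i f : (forall x, derivable f x (basis_vec i)) -> HD i f (partial i f).
Proof. by move=> h x; split => //; exact: h. Qed.

Lemma HD_derivable i f f' x : HD i f f' -> derivable f x (basis_vec i).
Proof. by move=> h; have [] := h x. Qed.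

Lemma HDD i f f' g g' : HD i f f' -> HD i g g' -> HD i (fun x => f x + g x) (fun x => f' x + g' x).
Proof. by move=> h1 h2 x; have := h1 x; have := h2 x => *; exact: is_deriveD. Qed.

Lemma HDB i f f' g g' : HD i f f' -> HD i g g' -> HD i (fun x => f x - g x) (fun x => f' x - g' x).
Proof. by move=> h1 h2 x; have := h1 x; have := h2 x => *; exact: is_deriveB. Qed.

Lemma HDM i f f' g g' : HD i f f' -> HD i g g' ->
  HD i (fun x => f x * g x) (fun x => f' x * g x + f x * g' x).
Proof.
move=> h1 h2 x; have h1x := h1 x; have h2x := h2 x.
have := is_deriveM h1x h2x.
by rewrite addrC; rewrite /GRing.scale /= [g x * _]mulrC.
Qed.

Lemma HDZ i c f f' : HD i f f' -> HD i (fun x => c * f x) (fun x => c * f' x).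
Proof. by move=> h x; have hx := h x; have := is_deriveZ c hx. Qed.

Lemma HD_comp i (F F' : R -> R) f f' : (forall u : R, is_derive u (1 : R) F (F' u)) -> HD i f f' ->
  HD i (fun x => F (f x)) (fun x => F' (f x) * f' x).
Proof. by move=> hF hf x; exact: is_derive_comp. Qed.

Lemma HD_scale i c f f' : HD i f f' -> HD i (fun x => f (c *: x)) (fun x => c * f' (c *: x)).
Proof.
move=> h x.
have line : is_derive (0 : R) 1 (fun s => f (s *: basis_vec i + c *: x)) (f' (c *: x)).
  by apply: is_derive_line; rewrite scale0r add0r.
have lin : is_derive (0 : R) 1 (fun s : R => c * s) c.
  have := is_deriveZ c (is_derive_id (0 : R) (1 : R)).
  by rewrite /GRing.scale /= mulr1.
have line' : is_derive (c * (0 : R)) 1 (fun s => f (s *: basis_vec i + c *: x)) (f' (c *: x)).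
  by rewrite mulr0.
have [h1 h2] := @is_derive1_comp R _ _ _ _ _ line' lin.
have E0 : (fun s : R => f (s *: basis_vec i + c *: x)) \o (fun s => c * s) =
    (fun h => f (c *: (h *: basis_vec i + x))).
  by apply/funext => s /=; rewrite scalerDr scalerA.
rewrite E0 in h1 h2; split; first exact: ((derivable1P (fun x => f (c *: x)) x _).2 h1).
by rewrite derive_lineE h2 mulrC.
Qed.

Lemma HD_shift i f f' w : HD i f f' -> HD i (fun x => f (x + w)) (fun x => f' (x + w)).
Proof.
move=> h x.
have line : is_derive (0 : R) 1 (fun s => f (s *: basis_vec i + (x + w))) (f' (x + w)).
  by apply: is_derive_line; rewrite scale0r add0r.
have E0 : (fun s : R => f (s *: basis_vec i + (x + w))) =
    (fun s => f (s *: basis_vec i + x + w)).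
  by apply/funext => s /=; rewrite addrA.
rewrite E0 in line; case: line => h1 h2.
split; first exact: ((derivable1P (fun x => f (x + w)) x _).2 h1).
by rewrite derive_lineE.
Qed.

Lemma HD_subl i f f' w : HD i f f' -> HD i (fun x => f (w - x)) (fun x => - f' (w - x)).
Proof.
move=> h; have := HD_scale (-1) (HD_shift w h).
rewrite (_ : (fun x => f (-1 *: x + w)) = (fun x => f (w - x))); last first.
  by apply/funext => x; rewrite scaleN1r addrC.
rewrite (_ : (fun x => -1 * _) = (fun x => - f' (w - x)))//.
by apply/funext => x; rewrite scaleN1r mulN1r addrC.
Qed.

Lemma L1_conv k Phi t x : L1 leb k -> buc Phi -> L1 leb (fun y => k y * Phi t (x - y)).
Proof.
move=> ik hP; have [M _ hM] := buc_bounded hP.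
under eq_fun do rewrite mulrC.
apply: (L1_mul_bounded (M := M)) => //.
by apply: (measurableT_comp (buc_measurable_at t hP)); exact: measurable_subl.
Qed.

Lemma convol_le k Phi Psi t t' x x' M : L1 leb k -> buc Phi -> buc Psi ->
  (forall y, `|Phi t (x - y) - Psi t' (x' - y)| <= M) ->
  `|convol k (Phi t) x - convol k (Psi t') x'| <= knorm k * M.
Proof.
move=> ik h1 h2 hM; rewrite /convol -RintB; [|exact: L1_conv..].
rewrite mulrC -RintZ; last exact: L1_norm.
apply: le_norm_Rint.
- by apply: L1B; exact: L1_conv.
- by apply: L1Z; exact: L1_norm.
- by move=> y; rewrite -mulrBr normrM mulrC ler_wpM2r.
Qed.

Lemma convol_bound k Phi t x M : L1 leb k -> buc Phi ->
  (forall y, `|Phi t y| <= M) -> `|convol k (Phi t) x| <= knorm k * M.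
Proof.
move=> ik h1 hM; have := @convol_le k Phi (fun _ _ => 0) t 0 x 0 M ik h1 (buc_cst _).
rewrite {2}/convol (_ : (fun y => k y * 0) = (fun=> 0)) ?Rint0 ?subr0; last first.
  by apply/funext => y; rewrite mulr0.
by apply => y; rewrite subr0.
Qed.

Lemma buc_convol k Phi : L1 leb k -> buc Phi -> buc (fun t => convol k (Phi t)).
Proof.
move=> ik hP; have [per bd uc] := hP; split.
- move=> t x i; apply: eq_Rint => y; congr (_ * _).
  by rewrite addrAC per.
- by have [M _ hM] := buc_bounded hP; exists (knorm k * M) => t x; exact: convol_bound.
move=> e e0; have e1 : 0 < e / (knorm k + 1) by rewrite divr_gt0// ltr_wpDl// knorm_ge0.
have [r r0 H] := uc _ e1; exists r => // t t' x x' h1 h2.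
have K1 : knorm k < knorm k + 1 by rewrite ltrDl.
apply: (@le_trans _ _ (knorm k * (e / (knorm k + 1)))).
  apply: convol_le => // y; apply: H => //.
  by rewrite opprB addrA subrK.
rewrite mulrA ler_pdivrMr ?ltr_wpDl ?knorm_ge0// mulrC ler_wpM2l// ltW//.
Qed.

(** A bounded uniformly continuous derivative makes the difference quotients
    converge uniformly, so the derivative passes under the integral with no
    hypothesis on the kernel other than integrability. *)
Lemma HD_convol i k f f' : L1 leb k -> buc (fun=> f) -> buc (fun=> f') -> HD i f f' ->
  HD i (convol k f) (convol k f').
Proof.
move=> ik hf hf' hD x; apply: cvg_derive => e e0.
have e1 : 0 < e / (knorm k + 1) by rewrite divr_gt0// ltr_wpDl// knorm_ge0.
have [_ _ uc] := hf'; have [r r0 H] := uc _ e1; exists r => // h h0 hr.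
rewrite /convol -RintB; [|exact: (@L1_conv k (fun=> f) 0)..].
rewrite -RintZ; last by apply: L1B; exact: (@L1_conv k (fun=> f) 0).
rewrite -RintB; [|apply: L1Z; apply: L1B; exact: (@L1_conv k (fun=> f) 0)|exact: (@L1_conv k (fun=> f') 0)].
apply: (@le_trans _ _ ((e / (knorm k + 1)) * knorm k)); last first.
  by rewrite mulrAC ler_pdivrMr ?ltr_wpDl ?knorm_ge0// ler_wpM2l ?lerDl// ltW.
rewrite -RintZ; last exact: L1_norm.
apply: le_norm_Rint.
- apply: L1B; last exact: (@L1_conv k (fun=> f') 0).
  by apply: L1Z; apply: L1B; exact: (@L1_conv k (fun=> f) 0).
- by apply: L1Z; exact: L1_norm.
move=> y.
have [s sh E0] := MVT_line (x - y) h hD.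
rewrite -mulrBr mulrCA -mulrBr normrM mulrC ler_wpM2r//.
rewrite [x + _ - y]addrAC E0 mulKf//.
apply: (H 0 0); first by rewrite subrr normr0.
by rewrite addrAC subrr add0r (le_lt_trans (norm_basis_vec _ _))// (le_lt_trans sh).
Qed.

(** Difference quotients of f have zero integral by translation invariance and
    converge uniformly to f'. This replaces boundary terms in every integration
    by parts on the torus. *)
Lemma Rint_partial i f f' : buc (fun=> f) -> buc (fun=> f') -> HD i f f' ->
  \int[tor]_x f' x = 0.
Proof.
move=> hf hf' hD; apply/eqP; rewrite -normr_le0; apply/ler_addgt0Pr => e e0; rewrite add0r.
have [_ _ uc] := hf'; have [r r0 H] := uc _ e0.
pose h := r / 2; have h0 : 0 < h by rewrite divr_gt0.
have hr : h < r by rewrite ltr_pdivrMr// ltr_pMr// ltr1n.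
have if' : L1 tor f' := @tor_buc _ _ _ 0 hf'.
have if1 : L1 tor f := @tor_buc _ _ _ 0 hf.
pose w : E := h *: basis_vec i.
have ifs : L1 tor (fun x => f (x + w)).
  have [M _ hM] := buc_bounded hf; apply: (@tor_bounded _ _ _ M) => [|x]; last exact: (hM 0).
  by apply: (measurableT_comp (@buc_measurable_at _ _ _ 0 hf)); exact: measurable_shiftD.
have -> : \int[tor]_x f' x = \int[tor]_x (f' x - h^-1 * (f (x + w) - f x)).
  rewrite RintB//; last by apply: L1Z; exact: L1B.
  rewrite RintZ; last exact: L1B.
  rewrite RintB// Rint_periodic ?subrr ?mulr0 ?subr0//.
    exact: (@buc_measurable_at _ _ _ 0 hf).
  by have [p _ _] := hf; exact: (p 0).
rewrite -[leRHS](Rint_tor_cst (d := d)); apply: le_norm_Rint.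
- by apply: L1B => //; apply: L1Z; exact: L1B.
- by apply: (@tor_bounded _ _ _ `|e|).
move=> x; have [s sh E0] := MVT_line x h hD.
rewrite E0 mulKf ?gt_eqF//; apply: (H 0 0); first by rewrite subrr normr0.
rewrite opprD addrA subrr add0r normrN (le_lt_trans (norm_basis_vec _ _))//.
by rewrite (le_lt_trans sh)// gtr0_norm.
Qed.


(** The indicator of the cube of half-width r, in product form so that its
    integral is computed by induction on the dimension. *)
Definition box_ind (r : R) n (x : 'rV[R]_n) : R := \prod_i ((`|x ord0 i| <= r)%R)%:R.

Lemma measurable_box_ind r n : measurable_fun setT (@box_ind r n).
Proof.
apply: measurable_prod => i _.
rewrite (_ : (fun x => _) = (fun u : R => ((`|u| <= r)%R)%:R : R) \o (fun x : 'rV[R]_n => x ord0 i))//.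
apply: measurableT_comp; last exact: measurable_coord.
rewrite (_ : (fun u => _) = \1_([set u : R | `|u| <= r])).
  apply: measurable_indic; rewrite -[X in measurable X]setTI.
  rewrite (_ : [set u : R | _] = (fun u : R => `|u|) @^-1` `]-oo, r]%classic); last first.
    by apply/seteqP; split => u /=; rewrite in_itv.
  by apply: (@normr_measurable R setT) => //; exact: measurable_itv.
by apply/funext => u; rewrite indicE mem_setE.
Qed.

Lemma box_ind_ge0 r n (x : 'rV[R]_n) : 0 <= box_ind r x.
Proof. by apply: prodr_ge0 => i _. Qed.

Lemma box_ind_lty r n : (\int[lebesgue_row n]_x (box_ind r x)%:E < +oo)%E.
Proof.
have me m : measurable_fun setT (fun x : 'rV[R]_m => (box_ind r x)%:E).
  by apply/measurable_EFinP; exact: measurable_box_ind.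
elim: n => [|n IH].
  by rewrite ge0_integral_lebesgue_row0 ?ltry// => x; rewrite lee_fin box_ind_ge0.
rewrite ge0_integral_lebesgue_rowS//; last by move=> x; rewrite lee_fin box_ind_ge0.
pose c := (\int[lebesgue_row n]_x (box_ind r x)%:E)%E.
have c0 : (0 <= c)%E by apply: integral_ge0 => x _; rewrite lee_fin box_ind_ge0.
have cE (a : R) : (\int[lebesgue_row n]_v (box_ind r (row_cons (a, v)))%:E =
    c * (\1_(`[- r, r]%classic) a)%:E)%E.
  rewrite muleC /c -ge0_integralZl//.
  - apply: eq_integral => v _; rewrite -EFinM; congr EFin.
    rewrite /box_ind big_ord_recl mxE unlift_none /=; congr (_ * _).
      by rewrite indicE mem_setE /= in_itv /= -ler_norml.
    by apply: eq_bigr => i _; rewrite mxE liftK.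
  - exact: me.
  - by move=> x _; rewrite lee_fin box_ind_ge0.
under eq_integral do rewrite cE.
rewrite ge0_integralZl//; last first.
  by apply/measurable_EFinP; exact: measurable_indic.
rewrite integral_indic// setIT.
apply: lte_mul_pinfty => //; first by rewrite ge0_fin_numE.
by rewrite [X in (X < _)%E]lebesgue_measure_itv /=; case: ifP => _; rewrite ?ltry// -EFinD ltry.
Qed.

Definition box_vol r : R := \int[leb]_x box_ind r x.

Lemma L1_box_ind r : L1 leb (@box_ind r d).
Proof.
apply: L1P; first exact: measurable_box_ind.
by under eq_integral do rewrite ger0_norm ?box_ind_ge0//; exact: box_ind_lty.
Qed.

Lemma box_indE r (x : E) : `|x| <= r -> box_ind r x = 1.
Proof.
by move=> xr; rewrite /box_ind big1// => i _; rewrite (le_trans (coord_le_norm _ _)).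
Qed.

Lemma box_dom f M r : 0 <= M -> (forall x, `|f x| <= M) -> (forall x, r < `|x| -> f x = 0) ->
  forall x, `|f x| <= M * box_ind r x.
Proof.
move=> M0 fM fr x; have [xr|xr] := leP `|x| r; first by rewrite box_indE// mulr1.
by rewrite fr// normr0 mulr_ge0// box_ind_ge0.
Qed.

Lemma L1_box f M r : 0 <= M -> measurable_fun setT f -> (forall x, `|f x| <= M) ->
  (forall x, r < `|x| -> f x = 0) -> L1 leb f.
Proof.
move=> M0 mf fM fr; apply: (L1_le mf (g := fun x => M * box_ind r x)).
  by apply: L1Z; exact: L1_box_ind.
exact: box_dom.
Qed.

Lemma Rint_box_le f M r : 0 <= M -> measurable_fun setT f -> (forall x, `|f x| <= M) ->
  (forall x, r < `|x| -> f x = 0) -> `|\int[leb]_x f x| <= M * box_vol r.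
Proof.
move=> M0 mf fM fr; rewrite /box_vol -RintZ; last exact: L1_box_ind.
apply: le_norm_Rint; first exact: L1_box fM fr.
  by apply: L1Z; exact: L1_box_ind.
exact: box_dom.
Qed.

Lemma compact_norm_ball r : compact [set x : E | `|x| <= r].
Proof.
apply: bounded_closed_compact.
  exists r; split; first exact: num_real.
  by move=> M rM x /= xr; rewrite (le_trans xr)// ltW.
rewrite (_ : [set x : E | _] = (fun x : E => `|x|) @^-1` [set y | y <= r])//.
apply: preimage_closed; first by move=> x _; exact: norm_continuous.
exact: closed_le.
Qed.

Lemma compact_support_bounded f r : continuous f -> (forall x, r < `|x| -> f x = 0) ->
  exists2 M, 0 <= M & forall x, `|f x| <= M.
Proof.
move=> cf fr.
have : compact (f @` [set x : E | `|x| <= r]).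
  by apply: continuous_compact; [exact: continuous_subspaceT|exact: compact_norm_ball].
move=> /compact_bounded[M [_ hM]]; exists (`|M| + 1); first by rewrite addr_ge0.
move=> x; have [xr|xr] := leP `|x| r; last by rewrite fr// normr0 addr_ge0.
apply: (hM (`|M| + 1)); last by exists x.
by rewrite (le_lt_trans (ler_norm M))// ltrDl.
Qed.

Lemma L1_compact_support f r : continuous f -> (forall x, r < `|x| -> f x = 0) -> L1 leb f.
Proof.
move=> cf fr; have [M M0 fM] := compact_support_bounded cf fr.
by apply: (L1_box M0 _ fM fr); exact: continuous_measurable_row.
Qed.

(** The argument used on the torus, with invariance of the Lebesgue measure of
    R^d under translation. *)
Lemma Rint_partial_compact i f f' r : 0 <= r -> continuous f -> continuous f' ->
  (forall x, r < `|x| -> f x = 0) -> (forall x, r < `|x| -> f' x = 0) -> HD i f f' ->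
  \int[leb]_x f' x = 0.
Proof.
move=> r0 cf cf' fr fr' hD.
have V0 : 0 < box_vol (r + 1) + 1.
  by rewrite ltr_wpDl//; apply: Rint_ge0 => x; exact: box_ind_ge0.
apply/eqP; rewrite -normr_le0; apply/ler_addgt0Pr => e e0; rewrite add0r.
have e1 : 0 < e / (box_vol (r + 1) + 1) by rewrite divr_gt0.
have [s s0 H] := heine_cantor (@compact_norm_ball (r + 2)) (fun x _ => cf' x) e1.
pose h := Num.min 1 (s / 2).
have h0 : 0 < h by rewrite lt_min ltr01 divr_gt0.
have h1 : h <= 1 by rewrite ge_min lexx.
have hs : h < s.
  by rewrite (@le_lt_trans _ _ (s / 2)) ?ge_min ?lexx ?orbT// ltr_pdivrMr// ltr_pMr// ltr1n.
pose w : E := h *: basis_vec i.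
have wh : `|w| <= h by rewrite (le_trans (norm_basis_vec _ _))// gtr0_norm.
have if1 := L1_compact_support cf fr; have if' := L1_compact_support cf' fr'.
have mf := continuous_measurable_row cf; have mf' := continuous_measurable_row cf'.
have mfs : measurable_fun setT (fun x : E => f (x + w)).
  by apply: (measurableT_comp mf); exact: measurable_shiftD.
have big (x : E) : r + 1 < `|x| -> r < `|x + w|.
  move=> xr; have := ler_normB (x + w) w; rewrite addrK; lra.
have ifs : L1 leb (fun x => f (x + w)).
  have [M M0 fM] := compact_support_bounded cf fr.
  by apply: (L1_box M0 mfs (fun x => fM _)) => x /big; exact: fr.
have -> : \int[leb]_x f' x = \int[leb]_x (f' x - h^-1 * (f (x + w) - f x)).
  rewrite RintB//; last by apply: L1Z; exact: L1B.
  rewrite RintZ; last exact: L1B.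
  by rewrite RintB// Rint_row_shift// subrr mulr0 subr0.
apply: (@le_trans _ _ (e / (box_vol (r + 1) + 1) * box_vol (r + 1))); last first.
  by rewrite mulrAC ler_pdivrMr// ler_wpM2l ?lerDl// ltW.
apply: Rint_box_le; first exact: ltW.
- apply: measurable_funB => //; apply: measurable_funM => //; exact: measurable_funB.
- move=> x; have [xr|xr] := leP `|x| (r + 2); last first.
    rewrite fr'; last by lra.
    rewrite fr; last by apply: big; lra.
    by rewrite fr ?subrr ?mulr0 ?subr0 ?normr0 ?ltW//; lra.
  have [t th E0] := MVT_line x h hD.
  rewrite E0 mulKf ?gt_eqF//; apply: H => //.
  rewrite mx_norm_ball /ball_ /= opprD addrA subrr add0r normrN.
  by rewrite (le_lt_trans (norm_basis_vec _ _))// (le_lt_trans th)// gtr0_norm.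
- move=> x xr; rewrite fr'; last by lra.
  by rewrite fr ?(big x xr)// fr ?subrr ?mulr0 ?subr0//; lra.
Qed.

Lemma continuous_subl (x : E) : continuous (fun y : E => x - y).
Proof. exact: continuous_subl_normed.
Qed.

(** Integration by parts in y |-> k(y) g(x - y), which is compactly supported
    with the kernel. *)
Lemma convol_partial i k k' g g' r : 0 <= r -> continuous k -> continuous k' ->
  (forall x, r < `|x| -> k x = 0) -> (forall x, r < `|x| -> k' x = 0) -> HD i k k' ->
  buc (fun=> g) -> buc (fun=> g') -> HD i g g' ->
  convol k' g = convol k g'.
Proof.
move=> r0 ck ck' kr kr' hk hg hg' hD; apply/funext => x.
have ik := L1_compact_support ck kr; have ik' := L1_compact_support ck' kr'.
have cg := @buc_continuous_at _ _ _ 0 hg; have cg' := @buc_continuous_at _ _ _ 0 hg'.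
have cgx : continuous (fun y : E => g (x - y)).
  by apply: cont_comp cg; exact: continuous_subl.
have cgx' : continuous (fun y : E => g' (x - y)).
  by apply: cont_comp cg'; exact: continuous_subl.
have := @Rint_partial_compact i (fun y => k y * g (x - y))
  (fun y => k' y * g (x - y) + k y * - g' (x - y)) r r0 _ _ _ _ (HDM hk (HD_subl x hD)).
rewrite RintD; last 2 first.
- exact: (@L1_conv k' (fun=> g) 0).
- by apply: (@L1_conv k (fun _ y => - g' y) 0) => //; exact: bucN.
rewrite (_ : (fun y => k y * - g' (x - y)) = (fun y => - (k y * g' (x - y)))); last first.
  by apply/funext => y; rewrite mulrN.
rewrite RintN; last exact: (@L1_conv k (fun=> g') 0).
move=> h; apply/eqP; rewrite -subr_eq0; apply/eqP; apply: h.
- exact: contM.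
- by apply: contD; apply: contM => //; exact: contN.
- by move=> y yr; rewrite kr// mul0r.
- by move=> y yr; rewrite kr// kr'// !mul0r addr0.
Qed.

End convolution_calculus.

Section mollifier_kernel.
Context {R : realType} {d : nat}.
Local Notation E := 'rV[R]_d.
Local Notation leb := (@lebesgue_row R d).
Local Opaque lebesgue_row.
Variables (D : R) (omega : E -> R) (hmol : mollifier D omega).
Variables (eta : R) (eta_gt0 : 0 < eta).
Local Notation k := (scaled omega eta).

Lemma mollifier_continuous : continuous omega.
Proof. by case: hmol => -[/(_ 0)[]]. Qed.

Lemma mollifier_HD i : HD i omega (partial i omega).
Proof. by case: hmol => -[/(_ 1)[_ /(_ i)[h _]] _ _ _] _; exact: partial_HD. Qed.

Lemma mollifier_partial_continuous i : continuous (partial i omega).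
Proof. by case: hmol => -[/(_ 1) + _ _ _] _ => -[_ /(_ i)[_ []]]. Qed.

Lemma mollifier_even x : omega (- x) = omega x.
Proof.
case: hmol => -[_ _ rad _] _; apply: rad; rewrite /enorm; congr Num.sqrt.
by apply: eq_bigr => i _; rewrite mxE sqrrN.
Qed.

Lemma coord_le_enorm (x : E) i : `|x ord0 i| <= enorm x.
Proof.
rewrite /enorm -sqrtr_sqr ler_sqrt; last by apply: sumr_ge0 => j _; exact: sqr_ge0.
by rewrite (bigD1 i)//= lerDl sumr_ge0// => j _; exact: sqr_ge0.
Qed.

Lemma mollifier_support x : 1 < `|x| -> omega x = 0.
Proof.
move=> x1; apply/eqP; apply: contraLR x1 => h; rewrite -leNgt.
case: hmol => -[_ _ _ /(_ _ h) xle] _; apply: norm_le_coord => // i.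
exact: le_trans (coord_le_enorm _ _) xle.
Qed.

(** The i-th partial derivative of the scaled kernel, with the chain rule
    already applied. *)
Definition dkernel i (x : E) := eta ^- d * (eta^-1 * partial i omega (eta^-1 *: x)).

Lemma kernel_HD i : HD i k (dkernel i).
Proof. by apply: HDZ; apply: HD_scale; exact: mollifier_HD. Qed.

Lemma kernel_partial i : partial i k = dkernel i.
Proof. exact: HD_partial (kernel_HD i). Qed.

Lemma continuous_scalel (c : R) : continuous (fun x : E => c *: x).
Proof. exact: continuous_scalel_normed.
Qed.

Lemma kernel_continuous : continuous k.
Proof.
apply: contM; first exact: cont_cst.
apply: cont_comp; [exact: continuous_scalel|exact: mollifier_continuous].
Qed.

Lemma dkernel_continuous i : continuous (dkernel i).
Proof.
apply: contM; first exact: cont_cst.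
apply: contM; first exact: cont_cst.
apply: cont_comp; [exact: continuous_scalel|exact: mollifier_partial_continuous].
Qed.

Lemma kernel_support x : eta < `|x| -> k x = 0.
Proof.
move=> xe; rewrite /scaled mollifier_support ?mulr0//.
by rewrite normrZ gtr0_norm ?invr_gt0// mulrC ltr_pdivlMr// mul1r.
Qed.

Lemma dkernel_support i x : eta < `|x| -> dkernel i x = 0.
Proof.
move=> xe; have [_ <-] := kernel_HD i x.
suff [_ ->] : is_derive x (basis_vec i) k 0 by [].
apply: cvg_derive => e e0; exists (`|x| - eta); first by rewrite subr_gt0.
move=> h _ hx; rewrite !kernel_support ?subrr ?mulr0 ?subr0 ?normr0 ?ltW//.
have := ler_normB (x + h *: basis_vec i) (h *: basis_vec i); rewrite addrK.
by have := norm_basis_vec i h; lra.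
Qed.

Lemma L1_kernel : L1 leb k.
Proof. exact: L1_compact_support kernel_continuous kernel_support. Qed.

Lemma L1_dkernel i : L1 leb (dkernel i).
Proof. exact: L1_compact_support (@dkernel_continuous i) (@dkernel_support i). Qed.

Lemma kernel_even x : k (- x) = k x.
Proof. by rewrite /scaled scalerN mollifier_even. Qed.

(** The kernel is radial, hence even, and the derivative of an even function is
    odd. *)
Lemma dkernel_odd i x : dkernel i (- x) = - dkernel i x.
Proof.
have h := HD_scale (-1) (kernel_HD i).
rewrite (_ : (fun x => k (-1 *: x)) = k) in h; last first.
  by apply/funext => y; rewrite scaleN1r kernel_even.
have [_ h1] := h x; have [_ h2] := kernel_HD i x.
by rewrite h2 in h1; rewrite h1 scaleN1r mulN1r opprK.
Qed.

Lemma kernel_ge0 x : 0 <= k x.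
Proof.
case: hmol => -[_ o0 _ _] _.
by rewrite mulr_ge0// invr_ge0 exprn_ge0// ltW.
Qed.

Lemma kernel_Rint : \int[leb]_y k y = 1.
Proof.
have io : L1 leb omega := L1_compact_support mollifier_continuous mollifier_support.
case: hmol => -[_ o0 _ _] [<- _ _]; rewrite /Rintegral; congr fine.
have mo : measurable_fun setT (EFin \o omega).
  by apply/measurable_EFinP; exact: continuous_measurable_row mollifier_continuous.
have o0' x : (0 <= (EFin \o omega) x)%E by rewrite lee_fin.
have e1 : 0 < eta^-1 by rewrite invr_gt0.
have h : (\int[leb]_x (EFin \o omega) (eta^-1 *: x)%R =
    (eta ^+ d)%:E * \int[leb]_x (EFin \o omega) x)%E.
  have := ge0_integral_row_affine 0 e1 mo o0'.
  rewrite exprVn invrK => <-.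
  by apply: eq_integral => x _; rewrite addr0.
under eq_integral do rewrite EFinM.
rewrite ge0_integralZl//; last 3 first.
- apply: (measurableT_comp mo).
  rewrite (_ : *:%R _ = (fun x => eta^-1 *: x + 0)); first exact: measurable_row_affine.
  by apply/funext => x; rewrite addr0.
- by move=> x _; exact: o0'.
- by rewrite lee_fin invr_ge0 exprn_ge0// ltW.
by rewrite h muleA -EFinM mulVf ?mul1e// expf_neq0// gt_eqF.
Qed.

Lemma knorm_kernel : knorm k = 1.
Proof.
rewrite -kernel_Rint; apply: eq_Rint => x.
by rewrite ger0_norm// kernel_ge0.
Qed.

Lemma convol_cst (c : R) x : convol k (fun=> c) x = c.
Proof.
rewrite /convol; under eq_Rintegral do rewrite mulrC.
by rewrite RintZ ?kernel_Rint ?mulr1//; exact: L1_kernel.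
Qed.

Lemma dkernel_convol i g g' : buc (fun=> g) -> buc (fun=> g') -> HD i g g' ->
  convol (dkernel i) g = convol k g'.
Proof.
move=> hg hg' hD; apply: (convol_partial (ltW eta_gt0) kernel_continuous _ _ _ _ hg hg' hD).
- exact: dkernel_continuous.
- exact: kernel_support.
- exact: dkernel_support.
- exact: kernel_HD.
Qed.

Lemma cform_kernel_sym f g : pl2 f -> pl2 g -> cform k f g = cform k g f.
Proof.
have E0 : (fun y => k (- y)) = k by apply/funext => y; exact: kernel_even.
move=> hf hg; rewrite cform_sym ?E0//; exact: L1_kernel.
Qed.

(** Since the derivative of the kernel is odd, the form it defines is
    antisymmetric. This brings a differentiable argument to the right, where it
    can take over the derivative of the kernel. *)
Lemma cform_dkernel_sym i f g : pl2 f -> pl2 g ->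
  cform (dkernel i) f g = - cform (dkernel i) g f.
Proof.
have E0 : (fun y => dkernel i (- y)) = (fun y => - dkernel i y).
  by apply/funext => y; exact: dkernel_odd.
have iN : L1 leb (fun y => - dkernel i y).
  by under eq_fun do rewrite -mulN1r; apply: L1Z; exact: L1_dkernel.
move=> hf hg; rewrite cform_sym ?E0//; last exact: L1_dkernel.
rewrite /cform -RintN; last by apply: conv_L1 => //; exact: L1_dkernel.
by apply: eq_Rint => z; rewrite /conv_fun mulrN mulNr.
Qed.

(** When one argument is differentiable, the derivative is moved from the
    kernel onto it. *)
Lemma cform_dkernel_r i f g g' : pl2 f -> buc (fun=> g) -> buc (fun=> g') -> HD i g g' ->
  cform (dkernel i) f g = cform k f g'.
Proof.
move=> hf hg hg' hD.
rewrite (cform_convol (L1_dkernel i) hf (pl2_buc 0 hg)).2.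
by rewrite (cform_convol L1_kernel hf (pl2_buc 0 hg')).2 (dkernel_convol hg hg').
Qed.

End mollifier_kernel.

(** * Bregman divergences and the potential *)

Section second_order_comparison.
Context {R : realType}.
Implicit Types f g : R -> R.

Lemma MVT_real f f' (x y : R) : (forall u : R, is_derive u (1 : R) f (f' u)) ->
  exists2 z, 0 <= (z - x) * (y - x) & f y - f x = f' z * (y - x).
Proof.
move=> df.
have cf a b : {within `[a, b], continuous f}.
  by apply: derivable_within_continuous => s _; case: (df s).
have [xy|yx] := leP x y.
  have [z + E] := MVT_segment xy (fun s _ => df s) (cf _ _).
  rewrite in_itv /= => /andP[h1 h2]; exists z => //.
  by rewrite mulr_ge0// subr_ge0.
have [z + E] := MVT_segment (ltW yx) (fun s _ => df s) (cf _ _).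
rewrite in_itv /= => /andP[h1 h2]; exists z.
  by rewrite mulr_le0// subr_le0// ltW.
by rewrite -[LHS]opprB E -mulrN opprB.
Qed.

(** The Bregman divergence of f at x, the defect of the affine approximation;
    the derivative is a separate argument. *)
Definition breg f f' (y x : R) := f y - f x - f' x * (y - x).

Lemma breg_ge0 f f' f'' (x y : R) : (forall u : R, is_derive u (1 : R) f (f' u)) ->
  (forall u : R, is_derive u (1 : R) f' (f'' u)) -> (forall u, 0 <= f'' u) ->
  0 <= breg f f' y x.
Proof.
move=> df df' f0; rewrite /breg.
have [z zxy ->] := MVT_real x y df.
rewrite -mulrBl; have [w _ ->] := MVT_real x z df'.
by rewrite -mulrA mulr_ge0.
Qed.

(** Divergences are monotone in the second derivative: both h - g and h + g are
    convex when the second derivative of g is dominated by that of h. *)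
Lemma breg_le g g' g'' h h' h'' (x y : R) :
  (forall u : R, is_derive u (1 : R) g (g' u)) ->
  (forall u : R, is_derive u (1 : R) g' (g'' u)) ->
  (forall u : R, is_derive u (1 : R) h (h' u)) ->
  (forall u : R, is_derive u (1 : R) h' (h'' u)) ->
  (forall u, `|g'' u| <= h'' u) -> `|breg g g' y x| <= breg h h' y x.
Proof.
move=> dg dg' dh dh' gh.
have D1 (a a' b b' : R -> R) : (forall u : R, is_derive u (1 : R) a (a' u)) ->
    (forall u : R, is_derive u (1 : R) b (b' u)) ->
    forall u : R, is_derive u (1 : R) (fun v => a v + b v) (a' u + b' u).
  by move=> h1 h2 u; have := h1 u; have := h2 u => *; exact: is_deriveD.
have D2 (a a' b b' : R -> R) : (forall u : R, is_derive u (1 : R) a (a' u)) ->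
    (forall u : R, is_derive u (1 : R) b (b' u)) ->
    forall u : R, is_derive u (1 : R) (fun v => a v - b v) (a' u - b' u).
  by move=> h1 h2 u; have := h1 u; have := h2 u => *; exact: is_deriveB.
have h1 := @breg_ge0 _ _ _ x y (D1 _ _ _ _ dh dg) (D1 _ _ _ _ dh' dg').
have h2 := @breg_ge0 _ _ _ x y (D2 _ _ _ _ dh dg) (D2 _ _ _ _ dh' dg').
rewrite ler_norml; apply/andP; split.
  have : 0 <= breg (fun v => h v + g v) (fun u => h' u + g' u) y x.
    by apply: h1 => u; have := gh u; rewrite ler_norml => /andP[]; lra.
  by rewrite /breg; lra.
have : 0 <= breg (fun v => h v - g v) (fun u => h' u - g' u) y x.
  by apply: h2 => u; have := gh u; rewrite ler_norml => /andP[]; lra.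
by rewrite /breg; lra.
Qed.

Lemma is_derive_quot (V : normedModType R) (f : V -> R) (x v : V) a e :
  is_derive x v f a -> 0 < e ->
  exists2 r, 0 < r & forall h, h != 0 -> `|h| < r ->
     `|h^-1 * (f (x + h *: v) - f x) - a| <= e.
Proof.
move=> [df <-] e0.
have := df; rewrite /derivable => /cvgrPdist_le/(_ _ e0).
move=> /nbhs_ballP[r /= r0 Hr]; exists r => // h h0 hr.
have := Hr h; rewrite /ball /= sub0r normrN => /(_ hr h0).
by rewrite /derive distrC /GRing.scale /= [x + _]addrC.
Qed.

Lemma is_derive_le0 f (t D : R) r : 0 < r -> is_derive t (1 : R) f D ->
  (forall s, t - r < s < t -> f t <= f s) -> D <= 0.
Proof.
move=> r0 hD fs; rewrite leNgt; apply/negP => D0.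
have D2 : 0 < D / 2 by rewrite divr_gt0.
have [q q0 H] := is_derive_quot hD D2.
pose m := Num.min r q; have m0 : 0 < m by rewrite lt_min r0.
have mr : m <= r by rewrite ge_min lexx.
have mq : m <= q by rewrite ge_min lexx orbT.
have h0 : - (m / 2) != 0 by rewrite oppr_eq0 gt_eqF// divr_gt0.
have := H _ h0; rewrite normrN gtr0_norm ?divr_gt0// => /(_ ltac:(lra)).
rewrite ler_norml => /andP[+ _].
have : (- (m / 2))^-1 * (f (t + - (m / 2) *: 1) - f t) <= 0.
  rewrite invrN mulNr oppr_le0 mulr_ge0 ?invr_ge0//; first lra.
  rewrite subr_ge0; apply: fs; rewrite [_ *: _]mulr1; apply/andP; split; lra.
lra.
Qed.

Lemma min_second_derivative f f' f'' x : (forall u : R, is_derive u (1 : R) f (f' u)) ->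
  (forall u : R, is_derive u (1 : R) f' (f'' u)) -> {for x, continuous f''} ->
  (forall u, f x <= f u) -> f' x = 0 /\ 0 <= f'' x.
Proof.
move=> df df' cf'' fx.
have f'x : f' x = 0.
  have : is_derive x (1 : R) f 0.
    have xab : x - 1 <= x + 1 by lra.
    have xi : x \in `]x - 1, x + 1[ by rewrite in_itv /=; apply/andP; split; lra.
    apply: (derive1_at_min xab _ xi (fun t _ => fx t)) => t _.
    by case: (df t).
  by have [_ <-] := df x; case.
split=> //; rewrite leNgt; apply/negP => fx0.
have nf : 0 < - f'' x by rewrite oppr_gt0.
have /cvgrPdist_lt/(_ _ nf)/nbhs_ballP[r /= r0 Hr] := cf''.
have neg u : `|u - x| < r -> f'' u < 0.
  move=> ur; have : ball x r u by rewrite /ball /= distrC.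
  move=> /Hr; rewrite /= ltr_norml => /andP[]; lra.
have xr : x < x + r / 2 by rewrite ltrDl divr_gt0.
have wc (g g' : R -> R) (a b : R) : (forall u : R, is_derive u (1 : R) g (g' u)) ->
    {within `[a, b], continuous g}.
  by move=> dg; apply: derivable_within_continuous => s _; case: (dg s).
have [c + E] := MVT xr (fun u _ => df u) (wc _ _ _ _ df).
rewrite in_itv /= => /andP[c1 c2].
have [w + E'] := MVT c1 (fun u _ => df' u) (wc _ _ _ _ df').
rewrite in_itv /= => /andP[w1 w2].
have : f'' w < 0 by apply: neg; rewrite gtr0_norm; lra.
move=> w0; have := fx (x + r / 2).
have f'c : f' c < 0 by move: E'; rewrite f'x subr0 => ->; nra.
by move: E => /eqP; rewrite subr_eq => /eqP ->; nra.
Qed.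

Lemma Ck1_is_derive n f m u : Ck1 n f -> (m < n)%N ->
  is_derive u (1 : R) (derive1n m f) (derive1n m.+1 f u).
Proof. by move=> [h _] mn; split; [exact: h|rewrite derive1nS derive1E]. Qed.

(** Convexity compares the difference quotient on a short segment with the one
    on the whole segment; let the length tend to 0. *)
Lemma convex_tangent f f' (x y : R) :
  convex_function setT (f : convex_lmodType R^o -> R^o) ->
  (forall u : R, is_derive u (1 : R) f (f' u)) -> 0 <= breg f f' y x.
Proof.
move=> cf df; rewrite /breg -[leRHS]opprK oppr_ge0 opprB subr_le0.
apply/ler_addgt0Pr => e e0.
pose v := y - x.
have hd : is_derive (0 : R) (1 : R) (fun s : R => f (s *: v + x)) (f' x * v).
  have lin : is_derive (0 : R) (1 : R) (fun s : R => s *: v + x) v.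
    have h1 : is_derive (0 : R) (1 : R) (fun s : R => s * v + x) (v + 0).
      apply: is_deriveD.
      have := is_deriveM (is_derive_id (0 : R) (1 : R)) (is_derive_cst v (0 : R) (1 : R)).
      by rewrite scaler0 add0r [v *: _]mulr1.
    by rewrite addr0 in h1.
  have df0 : is_derive ((0 : R) *: v + x) (1 : R) f (f' x) by rewrite scale0r add0r; exact: df.
  by have := @is_derive1_comp R f (fun s : R => s *: v + x) 0 _ _ df0 lin.
have [r r0 H] := is_derive_quot hd e0.
pose h := Num.min 1 (r / 2).
have h0 : 0 < h by rewrite lt_min ltr01 divr_gt0.
have h1 : h <= 1 by rewrite ge_min lexx.
have hr : h < r by rewrite (@le_lt_trans _ _ (r / 2)) ?ge_min ?lexx ?orbT//; lra.
have := H h (lt0r_neq0 h0); rewrite gtr0_norm// => /(_ hr).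
rewrite add0r [h *: 1]mulr1 scale0r add0r ler_norml => /andP[+ _].
have h01 : 0 <= h <= 1 by rewrite ltW.
have hi : Itv.spec (@Itv.num_sem R) (Itv.Real `[0%Z, 1%Z]) h.
  by rewrite /= /Itv.num_sem /= num_real in_itv /= h01.
have := cf (Itv.mk hi) y x; rewrite !inE => /(_ I I).
rewrite /conv /= => cvx.
suff : h^-1 * (f (h *: v + x) - f x) <= f y - f x by rewrite -/v; lra.
rewrite mulrC ler_pdivrMr//.
have {}cvx : f (h *: y + unstable.onem h *: x) <= h * f y + unstable.onem h * f x := cvx.
move: cvx; rewrite (_ : h *: y + unstable.onem h *: x = h *: v + x); first by rewrite /unstable.onem; lra.
by rewrite /v /unstable.onem /GRing.scale /=; ring.
Qed.

Lemma convex_derive2_ge0 f f' f'' (x : R) :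
  convex_function setT (f : convex_lmodType R^o -> R^o) ->
  (forall u : R, is_derive u (1 : R) f (f' u)) ->
  (forall u : R, is_derive u (1 : R) f' (f'' u)) -> 0 <= f'' x.
Proof.
move=> cf df df'; apply/ler_addgt0Pr => e e0.
have [r r0 H] := is_derive_quot (df' x) e0.
have r2 : 0 < r / 2 by rewrite divr_gt0.
have := H _ (lt0r_neq0 r2); rewrite gtr0_norm// => /(_ ltac:(lra)).
rewrite [_ *: 1]mulr1 ler_norml => /andP[_].
set y := x + r / 2.
have t1 := convex_tangent x y cf df; have t2 := convex_tangent y x cf df.
suff : 0 <= (r / 2)^-1 * (f' y - f' x) by lra.
apply: mulr_ge0; first by rewrite invr_ge0 ltW.
have : 0 <= (f' y - f' x) * (r / 2).
  by move: t1 t2; rewrite /breg /y; lra.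
by rewrite pmulr_lge0.
Qed.

End second_order_comparison.

Section derivation_rules.
Context {R : realType}.
Implicit Types f g : R -> R.

Definition DER f f' := forall u : R, is_derive u (1 : R) f (f' u).

Lemma DERD f f' g g' : DER f f' -> DER g g' -> DER (fun u => f u + g u) (fun u => f' u + g' u).
Proof. by move=> h1 h2 u; have := h1 u; have := h2 u => *; exact: is_deriveD. Qed.

Lemma DERB f f' g g' : DER f f' -> DER g g' -> DER (fun u => f u - g u) (fun u => f' u - g' u).
Proof. by move=> h1 h2 u; have := h1 u; have := h2 u => *; exact: is_deriveB. Qed.

Lemma DERZ c f f' : DER f f' -> DER (fun u => c * f u) (fun u => c * f' u).
Proof. by move=> h u; have hu := h u; exact: (is_deriveZ c hu). Qed.

Lemma DER_id : DER id (fun=> 1).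
Proof. by move=> u; exact: is_derive_id. Qed.

Lemma DERM f f' g g' : DER f f' -> DER g g' ->
  DER (fun u => f u * g u) (fun u => f' u * g u + f u * g' u).
Proof.
move=> h1 h2 u; have h1u := h1 u; have h2u := h2 u.
have := is_deriveM h1u h2u.
by rewrite addrC /GRing.scale /= [g u * _]mulrC.
Qed.

Lemma DER_sq : DER (fun u => u ^+ 2) (fun u => 2 * u).
Proof.
move=> u; have := DERM DER_id DER_id u.
by rewrite mul1r mulr1 -mulr2n mulr_natl.
Qed.

Lemma DER_lin c : DER (fun u => c * u) (fun=> c).
Proof. by move=> u; have := DERZ c DER_id u; rewrite mulr1. Qed.

End derivation_rules.

Section potential.
Context {R : realType}.

Lemma breg_sq_le (f f' f'' : R -> R) (M x y : R) : DER f f' -> DER f' f'' ->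
  (forall u, `|f'' u| <= M) -> `|breg f f' y x| <= M / 2 * (y - x) ^+ 2.
Proof.
move=> df df' fM.
have dlin : DER (fun u => M / 2 * (2 * u)) (fun=> M / 2 * 2) by apply: DERZ; exact: DER_lin.
have := breg_le x y df df' (DERZ (M / 2) DER_sq) dlin.
have -> : breg (fun v : R => M / 2 * v ^+ 2) (fun v : R => M / 2 * (2 * v)) y x =
    M / 2 * (y - x) ^+ 2 by rewrite /breg; field.
by apply => u; rewrite divfK.
Qed.

(** The second derivative of the pressure u F' - F is F'' + u F''', and its
    F1-part is at most C + 1 times F1'' up to an additive constant, by the
    hypothesis on u F1'''. Comparison of second derivatives then bounds the
    divergence of the pressure by the divergence of F1 plus a square, which is
    what the relative energy controls. *)
Lemma pressure_breg_le (F1 F1' F1'' F1''' F2 F2' F2'' F2''' : R -> R) (C M2 B3 x y : R) :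
  DER F1 F1' -> DER F1' F1'' -> DER F1'' F1''' ->
  DER F2 F2' -> DER F2' F2'' -> DER F2'' F2''' -> 0 <= C ->
  (forall u, 0 <= F1'' u) -> (forall u, `|u * F1''' u| <= C * (F1'' u + 1)) ->
  (forall u, `|F2'' u| <= M2) -> (forall u, `|u * F2''' u| <= B3) ->
  `|breg (fun u => u * (F1' u + F2' u) - (F1 u + F2 u)) (fun u => u * (F1'' u + F2'' u)) y x|
  <= (1 + C + M2 + B3) * (breg F1 F1' y x + (y - x) ^+ 2).
Proof.
move=> d1 d1' d1'' d2 d2' d2'' C0 F10 h1 h2 h3; set C' := 1 + C + M2 + B3.
have dg : DER (fun u => u * (F1' u + F2' u) - (F1 u + F2 u)) (fun u => u * (F1'' u + F2'' u)).
  have := DERB (DERM DER_id (DERD d1' d2')) (DERD d1 d2).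
  rewrite [X in DER _ X -> _](_ : _ = (fun u => u * (F1'' u + F2'' u)))//.
  by apply/funext => u /=; ring.
have dg' := DERM DER_id (DERD d1'' d2'').
have dh := DERD (DERZ C' d1) (DERZ C' DER_sq).
have dh' : DER (fun u => C' * F1' u + C' * (2 * u)) (fun u => C' * F1'' u + C' * 2).
  by apply: DERD; [exact: DERZ|apply: DERZ; exact: DER_lin].
apply: (le_trans (breg_le x y dg dg' dh dh' _)); last first.
  have -> : breg (fun u => C' * F1 u + C' * u ^+ 2) (fun u => C' * F1' u + C' * (2 * u)) y x =
    C' * breg F1 F1' y x + C' * (y - x) ^+ 2 by rewrite /breg; ring.
  by rewrite [leRHS]mulrDr.
move=> u; rewrite mul1r mulrDr.
have e1 := F10 u; have e2 := h2 u; have e3 := h1 u; have e4 := h3 u.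
have a1 := ler_normD (F1'' u + F2'' u) (u * F1''' u + u * F2''' u).
have a2 := ler_normD (F1'' u) (F2'' u).
have a3 := ler_normD (u * F1''' u) (u * F2''' u).
rewrite (ger0_norm e1) in a2.
have M20 : 0 <= M2 := le_trans (normr_ge0 _) e2.
have B30 : 0 <= B3 := le_trans (normr_ge0 _) e4.
have p1 := mulr_ge0 M20 e1; have p2 := mulr_ge0 B30 e1.
rewrite /C'; lra.
Qed.

Variables (CP : R) (F : R -> R) (hCP : 0 < CP) (hF : potential_assumption CP F).

Local Notation "f ^` ()" := (derive1 f) : ring_scope.
Local Notation "f ^` ( n )" := (derive1n n f) : ring_scope.

(** The growth assumptions in the form in which they act. The derivatives are
    named. F1 is convex; the nonconvexity of F2 is quantified by M2, strictly
    smaller than the inverse of the Poincare constant; Cp compares the Bregman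
    divergence of the pressure with that of F1. *)
Definition potential_data (F1 F1' F1'' F2 F2' F2'' F''' : R -> R) (M2 B Cp : R) : Prop :=
  [/\ [/\ forall u, F u = F1 u + F2 u, DER F1 F1', DER F2 F2', DER F1' F1'' & DER F2' F2''],
     [/\ DER (fun v => F1'' v + F2'' v) F''', continuous F1'', continuous F2'' & continuous F'''],
     [/\ forall u, 0 <= F1'' u, forall x y, 0 <= breg F1 F1' y x &
         forall u, - B <= F u],
     [/\ 0 <= M2, M2 < CP^-1, forall u, `|F2'' u| <= M2 &
          forall x y, `|breg F2 F2' y x| <= M2 / 2 * (y - x) ^+ 2] &
     0 <= Cp /\ forall x y,
      `|breg (fun u => u * (F1' u + F2' u) - (F1 u + F2 u)) (fun u => u * (F1'' u + F2'' u)) y x|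
       <= Cp * (breg F1 F1' y x + (y - x) ^+ 2)].

Lemma potential_facts : exists (F1 F1' F1'' F2 F2' F2'' F''' : R -> R) (M2 B Cp : R),
  potential_data F1 F1' F1'' F2 F2' F2'' F''' M2 B Cp.
Proof.
case: hF => k [C [F1 [F2 [k2 C0 FE [cF1 cv F10 [_ _ _ h3]] [cF2 [b0 b1 b2 b3] sM]]]]].
pose M2 := sup [set `|F2^`(2) s| | s in setT].
have D10 : DER F1 F1^`(1) := fun u => Ck1_is_derive u cF1 (isT : (0 < 4)%N).
have D11 : DER F1^`(1) F1^`(2) := fun u => Ck1_is_derive u cF1 (isT : (1 < 4)%N).
have D12 : DER F1^`(2) F1^`(3) := fun u => Ck1_is_derive u cF1 (isT : (2 < 4)%N).
have D20 : DER F2 F2^`(1) := fun u => Ck1_is_derive u cF2 (isT : (0 < 4)%N).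
have D21 : DER F2^`(1) F2^`(2) := fun u => Ck1_is_derive u cF2 (isT : (1 < 4)%N).
have D22 : DER F2^`(2) F2^`(3) := fun u => Ck1_is_derive u cF2 (isT : (2 < 4)%N).
have M2le u : `|F2^`(2) u| <= M2.
  case: b2 => M hM; apply: ub_le_sup; last by exists u.
  by exists M => _ [s _ <-]; exact: hM.
have F1p u : 0 <= F1^`(2) u by exact: (convex_derive2_ge0 u cv D10 D11).
have [B hB] := b0; have [B3 hB3] := b3.
have M20 : 0 <= M2 := le_trans (normr_ge0 _) (M2le 0).
have B30 : 0 <= B3 := le_trans (normr_ge0 _) (hB3 0).
exists F1, F1^`(1), F1^`(2), F2, F2^`(1), F2^`(2), (fun u => F1^`(3) u + F2^`(3) u), M2, B.
exists (1 + C + M2 + B3); split.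
- split; [exact: FE|exact: D10|exact: D20|exact: D11|exact: D21].
- split; first exact: (DERD D12 D22).
  + by case: cF1 => _ /(_ 2 isT).
  + by case: cF2 => _ /(_ 2 isT).
  + by apply: contD; [case: cF1 => _ /(_ 3 isT)|case: cF2 => _ /(_ 3 isT)].
- split; [exact: F1p|exact: (fun x y => convex_tangent x y cv D10)|].
  move=> u; rewrite FE; have := hB u; have := F10 u.
  by rewrite ler_norml => ? /andP[]; lra.
- split; [exact: M20|exact: sM|exact: M2le|].
  exact: (fun x y => breg_sq_le x y D20 D21 M2le).
- split; first by rewrite !addr_ge0// ltW.
  exact: (fun x y => pressure_breg_le x y D10 D11 D12 D20 D21 D22 (ltW C0) F1p h3 M2le hB3).
Qed.

End potential.

(** * The classical solution *)

Lemma continuous_line_normed {R : realType} (V : normedModType R) (v w : V) :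
  continuous (fun s : R => s *: v + w).
Proof. by move=> s; apply: cvgD; [apply: cvgZl; exact: cvg_id|exact: cvg_cst]. Qed.

Section classical_solution.
Context {R : realType} {d : nat}.
Local Notation E := 'rV[R]_d.
Local Notation tor := (torus_prob d : probability E R).
Local Notation leb := (@lebesgue_row R d).
Local Opaque lebesgue_row.
Variables (D : R) (omega : E -> R) (hmol : mollifier D omega).
Variables (eta : R) (eta0 : 0 < eta) (T : R) (T0 : 0 < T).
Variables (F F' F'' F''' : R -> R).
Hypotheses (dF : DER F F') (dF' : DER F' F'') (dF'' : DER F'' F''') (cF''' : continuous F''').
Variables (rho0 : E -> R) (rho : R -> E -> R).
Hypothesis hrho : classical_solution omega F T eta rho0 rho.
Local Notation k := (scaled omega eta).
Let ik : L1 leb k := L1_kernel hmol eta0.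
Let T0' : 0 <= T := ltW T0.

Lemma periodic_partial i (f : E -> R) : Zd_periodic f -> Zd_periodic (partial i f).
Proof.
move=> per x j.
have E0 : (fun h : R => f (h *: basis_vec i + (x + basis_vec j))) =
    (fun h : R => f (h *: basis_vec i + x)) by apply/funext => h; rewrite addrA per.
by rewrite /partial (derive_lineE f (x + basis_vec j)) (derive_lineE f x) E0.
Qed.

(** The density, frozen outside [0, T], followed by its gradient and Hessian;
    cmu, ca, cb and cM are the chemical potential with its gradient, Hessian
    and time derivative, and cG is div (rho grad mu), the right-hand side of
    the equation. The derivatives are written out so that their continuity is a
    closure property. *)
Definition cP t : E -> R := rho (clamp T t).
Definition cPi i t : E -> R := partial i (cP t).
Definition cPij i j t : E -> R := partial j (cPi i t).

Lemma cP_per t : 0 <= t <= T -> Zd_periodic (rho t).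
Proof. by move=> ht; have [/(_ t ht)[]] := hrho. Qed.

Lemma cP_in t : 0 <= t <= T -> cP t = rho t.
Proof. by move=> ht; rewrite /cP clamp_id. Qed.

Lemma buc_cP : buc cP.
Proof.
apply: (@buc_clamp R d T rho T0' cP_per).
by case: hrho => _ [].
Qed.

Lemma buc_cPi i : buc (cPi i).
Proof.
apply: (@buc_clamp R d T (fun t => partial i (rho t)) T0').
  by move=> t ht; apply: periodic_partial; exact: cP_per.
by case: hrho => _ [_ /(_ i)].
Qed.

Lemma buc_cPij i j : buc (cPij i j).
Proof.
apply: (@buc_clamp R d T (fun t => partial j (partial i (rho t))) T0').
  by move=> t ht; do 2! apply: periodic_partial; exact: cP_per.
by case: hrho => _ [_ _ /(_ i j)].
Qed.

Lemma HD_cP i t : HD i (cP t) (cPi i t).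
Proof.
have [/(_ (clamp T t) (clamp_itv _ T0'))[_ [_ /(_ i)[h _]]] _ _ _] := hrho.
exact: partial_HD.
Qed.

Lemma HD_cPi i j t : HD j (cPi i t) (cPij i j t).
Proof.
have [/(_ (clamp T t) (clamp_itv _ T0'))[_ [_ /(_ i)[_ [_ /(_ j)[h _]]]]] _ _ _] := hrho.
exact: partial_HD.
Qed.

Definition cmu t x := eta ^- 2 * (cP t x - convol k (cP t) x) + F' (cP t x).
Definition ca i t x := F'' (cP t x) * cPi i t x + eta ^- 2 * (cPi i t x - convol k (cPi i t) x).
Definition cb i j t x := (F''' (cP t x) * cPi j t x * cPi i t x + F'' (cP t x) * cPij i j t x)
  + eta ^- 2 * (cPij i j t x - convol k (cPij i j t) x).
Definition cG t x := \sum_i (cPi i t x * ca i t x + cP t x * cb i i t x).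
Definition cM t x := F'' (cP t x) * cG t x + eta ^- 2 * (cG t x - convol k (cG t) x).

Lemma DER_continuous (f f' : R -> R) : DER f f' -> continuous f.
Proof.
move=> df x; apply/differentiable_continuous/derivable1_diffP.
by case: (df x).
Qed.

Let cF' := DER_continuous dF'.
Let cF'' := DER_continuous dF''.

Lemma buc_cmu : buc cmu.
Proof.
apply: bucD; last exact: (buc_comp cF' buc_cP).
exact: (bucZ _ (bucB buc_cP (buc_convol ik buc_cP))).
Qed.

Lemma buc_ca i : buc (ca i).
Proof.
apply: bucD; first exact: (bucM (buc_comp cF'' buc_cP) (buc_cPi i)).
exact: (bucZ _ (bucB (buc_cPi i) (buc_convol ik (buc_cPi i)))).
Qed.

Lemma buc_cb i j : buc (cb i j).
Proof.
apply: bucD.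
  apply: bucD; last exact: (bucM (buc_comp cF'' buc_cP) (buc_cPij i j)).
  exact: (bucM (bucM (buc_comp cF''' buc_cP) (buc_cPi j)) (buc_cPi i)).
exact: (bucZ _ (bucB (buc_cPij i j) (buc_convol ik (buc_cPij i j)))).
Qed.

Lemma buc_cG : buc cG.
Proof.
by apply: buc_sum => i; exact: (bucD (bucM (buc_cPi i) (buc_ca i)) (bucM buc_cP (buc_cb i i))).
Qed.

Lemma buc_cM : buc cM.
Proof.
apply: bucD; first exact: (bucM (buc_comp cF'' buc_cP) buc_cG).
exact: (bucZ _ (bucB buc_cG (buc_convol ik buc_cG))).
Qed.

Lemma HD_conv_cP i t : HD i (convol k (cP t)) (convol k (cPi i t)).
Proof.
exact: (HD_convol ik (buc_static t buc_cP) (buc_static t (buc_cPi i)) (HD_cP i t)).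
Qed.

Lemma HD_conv_cPi i j t : HD j (convol k (cPi i t)) (convol k (cPij i j t)).
Proof.
exact: (HD_convol ik (buc_static t (buc_cPi i)) (buc_static t (buc_cPij i j)) (HD_cPi i j t)).
Qed.

Lemma HD_cmu i t : HD i (cmu t) (ca i t).
Proof.
have h := HDD (HDZ (eta ^- 2) (HDB (HD_cP i t) (HD_conv_cP i t))) (HD_comp dF' (HD_cP i t)).
rewrite (_ : ca i t = (fun x => eta ^- 2 * (cPi i t x - convol k (cPi i t) x) + F'' (cP t x) * cPi i t x)).
  exact: h.
by apply/funext => x; rewrite /ca addrC.
Qed.

Lemma HD_ca i j t : HD j (ca i t) (cb i j t).
Proof.
exact: (HDD (HDM (HD_comp dF'' (HD_cP j t)) (HD_cPi i j t))
  (HDZ (eta ^- 2) (HDB (HD_cPi i j t) (HD_conv_cPi i j t)))).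
Qed.

Lemma HD_flux i t : HD i (fun x => cP t x * ca i t x) (fun x => cPi i t x * ca i t x + cP t x * cb i i t x).
Proof. exact: (HDM (HD_cP i t) (HD_ca i i t)). Qed.

(** cG is a divergence; this is conservation of mass in infinitesimal form. *)
Lemma Rint_cG t : \int[tor]_x cG t x = 0.
Proof.
have b1 i : buc (fun (_ : R) x => cPi i t x * ca i t x + cP t x * cb i i t x).
  by apply: bucD; apply: bucM; apply: buc_static;
    [exact: buc_cPi|exact: buc_ca|exact: buc_cP|exact: buc_cb].
rewrite /cG Rint_sum; last by move=> i; exact: (tor_buc 0 (b1 i)).
rewrite big1// => i _; apply: Rint_partial (b1 i) (HD_flux i t).
by apply: bucM; apply: buc_static; [exact: buc_cP|exact: buc_ca].
Qed.

Lemma rho_evol t x : 0 < t < T -> is_derive t (1 : R) (fun s => rho s x) (cG t x).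
Proof.
move=> tT; have [_ _ /(_ t x tT)[dt eq] _] := hrho.
split => //; move: eq; rewrite derive1E => ->.
have tT' : 0 <= t <= T by case/andP: tT => ? ?; rewrite !ltW.
apply: eq_bigr => i _.
have -> : (fun x => B_op omega eta (rho t) x + F^`()%classic (rho t x)) = cmu t.
  apply/funext => y; rewrite /cmu (cP_in tT'); congr (_ + _).
  by rewrite derive1E; have [_ ->] := dF (rho t y).
by rewrite (HD_partial (HD_cmu i t)) -(cP_in tT') (HD_partial (HD_flux i t)).
Qed.

Lemma cP0 : cP 0 = rho0.
Proof. by rewrite cP_in ?lexx//; apply/funext => x; have [_ _ _ ->] := hrho. Qed.

Lemma continuous_time (Phi : R -> E -> R) x : buc Phi -> continuous (fun s => Phi s x).
Proof.
move=> h t; have [_ _ uc] := h; apply/cvgrPdist_le => e e0.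
have [r r0 H] := uc _ e0; apply/nbhs_ballP; exists r => // s st.
by apply: H => //; rewrite subrr normr0.
Qed.

Lemma cP_evol s x : 0 < s < T -> is_derive s (1 : R) (fun r => cP r x) (cG s x).
Proof.
move=> sT; have h1 := rho_evol x sT.
have [rr rr0 ball_] : exists2 r, 0 < r & forall u, `|u - s| < r -> 0 <= u <= T.
  exists (Num.min s (T - s)); first by rewrite lt_min subr_gt0.
  move=> u; rewrite lt_min => /andP[]; rewrite !ltr_norml => /andP[? ?] /andP[? ?].
  by apply/andP; split; lra.
apply: cvg_derive => e e0; have [q q0 Hq] := is_derive_quot h1 e0.
exists (Num.min rr q); first by rewrite lt_min rr0.
move=> h h0; rewrite lt_min => /andP[hr hq].
have := Hq h h0 hq; rewrite !cP_in//.
  by case/andP: sT => ? ?; rewrite !ltW.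
by apply: ball_; rewrite [_ *: _]mulr1 addrAC subrr add0r.
Qed.

(** The equation holds only in the interior of the time interval, while the end
    points are needed as well: the mean value theorem requires no more than
    continuity there. *)
Lemma evol_MVT (H H' : R -> R) x t t' : DER H H' -> 0 <= t <= T -> 0 <= t' <= T ->
  exists s, [/\ 0 <= s <= T, `|s - t| <= `|t' - t| &
    H (cP t' x) - H (cP t x) = (t' - t) * (H' (cP s x) * cG s x)].
Proof.
move=> dH.
have aux a b : 0 <= a -> a <= b -> b <= T -> exists s, [/\ a <= s <= b &
    H (cP b x) - H (cP a x) = (b - a) * (H' (cP s x) * cG s x)].
  move=> a0 ab bT.
  have der s : s \in `]a, b[ -> is_derive s (1 : R) (fun r => H (cP r x)) (H' (cP s x) * cG s x).
    rewrite in_itv /= => /andP[as_ sb].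
    have sT : 0 < s < T by rewrite (le_lt_trans a0)//= (lt_le_trans sb).
    have E1 := cP_evol x sT.
    exact: (is_derive1_comp (f := H) (g := fun r => cP r x)).
  have cont : {within `[a, b], continuous (fun r => H (cP r x))}.
    apply: continuous_subspaceT; apply: (@continuous_time (fun r x => H (cP r x))).
    by apply: buc_comp; [exact: DER_continuous dH|exact: buc_cP].
  have [s + E1] := MVT_segment ab der cont.
  rewrite in_itv /= => sab; exists s; split => //.
  by rewrite E1 mulrC.
move=> /andP[t1 t2] /andP[t3 t4]; have [tt|tt] := leP t t'.
  have [s [/andP[s1 s2] E1]] := aux t t' t1 tt t4.
  exists s; split => //; first by apply/andP; split; lra.
  by rewrite !ger0_norm ?subr_ge0//; lra.
have [s [/andP[s1 s2] E1]] := aux t' t t3 (ltW tt) t2.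
exists s; split => //; first by apply/andP; split; lra.
  by rewrite !ler0_norm ?subr_le0//; lra.
by rewrite -[LHS]opprB E1 -mulNr opprB.
Qed.

(** The remainder is o(t' - t) uniformly in space, because the derivative in
    time is uniformly continuous. Expansions of this form can be integrated in
    space and convolved, which pointwise derivatives cannot. *)
Lemma evol_expand (H H' : R -> R) : DER H H' -> continuous H' -> forall e, 0 < e ->
  exists2 r, 0 < r & forall t t' x, 0 <= t <= T -> 0 <= t' <= T -> `|t' - t| < r ->
    `|H (cP t' x) - H (cP t x) - (t' - t) * (H' (cP t x) * cG t x)| <= e * `|t' - t|.
Proof.
move=> dH cH e e0.
have [_ _ uc] : buc (fun t x => H' (cP t x) * cG t x).
  by apply: bucM; [apply: buc_comp => //; exact: buc_cP|exact: buc_cG].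
have [r r0 Hr] := uc _ e0; exists r => // t t' x ht ht' tr.
have [s [_ st ->]] := evol_MVT x dH ht ht'.
rewrite -mulrBr normrM mulrC ler_wpM2r//; apply: Hr; last by rewrite subrr normr0.
exact: le_lt_trans st tr.
Qed.

Lemma cP_lip : exists2 C, 0 < C & forall t t' x, 0 <= t <= T -> 0 <= t' <= T ->
  `|cP t' x - cP t x| <= C * `|t' - t|.
Proof.
have [C C0 hC] := buc_bounded buc_cG; exists C => // t t' x ht ht'.
have [s [_ _ E1]] := @evol_MVT id (fun=> 1) x t t' (@DER_id R) ht ht'.
by rewrite /= in E1; rewrite E1 mul1r normrM mulrC ler_wpM2r.
Qed.

Lemma convolB (f g : E -> R) x : buc (fun=> f) -> buc (fun=> g) ->
  convol k (fun y => f y - g y) x = convol k f x - convol k g x.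
Proof.
move=> hf hg; rewrite /convol -RintB; [|exact: (L1_conv 0 x ik hf)|exact: (L1_conv 0 x ik hg)].
by apply: eq_Rint => y; rewrite mulrBr.
Qed.

Lemma convolZ (c : R) (f : E -> R) x : buc (fun=> f) ->
  convol k (fun y => c * f y) x = c * convol k f x.
Proof.
move=> hf; rewrite /convol -RintZ; last exact: (L1_conv 0 x ik hf).
by apply: eq_Rint => y; rewrite mulrCA.
Qed.

(** The expansion for the density is convolved with the kernel: convolution
    does not increase the sup norm of the remainder. *)
Lemma cmu_expand e : 0 < e ->
  exists2 r, 0 < r & forall t t' x, 0 <= t <= T -> 0 <= t' <= T -> `|t' - t| < r ->
    `|cmu t' x - cmu t x - (t' - t) * cM t x| <= e * `|t' - t|.
Proof.
move=> e0; set c := eta ^- 2; have c0 : 0 < c by rewrite invr_gt0 exprn_gt0.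
have e1 : 0 < e / (2 * c + 1) by rewrite divr_gt0// ltr_wpDl// mulr_ge0// ltW.
have [r1 r10 H1] := @evol_expand id (fun=> 1) (@DER_id R) (@cont_cst _ _ 1) _ e1.
have [r2 r20 H2] := evol_expand dF' cF'' e1.
exists (Num.min r1 r2); first by rewrite lt_min r10.
move=> t t' x ht ht'; rewrite lt_min => /andP[tr1 tr2].
have h2 := H2 t t' x ht ht' tr2.
have h1 y : `|cP t' y - cP t y - (t' - t) * cG t y| <= e / (2 * c + 1) * `|t' - t|.
  by have := H1 t t' y ht ht' tr1; rewrite mul1r.
have b1 : buc (fun=> cP t') by exact: buc_static buc_cP.
have b2 : buc (fun=> cP t) by exact: buc_static buc_cP.
have b3 : buc (fun=> cG t) by exact: buc_static buc_cG.
have b4 : buc (fun (_ : R) y => (t' - t) * cG t y) by exact: bucZ.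
have b5 : buc (fun (_ : R) y => cP t' y - cP t y) by exact: bucB.
have h3 : `|convol k (cP t') x - convol k (cP t) x - (t' - t) * convol k (cG t) x| <=
    e / (2 * c + 1) * `|t' - t|.
  rewrite -convolZ// -convolB// -convolB//.
  have := @convol_bound _ _ k (fun _ y => cP t' y - cP t y - (t' - t) * cG t y) 0 x
    (e / (2 * c + 1) * `|t' - t|) ik (bucB b5 b4) h1.
  by rewrite (knorm_kernel hmol eta0) mul1r.
rewrite (_ : cmu t' x - _ - _ =
    (F' (cP t' x) - F' (cP t x) - (t' - t) * (F'' (cP t x) * cG t x)) +
    c * ((cP t' x - cP t x - (t' - t) * cG t x) -
     (convol k (cP t') x - convol k (cP t) x - (t' - t) * convol k (cG t) x))); last first.
  by rewrite /cmu /cM -/c; ring.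
apply: (le_trans (ler_normD _ _)); rewrite normrM (gtr0_norm c0).
have := ler_normB (cP t' x - cP t x - (t' - t) * cG t x)
  (convol k (cP t') x - convol k (cP t) x - (t' - t) * convol k (cG t) x).
have := h1 x; set A := _ * `|t' - t| in h2 h3 *; move=> h1x hAB.
have -> : e * `|t' - t| = A + c * (A + A).
  rewrite /A; field; apply: lt0r_neq0; apply: ltr_wpDl => //; rewrite mulr_ge0// ltW//.
apply: lerD => //; rewrite ler_pM2l//; lra.
Qed.

(** A function whose increments are o(t' - t) has derivative 0. *)
Lemma const_of_expand (m : R -> R) :
  (forall e, 0 < e -> exists2 r, 0 < r & forall t t', 0 <= t <= T -> 0 <= t' <= T ->
     `|t' - t| < r -> `|m t' - m t| <= e * `|t' - t|) ->
  forall t, 0 <= t <= T -> m t = m 0.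
Proof.
move=> hm t ht.
pose n s := m (clamp T s).
have hn e : 0 < e -> exists2 r, 0 < r & forall s s', `|s' - s| < r -> `|n s' - n s| <= e * `|s' - s|.
  move=> e0; have [r r0 H] := hm e e0; exists r => // s s' ss.
  have lip := clamp_lip s' s T0'.
  apply: le_trans (H _ _ _ _ _) _; [exact: clamp_itv|exact: clamp_itv|exact: le_lt_trans lip ss|].
  by rewrite ler_wpM2l// ltW.
have dn (s : R) : is_derive s (1 : R) n 0.
  apply: cvg_derive => e e0; have [r r0 H] := hn e e0; exists r => // h h0 hr.
  have := H s (s + h); rewrite addrAC subrr add0r => /(_ hr) hs.
  by rewrite subr0 normrM normfV [_ *: _]mulr1 mulrC ler_pdivrMr// normr_gt0.
have [z _] := MVT_real 0 t dn; rewrite mul0r => /eqP; rewrite subr_eq0 => /eqP.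
by rewrite /n !clamp_id// lexx.
Qed.

Lemma mass_cons t : 0 <= t <= T -> \int[tor]_x cP t x = \int[tor]_x rho0 x.
Proof.
move=> ht; rewrite -cP0; move: t ht; apply: const_of_expand => e e0.
have [r r0 H] := @evol_expand id (fun=> 1) (@DER_id R) (@cont_cst _ _ 1) _ e0.
exists r => // t t' ht ht' tr.
have i1 s : L1 tor (cP s) := tor_buc s buc_cP.
have i2 : L1 tor (cG t) := tor_buc t buc_cG.
have -> : \int[tor]_x cP t' x - \int[tor]_x cP t x =
    \int[tor]_x (cP t' x - cP t x - (t' - t) * cG t x).
  rewrite RintB; [|exact: L1B|exact: L1Z].
  by rewrite RintB// RintZ// Rint_cG mulr0 subr0.
rewrite -[leRHS](Rint_tor_cst (d := d)); apply: le_norm_Rint.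
- by apply: L1B; [exact: L1B|exact: L1Z].
- by apply: (@tor_bounded _ _ _ `|e * `|t' - t| |).
- by move=> x; have := H t t' x ht ht' tr; rewrite mul1r.
Qed.

(** The nonlocal operator B_eta applied to a bounded continuous function. *)
Definition cB (f : E -> R) x := eta ^- 2 * (f x - convol k f x).
(** The part of the relative energy that involves the classical solution alone.
    Its density F - P F' - P B P / 2 is chosen so that, added to the linear
    term - rho mu, it turns the energy into a Bregman divergence. *)
Definition cK t := \int[tor]_x (F (cP t x) - cP t x * F' (cP t x) - 2^-1 * (cP t x * cB (cP t) x)).

Lemma buc_cB Phi : buc Phi -> buc (fun t => cB (Phi t)).
Proof. by move=> h; exact: (bucZ _ (bucB h (buc_convol ik h))). Qed.

Lemma cB_sub f g x : buc (fun=> f) -> buc (fun=> g) ->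
  cB (fun y => f y - g y) x = cB f x - cB g x.
Proof. by move=> hf hg; rewrite /cB convolB//; ring. Qed.

Lemma Rint_cB_sym f g : buc (fun=> f) -> buc (fun=> g) ->
  \int[tor]_x (f x * cB g x) = \int[tor]_x (g x * cB f x).
Proof.
move=> hf hg.
have pf := pl2_buc 0 hf; have pg := pl2_buc 0 hg.
have key (u v : E -> R) : pl2 u -> pl2 v -> \int[tor]_x (u x * cB v x) =
    eta ^- 2 * (\int[tor]_x (u x * v x) - cform k u v).
  move=> pu pv; have [i1 ->] := cform_convol ik pu pv.
  rewrite -(RintB (pl2M pu pv) i1) -RintZ; last exact: (L1B (pl2M pu pv) i1).
  by apply: eq_Rint => x; rewrite /cB; ring.
rewrite !key// (cform_kernel_sym hmol eta0 pf pg).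
by congr (_ * (_ - _)); apply: eq_Rint => x; rewrite mulrC.
Qed.

Lemma cB_bound f M x : buc (fun=> f) -> (forall y, `|f y| <= M) -> `|cB f x| <= eta ^- 2 * (2 * M).
Proof.
move=> hf fM; have c0 : 0 < eta ^- 2 by rewrite invr_gt0 exprn_gt0.
rewrite /cB normrM gtr0_norm// ler_pM2l//.
have := @convol_bound _ _ k (fun=> f) 0 x M ik hf fM; rewrite (knorm_kernel hmol eta0) mul1r => h.
have := ler_normB (f x) (convol k f x); have := fM x; lra.
Qed.

Let dFc := DER_continuous dF.

(** An exact identity: the quadratic part is symmetrized with the
    self-adjointness of the nonlocal operator, so that the difference of K at
    two times is expressed by quantities that are all o(t' - t). *)
Lemma cK_diff t t' (dl : R) : 
  cK t' - cK t + dl * \int[tor]_x (cP t x * cM t x) =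
  \int[tor]_x (F (cP t' x) - F (cP t x) - (cP t' x - cP t x) * F' (cP t' x)
     - 2^-1 * ((cP t' x - cP t x) * cB (fun y => cP t' y - cP t y) x)
     - cP t x * (cmu t' x - cmu t x - dl * cM t x)).
Proof.
have bP s := buc_static s buc_cP.
have bF s : buc (fun (_ : R) => F \o cP s) := buc_comp dFc (bP s).
have bF' s : buc (fun (_ : R) => F' \o cP s) := buc_comp cF' (bP s).
have bB s := buc_cB (bP s).
have bM := buc_static t buc_cM.
have L1b (Phi : R -> E -> R) (h : buc Phi) : L1 tor (Phi 0) := tor_buc 0 h.
pose f s x := F (cP s x) - cP s x * F' (cP s x) - 2^-1 * (cP s x * cB (cP s) x).
have bf s : buc (fun (_ : R) => f s).
  exact: (bucB (bucB (bF s) (bucM (bP s) (bF' s))) (bucZ 2^-1 (bucM (bP s) (bB s)))).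
pose g x := 2^-1 * (cP t x * cB (cP t') x - cP t' x * cB (cP t) x).
have bg : buc (fun (_ : R) => g) by exact: (bucZ _ (bucB (bucM (bP t) (bB t')) (bucM (bP t') (bB t)))).
have g0 : \int[tor]_x g x = 0.
  rewrite RintZ; last exact: (L1b _ (bucB (bucM (bP t) (bB t')) (bucM (bP t') (bB t)))).
  rewrite RintB; [|exact: (L1b _ (bucM (bP t) (bB t')))|exact: (L1b _ (bucM (bP t') (bB t)))].
  by rewrite (Rint_cB_sym (bP t) (bP t')) subrr mulr0.
rewrite -[LHS]subr0 -g0 /cK.
rewrite -RintZ; last exact: (L1b _ (bucM (bP t) bM)).
rewrite -(RintB (L1b _ (bf t')) (L1b _ (bf t))).
rewrite -(RintD (L1b _ (bucB (bf t') (bf t))) (L1b _ (bucZ dl (bucM (bP t) bM)))).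
rewrite -(RintB (L1b _ (bucD (bucB (bf t') (bf t)) (bucZ dl (bucM (bP t) bM)))) (L1b _ bg)).
apply: eq_Rint => x; rewrite cB_sub// /f /g /cmu /cB; by set c := eta ^- 2; field.
Qed.

(** The derivative of K in time is - int P M. Up to sign, K is the Legendre
    transform of the energy evaluated at mu, so its derivative is the pairing
    of P with the time derivative of mu, and the time derivative of P does not
    appear. *)
Lemma cK_expand e : 0 < e ->
  exists2 r, 0 < r & forall t t', 0 <= t <= T -> 0 <= t' <= T -> `|t' - t| < r ->
    `|cK t' - cK t + (t' - t) * \int[tor]_x (cP t x * cM t x)| <= e * `|t' - t|.
Proof.
move=> e0.
have [M M0 hM] := buc_bounded buc_cP.
have [CF1 CF10 hF1] := buc_bounded (buc_comp cF' buc_cP).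
have [Cl Cl0 hl] := cP_lip.
set c := eta ^- 2; have c0 : 0 < c by rewrite invr_gt0 exprn_gt0.
pose e4 := e / 4; have e40 : 0 < e4 by rewrite divr_gt0.
have [r1 r10 H1] := evol_expand dF cF' e40.
have eF'0 : 0 < e4 / CF1 by rewrite divr_gt0.
have [r2 r20 H2] := @evol_expand id (fun=> 1) (@DER_id R) (@cont_cst _ _ 1) _ eF'0.
have eM : 0 < e4 / M by rewrite divr_gt0.
have [r3 r30 H3] := cmu_expand eM.
have q0 : 0 < Cl * Cl * c by rewrite !mulr_gt0.
pose r4 := e4 / (Cl * Cl * c); have r40 : 0 < r4 by rewrite divr_gt0.
exists (Num.min (Num.min r1 r2) (Num.min r3 r4)); first by rewrite !lt_min r10 r20 r30.
move=> t t' ht ht'; rewrite !lt_min => /andP[/andP[d1 d2] /andP[d3 d4]].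
set dl := t' - t.
have bP s := buc_static s buc_cP.
have bF s : buc (fun (_ : R) => F \o cP s) := buc_comp dFc (bP s).
have bF' s : buc (fun (_ : R) => F' \o cP s) := buc_comp cF' (bP s).
have bd : buc (fun (_ : R) y => cP t' y - cP t y) := bucB (bP t') (bP t).
rewrite cK_diff -[leRHS](Rint_tor_cst (d := d)); apply: le_norm_Rint.
- have b1 : buc (fun (_ : R) x => F (cP t' x) - F (cP t x) - (cP t' x - cP t x) * F' (cP t' x)).
    exact: (bucB (bucB (bF t') (bF t)) (bucM bd (bF' t'))).
  have b2 : buc (fun (_ : R) x => 2^-1 * ((cP t' x - cP t x) * cB (fun y => cP t' y - cP t y) x)).
    exact: (bucZ _ (bucM bd (buc_cB bd))).
  have b3 : buc (fun (_ : R) x => cP t x * (cmu t' x - cmu t x - dl * cM t x)).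
    apply: (bucM (bP t)); apply: bucB; last exact: (bucZ _ (buc_static t buc_cM)).
    exact: (bucB (buc_static t' buc_cmu) (buc_static t buc_cmu)).
  exact: (tor_buc 0 (bucB (bucB b1 b2) b3)).
- by apply: (@tor_bounded _ _ _ `|e * `|dl| |).
move=> x.
have rev : `|t - t'| = `|t' - t| by rewrite distrC.
have := H1 t' t x ht' ht; rewrite rev => /(_ d1) h1.
have := H2 t' t x ht' ht; rewrite rev mul1r => /(_ d2) h2.
have h3 := H3 t t' x ht ht' d3.
rewrite -/dl in h1 h2 h3 *.
set A := F _ - F _ - _; set B := 2^-1 * _; set C := cP t x * _.
have hA : `|A| <= 2 * e4 * `|dl|.
  have -> : A = - (F (cP t x) - F (cP t' x) - (t - t') * (F' (cP t' x) * cG t' x))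
     + F' (cP t' x) * (cP t x - cP t' x - (t - t') * cG t' x) by rewrite /A; ring.
  apply: (le_trans (ler_normD _ _)); rewrite normrN normrM.
  have : `|F' (cP t' x)| * `|cP t x - cP t' x - (t - t') * cG t' x| <= CF1 * (e4 / CF1 * `|dl|).
    by apply: ler_pM.
  rewrite mulrA [CF1 * (_ / _)]mulrC divfK ?gt_eqF//; lra.
have hB : `|B| <= e4 * `|dl|.
  have l1 := hl t t' x ht ht'.
  have l2 := cB_bound x bd (fun y => hl t t' y ht ht').
  rewrite /B normrM ger0_norm ?invr_ge0// normrM.
  have : `|cP t' x - cP t x| * `|cB (fun y => cP t' y - cP t y) x| <= (Cl * `|dl|) * (c * (2 * (Cl * `|dl|))).
    by apply: ler_pM.
  have : (Cl * Cl * c) * `|dl| <= e4 by rewrite mulrC -ler_pdivlMr// ltW.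
  move=> /(ler_wpM2r (normr_ge0 dl)); nra.
have hC : `|C| <= e4 * `|dl|.
  rewrite /C normrM.
  have : `|cP t x| * `|cmu t' x - cmu t x - dl * cM t x| <= M * (e4 / M * `|dl|) by apply: ler_pM.
  by rewrite mulrA [M * (_ / _)]mulrC divfK ?gt_eqF.
have := ler_normB (A - B) C; have := ler_normB A B.
have : e4 * 4 * `|dl| = e * `|dl| by rewrite /e4 divfK//.
lra.
Qed.

Hypothesis coef : forall u, 0 <= F'' u + eta ^- 2.
Variables (sigma : R) (sigma0 : 0 < sigma) (hsig : forall x, sigma <= rho0 x).

(** Comparison argument. Consider the first time at which exp(L t) P reaches
    the level sigma / 2, and a point where this happens. In space it is a
    minimum: the gradient vanishes, the pure second derivatives are
    nonnegative, and F'' + eta^-2 >= 0 makes the diffusive part of div (P grad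
    mu) nonnegative. What remains is the nonlocal term, which is linear in P
    and is beaten by the exponential if L is large; so exp(L t) P increases
    strictly at a time at which it should be decreasing. *)
Lemma cP_gt0 t x : 0 <= t < T -> 0 < cP t x.
Proof.
move=> /andP[t0 tT]; rewrite ltNge; apply/negP => Ptx.
have cW i : exists2 W, 0 < W & forall s y, `|convol k (cPij i i s) y| <= W.
  exact: (buc_bounded (buc_convol ik (buc_cPij i i))).
have /choice[W hW] : forall i : 'I_d, exists W, 0 < W /\ forall s y, `|convol k (cPij i i s) y| <= W.
  by move=> i; have [W W0 hW] := cW i; exists W.
set c := eta ^- 2; have c0 : 0 < c by rewrite invr_gt0 exprn_gt0.
(* W i bounds the smoothed second derivative; the extra 1 makes the final
   contradiction strict. *)
pose L := \sum_i (c * W i) + 1.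
pose f (z : R * E) := expR (L * z.1) * cP z.1 z.2.
have cf : continuous f.
  apply: contM; last exact: buc_continuous buc_cP.
  apply: (@cont_comp _ _ _ (fun z : R * E => L * z.1) expR); last exact: continuous_expR.
  by apply: contM; [exact: cont_cst|move=> z; exact: cvg_fst].
pose K : set (R * E) := `[0, t]%classic `*` [set v : E | forall i, `[0, 1]%classic (v ord0 i)].
have cK_ : compact K.
  apply: compact_setX; first exact: segment_compact.
  by apply: (@rV_compact R d (fun=> `[0, 1]%classic)) => i; exact: segment_compact.
pose lev := sigma / 2; have lev0 : 0 < lev by rewrite divr_gt0.
pose Z := K `&` [set z | f z <= lev].
have cZ : compact Z.
  apply: compact_closedI => //.
  rewrite (_ : [set z | _] = f @^-1` [set y | y <= lev])//.
  by apply: preimage_closed; [move=> z _; exact: cf|exact: closed_le].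
have shiftK s y : 0 <= s <= t -> exists2 z : R * E, K z & z.1 = s /\ f z = f (s, y).
  move=> hs; have [n hn] := periodic_cube y.
  exists (s, y + \sum_i (n i)%:~R *: basis_vec i).
    split => /=; first by rewrite in_itv.
    by move=> i; rewrite /= in_itv /=; have /andP[-> /ltW] := hn i.
  split => //; rewrite /f /=; congr (_ * _); apply: periodicD_int.
  by case: buc_cP.
have [z0 Z0] : Z !=set0.
  have [|z Kz [z1 fz]] := @shiftK t x; first by rewrite t0 lexx.
  exists z; split => //; rewrite /= fz /f /=.
  by apply: (@le_trans _ _ 0); [rewrite pmulr_rle0 ?expR_gt0|exact: ltW].
(* The first time: fst attains its minimum on the compact set Z. *)
have [z Zz zmin] : exists2 z, Z z & forall w, Z w -> z.1 <= w.1.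
  have [||z Zz zm] := @compact_EVT_min (R * E)%type R (@fst R E) Z _ cZ.
  - by exists z0.
  - by apply: continuous_subspaceT => w; exact: cvg_fst.
  - by exists z => [|w Zw]; [exact/set_mem|apply: zm; rewrite inE].
case: Zz => -[/= + _] fz; rewrite in_itv /= => /andP[z10 z1t].
have first_ s y : 0 <= s < z.1 -> lev < f (s, y).
  move=> /andP[s0 sz]; rewrite ltNge; apply/negP => fs.
  have [|w Kw [w1 fw]] := @shiftK s y; first by rewrite s0 (le_trans (ltW sz)).
  have Zw : Z w by split => //=; rewrite fw.
  by have := zmin w Zw; rewrite w1 leNgt sz.
have z1 : 0 < z.1.
  rewrite lt_neqAle z10 andbT; apply/eqP => z1.
  move: fz; rewrite /f -z1 mulr0 expR0 mul1r cP0 => h.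
  by have := hsig z.2; rewrite /lev in h; have := sigma0; lra.
have zT : 0 < z.1 < T by rewrite z1 (le_lt_trans z1t).
(* Before that time the function is above the level everywhere, hence also, by
   continuity, at that time. *)
have minz y : f (z.1, z.2) <= f (z.1, y).
  apply: (@le_trans _ _ lev); first by case: (z) fz.
  rewrite leNgt; apply/negP => fl.
  have cs : continuous (fun s => f (s, y)).
    apply: (@cont_comp R _ _ (fun s : R => (s, y)) f) => //.
    by apply: continuous_pair; [move=> s; exact: cvg_id|exact: cst_continuous].
  have h0 : 0 < lev - f (z.1, y) by rewrite subr_gt0.
  have /cvgrPdist_lt/(_ _ h0)/nbhs_ballP[r /= r0 Hr] := cs z.1.
  pose s := z.1 - Num.min (r / 2) (z.1 / 2).
  have m0 : 0 < Num.min (r / 2) (z.1 / 2) by rewrite lt_min !divr_gt0.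
  have m1 : Num.min (r / 2) (z.1 / 2) <= r / 2 by rewrite ge_min lexx.
  have m2 : Num.min (r / 2) (z.1 / 2) <= z.1 / 2 by rewrite ge_min lexx orbT.
  have fs : lev < f (s, y) by apply: first_; rewrite /s; apply/andP; split; lra.
  have : ball z.1 r s by rewrite /ball /= /s opprB addrC subrK gtr0_norm//; lra.
  by move=> /Hr; rewrite /= ltr_norml => /andP[]; lra.
have Pmin y : cP z.1 z.2 <= cP z.1 y.
  by have := minz y; rewrite /f /= ler_pM2l// expR_gt0.
have Pz : 0 < cP z.1 z.2.
  have : lev <= f z.
    have -> : f z = f (z.1, z.2) by case: (z).
    rewrite leNgt; apply/negP => fl.
    have cs : continuous (fun s => f (s, z.2)).
      apply: (@cont_comp R _ _ (fun s : R => (s, z.2)) f) => //.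
      by apply: continuous_pair; [move=> s; exact: cvg_id|exact: cst_continuous].
    have h0 : 0 < lev - f (z.1, z.2) by rewrite subr_gt0.
    have /cvgrPdist_lt/(_ _ h0)/nbhs_ballP[r /= r0 Hr] := cs z.1.
    pose s := z.1 - Num.min (r / 2) (z.1 / 2).
    have m0 : 0 < Num.min (r / 2) (z.1 / 2) by rewrite lt_min !divr_gt0.
    have m1 : Num.min (r / 2) (z.1 / 2) <= r / 2 by rewrite ge_min lexx.
    have m2 : Num.min (r / 2) (z.1 / 2) <= z.1 / 2 by rewrite ge_min lexx orbT.
    have fs : lev < f (s, z.2) by apply: first_; rewrite /s; apply/andP; split; lra.
    have : ball z.1 r s by rewrite /ball /= /s opprB addrC subrK gtr0_norm//; lra.
    by move=> /Hr; rewrite /= ltr_norml => /andP[]; lra.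
  rewrite /f => h; have := lt_le_trans lev0 h.
  by rewrite pmulr_rgt0// expR_gt0.
(* First and second order conditions for a minimum along each coordinate
   line. *)
have sp i : cPi i z.1 z.2 = 0 /\ 0 <= cPij i i z.1 z.2.
  have := @min_second_derivative R (fun s => cP z.1 (s *: basis_vec i + z.2))
    (fun s => cPi i z.1 (s *: basis_vec i + z.2)) (fun s => cPij i i z.1 (s *: basis_vec i + z.2)) 0.
  rewrite scale0r add0r; apply.
  - by move=> u; apply: is_derive_line; exact: HD_cP.
  - by move=> u; apply: is_derive_line; exact: HD_cPi.
  - apply: (@cont_comp R _ _ (fun s : R => s *: basis_vec i + z.2) (cPij i i z.1)); last first.
      exact: (buc_continuous_at (buc_cPij i i)).
    exact: continuous_line_normed.
  - by move=> u; exact: Pmin.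
have G0 : - (\sum_i (c * W i)) * cP z.1 z.2 <= cG z.1 z.2.
  rewrite mulNr mulr_suml -sumrN; apply: ler_sum => i _.
  have [h1 h2] := sp i.
  have cbE : cb i i z.1 z.2 = F'' (cP z.1 z.2) * cPij i i z.1 z.2 +
      c * (cPij i i z.1 z.2 - convol k (cPij i i z.1) z.2).
    by rewrite /cb h1; set u := F''' _; set v := F'' _ * _; rewrite /c; ring.
  have -> : cPi i z.1 z.2 * ca i z.1 z.2 = 0 by rewrite h1; ring.
  rewrite add0r cbE.
  have := (hW i).2 z.1 z.2; rewrite ler_norml => /andP[w1 w2].
  have := mulr_ge0 (coef (cP z.1 z.2)) h2; rewrite -/c mulrDl => h3.
  rewrite -mulNr [leRHS]mulrC ler_pM2r//=.
  have : c * convol k (cPij i i z.1) z.2 <= c * W i by rewrite ler_pM2l.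
  by rewrite mulrBr; lra.
have df : is_derive z.1 (1 : R) (fun s => f (s, z.2)) (expR (L * z.1) * (L * cP z.1 z.2 + cG z.1 z.2)).
  have E1 := cP_evol z.2 zT.
  have E2 : is_derive z.1 (1 : R) (fun s => expR (L * s)) (expR (L * z.1) * L).
    apply: (is_derive1_comp (f := expR) (g := fun s => L * s)).
    exact: DER_lin.
  have := is_deriveM E2 E1; rewrite /GRing.scale /= addrC.
  rewrite (_ : cP z.1 z.2 * (expR (L * z.1) * L) + _ = expR (L * z.1) * (L * cP z.1 z.2 + cG z.1 z.2)) //.
  by set u := expR _; ring.
have : expR (L * z.1) * (L * cP z.1 z.2 + cG z.1 z.2) <= 0.
  apply: (is_derive_le0 z1 df) => s /andP[s1 s2].
  apply: (@le_trans _ _ lev); first by case: (z) fz.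
  by apply: ltW; apply: first_; rewrite s2 andbT; lra.
rewrite pmulr_rle0 ?expR_gt0// /L mulrDl mul1r; lra.
Qed.

End classical_solution.

(** * A lower bound for the Poincare constant *)

Section half_step.
Context {R : realType}.

(** The 1-periodic function equal to -1/2 on the first half of each period and
    to 1/2 on the second half, written with floors so that periodicity and
    measurability are immediate. *)
Definition half_step (u : R) : R :=
  (Num.floor (2 * u))%:~R - 2 * (Num.floor u)%:~R - 2^-1.

Lemma half_stepE (m : int) (u : R) :
  (m%:~R <= u < m%:~R + 2^-1 -> half_step u = - 2^-1) /\
  (m%:~R + 2^-1 <= u < m%:~R + 1 -> half_step u = 2^-1).
Proof.
split => /andP[h1 h2]; rewrite /half_step.
- rewrite (@floor_def _ u m); last by rewrite intrD h1 /=; lra.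
  rewrite (@floor_def _ (2 * u) (2 * m)); last by rewrite intrD intrM; apply/andP; split; lra.
  by rewrite intrM; lra.
- rewrite (@floor_def _ u m); last by rewrite intrD; apply/andP; split; lra.
  rewrite (@floor_def _ (2 * u) (2 * m + 1)); last by rewrite !intrD intrM; apply/andP; split; lra.
  by rewrite intrD intrM; lra.
Qed.

Lemma half_step_cases (u : R) : exists m : int,
  (m%:~R <= u < m%:~R + 2^-1) \/ (m%:~R + 2^-1 <= u < m%:~R + 1).
Proof.
exists (Num.floor u); have := floor_itv u; rewrite intrD => /andP[h1 h2].
by have [h|h] := ltP u ((Num.floor u)%:~R + 2^-1); [left|right]; apply/andP.
Qed.

Lemma half_step_shift (u : R) : half_step (u + 2^-1) = - half_step u.
Proof.
have [m [h|h]] := half_step_cases u.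
  rewrite ((half_stepE m u).1 h) ((half_stepE m _).2) ?opprK//.
  by case/andP: h => ? ?; apply/andP; split; lra.
rewrite ((half_stepE m u).2 h) ((half_stepE (m + 1) _).1)//.
by case/andP: h => ? ?; rewrite intrD; apply/andP; split; lra.
Qed.

Lemma half_step_norm (u : R) : `|half_step u| = 2^-1.
Proof.
have [m [h|h]] := half_step_cases u.
  by rewrite ((half_stepE m u).1 h) normrN ger0_norm.
by rewrite ((half_stepE m u).2 h) ger0_norm.
Qed.

Lemma measurable_half_step : measurable_fun setT half_step.
Proof.
have mf : measurable_fun setT (fun u : R => (Num.floor u)%:~R : R).
  by apply: nondecreasing_measurable => // x y xy; rewrite ler_int; exact: le_floor.
apply: measurable_funB => //; apply: measurable_funB; last exact: measurable_funM.
by apply: (measurableT_comp mf); exact: measurable_funM.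
Qed.

End half_step.

Section poincare_constant.
Context {R : realType} {d : nat}.
Local Notation E := 'rV[R]_d.
Local Notation tor := (torus_prob d : probability E R).
Local Notation leb := (@lebesgue_row R d).
Local Opaque lebesgue_row.

Lemma L2norm_sq (f : E -> R) : (L2norm f ^+ 2 = \int[tor]_x (f x ^+ 2)%:E)%E.
Proof.
rewrite /L2norm unlock /=.
have -> : (\int[torus_measure]_x (`|f x|%:E `^ 2) = \int[tor]_x (f x ^+ 2)%:E)%E.
  apply: eq_integral => x _; rewrite poweR_EFin powR_mulrn//.
  by rewrite -normrX ger0_norm ?sqr_ge0.
have : (0 <= \int[tor]_x (f x ^+ 2)%:E)%E by apply: integral_ge0 => x _; rewrite lee_fin sqr_ge0.
case: (\int[tor]_x (f x ^+ 2)%:E)%E => [r||//].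
  rewrite lee_fin => r0; rewrite poweR_EFin -EFinM -expr2 -powR_mulrn ?powR_ge0//.
  by rewrite -powRrM mulVf// powRr1.
by move=> _; rewrite poweRyr ?invr_eq0 ?pnatr_eq0// mulyy.
Qed.

Variables (D : R) (omega : E -> R) (hmol : mollifier D omega).
Variables (eta : R) (eta_gt0 : 0 < eta).
Local Notation k := (scaled omega eta).

(** The function with values -1/2 and 1/2 on the two halves of the torus has
    the largest variance, 1/4, among functions of oscillation at most 1. For
    any such function the nonlocal Dirichlet energy is at most 1 / (4 eta^2),
    so the Poincare inequality for it yields eta^2 <= CP. Combined with M2 < 1
    / CP this gives F'' + eta^-2 >= 0, the parabolicity of the classical
    equation. *)
Lemma poincare_constant_ge (bound CP : R) : (0 < d)%N -> 0 < CP ->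
  poincare_constants omega bound CP -> eta < bound -> eta ^+ 2 <= CP.
Proof.
move=> d0 CP0 hP etab; pose i0 := Ordinal d0.
pose f (x : E) := half_step (x ord0 i0).
have mf : measurable_fun setT f.
  by apply: (measurableT_comp (@measurable_half_step R)); exact: measurable_coord.
have shift2 (x : E) : f (x + 2^-1 *: basis_vec i0) = - f x.
  by rewrite /f !mxE !eqxx mulr1 half_step_shift.
have per : Zd_periodic f.
  move=> x i; have [->|ne] := eqVneq i i0.
    rewrite -[f x]opprK -shift2 -shift2; congr f.
    rewrite -addrA -scalerDl (_ : 2^-1 + 2^-1 = 1 :> R) ?scale1r//; lra.
  by rewrite /f !mxE eqxx eq_sym (negPf ne) addr0.
(* A half-period shift changes the sign of f and preserves the integral. *)
have av : average f = 0.
  have h := Rint_periodic (2^-1 *: basis_vec i0) mf per.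
  have if1 : L1 tor f by apply: (@tor_bounded _ _ _ 2^-1) => // x; rewrite half_step_norm.
  have := h; rewrite (_ : (fun _ => _) = (fun x => - f x)); last exact/funext.
  rewrite RintN// /average torus_measureE => h2.
  have := h2; lra.
have L2f : (L2norm f ^+ 2 = (4^-1)%:E)%E.
  rewrite L2norm_sq (_ : (fun x => _) = cst (4^-1)%:E).
    by rewrite integral_cst// [X in (_ * X)%E]probability_setT mule1.
  apply/funext => x /=; congr EFin; rewrite -real_normK ?num_real// half_step_norm.
  by rewrite expr2; lra.
have L2lty : (L2norm f < +oo)%E.
  by move: L2f; case: (L2norm f) => [r||]//; rewrite ?ltry// expe2 mulyy.
have := hP eta _ f per mf L2lty; rewrite eta_gt0 etab => /(_ isT).
rewrite av (_ : (fun x => f x - 0) = f); last by apply/funext => x; rewrite subr0.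
rewrite L2f.
pose c := (4 * eta ^+ 2)^-1; have c0 : 0 <= c by rewrite invr_ge0 mulr_ge0// sqr_ge0.
have mk : measurable_fun setT k.
  exact: (L1_measurable (L1_kernel hmol eta_gt0)).
have k1 (x : E) : (\int[leb]_y (c * k (x - y))%:E = c%:E)%E.
  have mg : measurable_fun setT (fun y : E => (c * k y)%:E).
    by apply/measurable_EFinP; exact: measurable_funM.
  have g0 (y : E) : (0 <= (c * k y)%:E)%E by rewrite lee_fin mulr_ge0// (kernel_ge0 hmol).
  have mg' : measurable_fun setT (fun y : E => (c * k (x + y))%:E).
    rewrite (_ : (fun _ => _) = (fun y : E => (c * k y)%:E) \o (fun y => y + x)).
      by apply: (measurableT_comp mg); exact: measurable_shiftD.
    by apply/funext => y /=; rewrite addrC.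
  have e1 := @ge0_integral_row_opp R d _ mg' (fun y => g0 (x + y)).
  rewrite e1 (_ : (fun y : E => (c * k (x + y))%:E) = (fun y : E => (c * k (y + x))%:E)); last first.
    by apply/funext => y; rewrite addrC.
  rewrite (@ge0_integral_row_shift R d x _ mg g0).
  rewrite -EFin_Rint; last by apply: L1Z; exact: (L1_kernel hmol eta_gt0).
  by rewrite RintZ ?(kernel_Rint hmol eta_gt0) ?mulr1//; exact: (L1_kernel hmol eta_gt0).
have le1 : (\int[torus_measure]_x \int[leb]_y (`|f x - f y| ^+ 2 / (4 * eta ^+ 2) * k (x - y))%:E <= c%:E)%E.
  rewrite -[leRHS]mule1 -[X in (_ * X)%E](@torus_measureT R d) -integral_cst//.
  apply: ge0_le_integral => //.
  - move=> x _; apply: integral_ge0 => y _.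
    by rewrite lee_fin mulr_ge0 ?(kernel_ge0 hmol)// divr_ge0 ?sqr_ge0// mulr_ge0// sqr_ge0.
  - apply: (@measurable_fun_fubini_tonelli_F _ _ E E R leb
      (fun z : E * E => (`|f z.1 - f z.2| ^+ 2 / (4 * eta ^+ 2) * k (z.1 - z.2))%:E)).
    2: by move=> z; rewrite lee_fin mulr_ge0 ?(kernel_ge0 hmol)// divr_ge0 ?sqr_ge0// mulr_ge0// sqr_ge0.
    apply/measurable_EFinP; apply: measurable_funM.
      apply: measurable_funM => //; apply: measurable_funX; apply: measurableT_comp => //.
      by apply: measurable_funB; apply: (measurableT_comp mf); [exact: measurable_fst|exact: measurable_snd].
    by apply: (measurableT_comp mk); apply: measurable_row_sub.
  move=> x _; rewrite -(k1 x); apply: ge0_le_integral => //.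
  - move=> y _.
    by rewrite lee_fin mulr_ge0 ?(kernel_ge0 hmol)// divr_ge0 ?sqr_ge0// mulr_ge0// sqr_ge0.
  - apply/measurable_EFinP; apply: measurable_funM.
      apply: measurable_funM => //; apply: measurable_funX; apply: measurableT_comp => //.
      exact: measurable_funB.
    by apply: (measurableT_comp mk); exact: measurable_subl.
  - apply/measurable_EFinP; apply: measurable_funM => //.
    by apply: (measurableT_comp mk); exact: measurable_subl.
  move=> y _; rewrite lee_fin ler_wpM2r ?(kernel_ge0 hmol)// -[leRHS]mul1r ler_wpM2r//.
  rewrite expr_le1//.
  by have := ler_normB (f x) (f y); rewrite !half_step_norm; lra.
move=> le1'; have : (4^-1%:E <= CP%:E * c%:E)%E.
  by apply: (le_trans le1'); rewrite lee_pmul2l ?lte_fin.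
rewrite -EFinM lee_fin /c invfM mulrCA -{1}[4^-1]mulr1 ler_pM2l ?invr_gt0//.
by rewrite ler_pdivlMr ?mul1r// exprn_gt0.
Qed.
End poincare_constant.

(** * Integrals in time and cutoffs *)

Section time_integral.
Context {R : realType}.
Variables (T : R) (T0 : 0 < T).
Local Notation tm := (time_measure T).
Local Notation leb := (@lebesgue_measure R).
Local Notation RT := (measurableTypeR R).

Lemma tmE (A : set RT) : tm A = leb (A `&` `]0, T[%classic). Proof. by []. Qed.

Lemma tm_setT : tm setT = T%:E.
Proof.
rewrite tmE setTI lebesgue_measure_itv /= lte_fin T0.
by rewrite oppr0 addr0.
Qed.

Lemma tm_lty : (tm [set: RT] < +oo)%E.
Proof. by rewrite tm_setT ltry. Qed.

Lemma tm_bounded (f : RT -> R) M : measurable_fun setT f -> (forall x, `|f x| <= M) -> L1 tm f.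
Proof. by apply: L1_bounded; exact: tm_lty. Qed.

Lemma tm_cont (f : R -> R) M : continuous f -> (forall x, `|f x| <= M) -> L1 tm f.
Proof. by move=> cf; apply: tm_bounded; exact: continuous_measurable_fun. Qed.

Lemma Rint_tm_cst (c : R) : \int[tm]_s c = c * T.
Proof.
rewrite /Rintegral integral_cst// [X in (_ * X)%E]tm_setT.
by rewrite -EFinM.
Qed.

Lemma ge0_integral_tm (f : RT -> \bar R) : measurable_fun setT f -> (forall x, 0 <= f x)%E ->
  (\int[tm]_x f x = \int[leb]_(x in `]0%R, T[) f x)%E.
Proof. by move=> mf f0; exact: ge0_integral_mrestr. Qed.

Lemma Rint_tm (f : RT -> R) : measurable_fun setT f ->
  \int[tm]_x f x = \int[leb]_(x in `]0, T[) f x.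
Proof.
move=> mf; have mf' : measurable_fun setT (EFin \o f) by exact/measurable_EFinP.
rewrite /Rintegral; congr fine; rewrite integralE [RHS]integralE; congr (_ - _)%E.
  by apply: ge0_integral_tm => //; exact: measurable_funepos.
by apply: ge0_integral_tm => //; exact: measurable_funeneg.
Qed.

Lemma ae_tm (P : R -> Prop) : {ae leb, forall t, 0 < t < T -> P t} -> {ae tm, forall t, P t}.
Proof.
move=> [A [mA A0 sub]]; exists (A `|` ~` `]0, T[%classic); split.
- by apply: measurableU => //; apply: measurableC; exact: measurable_itv.
- rewrite tmE setIUl setICl setU0.
  by apply: (@subset_measure0 _ _ _ leb _ A) => //; exact: measurableI.
- move=> t /= nP; have [ht|ht] := pselect (`]0, T[%classic t); last by right.
  left; apply: sub => /= h; apply: nP; apply: h.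
  by move: ht; rewrite /= in_itv.
Qed.

Lemma ae_tm_itv : {ae tm, forall t : RT, 0 < t < T}.
Proof. by apply: ae_tm; apply: nearW. Qed.

(** How almost everywhere bounds become bounds at given times for quantities
    that are continuous in time. *)
Lemma ae_tm_dense (P : R -> Prop) t e : {ae tm, forall t, P t} -> 0 <= t <= T -> 0 < e ->
  exists t', [/\ `|t' - t| < e, 0 < t' < T & P t'].
Proof.
move=> [A [mA A0 sub]] /andP[t0 tT] e0.
apply: contrapT => nex.
have [a [b [ab a0 bT ain]]] : exists a b, [/\ a < b, 0 <= a, b <= T & forall s, a < s < b -> `|s - t| < e].
  have [tT2|tT2] := ltP t T.
    exists t, (Num.min T (t + e)); split => //.
    - by rewrite lt_min tT2 ltrDl.
    - by rewrite ge_min lexx.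
    - by move=> s; rewrite lt_min => /andP[? /andP[? ?]]; rewrite ltr_norml; apply/andP; split; lra.
  exists (Num.max 0 (t - e)), t; split => //.
  - by rewrite gt_max (lt_le_trans T0 tT2) ltrBlDr ltrDl.
  - by rewrite le_max lexx.
  - by move=> s; rewrite gt_max => /andP[/andP[? ?] ?]; rewrite ltr_norml; apply/andP; split; lra.
have subA : `]a, b[%classic `<=` A.
  move=> s /=; rewrite in_itv /= => /andP[as_ sb]; apply: sub => /= Ps; apply: nex.
  exists s; split => //; first by apply: ain; rewrite as_.
  by rewrite (le_lt_trans a0)//= (lt_le_trans sb).
have : (tm `]a, b[%classic <= tm A)%E.
  by apply: le_measure => //; rewrite inE//; exact: measurable_itv.
rewrite A0 tmE (_ : _ `&` _ = `]a, b[%classic).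
  by rewrite [X in (X <= _)%E]lebesgue_measure_itv /= lte_fin ab -EFinB lee_fin subr_le0 leNgt ab.
apply/seteqP; split => s /=; rewrite ?in_itv /=; first by case.
by move=> /andP[as_ sb]; split; [rewrite as_|rewrite (le_lt_trans a0 as_) (lt_le_trans sb bT)].
Qed.

(** The primitive vanishing at 0. It is an integral over the fixed interval ]0,
    T[ with an indicator, so that the domain of integration never changes. *)
Definition tI (t : R) (f : R -> R) := \int[tm]_s ((s < t)%R%:R * f s).

Lemma measurable_lt_ind (t : R) : measurable_fun setT (fun s : RT => (s < t)%R%:R : R).
Proof.
rewrite (_ : (fun _ => _) = \1_(`]-oo, t[%classic)).
  by apply: measurable_indic; exact: measurable_itv.
by apply/funext => s; rewrite indicE mem_setE in_itv.
Qed.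

Lemma L1_tI t f : L1 tm f -> L1 tm (fun s : RT => (s < t)%R%:R * f s).
Proof.
move=> h; apply: (@L1_mul_bounded _ _ _ _ _ _ 1 (measurable_lt_ind t)) => //.
by move=> s; case: (s < t); rewrite ?normr1 ?normr0.
Qed.

Lemma tID t f g : L1 tm f -> L1 tm g -> tI t (fun s => f s + g s) = tI t f + tI t g.
Proof.
by move=> h1 h2; rewrite -RintD; [apply: eq_Rint => s; rewrite mulrDr|exact: L1_tI|exact: L1_tI].
Qed.

Lemma tIZ t c f : L1 tm f -> tI t (fun s => c * f s) = c * tI t f.
Proof. by move=> h1; rewrite -RintZ; [apply: eq_Rint => s; rewrite mulrCA|exact: L1_tI]. Qed.

Lemma tIB t f g : L1 tm f -> L1 tm g -> tI t (fun s => f s - g s) = tI t f - tI t g.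
Proof.
by move=> h1 h2; rewrite -RintB; [apply: eq_Rint => s; rewrite mulrBr|exact: L1_tI|exact: L1_tI].
Qed.

Lemma le_tI t f g : L1 tm f -> L1 tm g -> {ae tm, forall s : RT, f s <= g s} -> tI t f <= tI t g.
Proof.
move=> h1 h2 h; apply: ae_le_Rint; [exact: L1_tI|exact: L1_tI|].
by move: h; apply: filterS => s; apply: ler_wpM2l; case: (s < t).
Qed.

Lemma tI_lip f B t t' : L1 tm f -> 0 <= B -> {ae tm, forall s : RT, `|f s| <= B} -> t <= t' ->
  `|tI t' f - tI t f| <= B * (t' - t).
Proof.
move=> h B0 hB tt.
have L1ind : L1 tm (fun s : RT => (s < t')%R%:R - (s < t)%R%:R : R).
  apply: (@tm_bounded _ 2); first by apply: measurable_funB; exact: measurable_lt_ind.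
  by move=> s; case: (s < t'); case: (s < t) => /=; rewrite ?subr0 ?sub0r ?subrr ?normrN ?normr0 ?normr1//; lra.
have ind0 (s : R) : 0 <= (s < t')%R%:R - (s < t)%R%:R :> R.
  by have [st|st] := ltP s t; rewrite ?(lt_le_trans st tt) ?subrr// subr0.
rewrite -RintB; [|exact: L1_tI|exact: L1_tI].
have -> : \int[tm]_x ((x < t')%R%:R * f x - (x < t)%R%:R * f x) =
    \int[tm]_x (((x < t')%R%:R - (x < t)%R%:R) * f x) by apply: eq_Rint => s; rewrite mulrBl.
have L1f : L1 tm (fun x : RT => ((x < t')%R%:R - (x < t)%R%:R) * f x).
  apply: (@L1_mul_bounded _ _ _ _ _ _ 1) => //; first exact: L1_measurable L1ind.
  move=> s; rewrite ger0_norm// lerBlDr; case: (s < t') => //=; first by rewrite lerDl.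
  by rewrite addr_ge0.
apply: (@le_trans _ _ (\int[tm]_x (B * ((x < t')%R%:R - (x < t)%R%:R)))).
  apply: (@le_trans _ _ (\int[tm]_x `|((x < t')%R%:R - (x < t)%R%:R) * f x|)).
    apply: le_norm_Rint => //; exact: L1_norm.
  apply: ae_le_Rint; [exact: L1_norm|exact: L1Z|].
  move: hB; apply: filterS => s fB.
  by rewrite normrM (ger0_norm (ind0 s)) mulrC ler_wpM2r.
rewrite RintZ// ler_wpM2l// Rint_tm; last exact: L1_measurable L1ind.
have mI : measurable (`[t, t'[%classic : set RT) by exact: measurable_itv.
rewrite (_ : (fun _ => _) = (\1_(`[t, t'[%classic) : R -> R)); last first.
  apply/funext => s; rewrite indicE mem_setE in_itv /=.
  by have [st|st] := ltP s t; rewrite ?(lt_le_trans st tt) ?subrr //= subr0.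
rewrite /Rintegral integral_indic//.
rewrite -lee_fin fineK.
  apply: (@le_trans _ _ (leb `[t, t'[%classic)).
    by apply: le_measure; rewrite ?inE//; exact: measurableI.
  rewrite lebesgue_measure_itv /= lte_fin; case: ltP => // ?.
  by rewrite lee_fin subr_ge0.
rewrite ge0_fin_numE//; apply: (@le_lt_trans _ _ (leb `[t, t'[%classic)).
  by apply: le_measure; rewrite ?inE//; exact: measurableI.
by rewrite lebesgue_measure_itv /=; case: ifP => _; [rewrite -EFinB ltry|].
Qed.

(** The primitive of a bounded function is Lipschitz, so a bound that holds for
    almost every t holds for all t. *)
Lemma tI_bound_ae f B c M : L1 tm f -> 0 <= B -> {ae tm, forall s : RT, `|f s| <= B} ->
  {ae tm, forall t : RT, `|c + tI t f| <= M} -> forall t, 0 <= t <= T -> `|c + tI t f| <= M.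
Proof.
move=> h B0 hB hM t ht; apply/ler_addgt0Pr => e e0.
have e1 : 0 < e / (B + 1) by rewrite divr_gt0// ltr_wpDl.
have [t' [tt _ Ht']] := ae_tm_dense hM ht e1.
have lip : `|tI t f - tI t' f| <= B * `|t - t'|.
  have [l|l] := leP t' t; first by rewrite (ger0_norm (_ : 0 <= t - t')) ?subr_ge0// tI_lip.
  by rewrite distrC (ltr0_norm (_ : t - t' < 0)) ?subr_lt0// opprB tI_lip// ltW.
have -> : c + tI t f = (c + tI t' f) + (tI t f - tI t' f) by ring.
apply: (le_trans (ler_normD _ _)); apply: lerD => //; apply: (le_trans lip).
rewrite distrC in tt.
apply: (@le_trans _ _ ((B + 1) * (e / (B + 1)))); last by rewrite mulrC divfK// gt_eqF// ltr_wpDl.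
by apply: ler_pM => //; rewrite ?lerDl// ltW.
Qed.

(** F is differentiable only inside the interval; at the end points continuity
    suffices. *)
Lemma tI_FTC (f F : R -> R) M t : 0 <= t <= T -> continuous f -> (forall s, `|f s| <= M) -> continuous F ->
  (forall s, 0 < s < T -> is_derive s (1 : R) F (f s)) -> tI t f = F t - F 0.
Proof.
move=> /andP[t0 tT] cf fM cF dF.
have mf : measurable_fun setT (f : RT -> R) by exact: continuous_measurable_fun.
have mtf : measurable_fun setT (fun s : RT => (s < t)%R%:R * f s).
  by apply: measurable_funM => //; exact: measurable_lt_ind.
rewrite /tI Rint_tm//.
have -> : \int[leb]_(x in `]0, T[) ((x < t)%R%:R * f x) = \int[leb]_(x in `]0, t[) f x.
  rewrite /Rintegral; congr fine; rewrite integral_mkcond [RHS]integral_mkcond.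
  apply: eq_integral => s _; rewrite !patchE !mem_setE !in_itv /=.
  have [s0|] //= := ltP 0 s; have [st|st] := ltP s t; first by rewrite (lt_le_trans st tT) mul1r.
  by case: (s < T) => //; rewrite mul0r.
move: t0; rewrite le_eqVlt => /predU1P[<-|t0].
  by rewrite subrr set_itvoo0 Rintegral_set0.
have dF' s : s \in `]0, t[ -> is_derive s (1 : R) F (f s).
  by rewrite in_itv /= => /andP[? st]; apply: dF; rewrite (lt_le_trans st tT) andbT.
have h : (\int[leb]_(x in `[0%R, t]) (f x)%:E = (F t)%:E - (F 0)%:E)%E.
  apply: continuous_FTC2 => //.
  - exact: continuous_subspaceT.
  - split.
    + by move=> s /dF'[].
    + exact/cvg_at_right_filter/cF.
    + exact/cvg_at_left_filter/cF.
  - by move=> s /dF' ds; rewrite derive1E; case: ds.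
rewrite /Rintegral -[RHS]/(fine ((F t)%:E - (F 0)%:E)) -h; congr fine.
rewrite integral_itv_bndo_bndc; last by apply/measurable_EFinP; exact: measurable_funTS.
by rewrite integral_itv_obnd_cbnd//; apply/measurable_EFinP; exact: measurable_funTS.
Qed.

(** The form that applies to functions of time obtained by integrating uniform
    expansions. *)
Lemma tI_FTC_expand (f F : R -> R) M t : 0 <= t <= T -> continuous f -> (forall s, `|f s| <= M) ->
  (forall e, 0 < e -> exists2 r, 0 < r & forall s s', 0 <= s <= T -> 0 <= s' <= T ->
     `|s' - s| < r -> `|F s' - F s - (s' - s) * f s| <= e * `|s' - s|) ->
  tI t f = F t - F 0.
Proof.
move=> ht cf fM ex; have T0' : 0 <= T by exact: ltW.
pose n s := F (clamp T s).
have [r1 r10 H1] := ex 1 ltr01.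
have M0 : 0 <= M by apply: le_trans (fM 0).
have cn : continuous n.
  move=> s; apply/cvgrPdist_le => e e0; apply/nbhs_ballP.
  exists (Num.min r1 (e / (1 + M))); first by rewrite /= lt_min r10 divr_gt0// ltr_wpDr.
  move=> s' /=; rewrite /ball /= lt_min => /andP[d1 d2].
  have lip := clamp_lip s' s T0'; rewrite distrC in d1 d2.
  have h := H1 (clamp T s) (clamp T s') (clamp_itv _ T0') (clamp_itv _ T0') (le_lt_trans lip d1).
  rewrite -/(n s) -/(n s') in h; rewrite distrC.
  have -> : n s' - n s = (n s' - n s - (clamp T s' - clamp T s) * f (clamp T s)) +
     (clamp T s' - clamp T s) * f (clamp T s) by ring.
  apply: (le_trans (ler_normD _ _)); rewrite normrM.
  have h2 : `|clamp T s' - clamp T s| * `|f (clamp T s)| <= `|clamp T s' - clamp T s| * M.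
    by rewrite ler_wpM2l.
  move: d2; rewrite ltr_pdivlMr ?ltr_wpDr//.
  have : `|clamp T s' - clamp T s| * (1 + M) <= `|s' - s| * (1 + M) by rewrite ler_wpM2r// addr_ge0.
  by rewrite mul1r in h; move: h; rewrite /n; lra.
have -> : F t - F 0 = n t - n 0 by rewrite /n !clamp_id// lexx.
apply: (tI_FTC ht cf fM cn) => s sT.
apply: cvg_derive => e e0; have [r r0 H] := ex e e0.
exists (Num.min r (Num.min s (T - s))); first by rewrite !lt_min r0 subr_gt0.
move=> h h0; rewrite !lt_min => /andP[hr /andP[hs hT]].
have sT' : 0 <= s <= T by case/andP: sT => ? ?; rewrite !ltW.
have shT : 0 <= s + h <= T.
  by move: hs hT; rewrite !ltr_norml => /andP[? ?] /andP[? ?]; apply/andP; split; lra.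
have := H s (s + h) sT' shT; rewrite addrAC subrr add0r => /(_ hr).
move=> hh; rewrite [h *: 1]mulr1 /n !clamp_id//.
have -> : h^-1 * (F (s + h) - F s) - f s = h^-1 * (F (s + h) - F s - h * f s) by field.
by rewrite normrM normfV mulrC ler_pdivrMr ?normr_gt0.
Qed.

End time_integral.

Section cutoff.
Context {R : realType}.

Definition pos (r : R) := Num.max r 0.

Lemma cont_pos : continuous pos.
Proof.
move=> r; apply/cvgrPdist_le => e e0; apply/nbhs_ballP; exists e => // s.
rewrite /ball /= => rs; apply: le_trans (ltW rs).
by rewrite /pos; case: (leP r 0) => ?; case: (leP s 0) => ?;
  rewrite ler_norml; have := ler_norm (r - s); have := ler_norm (s - r);
  rewrite distrC => *; apply/andP; split; lra.
Qed.

Lemma DER_pos_sq : DER (fun r => pos r ^+ 2) (fun r => 2 * pos r).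
Proof.
move=> r; apply: cvg_derive => e e0; exists e => // h h0 he.
rewrite [h *: 1]mulr1 [r + h]addrC.
have -> : h^-1 * (pos (h + r) ^+ 2 - pos r ^+ 2) - 2 * pos r = 
    h^-1 * (pos (h + r) ^+ 2 - pos r ^+ 2 - 2 * pos r * h) by field.
rewrite normrM normfV mulrC ler_pdivrMr ?normr_gt0//.
apply: (@le_trans _ _ (`|h| * `|h|)); last by rewrite ler_wpM2r// ltW.
rewrite -normrM -expr2 (ger0_norm (sqr_ge0 h)) ler_norml /pos.
by case: (leP (h + r) 0) => ?; case: (leP r 0) => ?; apply/andP; split; nra.
Qed.

(** The spline equals 1 on ]-oo, 0] and 0 on [2, +oo[, and its derivative is -
    hat, a tent of total mass 1 supported in [0, 2]. A quadratic spline is the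
    simplest explicit C^1 cutoff, and C^1 is the regularity of test functions.
    *)
Definition hat (r : R) := pos r - 2 * pos (r - 1) + pos (r - 2).
Definition spline (r : R) := 1 - 2^-1 * (pos r ^+ 2 - 2 * pos (r - 1) ^+ 2 + pos (r - 2) ^+ 2).

Lemma DER_affine (a b : R) (f f' : R -> R) : DER f f' -> DER (fun s => f (a * s - b)) (fun s => a * f' (a * s - b)).
Proof.
move=> df s; have d1 : is_derive s (1 : R) (fun s => a * s - b) (a - 0).
  exact: (DERB (DER_lin a) (fun u => is_derive_cst b u 1) s).
have := is_derive1_comp (f := f) (g := fun s => a * s - b) (df (a * s - b)) d1.
by rewrite subr0 mulrC.
Qed.

Lemma DER_spline : DER spline (fun r => - hat r).
Proof.
have dsh (a : R) : DER (fun r => pos (r - a) ^+ 2) (fun r => 2 * pos (r - a)).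
  have h := @DER_affine 1 a _ _ DER_pos_sq.
  by move=> r; have := h r; rewrite mul1r (_ : (fun s => pos (1 * s - a) ^+ 2) = (fun r => pos (r - a) ^+ 2)) ?mul1r//; apply/funext => s; rewrite mul1r.
have d0 : DER (fun r => pos r ^+ 2) (fun r => 2 * pos r) by exact: DER_pos_sq.
have h := DERB (fun u => is_derive_cst (1 : R) u 1) (DERZ 2^-1 (DERD (DERB d0 (DERZ 2 (dsh 1))) (dsh 2))).
move=> r; rewrite (_ : - hat r = 0 - 2^-1 * (2 * pos r - 2 * (2 * pos (r - 1)) + 2 * pos (r - 2))).
  exact: h.
by rewrite /hat; field.
Qed.

Lemma cont_hat : continuous hat.
Proof.
apply: contD.
  apply: contD; first exact: cont_pos.
  apply: contN; apply: contM; first exact: cont_cst.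
  by apply: cont_comp; [apply: contD; [move=> x; exact: cvg_id|exact: cont_cst]|exact: cont_pos].
by apply: cont_comp; [apply: contD; [move=> x; exact: cvg_id|exact: cont_cst]|exact: cont_pos].
Qed.

Lemma hat_itv r : 0 <= hat r <= 1.
Proof.
by rewrite /hat /pos; case: (leP r 0) => ?; case: (leP (r - 1) 0) => ?; case: (leP (r - 2) 0) => ?;
  apply/andP; split; lra.
Qed.

Lemma hat_eq0 r : r <= 0 \/ 2 <= r -> hat r = 0.
Proof.
by rewrite /hat /pos => -[?|?]; case: (leP r 0) => ?; case: (leP (r - 1) 0) => ?; case: (leP (r - 2) 0) => ?; lra.
Qed.

Lemma spline_itv r : 0 <= spline r <= 1.
Proof.
by rewrite /spline /pos; case: (leP r 0) => ?; case: (leP (r - 1) 0) => ?; case: (leP (r - 2) 0) => ?;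
  apply/andP; split; nra.
Qed.

Lemma spline_eq1 r : r <= 0 -> spline r = 1.
Proof.
by rewrite /spline /pos => ?; case: (leP r 0) => ?; case: (leP (r - 1) 0) => ?; case: (leP (r - 2) 0) => ?; nra.
Qed.

Lemma spline_eq0 r : 2 <= r -> spline r = 0.
Proof.
by rewrite /spline /pos => ?; case: (leP r 0) => ?; case: (leP (r - 1) 0) => ?; case: (leP (r - 2) 0) => ?; nra.
Qed.

(** Equal to 1 up to time t and to 0 after t + 2 h. *)
Definition cutoff (t h s : R) := spline (h^-1 * s - h^-1 * t).
Definition dcutoff (t h s : R) := h^-1 * - hat (h^-1 * s - h^-1 * t).

Lemma DER_cutoff t h : DER (cutoff t h) (dcutoff t h).
Proof. exact: DER_affine DER_spline. Qed.

Lemma cutoff_itv t h s : 0 <= cutoff t h s <= 1. Proof. exact: spline_itv. Qed.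

Lemma cutoff_eq1 t h s : 0 < h -> s <= t -> cutoff t h s = 1.
Proof. by move=> h0 st; apply: spline_eq1; rewrite -mulrBr pmulr_rle0 ?invr_gt0// subr_le0. Qed.

Lemma cutoff_eq0 t h s : 0 < h -> t + 2 * h <= s -> cutoff t h s = 0.
Proof.
move=> h0 st; apply: spline_eq0; rewrite -mulrBr mulrC ler_pdivlMr//; lra.
Qed.

Lemma cont_aff (a b : R) : continuous (fun s : R => a * s - b).
Proof. by apply: contD; [apply: contM; [exact: cont_cst|move=> x; exact: cvg_id]|exact: cont_cst]. Qed.

Lemma cont_dcutoff t h : continuous (dcutoff t h).
Proof.
apply: contM; first exact: cont_cst.
by apply: contN; apply: cont_comp; [exact: cont_aff|exact: cont_hat].
Qed.

Lemma cont_cutoff t h : continuous (cutoff t h).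
Proof. exact: DER_continuous (@DER_cutoff t h). Qed.

Lemma dcutoff_le0 t h s : 0 < h -> - h^-1 <= dcutoff t h s <= 0.
Proof.
move=> h0; have h1 : 0 < h^-1 by rewrite invr_gt0.
have /andP[a b] := hat_itv (h^-1 * s - h^-1 * t).
by rewrite /dcutoff mulrN lerN2 oppr_le0; apply/andP; split; [rewrite ler_piMr// ltW|rewrite mulr_ge0// ltW].
Qed.

Lemma dcutoff_eq0 t h s : 0 < h -> (s <= t) || (t + 2 * h <= s) -> dcutoff t h s = 0.
Proof.
move=> h0 st; rewrite /dcutoff hat_eq0 ?oppr0 ?mulr0//; rewrite -mulrBr mulrC.
case/orP: st => st; first by left; rewrite pmulr_lle0 ?invr_gt0// subr_le0.
by right; rewrite ler_pdivlMr//; lra.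
Qed.

End cutoff.

(** * Evolution equations satisfied almost everywhere *)

Section time_evolution.
Context {R : realType}.
Variables (T : R) (T0 : 0 < T).
Local Notation tm := (time_measure T).
Local Notation leb := (@lebesgue_measure R).
Local Notation RT := (measurableTypeR R).
Local Notation tI := (tI T).

(** The indicator of a ball around t as a real-valued function, to be used as a
    weight in integrals over the whole interval. *)
Definition near_ind (h t s : R) : R := (`|s - t| < h)%R%:R.

Lemma near_indE h t : near_ind h t = \1_(ball t h : set R).
Proof. by apply/funext => s; rewrite indicE mem_setE /near_ind /ball /= distrC. Qed.

Lemma measurable_near_ind h t : measurable_fun setT (near_ind h t : RT -> R).
Proof. by rewrite near_indE; apply: measurable_indic; exact: measurable_ball. Qed.

Lemma near_ind_norm h t s : `|near_ind h t s| <= 1.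
Proof. by rewrite /near_ind; case: (_ < _); rewrite ?normr1 ?normr0. Qed.

Lemma near_ind_ge0 h t s : 0 <= near_ind h t s.
Proof. by rewrite /near_ind; case: (_ < _). Qed.

Lemma L1_near h t f : L1 tm f -> L1 tm (fun s : RT => near_ind h t s * f s).
Proof. exact: (@L1_mul_bounded _ _ _ _ _ _ 1 (measurable_near_ind h t) (near_ind_norm h t)). Qed.

Lemma L1_near_ind h t : L1 tm (near_ind h t : RT -> R).
Proof. exact: (@tm_bounded _ T T0 _ 1 (measurable_near_ind h t) (near_ind_norm h t)). Qed.

Lemma near_ind_int h t : 0 < h -> \int[tm]_s near_ind h t s <= h *+ 2.
Proof.
move=> h0; rewrite -lee_fin EFin_Rint; last exact: L1_near_ind.
rewrite ge0_integral_tm; first last.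
- by move=> s; rewrite lee_fin near_ind_ge0.
- by apply/measurable_EFinP; exact: measurable_near_ind.
apply: (@le_trans _ _ (\int[leb]_s (near_ind h t s)%:E)%E).
  apply: ge0_subset_integral => //.
    by apply/measurable_EFinP; exact: measurable_near_ind.
  by move=> s _; rewrite lee_fin near_ind_ge0.
rewrite near_indE integral_indic//; last exact: measurable_ball.
by rewrite setIT [X in (X <= _)%E](lebesgue_measure_ball t (ltW h0)).
Qed.

Lemma L1_tm_patch (u : RT -> R) : L1 tm u ->
  leb.-integrable setT (EFin \o (u \_ `]0, T[%classic)).
Proof.
move=> hu; have mu_ : measurable_fun setT u := L1_measurable hu.
rewrite -restrict_EFin; apply/integrable_restrict => //=; rewrite ?setTI ?setIT.
apply/integrableP; split; first by apply/measurable_EFinP; exact: measurable_funTS.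
have := L1_lty hu; rewrite ge0_integral_tm//.
by apply/measurable_EFinP; exact: measurableT_comp.
Qed.

(** Lebesgue differentiation, with averages written as weighted integrals over
    ]0, T[. For times in the open interval, extension by 0 does not change
    small averages. *)
Lemma ae_lebesgue_pt (u : RT -> R) : L1 tm u -> {ae tm, forall t : RT, 
  forall e, 0 < e -> exists2 r, 0 < r & forall h, 0 < h < r ->
    \int[tm]_s (near_ind h t s * `|u s - u t|) <= e * h}.
Proof.
move=> hu; have mu_ : measurable_fun setT u := L1_measurable hu.
pose v := u \_ `]0, T[%classic.
have mv : measurable_fun setT v.
  by apply/measurable_EFinP; have /integrableP[] := L1_tm_patch hu.
have loc : locally_integrable setT v.
  by apply: open_integrable_locally; [exact: openT|exact: L1_tm_patch].
have hl := lebesgue_differentiation loc; apply: (@ae_tm _ T); case: hl => [A [mA A0 sub]]; exists A; split => //.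
apply: subset_trans sub => t /= nP pt; apply: nP => tT.
move=> e e0; have e20 : 0 < e / 2 by rewrite divr_gt0.
have vt : v t = u t by rewrite /v patchE mem_setE in_itv /= tT.
have hnear : \forall r \near 0^'+, (davg v t r <= (e / 2)%:E)%E.
  have /fine_cvgP[fin /cvgrPdist_le/(_ _ e20) hle] := pt.
  near=> r; have rfin : davg v t r \is a fin_num by near: r.
  rewrite -(fineK rfin) lee_fin.
  have : `|0 - fine (davg v t r)| <= e / 2 by near: r.
  by rewrite sub0r normrN; apply: le_trans; exact: ler_norm.
have [r /= r0 Hr] := hnear.
exists r => // h /andP[h0 hr].
have : (davg v t h <= (e / 2)%:E)%E.
  by apply: Hr => //=; rewrite sub0r normrN gtr0_norm.
rewrite /davg /iavg (lebesgue_measure_ball t (ltW h0)).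
rewrite inver mulrn_eq0 /= gt_eqF// lee_pdivrMl ?mulrn_wgt0// -EFinM.
have -> : h *+ 2 * (e / 2) = e * h by rewrite -mulr_natr; field.
move=> hJ; rewrite -lee_fin; apply: le_trans hJ.
have L1d : L1 tm (fun s : RT => near_ind h t s * `|u s - u t|).
  apply: L1_near; apply: L1_norm; apply: L1B => //.
  by apply: (@tm_bounded _ T T0 _ `|u t|) => //; exact: measurable_cst.
have md : measurable_fun setT (fun s : RT => (near_ind h t s * `|u s - u t|)%:E).
  by apply/measurable_EFinP; exact: L1_measurable L1d.
rewrite EFin_Rint// ge0_integral_tm//; last by move=> s; rewrite lee_fin mulr_ge0// near_ind_ge0.
rewrite integral_mkcond [leRHS]integral_mkcond; apply: ge0_le_integral => //.
- by move=> s _; apply: erestrict_ge0 => x _; rewrite lee_fin mulr_ge0// near_ind_ge0.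
- by apply/(measurable_restrictT _ _).1 => //; exact: measurable_funTS.
- apply/(measurable_restrictT _ _).1; first exact: measurable_ball.
  apply: measurable_funTS; apply/measurable_EFinP; apply: measurableT_comp => //.
  exact: measurable_funB.
move=> s _; rewrite !patchE mem_setE in_itv /=.
have [sT|_] := boolP (0 < s < T); last by case: ifP => // _; rewrite lee_fin.
have vs : v s = u s by rewrite /v patchE mem_setE in_itv /= sT.
case: ifPn => hb.
  by rewrite lee_fin /= vs vt /near_ind; case: (_ < _); rewrite ?mul1r ?mul0r.
rewrite /near_ind; case: ltP => [lt|]; last by rewrite mul0r.
by exfalso; move/negP: hb; apply; apply/mem_set; rewrite /ball /= distrC.
Unshelve. all: by end_near. Qed.

Lemma tI_T f : L1 tm f -> tI T f = \int[tm]_s f s.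
Proof.
move=> h; apply: ae_Rint; [exact: L1_measurable (L1_tI T h)|exact: L1_measurable h|].
have := ae_tm_itv T; apply: filterS => s /andP[_ sT].
by rewrite sT mul1r.
Qed.

(** As h tends to 0 the function dcutoff t h is an approximate Dirac mass of
    total mass -1 at t, and cutoff t h tends to the indicator of ]-oo, t[. At a
    common Lebesgue point of u and v both integrals converge, and the tested
    equation becomes the integrated one. No continuity in time of u is
    available, hence the restriction to almost every t. *)
Lemma weak_evolution (u v : RT -> R) c : L1 tm u -> L1 tm v ->
  (forall t h, 0 < t -> 0 < h -> t + 2 * h < T ->
     \int[tm]_s (dcutoff t h s * u s) + \int[tm]_s (cutoff t h s * v s) + c = 0) ->
  {ae tm, forall t : RT, u t = c + tI t v}.
Proof.
move=> hu hv weak.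
have h1 := ae_lebesgue_pt hu; have h2 := ae_lebesgue_pt hv; have h3 := ae_tm_itv T.
move: h1 h2 h3; apply: filterS3 => t Hu Hv /andP[t0 tT].
apply/eqP; rewrite -subr_eq0 -normr_le0; apply/ler_addgt0Pr => e e0; rewrite add0r.
have e9 : 0 < e / 9 by rewrite divr_gt0.
have [r1 r10 H1] := Hu _ e9; have [r2 r20 H2] := Hv _ e9.
(* The three error terms are bounded by e / 3 each: the two oscillations of u
   and v on a window of radius 3 h, which contains [t, t + 2 h], and the value
   of v at t times the length of the window. *)
pose q := e / (18 * (`|v t| + 1)); have q0 : 0 < q by rewrite divr_gt0// mulr_gt0// ltr_wpDl.
have [h [h0 hr1 hr2 hq [h1 tT2]]] : exists h, [/\ 0 < h, 3 * h < r1, 3 * h < r2, h < q &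
    h < 1 /\ t + 2 * h < T].
  pose m := Num.min (Num.min (r1 / 3) (r2 / 3)) (Num.min (Num.min 1 q) ((T - t) / 2)).
  have m0 : 0 < m by rewrite !lt_min q0 ltr01 !divr_gt0// subr_gt0.
  have hm : m / 2 < m by clear -m0; clearbody m; lra.
  exists (m / 2); have := hm; rewrite !lt_min => /andP[/andP[a1 a2] /andP[/andP[a3 a4] a5]].
  by clear -m0 a1 a2 a3 a4 a5; clearbody m; split; [lra|lra|lra|lra|split; lra].
have h3 : 0 < 3 * h by rewrite mulr_gt0.
have W := weak t h t0 h0 tT2.
have cd := @cont_dcutoff R t h; have cc := @cont_cutoff R t h.
have bd s : `|dcutoff t h s| <= h^-1.
  have /andP[l1 l2] := dcutoff_le0 t s h0; rewrite ler_norml l1 /= (le_trans l2)//.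
  by rewrite invr_ge0 ltW.
have bc s : `|cutoff t h s| <= 1.
  by have /andP[l1 l2] := cutoff_itv t h s; rewrite ger0_norm.
have mcd : measurable_fun setT (dcutoff t h : RT -> R) by exact: continuous_measurable_fun.
have mcc : measurable_fun setT (cutoff t h : RT -> R) by exact: continuous_measurable_fun.
have id : L1 tm (dcutoff t h) := tm_cont T0 cd bd.
have D1 : \int[tm]_s dcutoff t h s = -1.
  have TT : 0 <= T <= T by rewrite lexx ltW.
  rewrite -(tI_T id) (tI_FTC TT cd bd cc (fun s _ => @DER_cutoff R t h s)).
  by rewrite cutoff_eq0// ?cutoff_eq1// ?sub0r// ltW.
have icu : L1 tm (fun s : RT => u t) by apply: (@tm_bounded _ T T0 _ `|u t|) => //; exact: measurable_cst.
have icv : L1 tm (fun s : RT => v t) by apply: (@tm_bounded _ T T0 _ `|v t|) => //; exact: measurable_cst.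
have i1 := L1_mul_bounded mcd bd hu.
have i2 := L1_mul_bounded mcd bd (L1B hu icu).
have i3 := L1_mul_bounded mcc bc hv.
have i4 := L1_tI t hv.
have i5 := L1_near (3 * h) t (L1_norm (L1B hu icu)).
have i6 := L1_near (3 * h) t (L1_norm (L1B hv icv)).
have i7 := L1_near_ind (3 * h) t.
have E1 : \int[tm]_s (dcutoff t h s * (u s - u t)) = \int[tm]_s (dcutoff t h s * u s) + u t.
  transitivity (\int[tm]_s (dcutoff t h s * u s - u t * dcutoff t h s)).
    by apply: eq_Rint => s; ring.
  by rewrite (RintB i1 (L1Z (u t) id)) (RintZ (u t) id) D1; ring.
have -> : u t - (c + tI t v) = \int[tm]_s (dcutoff t h s * (u s - u t)) +
    \int[tm]_s (cutoff t h s * v s - (s < t)%R%:R * v s).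
  rewrite E1 RintB// -/(tI t v); clear -W; move: W; set A := \int[tm]_s _; set B := \int[tm]_s _; lra.
have B1 : `|\int[tm]_s (dcutoff t h s * (u s - u t))| <= h^-1 * (e / 9 * (3 * h)).
  apply: (@le_trans _ _ (\int[tm]_s (h^-1 * (near_ind (3 * h) t s * `|u s - u t|)))).
    apply: le_norm_Rint => //; first exact: L1Z.
    move=> s; rewrite normrM /near_ind; have [st|st] := ltP (`|s - t|) (3 * h).
      by rewrite mul1r ler_wpM2r.
    rewrite mul0r mulr0 dcutoff_eq0 ?normr0 ?mul0r//.
    by apply/orP; clear -st h0; move: st; rewrite ler_normr => /orP[?|?]; [right|left]; lra.
  by rewrite RintZ// ler_pM2l ?invr_gt0//; apply: H1; rewrite h3.
have B2 : `|\int[tm]_s (cutoff t h s * v s - (s < t)%R%:R * v s)| <=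
    e / 9 * (3 * h) + `|v t| * ((3 * h) *+ 2).
  apply: (@le_trans _ _ (\int[tm]_s (near_ind (3 * h) t s * `|v s - v t| + `|v t| * near_ind (3 * h) t s))).
    apply: le_norm_Rint; [exact: L1B|by apply: L1D => //; exact: L1Z|].
    move=> s; rewrite -mulrBl normrM /near_ind; have [st|st] := ltP (`|s - t|) (3 * h).
      rewrite mul1r mulr1.
      have : `|cutoff t h s - (s < t)%R%:R| <= 1.
        have /andP[l1 l2] := cutoff_itv t h s.
        by clear -l1 l2; rewrite ler_norml; case: (s < t); apply/andP; split; rewrite /=; lra.
      move=> /(ler_wpM2r (normr_ge0 (v s))); rewrite mul1r => /le_trans; apply.
      by have := ler_normD (v s - v t) (v t); rewrite subrK.
    rewrite mul0r mulr0 addr0 (_ : cutoff t h s - _ = 0) ?normr0 ?mul0r//.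
    move: st; rewrite ler_normr => /orP[st|st].
      have [l1 l2] : t <= s /\ t + 2 * h <= s by clear -st h0; split; lra.
      by rewrite cutoff_eq0// ltNge l1 subrr.
    have l1 : s < t by clear -st h0; lra.
    by rewrite cutoff_eq1 ?ltW// l1 subrr.
  rewrite RintD//; last exact: L1Z.
  rewrite RintZ//; apply: lerD; first by apply: H2; rewrite h3.
  by rewrite ler_wpM2l//; exact: near_ind_int.
apply: (le_trans (ler_normD _ _)).
have E2 : h^-1 * (e / 9 * (3 * h)) = e / 3 by field; rewrite gt_eqF.
have B3 : `|v t| * ((3 * h) *+ 2) <= e / 3.
  have : h * (18 * (`|v t| + 1)) <= e by rewrite -ler_pdivlMr ?ltW// mulr_gt0// ltr_wpDl.
  rewrite -mulr_natr; clear -h0; set w := `|v t|; nra.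
have B4 : e / 9 * (3 * h) <= e / 3 by clear -e0 h0 h1; nra.
rewrite E2 in B1; apply: le_trans (lerD B1 B2) _.
apply: le_trans (lerD (lexx _) (lerD B4 B3)) _; clear; lra.
Qed.

(** The weight exp(2 C t) is chosen so that integration followed by
    multiplication by C halves it. *)
Lemma tI_exp (C t : R) : 0 < C -> 0 <= t <= T ->
  L1 tm (fun s : RT => expR (2 * C * s)) /\
  tI t (fun s => expR (2 * C * s)) <= expR (2 * C * t) / (2 * C).
Proof.
move=> C0 ht; have C2 : 0 < 2 * C by rewrite mulr_gt0.
pose f s := expR (2 * C * clamp T s).
have cc : continuous (clamp T).
  move=> s; apply/cvgrPdist_le => e e0; apply/nbhs_ballP; exists e => // s' /= ss.
  by apply: le_trans (clamp_lip s s' (ltW T0)) _; exact: ltW.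
have cf : continuous f.
  apply: (@cont_comp _ _ _ (fun s => 2 * C * clamp T s) expR); last exact: continuous_expR.
  by apply: contM; [exact: cont_cst|exact: cc].
have fM s : `|f s| <= expR (2 * C * T).
  rewrite ger0_norm ?expR_ge0// ler_expR ler_pM2l//.
  by have /andP[] := clamp_itv s (ltW T0).
have lf : L1 tm f := tm_cont T0 cf fM.
have me : measurable_fun setT (fun s : RT => expR (2 * C * s)).
  apply: continuous_measurable_fun.
  apply: (@cont_comp _ _ _ (fun s : R => 2 * C * s) expR); last exact: continuous_expR.
  by apply: contM; [exact: cont_cst|move=> x; exact: cvg_id].
have ae : {ae tm, forall s : RT, expR (2 * C * s) = f s}.
  have := ae_tm_itv T; apply: filterS => s /andP[s0 sT].
  by rewrite /f clamp_id// !ltW.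
have l1 := ae_L1 me lf ae; split => //.
have -> : tI t (fun s => expR (2 * C * s)) = tI t f.
  apply: ae_Rint; [exact: L1_measurable (L1_tI t l1)|exact: L1_measurable (L1_tI t lf)|].
  by move: ae; apply: filterS => s ->.
pose F s := (2 * C)^-1 * expR (2 * C * s).
have dF (s : R) : is_derive s (1 : R) F (expR (2 * C * s)).
  have d1 : is_derive s (1 : R) (fun s => expR (2 * C * s)) (expR (2 * C * s) * (2 * C)).
    by apply: (is_derive1_comp (f := expR) (g := fun s => 2 * C * s)); exact: DER_lin.
  have := is_deriveZ (2 * C)^-1 d1; rewrite /GRing.scale /= mulrCA mulVf ?gt_eqF// mulr1.
  exact.
have dF' (s : R) : 0 < s < T -> is_derive s (1 : R) F (f s).
  by move=> /andP[s0 sT]; rewrite /f clamp_id ?ltW//; exact: dF.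
rewrite (tI_FTC ht cf fM (DER_continuous dF) dF') /F mulrC lerBlDr lerDl.
by rewrite mulr_ge0 ?expR_ge0// invr_ge0 ltW.
Qed.

(** The inequality holds only almost everywhere and f need not be continuous,
    so the differential proof is not available. A bound f <= N exp(2 C t)
    improves itself to f <= (A + N / 2) exp(2 C t); starting from the crude
    constant S and iterating, N tends to the fixed point 2 A. *)
Lemma gronwall_ae (f : RT -> R) A C S : L1 tm f -> 0 <= A -> 0 < C ->
  {ae tm, forall t : RT, f t <= A + C * tI t f} -> {ae tm, forall t : RT, f t <= S} ->
  {ae tm, forall t : RT, f t <= 2 * A * expR (2 * C * t)}.
Proof.
move=> lf A0 C0 hA hS; have C2 : 0 < 2 * C by rewrite mulr_gt0.
have T1 : 0 <= T <= T by rewrite lexx ltW.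
have [le _] := tI_exp C0 T1.
have step N : 0 <= N -> {ae tm, forall t : RT, f t <= N * expR (2 * C * t)} ->
    {ae tm, forall t : RT, f t <= (A + N / 2) * expR (2 * C * t)}.
  move=> N0 hN; have h3 := ae_tm_itv T; move: hA h3; apply: filterS2 => t ft /andP[t0 tT].
  have ht : 0 <= t <= T by rewrite !ltW.
  have h1 := le_tI t lf (L1Z N le) hN.
  rewrite (tIZ t N le) in h1.
  have [_ /(ler_wpM2l N0) h2] := tI_exp C0 ht.
  have h4 := ler_wpM2l (ltW C0) (le_trans h1 h2).
  have e1 : 1 <= expR (2 * C * t) by rewrite -expR0 ler_expR !mulr_ge0// ltW.
  have E : C * (N * (expR (2 * C * t) / (2 * C))) = N / 2 * expR (2 * C * t).
    by field; rewrite gt_eqF.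
  rewrite E in h4; move: (ler_wpM2l A0 e1) ft h4; clear; rewrite mulr1 mulrDl.
  set w := expR _; set I := tI t f; lra.
pose S0 := Num.max S 0.
have S00 : 0 <= S0 by rewrite le_max lexx orbT.
have it n : {ae tm, forall t : RT, f t <= (2 * A + S0 / 2 ^+ n) * expR (2 * C * t)}.
  elim: n => [|n IH].
    have h3 := ae_tm_itv T; move: hS h3; apply: filterS2 => t ft /andP[t0 _].
    apply: (le_trans ft); rewrite expr0 divr1; apply: (@le_trans _ _ S0); first by rewrite le_max lexx.
    have e1 : 1 <= expR (2 * C * t) by rewrite -expR0 ler_expR !mulr_ge0// ltW.
    rewrite -[leLHS]mulr1; apply: ler_pM => //.
    by rewrite lerDr mulr_ge0.
  have N0 : 0 <= 2 * A + S0 / 2 ^+ n by rewrite addr_ge0 ?mulr_ge0// invr_ge0 exprn_ge0.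
  have := step _ N0 IH; apply: filterS => t; congr (_ <= _ * _).
  by rewrite exprS; field; rewrite ?expf_neq0.
have : {ae tm, forall t : RT, forall n, f t <= (2 * A + S0 / 2 ^+ n) * expR (2 * C * t)}.
  exact: ae_foralln.
apply: filterS => t ft; apply/ler_addgt0Pr => e e0.
have w0 : 0 < expR (2 * C * t) by exact: expR_gt0.
have [n hn] : exists n, S0 * expR (2 * C * t) / e < 2 ^+ n.
  have h0 : 0 <= S0 * expR (2 * C * t) / e by rewrite divr_ge0 ?mulr_ge0// ltW.
  exists (Num.bound (S0 * expR (2 * C * t) / e)).
  apply: lt_le_trans (archi_boundP h0) _.
  by rewrite -natrX ler_nat ltnW// ltn_expl.
apply: (le_trans (ft n)); rewrite mulrDl lerD2l.
rewrite mulrAC ler_pdivrMr ?exprn_gt0// mulrC -ler_pdivrMl//.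
apply: le_trans (ltW hn); rewrite le_eqVlt; apply/orP; left; apply/eqP; ring.
Qed.

End time_evolution.

(** * The Young measure as a measure on phase space *)

Section fine_integral.
Context d (U : measurableType d) (R : realType) (mu : {measure set U -> \bar R}).

Lemma fine_ge0_L1 (A : U -> \bar R) : measurable_fun setT A -> (forall x, 0 <= A x)%E ->
  (\int[mu]_x A x < +oo)%E ->
  [/\ L1 mu (fun x => fine (A x)), {ae mu, forall x, A x \is a fin_num} &
      \int[mu]_x fine (A x) = fine (\int[mu]_x A x)].
Proof.
move=> mA A0 Aoo.
have iA : mu.-integrable setT A.
  apply/integrableP; split => //; apply: le_lt_trans Aoo.
  by apply: ge0_le_integral => //; [exact: measurableT_comp|move=> x _; rewrite gee0_abs].
have fin := integrable_ae measurableT iA.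
have fin' : {ae mu, forall x, A x \is a fin_num} by move: fin; apply: filterS => x /(_ Logic.I).
have mfA : measurable_fun setT (fun x => fine (A x)).
  exact: (measurableT_comp (@fine_measurable R setT measurableT)).
have eqA : (\int[mu]_x (fine (A x))%:E = \int[mu]_x A x)%E.
  apply: ae_eq_integral => //; first exact/measurable_EFinP.
  by move: fin'; apply: filterS => x hx _; rewrite fineK.
split => //; last by rewrite /Rintegral eqA.
apply: L1P => //; apply: le_lt_trans Aoo; rewrite -eqA.
apply: ge0_le_integral => //.
- by apply/measurable_EFinP; exact: measurableT_comp.
- exact/measurable_EFinP.
- by move=> x _; rewrite ger0_norm// fine_ge0.
Qed.

End fine_integral.

Section young_joint.
Context {R : realType} {d : nat}.
Local Notation E := 'rV[R]_d.
Local Notation Y := (R * E)%type.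
Local Notation tor := (torus_prob d : probability E R).
Local Opaque lebesgue_row.
Variable s : mv_data R d.

(** Measurability of the kernel passes to integrals of nonnegative functions;
    positive and negative parts are treated separately. *)
Lemma measurable_ymean (f : Y -> R) : measurable_fun setT f ->
  measurable_fun setT (fun z : R * E => ymean s f z.1 z.2).
Proof.
move=> mf; have mf' : measurable_fun setT (EFin \o f) by exact/measurable_EFinP.
rewrite (_ : (fun z : R * E => _) = (fun z => fine ((\int[young s z]_l (EFin \o f)^\+ l) - (\int[young s z]_l (EFin \o f)^\- l)))%E); last first.
  by apply/funext => -[t x]; rewrite /ymean /Rintegral integralE.
apply: (measurableT_comp (@fine_measurable R setT measurableT)).
apply: emeasurable_funB.
- apply: (measurable_fun_integral_kernel (l := young s)) => //; first exact: measurable_kernel.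
  exact: measurable_funepos.
- apply: (measurable_fun_integral_kernel (l := young s)) => //; first exact: measurable_kernel.
  exact: measurable_funeneg.
Qed.

Lemma measurable_Rint_section d1 d2 (U : measurableType d1) (W : measurableType d2)
    (m : {sigma_finite_measure set W -> \bar R}) (f : U * W -> R) :
  measurable_fun setT f -> measurable_fun setT (fun u => \int[m]_w f (u, w)).
Proof.
move=> mf; have mf' : measurable_fun setT (EFin \o f) by exact/measurable_EFinP.
rewrite (_ : (fun u => _) = (fun u => fine ((\int[m]_w (EFin \o f)^\+ (u, w)) - (\int[m]_w (EFin \o f)^\- (u, w))))%E); last first.
  apply/funext => u; rewrite /Rintegral integralE; congr (fine (_ - _)%E).
    by apply: eq_integral => w _; rewrite !funeposE.
  by apply: eq_integral => w _; rewrite !funenegE.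
apply: (measurableT_comp (@fine_measurable R setT measurableT)).
apply: emeasurable_funB.
- by apply: (measurable_fun_fubini_tonelli_F (m2 := m) (EFin \o f)^\+%E) => //; exact: measurable_funepos.
- by apply: (measurable_fun_fubini_tonelli_F (m2 := m) (EFin \o f)^\-%E) => //; exact: measurable_funeneg.
Qed.

Let mpair (z : R * E) : measurable_fun setT (fun l : Y => (z.2, l)).
Proof. exact: measurable_pair1. Qed.

(** The Young measure at z, carried to the fibre over the space component of z.
    *)
Definition lift_young (z : R * E) : {measure set (E * Y) -> \bar R} :=
  measure_function_pushforward__canonical__measure_function_Measure (young s z) (mpair z).

Let measurable_lift U : measurable U -> measurable_fun setT (lift_young ^~ U).
Proof.
move=> mU.
pose V : set ((R * E) * Y) := (fun w => (w.1.2, w.2)) @^-1` U.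
have mV : measurable V.
  rewrite -[V]setTI; apply: (_ : measurable_fun setT (fun w : (R * E) * Y => (w.1.2, w.2))) => //.
  apply/measurable_fun_pairP; split; last exact: measurable_snd.
  exact: (measurableT_comp measurable_snd measurable_fst).
rewrite (_ : (fun _ => _) = (fun z => young s z (xsection V z))); last first.
  apply/funext => z; rewrite /= /pushforward; congr (young s z _).
  by apply/seteqP; split => l; rewrite /xsection /= => h; [exact/mem_set|exact: set_mem h].
by apply: measurable_fun_xsection_finite_kernel; rewrite inE.
Qed.

HB.instance Definition _ := isKernel.Build _ _ _ _ R lift_young measurable_lift.

Let lift_prob z : lift_young z setT = 1%E.
Proof. by rewrite /= /pushforward preimage_setT prob_kernel. Qed.

HB.instance Definition _ := Kernel_isProbability.Build _ _ _ _ R lift_young lift_prob.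

Definition torus_kernel : R -> {measure set E -> \bar R} :=
  kprobability (@measurable_cst _ _ R (pprobability E R) setT (tor : pprobability E R)).

HB.instance Definition _ := Kernel.on torus_kernel.
HB.instance Definition _ := SFiniteKernel.on torus_kernel.
HB.instance Definition _ := ProbabilityKernel.on torus_kernel.

(** The measure dx dnu_{t,x}(l) on T^d times the phase space. Every quantity at
    a fixed time becomes one integral with respect to it; pointwise
    inequalities in l are integrated directly, and integrability is asked once
    instead of for almost every x. *)
Definition joint (t : R) : {measure set (E * Y) -> \bar R} := mkcomp torus_kernel lift_young t.

Lemma ge0_integral_joint t (f : E * Y -> \bar R) : measurable_fun setT f -> (forall z, 0 <= f z)%E ->
  (\int[joint t]_z f z = \int[tor]_x \int[young s (t, x)]_l f (x, l))%E.
Proof.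
move=> mf f0; rewrite [LHS](integral_kcomp torus_kernel lift_young t f0 mf).
apply: eq_integral => x _.
by rewrite (@ge0_integral_pushforward _ _ _ _ _ _ (mpair (t, x)))// preimage_setT.
Qed.

Lemma jointT t : joint t setT = 1%E.
Proof.
rewrite -[LHS]mul1e -integral_cst// ge0_integral_joint//.
rewrite (_ : (fun x => _) = cst 1%E); last first.
  by apply/funext => x; rewrite integral_cst// prob_kernel mule1.
by rewrite integral_cst// mul1e [LHS]probability_setT.
Qed.

Lemma joint_lty t : (joint t setT < +oo)%E. Proof. by rewrite jointT ltry. Qed.

(** Disintegration along the torus; almost every fibre is integrable. *)
Lemma Rint_joint t (f : E * Y -> R) : L1 (joint t) f ->
  [/\ {ae tor, forall x, L1 (young s (t, x)) (fun l => f (x, l))},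
      L1 tor (fun x => \int[young s (t, x)]_l f (x, l)) &
      \int[joint t]_z f z = \int[tor]_x \int[young s (t, x)]_l f (x, l)].
Proof.
move=> hf; have mf := L1_measurable hf.
have mfe : measurable_fun setT (EFin \o f) by exact/measurable_EFinP.
pose g z := (f z)%:E.
have mp : measurable_fun setT g^\+%E by exact: measurable_funepos.
have mn : measurable_fun setT g^\-%E by exact: measurable_funeneg.
have [_ aoo] := integrableP _ _ _ hf.
have gp : (\int[joint t]_z g^\+ z < +oo)%E.
  apply: le_lt_trans aoo; apply: ge0_le_integral => //; first exact: measurableT_comp.
  by move=> z _; rewrite funeposE ge_max abse_ge0 /= lee_fin ler_norm.
have gn : (\int[joint t]_z g^\- z < +oo)%E.
  apply: le_lt_trans aoo; apply: ge0_le_integral => //; first exact: measurableT_comp.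
  by move=> z _; rewrite funenegE ge_max abse_ge0 /= lee_fin -normrN ler_norm.
have meas (h : E * Y -> \bar R) : measurable_fun setT h -> (forall z, 0 <= h z)%E ->
    measurable_fun setT (fun x => \int[young s (t, x)]_l h (x, l))%E.
  move=> mh h0.
  have mh' : measurable_fun setT (fun w : (R * E) * Y => h (w.1.2, w.2)).
    apply: (measurableT_comp mh); apply/measurable_fun_pairP; split; last exact: measurable_snd.
    exact: (measurableT_comp measurable_snd measurable_fst).
  have mk := @measurable_fun_integral_finite_kernel _ _ _ _ _ (fun w : (R * E) * Y => h (w.1.2, w.2))
    (young s) (fun w => h0 _) mh'.
  exact: (measurableT_comp mk (@measurable_pair1 _ _ R E t)).
have Ap0 x : (0 <= \int[young s (t, x)]_l g^\+ (x, l))%E by apply: integral_ge0.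
have An0 x : (0 <= \int[young s (t, x)]_l g^\- (x, l))%E by apply: integral_ge0.
have mAp := meas _ mp (fun z => funepos_ge0 g z).
have mAn := meas _ mn (fun z => funeneg_ge0 g z).
rewrite ge0_integral_joint// in gp; rewrite ge0_integral_joint// in gn.
have [p1 p2 p3] := fine_ge0_L1 mAp Ap0 gp.
have [n1 n2 n3] := fine_ge0_L1 mAn An0 gn.
have E1 x : \int[young s (t, x)]_l f (x, l) =
    fine (\int[young s (t, x)]_l g^\+ (x, l) - \int[young s (t, x)]_l g^\- (x, l)).
  rewrite /Rintegral integralE; congr (fine (_ - _)%E).
    by apply: eq_integral => w _; rewrite !funeposE.
  by apply: eq_integral => w _; rewrite !funenegE.
have mI : measurable_fun setT (fun x => \int[young s (t, x)]_l f (x, l)).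
  rewrite (_ : (fun x => _) = (fun x => fine (\int[young s (t, x)]_l g^\+ (x, l) - \int[young s (t, x)]_l g^\- (x, l)))%E); last exact/funext.
  apply: (measurableT_comp (@fine_measurable R setT measurableT)).
  exact: emeasurable_funB.
have aeE : {ae tor, forall x, \int[young s (t, x)]_l f (x, l) =
    fine (\int[young s (t, x)]_l g^\+ (x, l)) - fine (\int[young s (t, x)]_l g^\- (x, l))}.
  by move: p2 n2; apply: filterS2 => x hp hn; rewrite E1 fineB.
split.
- move: p2 n2; apply: filterS2 => x hp hn; apply: L1P.
    exact: (measurableT_comp mf (@measurable_pair1 _ _ E Y x)).
  rewrite (_ : (fun l => _) = (fun l => g^\+ (x, l) + g^\- (x, l))%E); last first.
    by apply/funext => l; rewrite -[RHS]/((g^\+ \+ g^\-)%E (x, l)) -fune_abse.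
  rewrite ge0_integralD//.
  + by rewrite lte_add_pinfty// ltey_eq ?hp ?hn.
  + exact: (measurableT_comp mp (@measurable_pair1 _ _ E Y x)).
  + exact: (measurableT_comp mn (@measurable_pair1 _ _ E Y x)).
- exact: ae_L1 mI (L1B p1 n1) aeE.
rewrite (ae_Rint mI (L1_measurable (L1B p1 n1)) aeE) RintB// p3 n3.
rewrite /Rintegral integralE -/g !ge0_integral_joint// fineB//.
- by rewrite ge0_fin_numE// integral_ge0.
- by rewrite ge0_fin_numE// integral_ge0.
Qed.

Lemma Rint_ymean t (phi : E -> R) (f : Y -> R) M : measurable_fun setT phi ->
  (forall x, `|phi x| <= M) -> L1 (joint t) (fun z => f z.2) ->
  [/\ L1 (joint t) (fun z => phi z.1 * f z.2), L1 tor (fun x => phi x * ymean s f t x) &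
     \int[tor]_x (phi x * ymean s f t x) = \int[joint t]_z (phi z.1 * f z.2)].
Proof.
move=> mphi bphi hf.
have mphi1 : measurable_fun setT (fun z : E * Y => phi z.1) by exact: (measurableT_comp mphi measurable_fst).
have h := @L1_mul_bounded _ _ _ (joint t) (fun z => phi z.1) (fun z => f z.2) M mphi1 (fun z => bphi z.1) hf.
have [_ h2 h3] := Rint_joint h.
have [k1 k2 _] := Rint_joint hf.
have k2' := @L1_mul_bounded _ _ _ tor phi _ M mphi bphi k2.
split => //; rewrite h3.
apply: ae_Rint; [exact: L1_measurable k2'|exact: L1_measurable h2|].
by move: k1; apply: filterS => x hx; rewrite /= RintZ.
Qed.

(** Jensen's inequality for the square: the variance of f under almost every
    nu_{t,x} is nonnegative. *)
Lemma ymean_sq_le t (f : Y -> R) : measurable_fun setT f ->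
  L1 (joint t) (fun z => f z.2 ^+ 2) ->
  [/\ L1 (joint t) (fun z => f z.2), L1 tor (fun x => ymean s f t x ^+ 2) &
   {ae tor, forall x, ymean s f t x ^+ 2 <= ymean s (fun l => f l ^+ 2) t x}].
Proof.
move=> mf h.
have cst1 : L1 (joint t) (fun=> 1) by apply: (@L1_bounded _ _ _ _ _ 1) => //; [exact: joint_lty|move=> x; rewrite normr1].
have hf : L1 (joint t) (fun z => f z.2).
  apply: (@L1_le _ _ _ _ _ (fun z => f z.2 ^+ 2 + 1)).
  - exact: (measurableT_comp mf measurable_snd).
  - exact: L1D.
  - by move=> z; rewrite ler_norml; apply/andP; split; nra.
have [k1 k2 _] := Rint_joint hf; have [h1 h2 _] := Rint_joint h.
have ae : {ae tor, forall x, ymean s f t x ^+ 2 <= ymean s (fun l => f l ^+ 2) t x}.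
  move: k1 h1; apply: filterS2 => x kx hx.
  set m := ymean s f t x.
  have c1 (c : R) : L1 (young s (t, x)) (fun=> c).
    by apply: (@L1_bounded _ _ _ _ _ `|c|) => //; rewrite [X in (X < _)%E]prob_kernel ltry.
  have : 0 <= \int[young s (t, x)]_l (f l - m) ^+ 2 by apply: Rint_ge0 => l; exact: sqr_ge0.
  have -> : \int[young s (t, x)]_l (f l - m) ^+ 2 =
      \int[young s (t, x)]_l (f l ^+ 2 - 2 * m * f l + m ^+ 2) by apply: eq_Rint => l; ring.
  rewrite /= in kx hx.
  rewrite (RintD (L1B hx (L1Z (2 * m) kx)) (c1 (m ^+ 2))) (RintB hx (L1Z (2 * m) kx)) (RintZ (2 * m) kx).
  rewrite Rint_cst_prob; last exact: prob_kernel.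
  rewrite -/(ymean s f t x) -/(ymean s (fun l => f l ^+ 2) t x) -/m.
  set w := ymean _ _ _ _; nra.
split => //.
have my : measurable_fun setT (fun x => ymean s f t x).
  have := measurableT_comp (measurable_ymean mf) (@measurable_pair1 _ _ R E t).
  exact.
apply: L1P; first exact: measurable_funX.
have := L1_lty h2; apply: le_lt_trans.
apply: ae_ge0_le_integral => //.
- by apply/measurable_EFinP; apply: measurableT_comp => //; exact: measurable_funX.
- by apply/measurable_EFinP; apply: measurableT_comp => //; exact: L1_measurable h2.
move: ae; apply: filterS => x hx _.
by rewrite lee_fin ger0_norm ?sqr_ge0// (le_trans hx)// ler_norm.
Qed.

End young_joint.

(** * Functionals defined by measures and charges *)

Section restricted_measure.
Context d (U : measurableType d) (R : realType).
Import HBNNSimple.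

Lemma Rint_mrestr (m : {measure set U -> \bar R}) (D : set U) (mD : measurable D) (f : U -> R) :
  measurable_fun setT f -> \int[mrestr m mD]_x f x = \int[m]_(x in D) f x.
Proof.
move=> mf; have mf' : measurable_fun setT (EFin \o f) by exact/measurable_EFinP.
rewrite /Rintegral; congr fine; rewrite integralE [RHS]integralE; congr (_ - _)%E.
  by apply: ge0_integral_mrestr => //; exact: measurable_funepos.
by apply: ge0_integral_mrestr => //; exact: measurable_funeneg.
Qed.

Lemma mrestrC0 (m : {measure set U -> \bar R}) (D : set U) (mD : measurable D) :
  mrestr m mD (~` D) = 0%E.
Proof. by rewrite /mrestr setICl measure0. Qed.

Lemma ge0_integral_le_off (m : {measure set U -> \bar R}) (D : set U) (mD : measurable D) (f g : U -> \bar R) :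
  m (~` D) = 0%E -> (forall x, D x -> f x = g x) -> (forall x, 0 <= f x)%E -> (forall x, 0 <= g x)%E ->
  (\int[m]_x f x <= \int[m]_x g x)%E.
Proof.
move=> m0 fg f0 g0; rewrite !ge0_integralTE//; apply: ge_ereal_sup => _ [h /= hf <-].
have -> : sintegral m h = sintegral m (proj_nnsfun h mD).
  rewrite -!integralT_nnsfun; apply: ae_eq_integral => //; try exact/measurable_EFinP.
  exists (~` D); split => //; first exact: measurableC.
  move=> x /= nx Dx; apply: nx => _; congr EFin.
  by rewrite /= /mindic indicE mem_set// mulr1.
apply: ereal_sup_ubound; exists (proj_nnsfun h mD) => //= x.
have [Dx|nDx] := pselect (D x).
  by rewrite /= /mindic indicE mem_set// mulr1 -fg.
by rewrite /= /mindic indicE memNset// mulr0.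
Qed.

(** Measurability is not asked of the integrands: integrals of nonnegative
    functions are suprema over simple functions below them, and these may be
    cut off outside D. *)
Lemma eq_integral_mrestr (m : {measure set U -> \bar R}) (D : set U) (mD : measurable D) (f g : U -> R) :
  (forall x, D x -> f x = g x) -> \int[mrestr m mD]_x f x = \int[mrestr m mD]_x g x.
Proof.
move=> fg; rewrite /Rintegral integralE [in RHS]integralE; congr (fine (_ - _)%E);
  apply/eqP; rewrite eq_le; apply/andP; split;
  by apply: (ge0_integral_le_off mD (mrestrC0 m mD)) => // x Dx; rewrite ?funeposE ?funenegE fg.
Qed.

(** By the same principle null sets are irrelevant for arbitrary functions. The
    integrands in time that come from concentration measures are only known to
    be measurable on ]0, T[, hence the interest of this generality. *)
Lemma ae_eq_Rint (m : {measure set U -> \bar R}) (f g : U -> R) :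
  {ae m, forall x, f x = g x} -> \int[m]_x f x = \int[m]_x g x.
Proof.
move=> [N [mN N0 sN]].
have fg x : (~` N) x -> f x = g x.
  by move=> nN; apply: contrapT => h; apply: nN; exact: sN.
have mD := measurableC mN; have D0 : m (~` (~` N)) = 0%E by rewrite setCK.
rewrite /Rintegral integralE [in RHS]integralE; congr (fine (_ - _)%E);
  apply/eqP; rewrite eq_le; apply/andP; split;
  by apply: (ge0_integral_le_off mD D0) => // x Dx; rewrite ?funeposE ?funenegE fg.
Qed.

End restricted_measure.

Section charge_bounds.
Context {R : realType} {d : nat}.
Local Notation E := 'rV[R]_d.
Local Notation mcube := (@measurable_cube R d).

Definition cube_restr (m : {measure set E -> \bar R}) : {measure set E -> \bar R} := mrestr m mcube.

Lemma Rint_cube (m : {measure set E -> \bar R}) (f : E -> R) : measurable_fun setT f ->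
  \int[m]_(x in cube) f x = \int[cube_restr m]_x f x.
Proof. by move=> mf; rewrite Rint_mrestr. Qed.

Lemma cube_restrT (m : {measure set E -> \bar R}) : cube_restr m setT = m cube.
Proof. by rewrite /cube_restr /= /mrestr setTI. Qed.

Lemma finite_cube (m : {finite_measure set E -> \bar R}) : m cube = (fine (m cube))%:E.
Proof. by rewrite fineK// fin_num_measure//; exact: measurable_cube. Qed.

Lemma cube_restr_lty (m : {finite_measure set E -> \bar R}) : (cube_restr m setT < +oo)%E.
Proof.
by rewrite cube_restrT -ge0_fin_numE// fin_num_measure//; exact: measurable_cube.
Qed.

Lemma L1_cube (m : {finite_measure set E -> \bar R}) (f : E -> R) M : measurable_fun setT f ->
  (forall x, `|f x| <= M) -> L1 (cube_restr m) f.
Proof. by apply: L1_bounded; exact: cube_restr_lty. Qed.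

Lemma Rint_cube_cst (m : {finite_measure set E -> \bar R}) (c : R) :
  \int[cube_restr m]_x c = c * fine (m cube).
Proof.
rewrite /Rintegral integral_cst// [X in (_ * X)%E]cube_restrT.
rewrite -[X in (_ * X)%E]fineK -?EFinM// fin_num_measure//; exact: measurable_cube.
Qed.

Lemma Rint_cube_bound (m : {finite_measure set E -> \bar R}) (f : E -> R) M : measurable_fun setT f ->
  (forall x, `|f x| <= M) -> `|\int[m]_(x in cube) f x| <= M * fine (m cube).
Proof.
move=> mf fM; rewrite Rint_cube// -Rint_cube_cst; apply: le_norm_Rint => //.
  exact: (L1_cube _ mf fM).
by apply: (@L1_cube _ _ `|M|).
Qed.

(** The Hahn decomposition chosen in the definition of the integral is made
    available as a pair of finite measures with disjoint supports. *)
Lemma charge_integral_decomp (nu : {charge set E -> \bar R}) :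
  exists (p n : {finite_measure set E -> \bar R}) (P : set E),
  [/\ measurable P, forall A, measurable A -> p A = nu (A `&` P),
      forall A, measurable A -> n A = (- nu (A `&` ~` P))%E &
      forall f, charge_integral nu f = \int[p]_(x in cube) f x - \int[n]_(x in cube) f x].
Proof.
have [P [N [hPN hE]]] : exists P N (h : hahn_decomposition nu P N), forall f,
    charge_integral nu f = \int[jordan_pos h]_(x in cube) f x - \int[jordan_neg h]_(x in cube) f x.
  rewrite /charge_integral; case: (cid (Hahn_decomposition nu)) => P hP.
  by case: (cid hP) => N hPN; exists P, N, hPN.
exists (jordan_pos hPN), (jordan_neg hPN), P.
have [[mP _] [mN _] PN PN0] := hPN.
have NE : N = ~` P.
  apply/seteqP; split => x /=.
    by move=> Nx Px; have : (P `&` N) x by []; rewrite PN0.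
  by move=> nPx; have : [set: E] x by []; rewrite -PN => -[].
split => //.
- move=> A mA; etransitivity; first exact: jordan_posE.
  by rewrite cjordan_posE /crestr0 mem_set.
- move=> A mA; etransitivity; first exact: jordan_negE.
  by rewrite cjordan_negE /crestr0 mem_set//= /crestr -NE.
Qed.

(** The common features of integration against a measure, a charge, a moment of
    the Young measure, or a combination of these: linear on bounded measurable
    functions and bounded by K times the sup norm. Barred quantities need no
    finer structure than this. *)
Definition lin_bounded (L : (E -> R) -> R) (K : R) : Prop :=
  [/\ forall (f g : E -> R) (M N : R), measurable_fun setT f -> measurable_fun setT g ->
       (forall x, `|f x| <= M) -> (forall x, `|g x| <= N) -> L (fun x => f x + g x) = L f + L g,
     forall (c : R) (f : E -> R) (M : R), measurable_fun setT f -> (forall x, `|f x| <= M) -> L (fun x => c * f x) = c * L f,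
     forall (f : E -> R) (M : R), measurable_fun setT f -> (forall x, `|f x| <= M) -> `|L f| <= M * K & 0 <= K].

Lemma lin_bounded_measure (m : {finite_measure set E -> \bar R}) :
  lin_bounded (fun f => \int[m]_(x in cube) f x) (fine (m cube)).
Proof.
split.
- move=> f g M N mf mg fM gN; rewrite !Rint_cube//; last exact: measurable_funD.
  by rewrite RintD//; [exact: L1_cube mf fM|exact: L1_cube mg gN].
- move=> c f M mf fM; rewrite !Rint_cube//; last exact: measurable_funM.
  by rewrite RintZ//; exact: L1_cube mf fM.
- by move=> f M mf fM; exact: Rint_cube_bound.
- exact: fine_ge0.
Qed.

Lemma lin_boundedB L1 L2 K1 K2 : lin_bounded L1 K1 -> lin_bounded L2 K2 ->
  lin_bounded (fun f => L1 f - L2 f) (K1 + K2).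
Proof.
move=> [a1 a2 a3 a4] [b1 b2 b3 b4]; split.
- by move=> f g M N mf mg fM gN; rewrite (a1 _ _ M N)// (b1 _ _ M N)//; ring.
- by move=> c f M mf fM; rewrite (a2 _ _ M)// (b2 _ _ M)//; ring.
- move=> f M mf fM; apply: (le_trans (ler_normB _ _)).
  by rewrite mulrDr; apply: lerD; [exact: a3|exact: b3].
- exact: addr_ge0.
Qed.

Lemma lin_bounded_charge (nu : {charge set E -> \bar R}) : exists K, lin_bounded (charge_integral nu) K.
Proof.
have [p [n [P [_ _ _ hE]]]] := charge_integral_decomp nu.
exists (fine (p cube) + fine (n cube)).
have -> : charge_integral nu = (fun f => \int[p]_(x in cube) f x - \int[n]_(x in cube) f x).
  exact/funext.
by apply: lin_boundedB; exact: lin_bounded_measure.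
Qed.

Lemma charge_integral_indic (nu : {charge set E -> \bar R}) A : measurable A ->
  charge_integral nu (\1_A) = fine (nu (cube `&` A)).
Proof.
move=> mA; have [p [n [P [mP pE nE hE]]]] := charge_integral_decomp nu.
have mc : measurable (cube : set E) := mcube.
have mcA : measurable (cube `&` A) by exact: measurableI.
have E1 (m : {finite_measure set E -> \bar R}) : \int[m]_(x in cube) (\1_A x) = fine (m (cube `&` A)).
  by rewrite /Rintegral integral_indic// setIC.
rewrite hE !E1 pE// nE//.
have PP : measurable (~` P) by exact: measurableC.
have fin B : measurable B -> nu B \is a fin_num by move=> mB; exact: fin_num_measure.
rewrite -fineB; [|exact/fin/measurableI|by rewrite fin_numN; exact/fin/measurableI].
rewrite oppeK; congr fine; rewrite -chargeU//.
- by rewrite -setIUr setUCr setIT.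
- exact: measurableI.
- exact: measurableI.
by rewrite setIACA setICr setI0.
Qed.

(** The Hahn set and its complement form an admissible partition in the
    definition of the variation, and the absolute value of one component is at
    most the Euclidean norm of all. *)
Lemma charge_integral_bound (I : finType) (nu : I -> {charge set E -> \bar R}) (i : I) (K : R) (f : E -> R) M :
  (vec_variation (fun i => nu i : set E -> \bar R) cube <= K%:E)%E ->
  measurable_fun setT f -> (forall x, `|f x| <= M) -> `|charge_integral (nu i) f| <= M * K.
Proof.
move=> hK mf fM; have [p [n [P [mP pE nE hE]]]] := charge_integral_decomp (nu i).
have M0 : 0 <= M by apply: le_trans (fM 0).
rewrite hE; apply: (le_trans (ler_normB _ _)).
apply: (@le_trans _ _ (M * (fine (p cube) + fine (n cube)))).
  by rewrite mulrDr; apply: lerD; exact: Rint_cube_bound.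
rewrite ler_wpM2l//.
have PP : measurable (~` P) by exact: measurableC.
pose B (k : 'I_2) : set E := if k == ord0 then cube `&` P else cube `&` ~` P.
have mc : measurable (cube : set E) := mcube.
have mB k : measurable (B k) by rewrite /B; case: ifP => _; exact: measurableI.
rewrite -lee_fin; apply: le_trans hK.
apply: (@le_trans _ _ (\sum_(k < 2) (Num.sqrt (\sum_i fine (nu i (B k)) ^+ 2))%:E)%E); last first.
  apply: ereal_sup_ubound; exists 2%N, B; split => //.
  - apply/trivIsetP => j k _ _ jk; rewrite /B.
    have [j0|j1] := eqVneq j ord0; have [k0|k1] := eqVneq k ord0.
    + by move: jk; rewrite j0 k0 eqxx.
    + by rewrite setIACA setICr setI0.
    + by rewrite setIACA setICl setI0.
    + by move: jk j1 k1; case: j => -[|[|j]] // ?; case: k => -[|[|k]] //.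
  - apply/seteqP; split => x.
      by move=> [k _]; rewrite /B; case: ifP => _ [].
    move=> cx; have [Px|nPx] := pselect (P x); first by exists ord0.
    by exists ord_max.
rewrite big_ord_recl big_ord1 -EFinD lee_fin.
have key k : `|fine (nu i (B k))| <= Num.sqrt (\sum_i fine (nu i (B k)) ^+ 2).
  rewrite -sqrtr_sqr ler_wsqrtr// (bigD1 i)//= lerDl.
  by apply: sumr_ge0 => j _; exact: sqr_ge0.
apply: lerD.
  apply: le_trans (key ord0); rewrite /B eqxx pE//; exact: ler_norm.
apply: le_trans (key _); rewrite /B /= nE//.
by rewrite fineN -normrN ler_norm.
Qed.

End charge_bounds.

Section measurable_in_time.
Context {R : realType} {d : nat}.
Local Notation E := 'rV[R]_d.
Variables (T : R).
Local Notation RT := (measurableTypeR R).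

(** The largest multiple of 1 / N.+1 below y, for y between 0 and K / N.+1, as
    a finite sum of indicators of superlevel sets. *)
Definition staircase (N : nat) (y : R) (K : nat) : R := \sum_(k < K) N.+1%:R^-1 * ((k.+1%:R / N.+1%:R <= y)%R%:R : R).

Lemma staircase_approx N y K : 0 <= y -> y <= K%:R / N.+1%:R -> `|y - staircase N y K| <= N.+1%:R^-1.
Proof.
move=> y0 yK; set q := N.+1%:R^-1; have q0 : 0 < q by rewrite invr_gt0.
have hi n : staircase N y n <= y.
  have : staircase N y n <= Num.min y (n%:R * q).
    elim: n => [|n IH]; first by rewrite /staircase big_ord0 le_min y0 mul0r lexx.
    rewrite /staircase big_ord_recr /= -/(staircase N y n) -/q; move: IH; rewrite !le_min => /andP[h1 h2].
    have [le|gt] := leP (n.+1%:R * q) y; rewrite ?mulr1 ?mulr0 ?addr0.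
      by move: le; rewrite -natr1 mulrDl mul1r => le; apply/andP; split; lra.
    by rewrite h1 (le_trans h2)// ler_pM2r// ler_nat.
  by rewrite le_min => /andP[].
have lo n : Num.min (y - q) (n%:R * q) <= staircase N y n.
  elim: n => [|n IH]; first by rewrite /staircase big_ord0 mul0r ge_min lexx orbT.
  rewrite /staircase big_ord_recr /= -/(staircase N y n) -/q; move: IH; rewrite !ge_min.
  have [le|gt] := leP (n.+1%:R * q) y; rewrite ?mulr1 ?mulr0 ?addr0.
    by move: le; rewrite -natr1 mulrDl mul1r => le /orP[h|h]; apply/orP; right; lra.
  by move: gt; rewrite -natr1 mulrDl mul1r => gt /orP[h|h]; apply/orP; left; lra.
have h1 := hi K; have h2 := lo K.
rewrite ger0_norm ?subr_ge0//; move: h2; rewrite ge_min => /orP[h|h]; move: yK; rewrite -/q; lra.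
Qed.

(** Weak measurability in time is only given on indicators of sets. A bounded
    measurable f is a uniform limit of finite linear combinations of
    indicators, and the functionals are bounded for the sup norm. *)
Lemma measurable_functional (L : R -> (E -> R) -> R) (f : E -> R) M :
  (forall t, exists K, lin_bounded (L t) K) ->
  (forall A, measurable A -> measurable_fun `]0, T[%classic (fun t : RT => L t (\1_A))) ->
  measurable_fun setT f -> (forall x, `|f x| <= M) ->
  measurable_fun `]0, T[%classic (fun t : RT => L t f).
Proof.
move=> Lb mL mf fM.
have mI : measurable (`]0, T[%classic : set RT) by exact: measurable_itv.
have M0 : 0 <= M by apply: le_trans (fM 0).
pose A N k : set E := [set x | k.+1%:R / N.+1%:R <= f x + M].
have mA N k : measurable (A N k).
  rewrite -[A N k]setTI (_ : A N k = (fun x => f x + M) @^-1` `[k.+1%:R / N.+1%:R, +oo[%classic); last first.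
    by apply/seteqP; split => x /=; rewrite in_itv /= andbT.
  by apply: (_ : measurable_fun setT (fun x => f x + M)) => //; exact: measurable_funD.
pose K N := Num.bound (2 * M * N.+1%:R).
pose F N (t : RT) := \sum_(k < K N) N.+1%:R^-1 * L t (\1_(A N k)) - M * L t (\1_setT).
have mF N : measurable_fun `]0, T[%classic (F N).
  apply: measurable_funB; last by apply: measurable_funM => //; exact: mL.
  by apply: measurable_sum => k; apply: measurable_funM => //; exact: mL.
have ind1 (B : set E) x : `|\1_B x : R| <= 1 by rewrite indicE; case: (_ \in _); rewrite ?normr1 ?normr0.
have mind (B : set E) : measurable B -> measurable_fun setT (\1_B : E -> R) by move=> mB; exact: measurable_indic.
have FE N t C : lin_bounded (L t) C -> `|L t f - F N t| <= N.+1%:R^-1 * C.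
  move=> [l1 l2 l3 l4].
  have sumE n : [/\ measurable_fun setT (fun x => staircase N (f x + M) n),
      (forall x, `|staircase N (f x + M) n| <= n%:R * N.+1%:R^-1) &
      L t (fun x => staircase N (f x + M) n) = \sum_(k < n) N.+1%:R^-1 * L t (\1_(A N k))].
    have sE m : (fun x => staircase N (f x + M) m.+1) =
        (fun x => staircase N (f x + M) m + N.+1%:R^-1 * \1_(A N m) x).
      apply/funext => x; rewrite /staircase big_ord_recr /=; congr (_ + _ * _).
      by rewrite indicE; congr (_%:R); rewrite mem_setE.
    elim: n => [|n [i1 i2 i3]].
      split.
      - by rewrite (_ : (fun x => _) = cst 0)//; apply/funext => x; rewrite /staircase big_ord0.
      - by move=> x; rewrite /staircase big_ord0 normr0 mul0r.
      rewrite big_ord0 (_ : (fun x => _) = (fun x => 0 * \1_setT x)).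
        by rewrite (l2 0 _ 1)// ?mul0r//; exact: mind.
      by apply/funext => x; rewrite /staircase big_ord0 mul0r.
    have m2 : measurable_fun setT (fun x : E => N.+1%:R^-1 * \1_(A N n) x : R).
      by apply: measurable_funM => //; exact: mind.
    have b2 x : `|N.+1%:R^-1 * \1_(A N n) x : R| <= N.+1%:R^-1.
      by rewrite normrM ger0_norm ?invr_ge0// ler_piMr ?invr_ge0.
    rewrite sE big_ord_recr /=; split.
    - exact: measurable_funD.
    - move=> x; rewrite -natr1 mulrDl mul1r; have -> : staircase N (f x + M) n.+1 = staircase N (f x + M) n + N.+1%:R^-1 * \1_(A N n) x.
        exact: (congr1 (fun h => h x) (sE n)).
      by apply: (le_trans (ler_normD _ _)); exact: lerD.
    by rewrite (l1 _ _ _ _ i1 m2 i2 b2) i3 (l2 _ _ 1)//; exact: mind.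
  have [s1 s2 s3] := sumE (K N).
  have m1 : measurable_fun setT (fun x : E => (- M) * \1_setT x : R).
    by apply: measurable_funM => //; exact: mind.
  have b1 (x : E) : `|(- M) * \1_(setT : set E) x : R| <= M by rewrite indicT mulr1 normrN ger0_norm.
  have m2 : measurable_fun setT (fun x => staircase N (f x + M) (K N) + (- M) * \1_setT x).
    exact: measurable_funD.
  have b2 x : `|staircase N (f x + M) (K N) + (- M) * \1_setT x| <= (K N)%:R * N.+1%:R^-1 + M.
    by apply: (le_trans (ler_normD _ _)); exact: lerD.
  have E1 : F N t = L t (fun x => staircase N (f x + M) (K N) + (- M) * \1_setT x).
    by rewrite (l1 _ _ _ _ s1 m1 s2 b1) s3 (l2 _ _ 1)// ?mulNr//; exact: mind.
  rewrite E1 -mulN1r -(l2 _ _ _ m2 b2).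
  have m3 : measurable_fun setT (fun x : E => (-1) * (staircase N (f x + M) (K N) + (- M) * \1_setT x)).
    exact: measurable_funM.
  have b3 x : `|(-1) * (staircase N (f x + M) (K N) + (- M) * \1_setT x)| <= (K N)%:R * N.+1%:R^-1 + M.
    by rewrite mulN1r normrN.
  rewrite -(l1 _ _ _ _ mf m3 fM b3); apply: l3; first exact: measurable_funD.
  move=> x; rewrite indicT mulr1.
  have -> : f x + -1 * (staircase N (f x + M) (K N) - M) = (f x + M) - staircase N (f x + M) (K N) by ring.
  have := fM x; rewrite ler_norml => /andP[f1 f2].
  apply: staircase_approx; first lra.
  rewrite ler_pdivlMr//; apply: (@le_trans _ _ (2 * M * N.+1%:R)).
    by rewrite ler_pM2r//; lra.
  by apply/ltW/archi_boundP; rewrite !mulr_ge0.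
apply: (@measurable_fun_cvg _ RT R `]0, T[%classic F) => //= t _.
have [C hC] := Lb t; have C0 : 0 <= C by case: hC.
apply/cvgrPdist_le => e e0.
have [n hn] : exists n : nat, C / e < n%:R.
  by exists (Num.bound (C / e)); apply: archi_boundP; rewrite divr_ge0// ltW.
exists n => // m /= nm; apply: (le_trans (FE m t C hC)).
rewrite mulrC ler_pdivrMr// mulrC -ler_pdivrMr//.
by apply: (le_trans (ltW hn)); rewrite ler_nat (leq_trans nm).
Qed.

End measurable_in_time.

(** * Identities satisfied by the classical solution *)

Section reference.
Context {R : realType} {d : nat}.
Local Notation E := 'rV[R]_d.
Local Notation tor := (torus_prob d : probability E R).

(** What the comparison with the measure-valued solution uses of the classical
    solution: the density P, the chemical potential mu with gradient a, Hessian
    b and time derivative M, and the functional K. The identities ref_zeroth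
    and ref_first are the terms of order 0 and 1, at P, of the momentum balance
    tested with a = grad mu, in which epsilon^-1 rho u has been replaced by -
    rho a, its value in the relaxation limit. Because both orders balance, the
    remainder is quadratic in the deviation. *)
Record reference (omega : E -> R) (eta T : R) (F F' F'' : R -> R) (rho0 : E -> R)
    (P mu M : R -> E -> R) (a : 'I_d -> R -> E -> R) (b : 'I_d -> 'I_d -> R -> E -> R) (K : R -> R) : Prop :=
  Reference {
  ref_bP : buc P ;
  ref_bmu : buc mu ;
  ref_bM : buc M ;
  ref_ba : forall i, buc (a i) ;
  ref_bb : forall i j, buc (b i j) ;
  ref_Dmu : forall i t, HD i (mu t) (a i t) ;
  ref_Da : forall i j t, HD j (a i t) (b i j t) ;
  ref_mu : forall t x, mu t x = cB omega eta (P t) x + F' (P t x) ;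
  ref_gt0 : forall t x, 0 < t < T -> 0 <= P t x ;
  ref_mass : forall t, 0 <= t <= T -> \int[tor]_x P t x = \int[tor]_x rho0 x ;
  ref_init : P 0 = rho0 ;
  ref_mut : forall e, 0 < e -> exists2 r, 0 < r & forall t t' x, 0 <= t <= T -> 0 <= t' <= T ->
     `|t' - t| < r -> `|mu t' x - mu t x - (t' - t) * M t x| <= e * `|t' - t| ;
  ref_K : forall t, K t = \int[tor]_x (F (P t x) - P t x * F' (P t x)
     - 2^-1 * (P t x * cB omega eta (P t) x)) ;
  ref_Kt : forall e, 0 < e -> exists2 r, 0 < r & forall t t', 0 <= t <= T -> 0 <= t' <= T ->
     `|t' - t| < r ->
     `|K t' - K t + (t' - t) * \int[tor]_x (P t x * M t x)| <= e * `|t' - t| ;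
  ref_zeroth : forall t,
     \int[tor]_x (P t x * \sum_i a i t x ^+ 2)
     + \int[tor]_x ((\sum_i b i i t x) * (P t x * F' (P t x) - F (P t x) + (2 * eta ^+ 2)^-1 * P t x ^+ 2))
     + eta ^- 2 * \sum_i cform (dkernel omega eta i) (fun x => a i t x * P t x) (P t) = 0 ;
  ref_first : forall t h, pl2 h ->
     \int[tor]_x (h x * \sum_i a i t x ^+ 2)
     + \int[tor]_x (h x * ((\sum_i b i i t x) * (P t x * F'' (P t x) + eta ^- 2 * P t x)))
     + eta ^- 2 * \sum_i (cform (dkernel omega eta i) (fun x => a i t x * h x) (P t)
                        + cform (dkernel omega eta i) (fun x => a i t x * P t x) h)
     = \int[tor]_x (h x * M t x) }.

Local Notation leb := (@lebesgue_row R d).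
Local Opaque lebesgue_row.
Variables (D : R) (omega : E -> R) (hmol : mollifier D omega).
Variables (eta : R) (eta0 : 0 < eta) (T : R) (T0 : 0 < T).
Variables (F F' F'' F''' : R -> R).
Hypotheses (dF : DER F F') (dF' : DER F' F'') (dF'' : DER F'' F''') (cF''' : continuous F''').
Variables (rho0 : E -> R) (rho : R -> E -> R).
Hypothesis hrho : classical_solution omega F T eta rho0 rho.
Local Notation k := (scaled omega eta).
Local Notation P := (cP T rho).
Local Notation Pi := (cPi T rho).
Local Notation mu := (cmu omega eta T F' rho).
Local Notation a := (ca omega eta T F'' rho).
Local Notation b := (cb omega eta T F'' F''' rho).
Local Notation G := (cG omega eta T F'' F''' rho).
Local Notation M := (cM omega eta T F'' F''' rho).
Local Notation K := (cK omega eta T F F' rho).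

Let ik : L1 leb k := L1_kernel hmol eta0.
Let bP : buc P := buc_cP T0 hrho.
Let bPi i : buc (Pi i) := buc_cPi T0 hrho i.
Let ba i : buc (a i) := buc_ca hmol eta0 T0 dF'' hrho i.
Let bb i j : buc (b i j) := buc_cb hmol eta0 T0 dF'' cF''' hrho i j.
Let bM : buc M := buc_cM hmol eta0 T0 dF'' cF''' hrho.
Let DP i t : HD i (P t) (Pi i t) := HD_cP T0 hrho i t.
Let Da i j t : HD j (a i t) (b i j t) := HD_ca hmol eta0 T0 dF'' hrho i j t.
Let cF := DER_continuous dF.
Let cF' := DER_continuous dF'.
Let cF'' := DER_continuous dF''.

Let st (Phi : R -> E -> R) t (h : buc Phi) : buc (fun=> Phi t) := buc_static t h.
Let l1 (f : E -> R) (h : buc (fun=> f)) : L1 tor f := tor_buc 0 h.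
Let pl (f : E -> R) (h : buc (fun=> f)) : pl2 f := pl2_buc 0 h.

Definition pressure u := u * F' u - F u.

Lemma DER_pressure : DER pressure (fun u => u * F'' u).
Proof.
have h := DERB (DERM (@DER_id R) dF') dF.
by move=> u; have := h u; rewrite mul1r addrAC subrr add0r.
Qed.

(** The derivative of u F' - F is u F'', so grad of the pressure is P F'' grad
    P; one derivative is moved from b = grad a onto the pressure. *)
Lemma pressure_by_parts i t :
  \int[tor]_x (b i i t x * (pressure (P t x) + (2 * eta ^+ 2)^-1 * P t x ^+ 2)) =
  - \int[tor]_x (a i t x * (P t x * F'' (P t x) * Pi i t x + eta ^- 2 * P t x * Pi i t x)).
Proof.
set c := (2 * eta ^+ 2)^-1.
have E2 : eta ^- 2 = 2 * c by rewrite /c; field; rewrite gt_eqF.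
have dq : DER (fun u => pressure u + c * u ^+ 2) (fun u => u * F'' u + c * (2 * u)).
  exact: (DERD DER_pressure (DERZ c (@DER_sq R))).
have cq := DER_continuous dq.
have cq' : continuous (fun u : R => u * F'' u + c * (2 * u)).
  apply: contD; first by apply: contM; [move=> x; exact: cvg_id|exact: cF''].
  apply: contM; first exact: cont_cst.
  by apply: contM; [exact: cont_cst|move=> x; exact: cvg_id].
have b1 : buc (fun (_ : R) x => pressure (P t x) + c * P t x ^+ 2).
  exact: (buc_comp cq (st t bP)).
have b2 : buc (fun (_ : R) x => (P t x * F'' (P t x) + c * (2 * P t x)) * Pi i t x).
  exact: (bucM (buc_comp cq' (st t bP)) (st t (bPi i))).
have H := HDM (Da i i t) (HD_comp dq (DP i t)).
have bA := bucM (st t (bb i i)) b1.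
have bB := bucM (st t (ba i)) b2.
have := Rint_partial (bucM (st t (ba i)) b1) (bucD bA bB) H.
rewrite (RintD (l1 bA) (l1 bB)) => /eqP; rewrite addr_eq0 => /eqP ->.
congr (- _); apply: eq_Rint => x; rewrite E2; ring.
Qed.

(** Integrated by parts, the pressure term and the nonlocal term recombine into
    - int P a . grad mu, and grad mu = a. *)
Lemma classical_zeroth t :
  \int[tor]_x (P t x * \sum_i a i t x ^+ 2)
  + \int[tor]_x ((\sum_i b i i t x) * (pressure (P t x) + (2 * eta ^+ 2)^-1 * P t x ^+ 2))
  + eta ^- 2 * \sum_i cform (dkernel omega eta i) (fun x => a i t x * P t x) (P t) = 0.
Proof.
set c := (2 * eta ^+ 2)^-1.
have cq : continuous (fun u => pressure u + c * u ^+ 2).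
  by have := DERD DER_pressure (DERZ c (@DER_sq R)) => /DER_continuous.
have bq := buc_comp cq (st t bP).
have baP i := bucM (st t (ba i)) (st t bP).
have bKP i := buc_convol ik (st t (bPi i)).
have E1 : \int[tor]_x (P t x * \sum_i a i t x ^+ 2) = \sum_i \int[tor]_x (P t x * a i t x ^+ 2).
  rewrite -Rint_sum; first by apply: eq_Rint => x; rewrite mulr_sumr.
  by move=> i; exact: (l1 (bucM (st t bP) (bucX 2 (st t (ba i))))).
have E2 : \int[tor]_x ((\sum_i b i i t x) * (pressure (P t x) + c * P t x ^+ 2)) =
    \sum_i \int[tor]_x (b i i t x * (pressure (P t x) + c * P t x ^+ 2)).
  rewrite -Rint_sum; first by apply: eq_Rint => x; rewrite mulr_suml.
  by move=> i; exact: (l1 (bucM (st t (bb i i)) bq)).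
rewrite E1 E2 mulr_sumr -!big_split big1// => i _ /=.
rewrite (cform_dkernel_r hmol eta0 (pl (baP i)) (st t bP) (st t (bPi i)) (DP i t)).
have [_ ->] := cform_convol ik (pl (baP i)) (pl (st t (bPi i))).
rewrite /c pressure_by_parts.
have bF := bucM (st t bP) (buc_comp cF'' (st t bP)).
have b1 := bucM (st t bP) (bucX 2 (st t (ba i))).
have b2 := bucM (st t (ba i)) (bucD (bucM bF (st t (bPi i))) (bucM (bucZ (eta ^- 2) (st t bP)) (st t (bPi i)))).
have b3 := bucM (baP i) (bKP i).
rewrite -(RintZ (eta ^- 2) (l1 b3)) -(RintB (l1 b1) (l1 b2)) -(RintD (l1 (bucB b1 b2)) (l1 (bucZ _ b3))).
rewrite (@eq_Rint _ _ _ tor _ (fun=> 0)) ?Rint0// => x.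
have -> : a i t x ^+ 2 = a i t x * (F'' (P t x) * Pi i t x + eta ^- 2 * (Pi i t x - convol k (Pi i t) x)) by rewrite expr2 {2}/ca.
by set q := eta ^- 2; ring.
Qed.

(** This is the variation of the preceding identity in the direction h, mu
    being kept fixed in the role of test function. The antisymmetry of the
    kernel derivative lets all derivatives fall on P a, where they form div (P
    a); the operator F'' + B applied to it is the time derivative of mu. *)
Lemma classical_first t h : pl2 h ->
  \int[tor]_x (h x * \sum_i a i t x ^+ 2)
  + \int[tor]_x (h x * ((\sum_i b i i t x) * (P t x * F'' (P t x) + eta ^- 2 * P t x)))
  + eta ^- 2 * \sum_i (cform (dkernel omega eta i) (fun x => a i t x * h x) (P t)
                     + cform (dkernel omega eta i) (fun x => a i t x * P t x) h)
  = \int[tor]_x (h x * M t x).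
Proof.
move=> ph.
have baP i := bucM (st t (ba i)) (st t bP).
have bg i := bucD (bucM (st t (bPi i)) (st t (ba i))) (bucM (st t bP) (st t (bb i i))).
have bKP i := buc_convol ik (st t (bPi i)).
have pah i : pl2 (fun x => a i t x * h x) by exact: (pl2_mul t (ba i) ph).
have L1h (f : E -> R) (hf : buc (fun=> f)) : L1 tor (fun x => h x * f x) := pl2M ph (pl hf).
have Dflux i : HD i (fun x => a i t x * P t x) (fun x => Pi i t x * a i t x + P t x * b i i t x).
  by have := HDM (DP i t) (Da i i t) => H; under eq_fun do rewrite mulrC; exact: H.
have EK : convol k (G t) = (fun x => \sum_i convol k (fun x => Pi i t x * a i t x + P t x * b i i t x) x).
  apply/funext => x; rewrite /convol -Rint_sum; last by move=> i; exact: (L1_conv 0 x ik (bg i)).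
  by apply: eq_Rint => y; rewrite mulr_sumr.
have Ei i : cform (dkernel omega eta i) (fun x => a i t x * h x) (P t)
     + cform (dkernel omega eta i) (fun x => a i t x * P t x) h =
   \int[tor]_x (h x * (a i t x * convol k (Pi i t) x -
      convol k (fun x => Pi i t x * a i t x + P t x * b i i t x) x)).
  rewrite (cform_dkernel_sym hmol eta0 i (pl (baP i)) ph).
  rewrite (cform_dkernel_r hmol eta0 ph (baP i) (bg i) (Dflux i)).
  rewrite (cform_dkernel_r hmol eta0 (pah i) (st t bP) (st t (bPi i)) (DP i t)).
  have [_ ->] := cform_convol ik (pah i) (pl (st t (bPi i))).
  have [_ ->] := cform_convol ik ph (pl (bg i)).
  have i1 := L1h _ (bucM (st t (ba i)) (bKP i)).
  have i2 := L1h _ (buc_convol ik (bg i)).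
  rewrite (@eq_Rint _ _ _ tor (fun x => a i t x * h x * _) (fun x => h x * (a i t x * convol k (Pi i t) x))); last by move=> x; ring.
  by rewrite -(RintB i1 i2); apply: eq_Rint => x; ring.
have bi i := bucB (bucM (st t (ba i)) (bKP i)) (buc_convol ik (bg i)).
rewrite (eq_bigr _ (fun i _ => Ei i)) -Rint_sum; last by move=> i; exact: (L1h _ (bi i)).
have bs : buc (fun (_ : R) x => \sum_i (a i t x * convol k (Pi i t) x -
      convol k (fun x => Pi i t x * a i t x + P t x * b i i t x) x)).
  by apply: buc_sum => i; exact: bi.
rewrite (@eq_Rint _ _ _ tor (fun x => \sum_i (h x * _)) (fun x => h x * \sum_i (a i t x * convol k (Pi i t) x -
      convol k (fun x => Pi i t x * a i t x + P t x * b i i t x) x))); last by move=> x; rewrite mulr_sumr.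
have b1 : buc (fun (_ : R) x => \sum_i a i t x ^+ 2) by apply: buc_sum => i; exact: (bucX 2 (st t (ba i))).
have b2 : buc (fun (_ : R) x => \sum_i b i i t x) by apply: buc_sum => i; exact: (st t (bb i i)).
have b3 := bucM b2 (bucD (bucM (st t bP) (buc_comp cF'' (st t bP))) (bucZ (eta ^- 2) (st t bP))).
rewrite -(RintZ (eta ^- 2) (L1h _ bs)) -(RintD (L1h _ b1) (L1h _ b3)).
rewrite -(RintD (L1D (L1h _ b1) (L1h _ b3)) (L1Z _ (L1h _ bs))).
apply: eq_Rint => x; rewrite /cM EK.
have -> : G t x = \sum_i (Pi i t x * a i t x + P t x * b i i t x) by [].
set c := eta ^- 2; set f2 := F'' (P t x).
have -> : h x * (f2 * (\sum_i (Pi i t x * a i t x + P t x * b i i t x)) + c * (\sum_i (Pi i t x * a i t x + P t x * b i i t x) - \sum_i convol k (fun x => Pi i t x * a i t x + P t x * b i i t x) x)) =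
  h x * \sum_i ((f2 + c) * (Pi i t x * a i t x + P t x * b i i t x) - c * convol k (fun x => Pi i t x * a i t x + P t x * b i i t x) x).
  by rewrite [in RHS]big_split /= sumrN -!mulr_sumr; ring.
have -> : h x * (\sum_i a i t x ^+ 2) + h x * ((\sum_i b i i t x) * (P t x * f2 + c * P t x)) + 
   c * (h x * \sum_i (a i t x * convol k (Pi i t) x - convol k (fun x => Pi i t x * a i t x + P t x * b i i t x) x)) =
   h x * \sum_i (a i t x ^+ 2 + b i i t x * (P t x * f2 + c * P t x) + c * (a i t x * convol k (Pi i t) x - convol k (fun x => Pi i t x * a i t x + P t x * b i i t x) x)).
  by rewrite [in RHS]big_split [in RHS]big_split /= -mulr_suml -mulr_sumr; ring.
congr (_ * _); apply: eq_bigr => i _.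
set g := convol k (fun x => Pi i t x * a i t x + _) x.
have -> : a i t x ^+ 2 = a i t x * (f2 * Pi i t x + c * (Pi i t x - convol k (Pi i t) x)) by rewrite expr2 {2}/ca.
ring.
Qed.

Hypothesis coef : forall u, 0 <= F'' u + eta ^- 2.
Variables (sigma : R) (sigma0 : 0 < sigma) (hsig : forall x, sigma <= rho0 x).

Theorem classical_reference : reference omega eta T F F' F'' rho0 P mu M a b K.
Proof.
split=> //.
- exact: (buc_cmu hmol eta0 T0 dF' hrho).
- exact: (HD_cmu hmol eta0 T0 dF' hrho).
- move=> t x /andP[t0 tT]; apply: ltW.
  by apply: (cP_gt0 hmol eta0 T0 dF dF' dF'' hrho coef sigma0 hsig); rewrite ltW.
- exact: (mass_cons hmol eta0 T0 dF dF' dF'' cF''' hrho).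
- exact: (cP0 T0 hrho).
- exact: (cmu_expand hmol eta0 T0 dF dF' dF'' cF''' hrho).
- exact: (cK_expand hmol eta0 T0 dF dF' dF'' cF''' hrho).
- exact: classical_zeroth.
- exact: classical_first.
Qed.

End reference.

(** * The relative energy at a fixed time *)

Section mv_static.
Context {R : realType} {d : nat}.
Local Notation E := 'rV[R]_d.
Local Notation Y := (R * E)%type.
Local Notation tor := (torus_prob d : probability E R).
Local Notation leb := (@lebesgue_row R d).
Local Opaque lebesgue_row.

(** Expanding the product gives f g twice, by translation invariance, and two
    cross terms, equal because the kernel is even. *)
Lemma Rint_double_diff (D : R) (omega : E -> R) (hmol : mollifier D omega) (eta : R) (eta0 : 0 < eta) (f g : E -> R) :
  pl2 f -> pl2 g -> pl2 (fun x => f x * g x) ->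
  \int[tor]_x \int[leb]_y (scaled omega eta y * (f x - f (x - y)) * (g x - g (x - y))) =
  2 * (\int[tor]_x (f x * g x) - cform (scaled omega eta) f g).
Proof.
move=> hf hg hfg; set k := scaled omega eta.
have ik : L1 leb k := L1_kernel hmol eta0.
have b1 : buc (fun (_ : R) (_ : E) => (1 : R)) := buc_cst _.
have h1 : pl2 (fun _ : E => (1 : R)) := pl2_buc 0 b1.
have i1 := conv_L1 ik hfg h1; have i2 := conv_L1 ik hf hg.
have i3 := conv_L1 ik hg hf; have i4 := conv_L1 ik h1 hfg.
pose w (z : E * E) := conv_fun k (fun x => f x * g x) (fun=> 1) z - conv_fun k f g z - conv_fun k g f z
    + conv_fun k (fun=> 1) (fun x => f x * g x) z.
have iw := L1D (L1B (L1B i1 i2) i3) i4.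
transitivity (\int[tor]_x \int[leb]_y w (x, y)).
  by apply: eq_Rint => x; apply: eq_Rint => y; rewrite /w /conv_fun /=; ring.
rewrite -(Rfubini1 iw) (RintD (L1B (L1B i1 i2) i3) i4) (RintB (L1B i1 i2) i3) (RintB i1 i2).
rewrite -/(cform k f g) -/(cform k g f) -/(cform k (fun x => f x * g x) (fun=> 1)) -/(cform k (fun=> 1) (fun x => f x * g x)).
rewrite (cform_kernel_sym hmol eta0 hg hf) (cform_kernel_sym hmol eta0 h1 hfg).
have [_ ->] := cform_convol ik hfg h1.
have -> : \int[tor]_x (f x * g x * convol k (fun=> 1) x) = \int[tor]_x (f x * g x).
  by apply: eq_Rint => x; rewrite (convol_cst hmol eta0) mulr1.
ring.
Qed.

Variables (D : R) (omega : E -> R) (hmol : mollifier D omega).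
Variables (eta : R) (eta0 : 0 < eta) (T : R) (T0 : 0 < T).
Variables (F F1 F1' F1'' F2 F2' F2'' F''' : R -> R) (M2 B Cp CP : R) (CP0 : 0 < CP).
Hypothesis hpot : potential_data CP F F1 F1' F1'' F2 F2' F2'' F''' M2 B Cp.
Local Notation F' := (fun u => F1' u + F2' u).
Local Notation F'' := (fun u => F1'' u + F2'' u).
Variables (rho0 : E -> R) (P mu M : R -> E -> R) (a : 'I_d -> R -> E -> R) (b : 'I_d -> 'I_d -> R -> E -> R) (K : R -> R).
Hypothesis href : reference omega eta T F F' F'' rho0 P mu M a b K.
Local Notation k := (scaled omega eta).
Variables (CF : R) (s : mv_data R d).
Local Notation kd := (dkernel omega eta).

(** The properties that hold at almost every time, collected so that everything
    up to the integration in time is an argument at one such time. The nonlocal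
    Poincare inequality enters through its instance for the classical density.
    *)
Record good_time (t : R) : Prop := GoodTime {
  gt_T : 0 < t < T ;
  gt_per : forall A, measurable A -> Zd_periodic (fun x => young s (t, x) A) ;
  gt_rho2 : L1 (joint s t) (fun z => z.2.1 ^+ 2) ;
  gt_u2 : L1 (joint s t) (fun z => enorm z.2.2 ^+ 2) ;
  gt_F : L1 (joint s t) (fun z => F z.2.1) ;
  gt_rF : L1 (joint s t) (fun z => z.2.1 * F^`()%classic z.2.1) ;
  gt_pos : {ae joint s t, forall z, 0 <= z.2.1} ;
  gt_ruu : (vec_variation (fun ij : 'I_d * 'I_d => m_ruu s ij.1 ij.2 t : set E -> \bar R) cube
     <= m_ru2 s t cube)%E ;
  gt_rFv : (vec_variation (fun _ : unit => m_rF' s t : set E -> \bar R) cube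
     <= CF%:E * m_F s t cube + CF%:E * m_rho2 s t cube)%E ;
  gt_poincare : bar_diff2 s P t (cst 1) <= CP / (4 * eta ^+ 2) * bar_nonlocal_diff omega eta s P t (cst 1) }.

Let ik : L1 leb k := L1_kernel hmol eta0.
Let bP : buc P := ref_bP href.

Lemma FE : F = (fun u => F1 u + F2 u).
Proof. by case: hpot => -[h _ _ _ _] _ _ _ _; exact/funext. Qed.

Lemma dF : DER F F'.
Proof. by rewrite FE; case: hpot => -[_ h1 h2 _ _] _ _ _ _; exact: DERD. Qed.

Lemma dF' : DER F' F''.
Proof. by case: hpot => -[_ _ _ h1 h2] _ _ _ _; exact: DERD. Qed.

Lemma F'E : F^`()%classic = F'.
Proof. by apply/funext => u; rewrite derive1E; case: (dF u). Qed.

Let cF := DER_continuous dF.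
Let cF' := DER_continuous dF'.

Section fixed_time.
Variables (t : R) (gt : good_time t).
Local Notation J := (joint s t).
Local Notation r := (mv_rho s t).
Let tT : 0 <= t <= T. Proof. by have /andP[? ?] := gt_T gt; rewrite !ltW. Qed.

Let bst (f : E -> R) (h : buc (fun=> f)) : exists M, forall x, `|f x| <= M.
Proof. by have [C _ hC] := buc_bounded h; exists C => x; exact: (hC 0). Qed.

Let mst (f : E -> R) (h : buc (fun=> f)) : measurable_fun setT f := buc_measurable_at 0 h.

Lemma L1_joint_fst (f : E -> R) : buc (fun=> f) -> L1 J (fun z => f z.1).
Proof.
move=> h; have [C hC] := bst h; apply: (@L1_bounded _ _ _ _ _ C) => //; first exact: joint_lty.
exact: (measurableT_comp (mst h) measurable_fst).
Qed.

Lemma L1_joint_mul (f : E -> R) (g : E * Y -> R) : buc (fun=> f) -> L1 J g -> L1 J (fun z => f z.1 * g z).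
Proof.
move=> h hg; have [C hC] := bst h.
apply: (@L1_mul_bounded _ _ _ J (fun z => f z.1) g C) => //.
exact: (measurableT_comp (mst h) measurable_fst).
Qed.

Lemma joint_snd (f : E -> R) (g : Y -> R) : buc (fun=> f) -> L1 J (fun z => g z.2) ->
  \int[tor]_x (f x * ymean s g t x) = \int[J]_z (f z.1 * g z.2).
Proof. by move=> h hg; have [C hC] := bst h; have [] := Rint_ymean (mst h) hC hg. Qed.

Lemma joint_fst (f : E -> R) : buc (fun=> f) -> \int[J]_z f z.1 = \int[tor]_x f x.
Proof.
move=> h; have one : L1 J (fun _ => 1) := @L1_joint_fst (fun=> 1) (buc_cst _).
have := @joint_snd f (fun=> 1) h one.
rewrite (@eq_Rint _ _ _ tor _ f); last first.
  by move=> x; rewrite /ymean Rint_cst_prob ?mulr1//; exact: prob_kernel.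
by move=> ->; apply: eq_Rint => z; rewrite mulr1.
Qed.

Lemma L1_rho : L1 J (fun z => z.2.1).
Proof. by have [] := @ymean_sq_le _ _ s t fst measurable_fst (gt_rho2 gt). Qed.

Lemma rho_periodic : Zd_periodic r.
Proof.
move=> x i; rewrite /mv_rho /ymean /Rintegral; congr fine.
by apply: eq_measure_integral => A mA _; exact: gt_per.
Qed.

Lemma pl2_rho : pl2 r.
Proof.
have [_ h2 _] := @ymean_sq_le _ _ s t fst measurable_fst (gt_rho2 gt).
split => //; first exact: rho_periodic.
exact: (measurableT_comp (measurable_ymean s (@measurable_fst _ _ R E)) (@measurable_pair1 _ _ R E t)).
Qed.

Lemma sq_rho_le : sq r <= \int[J]_z z.2.1 ^+ 2.
Proof.
have [_ h2 h3] := @ymean_sq_le _ _ s t fst measurable_fst (gt_rho2 gt).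
have [_ k2 ->] := Rint_joint (gt_rho2 gt).
exact: ae_le_Rint.
Qed.

Lemma joint_rho (f : E -> R) : buc (fun=> f) -> \int[tor]_x (f x * r x) = \int[J]_z (f z.1 * z.2.1).
Proof. by move=> h; exact: (joint_snd h L1_rho). Qed.

(** The deviation of the barycentre of the Young measure, as opposed to z.2.1 -
    P t z.1, the deviation of the microscopic variable. *)
Definition hdiff x := r x - P t x.
Local Notation h := hdiff.
Let bPt := buc_static t bP.

Lemma pl2_h : pl2 h. Proof. exact: (pl2B pl2_rho (pl2_buc 0 bPt)). Qed.

Lemma L1_l (f : E -> R) : buc (fun=> f) -> L1 J (fun z => f z.1 * z.2.1).
Proof. by move=> hf; exact: (L1_joint_mul hf L1_rho). Qed.

Lemma L1_diff2 : L1 J (fun z => (z.2.1 - P t z.1) ^+ 2).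
Proof.
have := L1D (L1B (gt_rho2 gt) (L1Z 2 (L1_l bPt))) (L1_joint_fst (bucX 2 bPt)).
by congr (integrable _ _ _); apply/funext => z /=; congr EFin; ring.
Qed.

(** The quadratic deviation of the microscopic density. Adding the mass of the
    concentration measure of the square, devX is the integral of the barred
    quantity |rho - P|^2. *)
Definition dev := \int[J]_z (z.2.1 - P t z.1) ^+ 2.
Definition mass_rho2 := fine (m_rho2 s t cube).
Definition mass_ru2 := fine (m_ru2 s t cube).
Definition mass_F := fine (m_F s t cube).
Definition devX := dev + mass_rho2.

Lemma mass_rho2_ge0 : 0 <= mass_rho2. Proof. exact: fine_ge0. Qed.
Lemma mass_ru2_ge0 : 0 <= mass_ru2. Proof. exact: fine_ge0. Qed.
Lemma mass_F_ge0 : 0 <= mass_F. Proof. exact: fine_ge0. Qed.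
Lemma dev_ge0 : 0 <= dev. Proof. by apply: Rint_ge0 => z; exact: sqr_ge0. Qed.

Lemma devE : dev = \int[J]_z z.2.1 ^+ 2 - 2 * \int[tor]_x (P t x * r x) + sq (P t).
Proof.
rewrite (joint_rho bPt) /sq -(joint_fst (bucX 2 bPt)).
rewrite -(RintZ 2 (L1_l bPt)) -(RintB (gt_rho2 gt) (L1Z 2 (L1_l bPt))).
rewrite -(RintD (L1B (gt_rho2 gt) (L1Z 2 (L1_l bPt))) (L1_joint_fst (bucX 2 bPt))).
by apply: eq_Rint => z; ring.
Qed.

Lemma sq_hE : sq h = sq r - 2 * \int[tor]_x (P t x * r x) + sq (P t).
Proof.
have p1 := pl2_rho; have p2 := pl2_buc 0 bPt.
have [_ _ i1] := p1; have [_ _ i2] := p2; have i3 := pl2M p2 p1.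
rewrite /sq -(RintZ 2 i3) -(RintB i1 (L1Z 2 i3)) -(RintD (L1B i1 (L1Z 2 i3)) i2).
by apply: eq_Rint => x; rewrite /h; ring.
Qed.

Lemma sq_h_le : sq h <= dev.
Proof. by rewrite devE sq_hE; have := sq_rho_le; lra. Qed.

Lemma joint_cst1 (g : Y -> R) : L1 J (fun z => g z.2) ->
  \int[torus_measure]_x (cst 1 x * ymean s g t x) = \int[J]_z g z.2.
Proof.
move=> hg; have := @joint_snd (fun=> 1) g (buc_cst _) hg.
by move=> ->; apply: eq_Rint => z; rewrite mul1r.
Qed.

Lemma cube_cst1 (m : {finite_measure set E -> \bar R}) : \int[m]_(x in cube) (cst 1 x : R) = fine (m cube).
Proof. by rewrite Rint_cube// (Rint_cube_cst m 1) mul1r. Qed.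

Lemma bar_rho2_1 : bar_rho2 s t (cst 1) = \int[J]_z z.2.1 ^+ 2 + mass_rho2.
Proof. by rewrite /bar_rho2 (@joint_cst1 (fun l => l.1 ^+ 2) (gt_rho2 gt)) cube_cst1. Qed.

Lemma bar_ru2_1 : bar_ru2 s t (cst 1) = \int[J]_z enorm z.2.2 ^+ 2 + mass_ru2.
Proof. by rewrite /bar_ru2 (@joint_cst1 (fun l => enorm l.2 ^+ 2) (gt_u2 gt)) cube_cst1. Qed.

Lemma bar_F_1 : bar_F F s t (cst 1) = \int[J]_z F z.2.1 + mass_F.
Proof. by rewrite /bar_F (@joint_cst1 (fun l => F l.1) (gt_F gt)) cube_cst1. Qed.

Lemma bar_rho2_conv_1 : bar_rho2_conv omega eta s t (cst 1) = bar_rho2 s t (cst 1).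
Proof.
rewrite /bar_rho2_conv; congr bar_rho2; apply/funext => x.
rewrite -[RHS](kernel_Rint hmol eta0); apply: eq_Rint => y.
by rewrite mulr1.
Qed.

Lemma Rint_cst1 (f : E -> R) : \int[torus_measure]_x (cst 1 x * f x) = \int[tor]_x f x.
Proof. by rewrite torus_measureE; apply: eq_Rint => x; rewrite mul1r. Qed.

Lemma bar_nonlocal_1 : bar_nonlocal omega eta s t (cst 1) = 2 * (bar_rho2 s t (cst 1) - cform k r r).
Proof.
rewrite /bar_nonlocal bar_rho2_conv_1 Rint_cst1.
by have [_ <-] := cform_convol ik pl2_rho pl2_rho; ring.
Qed.

Lemma bar_diff2_1 : bar_diff2 s P t (cst 1) = devX.
Proof.
rewrite /bar_diff2 bar_rho2_1 !Rint_cst1 /devX devE /sq.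
rewrite (@eq_Rint _ _ _ tor (fun x => r x * P t x) (fun x => P t x * r x)); last by move=> x; rewrite mulrC.
ring.
Qed.

(** The barred nonlocal quadratic form of rho - P expands like the form of an
    honest function, the square of rho being replaced by the barred square. *)
Lemma bar_nonlocal_diff_1 : bar_nonlocal_diff omega eta s P t (cst 1) =
  2 * (bar_rho2 s t (cst 1) - cform k r r + (sq (P t) - cform k (P t) (P t))
       - 2 * (\int[tor]_x (P t x * r x) - cform k (P t) r)).
Proof.
have p2 := pl2_buc 0 bPt.
rewrite /bar_nonlocal_diff bar_nonlocal_1 !Rint_cst1.
have e1 := @Rint_double_diff D omega hmol eta eta0 (P t) (P t) p2 p2 (pl2_mul t bP p2).
have e2 := @Rint_double_diff D omega hmol eta eta0 (P t) r p2 pl2_rho (pl2_mul t bP pl2_rho).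
rewrite e2.
have -> : \int[tor]_x \int[leb]_y (k y * `|P t x - P t (x - y)| ^+ 2) =
   2 * (\int[tor]_x (P t x * P t x) - cform k (P t) (P t)).
  rewrite -e1; apply: eq_Rint => x; apply: eq_Rint => y.
  by rewrite real_normK ?num_real// expr2 mulrA.
rewrite /sq (@eq_Rint _ _ _ tor (fun x => P t x * P t x) (fun x => P t x ^+ 2)); last by move=> x; rewrite expr2.
ring.
Qed.

Lemma L1_breg : L1 J (fun z => breg F F' z.2.1 (P t z.1)) /\
  \int[J]_z breg F F' z.2.1 (P t z.1) =
  \int[J]_z F z.2.1 - \int[tor]_x F (P t x) - \int[tor]_x (F' (P t x) * h x).
Proof.
have b1 := buc_comp cF bPt; have b2 := buc_comp cF' bPt.
have i1 := L1_joint_fst b1; have i2 := L1_l b2; have b3 := bucM b2 bPt; have i3 := L1_joint_fst b3.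
have i4 := L1B (L1B (gt_F gt) i1) (L1B i2 i3).
have E0 : (fun z : E * Y => breg F F' z.2.1 (P t z.1)) =
   (fun z => F z.2.1 - F (P t z.1) - (F' (P t z.1) * z.2.1 - F' (P t z.1) * P t z.1)).
  by apply/funext => z; rewrite /breg mulrBr.
rewrite E0; split => //.
rewrite (RintB (L1B (gt_F gt) i1) (L1B i2 i3)) (RintB (gt_F gt) i1) (RintB i2 i3).
rewrite (joint_fst b1) (joint_fst b3) -(joint_rho b2); congr (_ - _).
have p2 := pl2_buc 0 b2.
rewrite -(RintB (pl2M p2 pl2_rho) (tor_buc 0 b3)); apply: eq_Rint => x.
by rewrite /h mulrBr.
Qed.

Lemma measurable_breg (f f' : R -> R) : continuous f -> continuous f' ->
  measurable_fun setT (fun z : E * Y => breg f f' z.2.1 (P t z.1)).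
Proof.
move=> cf cf'.
have m1 : measurable_fun setT (fun z : E * Y => z.2.1).
  exact: (measurableT_comp measurable_fst measurable_snd).
have m2 : measurable_fun setT (fun z : E * Y => P t z.1).
  exact: (measurableT_comp (mst bPt) measurable_fst).
have mf : measurable_fun setT (f : R -> R) by exact: continuous_measurable_fun.
have mf' : measurable_fun setT (f' : R -> R) by exact: continuous_measurable_fun.
apply: measurable_funB.
  by apply: measurable_funB; [exact: (measurableT_comp mf m1)|exact: (measurableT_comp mf m2)].
by apply: measurable_funM; [exact: (measurableT_comp mf' m2)|exact: measurable_funB].
Qed.

(** The lack of convexity costs at most M2 / 2 times the quadratic deviation.
    *)
Lemma L1_breg2 : L1 J (fun z => breg F2 F2' z.2.1 (P t z.1)) /\
  - (M2 / 2 * dev) <= \int[J]_z breg F2 F2' z.2.1 (P t z.1).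
Proof.
have [[_ d1 d2 d3 d4] _ _ [M20 _ _ hb] _] := hpot.
have i1 : L1 J (fun z => breg F2 F2' z.2.1 (P t z.1)).
  apply: (@L1_le _ _ _ J _ (fun z : E * Y => M2 / 2 * (z.2.1 - P t z.1) ^+ 2)).
  - by apply: measurable_breg; exact: DER_continuous.
  - exact: (L1Z _ L1_diff2).
  - by move=> z; exact: hb.
split => //; have i2 := L1Z (M2 / 2) L1_diff2.
rewrite /dev -(RintZ (M2 / 2) L1_diff2) -(RintN i2).
apply: le_Rint => //.
  by have := L1Z (-1) i2; congr (integrable _ _ _); apply/funext => z /=; rewrite mulN1r.
by move=> z; have := hb (P t z.1) z.2.1; rewrite ler_norml => /andP[].
Qed.

Definition dev1 := \int[J]_z breg F1 F1' z.2.1 (P t z.1).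
Definition devZ := dev1 + mass_F.

Lemma L1_breg1 : L1 J (fun z => breg F1 F1' z.2.1 (P t z.1)) /\
  \int[J]_z breg F F' z.2.1 (P t z.1) = dev1 + \int[J]_z breg F2 F2' z.2.1 (P t z.1).
Proof.
have [i0 _] := L1_breg; have [i2 _] := L1_breg2.
have E0 : (fun z : E * Y => breg F1 F1' z.2.1 (P t z.1)) =
   (fun z => breg F F' z.2.1 (P t z.1) - breg F2 F2' z.2.1 (P t z.1)).
  by apply/funext => z; rewrite /breg FE; ring.
have i1 : L1 J (fun z => breg F1 F1' z.2.1 (P t z.1)) by rewrite E0; exact: L1B.
split => //; rewrite /dev1 -(RintD i1 i2); apply: eq_Rint => z.
by rewrite /breg FE; ring.
Qed.

Lemma dev1_ge0 : 0 <= dev1.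
Proof. by apply: Rint_ge0 => z; case: hpot => _ _ [_ hb _] _ _. Qed.

Definition devY := 2^-1 * bar_ru2 s t (cst 1).
(** The relative energy: the energy minus its affine approximation at P. Since
    mu is the derivative of the energy at P, the linear term is - int rho mu,
    and K collects the constants. *)
Definition theta := E_mvs omega F eta s t - \int[tor]_x (r x * mu t x) - K t.

(** Expanding at P, theta is the kinetic energy, plus the Bregman divergence of
    F, plus half the nonlocal quadratic form of the deviation. The Poincare
    inequality bounds the last term below by 1 / CP times devX, which absorbs
    the nonconvex part of the potential with a positive balance because M2 < 1
    / CP. *)
Lemma coercive : devY + devZ + (CP^-1 - M2 / 2) * devX <= theta.
Proof.
have p2 := pl2_buc 0 bPt; have pr := pl2_rho.
have [i0 E0] := L1_breg; have [i1 E1] := L1_breg1; have [i2 E2] := L1_breg2.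
have := gt_poincare gt; rewrite bar_diff2_1 bar_nonlocal_diff_1 => hpo.
rewrite /theta /E_mvs bar_F_1 bar_nonlocal_1 (ref_K href) -/devY.
set c := eta ^- 2; have c0 : 0 < c by rewrite invr_gt0 exprn_gt0.
have b1 := buc_comp cF bPt; have b2 := buc_comp cF' bPt.
have bB := buc_cB hmol eta0 bPt.
have j1 := tor_buc 0 b1; have j2 := tor_buc 0 (bucM bPt b2); have j3 := tor_buc 0 (bucM bPt bB).
have EK : \int[tor]_x (F (P t x) - P t x * F' (P t x) - 2^-1 * (P t x * cB omega eta (P t) x)) =
   \int[tor]_x F (P t x) - \int[tor]_x (P t x * F' (P t x)) - 2^-1 * \int[tor]_x (P t x * cB omega eta (P t) x).
  by rewrite -(RintZ 2^-1 j3) -(RintB j1 j2) -(RintB (L1B j1 j2) (L1Z 2^-1 j3)).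
rewrite EK.
have cBE (u : E -> R) : pl2 u -> \int[tor]_x (u x * cB omega eta (P t) x) = c * (\int[tor]_x (u x * P t x) - cform k u (P t)).
  move=> pu; have [l1 ->] := cform_convol ik pu p2.
  rewrite -(RintB (pl2M pu p2) l1) -(RintZ _ (L1B (pl2M pu p2) l1)).
  by apply: eq_Rint => x; rewrite /cB -/c; ring.
have Emu : \int[tor]_x (r x * mu t x) = c * (\int[tor]_x (r x * P t x) - cform k r (P t)) + \int[tor]_x (F' (P t x) * h x) + \int[tor]_x (P t x * F' (P t x)).
  rewrite -(cBE r pr).
  have l1 := pl2M pr (pl2_buc 0 bB); have l2 := pl2M (pl2_buc 0 b2) pl2_h.
  rewrite -(RintD l1 l2) -(RintD (L1D l1 l2) j2); apply: eq_Rint => x.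
  by rewrite (ref_mu href) /h; ring.
rewrite Emu (cBE _ p2) (cform_kernel_sym hmol eta0 pr p2).
rewrite (@eq_Rint _ _ _ tor (fun x => r x * P t x) (fun x => P t x * r x)); last by move=> x; rewrite mulrC.
rewrite (@eq_Rint _ _ _ tor (fun x => P t x * P t x) (fun x => P t x ^+ 2)); last by move=> x; rewrite expr2.
rewrite -/(sq (P t)).
rewrite E0 in E1.
have -> : (4 * eta ^+ 2)^-1 = c / 4 by rewrite /c invfM mulrC.
have hX : CP^-1 * devX <= c / 2 * (bar_rho2 s t (cst 1) - cform k r r + (sq (P t) - cform k (P t) (P t))
   - 2 * (\int[tor]_x (P t x * r x) - cform k (P t) r)).
  rewrite ler_pdivrMl//; apply: (le_trans hpo).
  rewrite le_eqVlt; apply/orP; left; apply/eqP; rewrite /c; field; rewrite gt_eqF//.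
have hM : M2 / 2 * dev <= M2 / 2 * devX.
  have [_ _ _ [M20 _ _ _] _] := hpot.
  by rewrite ler_wpM2l ?divr_ge0// /devX lerDl mass_rho2_ge0.
rewrite /devZ mulrBl.
set A := \int[J]_z F z.2.1 in E1 *.
lra.
Qed.

Local Notation L := (fun x => \sum_i b i i t x).
Local Notation asq := (fun x => \sum_i a i t x ^+ 2).
Local Notation c2 := ((2 * eta ^+ 2)^-1).
Let bL : buc (fun (_ : R) => L) := buc_sum _ (fun i => buc_static t (ref_bb href i i)).
Let basq : buc (fun (_ : R) => asq) := buc_sum _ (fun i => bucX 2 (buc_static t (ref_ba href i))).
Let bM := buc_static t (ref_bM href).
Let pr := pressure F F'.
Let pr' := fun u => u * F'' u.

Let bpr : buc (fun (_ : R) x => pr (P t x)).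
Proof. exact: (buc_comp (DER_continuous (DER_pressure dF dF')) bPt). Qed.

Let bpr' : buc (fun (_ : R) x => pr' (P t x)).
Proof.
have [_ [_ h1 h2 _] _ _ _] := hpot.
apply: (@buc_comp _ _ pr' (fun=> P t)) => //.
by apply: contM; [move=> x; exact: cvg_id|exact: contD].
Qed.

Lemma rho_split (f : E -> R) : buc (fun=> f) ->
  \int[tor]_x (f x * r x) = \int[tor]_x (f x * P t x) + \int[tor]_x (f x * h x).
Proof.
move=> hf; have p := pl2_buc 0 hf.
rewrite -(RintD (tor_buc 0 (bucM hf bPt)) (pl2M p pl2_h)).
by apply: eq_Rint => x; rewrite /h; ring.
Qed.

Lemma joint_dev (f : E -> R) : buc (fun=> f) ->
  L1 J (fun z => f z.1 * (z.2.1 - P t z.1)) /\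
  \int[J]_z (f z.1 * (z.2.1 - P t z.1)) = \int[tor]_x (f x * h x).
Proof.
move=> hf; have b1 := bucM hf bPt.
have E0 : (fun z : E * Y => f z.1 * (z.2.1 - P t z.1)) = (fun z => f z.1 * z.2.1 - f z.1 * P t z.1).
  by apply/funext => z; rewrite mulrBr.
rewrite E0 (RintB (L1_l hf) (L1_joint_fst b1)) (joint_fst b1) -(joint_rho hf) (rho_split hf).
by split; [exact: (L1B (L1_l hf) (L1_joint_fst b1))|ring].
Qed.

Lemma L1_pressure : L1 J (fun z => pr z.2.1).
Proof.
have := L1B (gt_rF gt) (gt_F gt); congr (integrable _ _ _).
by apply/funext => z /=; rewrite F'E.
Qed.

Lemma L1_breg_pressure : L1 J (fun z => breg pr pr' z.2.1 (P t z.1)).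
Proof.
have [i2 _] := joint_dev bpr'.
have := L1B (L1B L1_pressure (L1_joint_fst bpr)) i2.
by congr (integrable _ _ _); apply/funext.
Qed.

Lemma joint_pressure (f : E -> R) : buc (fun=> f) ->
  \int[J]_z (f z.1 * pr z.2.1) = \int[J]_z (f z.1 * breg pr pr' z.2.1 (P t z.1))
   + \int[tor]_x (f x * pr (P t x)) + \int[tor]_x (f x * pr' (P t x) * h x).
Proof.
move=> hf; have b1 := bucM hf bpr; have b2 := bucM hf bpr'; have [i2 <-] := joint_dev b2.
rewrite -(joint_fst b1); have i0 := L1_joint_mul hf L1_breg_pressure; have i1 := L1_joint_fst b1.
rewrite -(RintD i0 i1) -(RintD (L1D i0 i1) i2); apply: eq_Rint => z.
by rewrite /breg; ring.
Qed.

Lemma joint_square (f : E -> R) : buc (fun=> f) ->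
  \int[J]_z (f z.1 * z.2.1 ^+ 2) = \int[J]_z (f z.1 * (z.2.1 - P t z.1) ^+ 2)
   + 2 * \int[tor]_x (f x * P t x * h x) + \int[tor]_x (f x * P t x ^+ 2).
Proof.
move=> hf; have b1 := bucM hf bPt; have b2 := bucM hf (bucX 2 bPt); have [i2 <-] := joint_dev b1.
rewrite -(joint_fst b2); have i0 := L1_joint_mul hf L1_diff2; have i1 := L1_joint_fst b2.
rewrite -(RintZ 2 i2) -(RintD i0 (L1Z 2 i2)) -(RintD (L1D i0 (L1Z 2 i2)) i1); apply: eq_Rint => z.
by ring.
Qed.

Lemma bar_pE (f : E -> R) : buc (fun=> f) ->
  bar_p F eta s t f = \int[J]_z (f z.1 * pr z.2.1) + charge_integral (m_rF' s t) f
    - \int[m_F s t]_(x in cube) f x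
    + c2 * (\int[J]_z (f z.1 * z.2.1 ^+ 2) + \int[m_rho2 s t]_(x in cube) f x).
Proof.
move=> hf; rewrite /bar_p /bar_rF' /bar_F /bar_rho2.
rewrite (@joint_snd f (fun l => l.1 * F^`()%classic l.1) hf (gt_rF gt)).
rewrite (@joint_snd f (fun l => F l.1) hf (gt_F gt)) (@joint_snd f (fun l => l.1 ^+ 2) hf (gt_rho2 gt)).
have -> : \int[J]_z (f z.1 * pr z.2.1) = \int[J]_z (f z.1 * (z.2.1 * F^`()%classic z.2.1)) - \int[J]_z (f z.1 * F z.2.1).
  rewrite -(RintB (L1_joint_mul hf (gt_rF gt)) (L1_joint_mul hf (gt_F gt))).
  by apply: eq_Rint => z; rewrite F'E /pr /pressure; ring.
ring.
Qed.

(** What is left of the time derivative of theta once the damping has been used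
    and the momentum balance, tested with grad mu, has been substituted. *)
Definition remainder := \int[tor]_x (asq x * r x) + bar_p F eta s t L
  + eta ^- 2 * \sum_i \int[tor]_x (a i t x * (r x * convol (partial i k) r x))
  - \int[tor]_x (M t x * r x) + \int[tor]_x (P t x * M t x).

(** The interaction force of the measure-valued solution in terms of the
    bilinear form of the kernel derivative. *)
Lemma cform_rho i (f : E -> R) : buc (fun=> f) ->
  \int[tor]_x (f x * (r x * convol (partial i k) r x)) = cform (kd i) (fun x => f x * r x) r.
Proof.
move=> hf; have -> : partial i k = kd i := @kernel_partial R d D omega hmol eta i.
have [_ ->] := cform_convol (L1_dkernel hmol eta0 i) (pl2_mul 0 hf pl2_rho) pl2_rho.
by apply: eq_Rint => x; rewrite mulrA.
Qed.

(** The pressure is expanded at P to first order, the quadratic terms in rho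
    are split as P + h, and the contributions of order 0 and 1 in the deviation
    are exactly those which vanish by the identities of the classical solution.
    *)
Lemma remainderE : remainder =
  \int[J]_z (L z.1 * breg pr pr' z.2.1 (P t z.1)) + charge_integral (m_rF' s t) L
  - \int[m_F s t]_(x in cube) L x
  + c2 * (\int[J]_z (L z.1 * (z.2.1 - P t z.1) ^+ 2) + \int[m_rho2 s t]_(x in cube) L x)
  + eta ^- 2 * \sum_i cform (kd i) (fun x => a i t x * h x) h.
Proof.
have ba i := buc_static t (ref_ba href i).
have p2 := pl2_buc 0 bPt; have ph := pl2_h.
have paP i : pl2 (fun x => a i t x * P t x) := pl2_buc 0 (bucM (ba i) bPt).
have pah i : pl2 (fun x => a i t x * h x) := pl2_mul 0 (ba i) ph.
have e0 := ref_zeroth href t; have e1 := ref_first href t ph.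
have ikd i := L1_dkernel hmol eta0 i.
(* The bilinear form at (P + h, P + h) splits into one term of order 0, two of
   order 1 and one of order 2. *)
have Ec i : \int[tor]_x (a i t x * (r x * convol (partial i k) r x)) =
    cform (kd i) (fun x => a i t x * P t x) (P t) + (cform (kd i) (fun x => a i t x * h x) (P t)
    + cform (kd i) (fun x => a i t x * P t x) h) + cform (kd i) (fun x => a i t x * h x) h.
  rewrite (cform_rho i (ba i)).
  have -> : r = (fun x => P t x + h x) by apply/funext => x; rewrite /h addrC subrK.
  rewrite (cformDr (ikd i) _ p2 ph); last exact: (pl2_mul 0 (ba i) (pl2D p2 ph)).
  have -> : (fun x => a i t x * (P t x + h x)) = (fun x => a i t x * P t x + a i t x * h x).
    by apply/funext => x; rewrite mulrDr.
  rewrite (cformDl (ikd i) (paP i) (pah i) p2) (cformDl (ikd i) (paP i) (pah i) ph).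
  ring.
rewrite /remainder (eq_bigr _ (fun i _ => Ec i)) !big_split /=.
rewrite (bar_pE bL) (joint_pressure bL) (joint_square bL) (rho_split basq) (rho_split bM).
rewrite big_split /= in e1.
have bLP := bucM bL bPt; have pLP := pl2_buc 0 bLP; have pLp := pl2_buc 0 (bucM bL bpr').
have j0 := tor_buc 0 (bucM bL bpr); have j1 := tor_buc 0 (bucM bL (bucX 2 bPt)).
have F0 : \int[tor]_x (L x * (P t x * F' (P t x) - F (P t x) + c2 * P t x ^+ 2)) =
   \int[tor]_x (L x * pr (P t x)) + c2 * \int[tor]_x (L x * P t x ^+ 2).
  by rewrite -(RintZ _ j1) -(RintD j0 (L1Z _ j1)); apply: eq_Rint => x; rewrite /pr /pressure; ring.
have F1_ : \int[tor]_x (h x * (L x * (P t x * F'' (P t x) + eta ^- 2 * P t x))) =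
   \int[tor]_x (L x * pr' (P t x) * h x) + eta ^- 2 * \int[tor]_x (L x * P t x * h x).
  have j2 := pl2M pLp ph; have j3 := pl2M pLP ph.
  by rewrite -(RintZ _ j3) -(RintD j2 (L1Z _ j3)); apply: eq_Rint => x; rewrite /pr'; ring.
rewrite F0 in e0; rewrite F1_ in e1.
rewrite (@eq_Rint _ _ _ tor (fun x => P t x * asq x) (fun x => asq x * P t x)) in e0; last by move=> x; rewrite mulrC.
rewrite (@eq_Rint _ _ _ tor (fun x => h x * asq x) (fun x => asq x * h x)) in e1; last by move=> x; rewrite mulrC.
rewrite (@eq_Rint _ _ _ tor (fun x => h x * M t x) (fun x => M t x * h x)) in e1; last by move=> x; rewrite mulrC.
rewrite (@eq_Rint _ _ _ tor (fun x => P t x * M t x) (fun x => M t x * P t x)); last by move=> x; rewrite mulrC.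
have Ec2 : eta ^- 2 = 2 * c2 by field; rewrite gt_eqF.
rewrite Ec2 in e0 e1 *.
set c := (2 * eta ^+ 2)^-1 in e0 e1 *.
move: e0 e1.
set A1 := \int[tor]_x (asq x * P t x); set A2 := \int[tor]_x (asq x * h x).
set B1 := \int[tor]_x (L x * pr (P t x)); set B2 := \int[tor]_x (L x * pr' (P t x) * h x).
set C1 := \int[tor]_x (L x * P t x ^+ 2); set C2 := \int[tor]_x (L x * P t x * h x).
set D1 := \int[tor]_x (M t x * P t x); set D2 := \int[tor]_x (M t x * h x).
set S1 := \sum_i cform _ _ (P t); set S2 := \sum_i cform _ _ (P t); set S3 := \sum_i cform _ _ h.
set S4 := \sum_i cform _ _ h; set J1 := \int[J]_z _; set J2 := \int[J]_z _.
set Q1 := charge_integral _ _; set Q2 := \int[_]_(x in cube) _; set Q3 := \int[_]_(x in cube) _.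
move=> e0 e1.
have -> : A1 = - (B1 + c * C1) - 2 * c * S1 by move: e0; lra.
have -> : A2 = D2 - (B2 + 2 * c * C2) - 2 * c * (S2 + S3) by move: e1; lra.
ring.
Qed.

(** The signed concentration of the pressure is controlled by the nonnegative
    ones, by the definition of the solution class. *)
Lemma charge_bound (f : E -> R) C : measurable_fun setT f -> (forall x, `|f x| <= C) ->
  `|charge_integral (m_rF' s t) f| <= C * (CF * mass_F + CF * mass_rho2).
Proof.
move=> mf fC.
apply: (@charge_integral_bound _ _ unit (fun=> m_rF' s t) tt _ f C) => //.
apply: le_trans (gt_rFv gt) _.
by rewrite /mass_F /mass_rho2 EFinD !EFinM !fineK// fin_num_measure//; exact: measurable_cube.
Qed.

(** Each term of the expanded remainder is quadratic in the deviation or linear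
    in a concentration mass, and these are the quantities that coercivity
    controls. *)
Lemma remainder_bound AL Aa : (forall x, `|L x| <= AL) -> (forall i x, `|a i t x| <= Aa) ->
  remainder <= (AL * (Cp + `|CF| + 1 + c2) + eta ^- 2 * \sum_i (knorm (kd i) * ((Aa ^+ 2 + 1) / 2))) * (devX + devZ).
Proof.
move=> hL ha; have c20 : 0 <= c2 by rewrite invr_ge0 mulr_ge0// sqr_ge0.
have AL0 : 0 <= AL by apply: le_trans (hL 0).
have X0 : 0 <= dev := dev_ge0; have Z0 := dev1_ge0.
have r0 := mass_rho2_ge0; have f0 := mass_F_ge0.
have [_ _ _ _ [Cp0 hb]] := hpot.
have [i1 _] := L1_breg1; have i2 := L1_diff2.
have mL := mst bL.
have t1 : `|\int[J]_z (L z.1 * breg pr pr' z.2.1 (P t z.1))| <= AL * Cp * (dev1 + dev).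
  rewrite /dev1 /dev -(RintD i1 i2) -(RintZ _ (L1D i1 i2)).
  apply: le_norm_Rint; [exact: (L1_joint_mul bL L1_breg_pressure)|exact: (L1Z _ (L1D i1 i2))|].
  move=> z; rewrite normrM -mulrA; apply: ler_pM => //.
  have := hb (P t z.1) z.2.1; rewrite /pr /pr' /pressure FE; exact.
have t2 : `|\int[J]_z (L z.1 * (z.2.1 - P t z.1) ^+ 2)| <= AL * dev.
  rewrite /dev -(RintZ _ i2); apply: le_norm_Rint; [exact: (L1_joint_mul bL i2)|exact: (L1Z _ i2)|].
  by move=> z; rewrite normrM [`|_ ^+ 2|]ger0_norm ?sqr_ge0// ler_wpM2r// sqr_ge0.
have t3 := charge_bound mL hL.
have t4 : `|\int[m_F s t]_(x in cube) L x| <= AL * mass_F := Rint_cube_bound (m_F s t) mL hL.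
have t5 : `|\int[m_rho2 s t]_(x in cube) L x| <= AL * mass_rho2 := Rint_cube_bound (m_rho2 s t) mL hL.
have t6 i : cform (kd i) (fun x => a i t x * h x) h <= knorm (kd i) * ((Aa ^+ 2 + 1) / 2) * dev.
  have ikd := L1_dkernel hmol eta0 i; have ph := pl2_h; have ba := buc_static t (ref_ba href i).
  have pah : pl2 (fun x => a i t x * h x) := pl2_mul 0 ba ph.
  have [_ _ q1] := pah; have [_ _ q2] := ph.
  have h1 : sq (fun x => a i t x * h x) <= Aa ^+ 2 * sq h.
    rewrite /sq -(RintZ _ q2); apply: le_Rint => //; first exact: L1Z.
    by move=> x; rewrite exprMn ler_wpM2r ?sqr_ge0// -[leLHS]real_normK ?num_real// lerXn2r ?nnegrE// (le_trans _ (ha i 0)).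
  have h2 := sq_h_le; have h3 := sq_ge0 h; have n0 := knorm_ge0 (kd i).
  apply: (le_trans (ler_norm _)); apply: (le_trans (cform_bound ikd pah ph)).
  rewrite -mulrA ler_wpM2l//; rewrite mulrAC ler_pM2r ?invr_gt0//.
  apply: (@le_trans _ _ ((Aa ^+ 2 + 1) * sq h)); first by rewrite mulrDl mul1r lerD2r.
  by rewrite ler_wpM2l// addr_ge0// sqr_ge0.
have t7 : \sum_i cform (kd i) (fun x => a i t x * h x) h <= (\sum_i (knorm (kd i) * ((Aa ^+ 2 + 1) / 2))) * dev.
  by rewrite mulr_suml; apply: ler_sum => i _.
have S0 : 0 <= \sum_i (knorm (kd i) * ((Aa ^+ 2 + 1) / 2)).
  by apply: sumr_ge0 => i _; rewrite mulr_ge0 ?knorm_ge0// divr_ge0// addr_ge0// sqr_ge0.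
have e20 : 0 <= eta ^- 2 by rewrite invr_ge0 sqr_ge0.
have t8 := ler_wpM2l e20 t7.
have t9 : CF * mass_F + CF * mass_rho2 <= `|CF| * (mass_F + mass_rho2).
  by rewrite -mulrDr ler_wpM2r ?ler_norm// addr_ge0.
have t10 := ler_wpM2l AL0 t9.
rewrite remainderE /devX /devZ.
set S := \sum_i (knorm _ * _) in S0 t7 t8 *.
have u1 : \int[J]_z (L z.1 * breg pr pr' z.2.1 (P t z.1)) <= AL * Cp * (dev + mass_rho2 + (dev1 + mass_F)).
  apply: (le_trans (ler_norm _)); apply: (le_trans t1); rewrite ler_wpM2l ?mulr_ge0//; lra.
have u2 : charge_integral (m_rF' s t) L <= AL * `|CF| * (dev + mass_rho2 + (dev1 + mass_F)).
  apply: (le_trans (ler_norm _)); apply: (le_trans t3); apply: (le_trans t10); rewrite mulrA ler_wpM2l ?mulr_ge0//; lra.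
have u3 : - (\int[m_F s t]_(x in cube) L x) <= AL * mass_F.
  by apply: (le_trans (ler_norm _)); rewrite normrN.
have u4 : c2 * (\int[J]_z (L z.1 * (z.2.1 - P t z.1) ^+ 2) + \int[m_rho2 s t]_(x in cube) L x) <=
    c2 * (AL * (dev + mass_rho2 + (dev1 + mass_F))).
  rewrite ler_wpM2l//; apply: (@le_trans _ _ (AL * dev + AL * mass_rho2)).
    by apply: lerD; apply: (le_trans (ler_norm _)).
  by rewrite -mulrDr ler_wpM2l//; lra.
have u5 : AL * mass_F <= AL * (dev + mass_rho2 + (dev1 + mass_F)).
  by rewrite ler_wpM2l//; lra.
have u6 : eta ^- 2 * (S * dev) <= eta ^- 2 * S * (dev + mass_rho2 + (dev1 + mass_F)).
  by rewrite mulrA ler_wpM2l ?mulr_ge0//; lra.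
move: u1 u2 u3 u4 u5 u6 t8.
set W := dev + mass_rho2 + _; set V := eta ^- 2; set c := (2 * eta ^+ 2)^-1; lra.
Qed.

End fixed_time.
End mv_static.

(** * Test functions *)

Section test_functions.
Context {R : realType} {d : nat}.
Local Notation E := 'rV[R]_d.
Variables (T : R) (T0 : 0 < T).
Variables (w wt : R -> E -> R) (wi : 'I_d -> R -> E -> R).
Hypotheses (bw : buc w) (bwt : buc wt) (bwi : forall i, buc (wi i)) (Dw : forall i t, HD i (w t) (wi i t)).
Hypothesis wexp : forall e, 0 < e -> exists2 r, 0 < r & forall t t' x, 0 <= t <= T -> 0 <= t' <= T ->
     `|t' - t| < r -> `|w t' x - w t x - (t' - t) * wt t x| <= e * `|t' - t|.

(** Test functions are C^1 on the whole time axis, whereas mu is differentiable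
    in time on [0, T] only. The reflection 2 f(0) - f(- t) through the initial
    point extends f to negative times with a continuous derivative, namely the
    even extension of the derivative. *)
Definition reflect (f : R -> E -> R) (t : R) (x : E) := f (pos t) x + f 0 x - f (pos (- t)) x.

Lemma pos_ge0 (t : R) : 0 <= t -> pos t = t.
Proof. by rewrite /pos => t0; rewrite max_l. Qed.

Lemma pos_le0 (t : R) : t <= 0 -> pos t = 0.
Proof. by rewrite /pos => t0; rewrite max_r. Qed.

Lemma reflect_ge0 f t : 0 <= t -> reflect f t = f t.
Proof.
by move=> t0; apply/funext => x; rewrite /reflect (pos_ge0 t0) pos_le0 ?oppr_le0// addrK.
Qed.

Lemma reflect_cont f : buc f -> continuous (fun z : R * E => reflect f z.1 z.2).
Proof.
move=> bf; have cf := buc_continuous bf.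
have aux (g : R -> R) : continuous g -> continuous (fun z : R * E => f (g z.1) z.2).
  move=> cg; apply: (@cont_comp R _ _ (fun z : R * E => (g z.1, z.2)) (fun z => f z.1 z.2)) => //.
  apply: continuous_pair; last by move=> z; exact: cvg_snd.
  apply: (@cont_comp R _ _ (fun z : R * E => z.1) g) => //.
  by move=> z; exact: cvg_fst.
have c1 := aux _ (@cont_pos R).
have c2 := aux (fun=> 0) (@cont_cst _ _ 0).
have c3 : continuous (fun z : R * E => f (pos (- z.1)) z.2).
  apply: (aux (fun t => pos (- t))).
  apply: (@cont_comp R _ _ (fun t : R => - t) pos); last exact: cont_pos.
  by apply: contN => z; exact: cvg_id.
exact: (contD (contD c1 c2) (contN c3)).
Qed.

Lemma reflect_per f t : buc f -> Zd_periodic (reflect f t).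
Proof. by case=> per _ _ x i; rewrite /reflect !per. Qed.

Lemma reflect_HD i t : HD i (reflect w t) (reflect (wi i) t).
Proof. exact: (HDB (HDD (Dw i _) (Dw i _)) (Dw i _)). Qed.

Lemma reflect_derive t x : `|t| < T -> is_derive t (1 : R) (fun s => reflect w s x) (wt `|t| x).
Proof.
move=> tT; apply: cvg_derive => e e0; have [r r0 H] := wexp e0.
pose r1 := if t == 0 then T else `|t|.
have r10 : 0 < r1 by rewrite /r1; case: eqVneq => [//|t0]; rewrite normr_gt0.
exists (Num.min (Num.min r r1) (T - `|t|)); first by rewrite !lt_min r0 r10 subr_gt0.
move=> h h0; rewrite !lt_min => /andP[/andP[hr h1] hT]; rewrite [h *: 1]mulr1.
suff : `|reflect w (t + h) x - reflect w t x - h * wt `|t| x| <= e * `|h|.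
  move=> hh; have -> : h^-1 * (reflect w (t + h) x - reflect w t x) - wt `|t| x =
     h^-1 * (reflect w (t + h) x - reflect w t x - h * wt `|t| x) by field.
  by rewrite normrM normfV mulrC ler_pdivrMr ?normr_gt0.
have TT : 0 <= T by exact: ltW.
have hTT : `|t + h| <= T.
  by apply: (le_trans (ler_normD _ _)); rewrite -lerBrDl ltW.
have key u v : 0 <= u <= T -> 0 <= v <= T -> v - u = h ->
    `|w v x - w u x - h * wt u x| <= e * `|h|.
  by move=> hu hv E1; have := H u v x hu hv; rewrite E1; apply.
have keyN u v : 0 <= u <= T -> 0 <= v <= T -> v - u = - h ->
    `|w v x - w u x + h * wt u x| <= e * `|h|.
  by move=> hu hv E1; have := H u v x hu hv; rewrite E1 normrN mulNr opprK; apply.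
have pcase : 0 <= t -> 0 <= t + h -> `|reflect w (t + h) x - reflect w t x - h * wt `|t| x| <= e * `|h|.
  move=> t0 th; rewrite !reflect_ge0// (ger0_norm t0); apply: key.
  - by rewrite t0 /=; move: tT; rewrite ger0_norm// => /ltW.
  - by rewrite th /=; move: hTT; rewrite ger0_norm.
  - by rewrite addrAC subrr add0r.
have ncase : t <= 0 -> t + h <= 0 -> `|reflect w (t + h) x - reflect w t x - h * wt `|t| x| <= e * `|h|.
  move=> t0 th.
  have -> : reflect w (t + h) x - reflect w t x - h * wt `|t| x =
      - (w (- (t + h)) x - w (- t) x + h * wt (- t) x).
    by rewrite /reflect !(pos_le0 t0) !(pos_le0 th) !pos_ge0 ?oppr_ge0// (ler0_norm t0); ring.
  rewrite normrN; apply: keyN.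
  - by rewrite oppr_ge0 t0 /=; move: tT; rewrite ler0_norm// => /ltW.
  - by rewrite oppr_ge0 th /=; move: hTT; rewrite ler0_norm.
  - by rewrite opprD opprK addrAC addNr add0r.
have [t0|t0] := eqVneq t 0.
  have [th|th] := leP 0 (t + h); first by apply: (pcase _ th); rewrite t0.
  by apply: (ncase _ (ltW th)); rewrite t0.
move: h1; rewrite /r1 (negPf t0) => h1.
have [tp|tn] := ltP 0 t.
  by apply: pcase; [exact: ltW|move: h1; rewrite (gtr0_norm tp) ltr_norml => /andP[? _]; lra].
by apply: ncase => //; move: h1; rewrite (ler0_norm tn) ltr_norml => /andP[_ ?]; lra.
Qed.

Variables (t0 h : R) (t00 : 0 < t0) (h0 : 0 < h) (th : t0 + 2 * h < T).

(** The second factor is 1 for positive times; it stops the test function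
    before the reflection leaves the interval on which it is differentiable. T
    / 8 leaves room for a transition of length T / 4. *)
Definition tcut (s : R) := cutoff t0 h s * cutoff 0 (T / 8) (- s).
Definition dtcut (s : R) := dcutoff t0 h s * cutoff 0 (T / 8) (- s) + cutoff t0 h s * - dcutoff 0 (T / 8) (- s).

Let T8 : 0 < T / 8. Proof. by rewrite divr_gt0. Qed.

Lemma DER_tcut : DER tcut dtcut.
Proof.
apply: DERM; first exact: DER_cutoff.
have := @DER_affine R (-1) 0 _ _ (@DER_cutoff R 0 (T / 8)).
move=> H s; have := H s; rewrite mulN1r subr0 mulN1r.
by rewrite (_ : (fun u => cutoff 0 (T / 8) (-1 * u - 0)) = (fun u => cutoff 0 (T / 8) (- u)))//; apply/funext => u; rewrite mulN1r subr0.
Qed.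

Lemma cont_dtcut : continuous dtcut.
Proof.
have cN (g : R -> R) : continuous g -> continuous (fun s : R => g (- s)).
  by move=> cg; apply: (@cont_comp R _ _ (fun s : R => - s) g) => //; apply: contN => z; exact: cvg_id.
apply: contD.
  by apply: contM; [exact: cont_dcutoff|exact: (cN _ (@cont_cutoff R 0 (T / 8)))].
by apply: contM; [exact: cont_cutoff|exact: (contN (cN _ (@cont_dcutoff R 0 (T / 8))))].
Qed.

Lemma tcut_ge0 s : 0 <= s -> tcut s = cutoff t0 h s.
Proof. by move=> s0; rewrite /tcut (@cutoff_eq1 _ 0) ?mulr1// oppr_le0. Qed.

Lemma dtcut_ge0 s : 0 <= s -> dtcut s = dcutoff t0 h s.
Proof.
by move=> s0; rewrite /dtcut (@cutoff_eq1 _ 0) ?oppr_le0// (@dcutoff_eq0 _ 0) ?oppr_le0 ?s0// mulr1 oppr0 mulr0 addr0.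
Qed.

Lemma tcut_far s : T <= `|s| \/ t0 + 2 * h <= s -> tcut s = 0 /\ dtcut s = 0.
Proof.
move=> hs; have [ge|lt] := leP (t0 + 2 * h) s.
  by rewrite /tcut /dtcut cutoff_eq0// dcutoff_eq0 ?ge ?orbT// !mul0r addr0.
case: hs => [hs|]; last by rewrite leNgt lt.
have sN : 0 + 2 * (T / 8) <= - s.
  have := th; have := T0; move: hs; rewrite ler_normr add0r => /orP[hs|hs] hT ht; lra.
by rewrite /tcut /dtcut (@cutoff_eq0 _ 0)// (@dcutoff_eq0 _ 0) ?sN ?orbT// oppr0 !mulr0 addr0.
Qed.

Definition test s x := tcut s * reflect w s x.
Definition test_t s x := dtcut s * reflect w s x + tcut s * wt `|s| x.

Lemma test_derive s x : is_derive s (1 : R) (fun u => test u x) (test_t s x).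
Proof.
have [sT|sT] := ltP `|s| T.
  have := is_deriveM (DER_tcut s) (reflect_derive x sT).
  rewrite /GRing.scale /= addrC [reflect w s x * _]mulrC.
  exact.
have [z1 z2] := tcut_far (or_introl sT).
rewrite /test_t z1 z2 !mul0r addr0; apply: cvg_derive => e e0.
have [C C0 hC] : exists2 C, 0 < C & forall u, `|reflect w u x| <= C.
  have [C C0 hC] := buc_bounded bw; exists (C + C + C); first by rewrite !addr_gt0.
  move=> u; apply: (le_trans (ler_normB _ _)); apply: lerD => //.
  by apply: (le_trans (ler_normD _ _)); apply: lerD.
have [r r0 H] := is_derive_quot (DER_tcut s) (divr_gt0 e0 C0).
exists r => // u u0 ur; have := H u u0 ur.
rewrite z2 subr0 z1 subr0 /test z1 mul0r !subr0 => hh.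
rewrite mulrA normrM; apply: (@le_trans _ _ (e / C * C)); last by rewrite divfK ?gt_eqF.
exact: ler_pM.
Qed.

Lemma test_fun : test_function T test.
Proof.
split.
- by move=> s x i; rewrite /test (reflect_per s bw).
- split=> [s x|s x i]; first by case: (test_derive s x).
  have H : HD i (test s) (fun x => tcut s * reflect (wi i) s x) := HDZ _ (reflect_HD i s).
  exact: (HD_derivable H).
- split.
    rewrite (_ : (fun z : R * E => _) = (fun z => dtcut z.1 * reflect w z.1 z.2 + tcut z.1 * wt `|z.1| z.2)); last first.
      by apply/funext => z; rewrite derive1E; case: (test_derive z.1 z.2).
    have c1 (g : R -> R) : continuous g -> continuous (fun z : R * E => g z.1).
      by move=> cg; apply: (@cont_comp R _ _ (fun z : R * E => z.1) g) => // z; exact: cvg_fst.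
    apply: contD; first by apply: contM; [exact/c1/cont_dtcut|exact: reflect_cont].
    apply: contM; first exact/c1/(DER_continuous DER_tcut).
    apply: (@cont_comp R _ _ (fun z : R * E => (`|z.1|, z.2)) (fun z => wt z.1 z.2)); last exact: buc_continuous.
    apply: continuous_pair; last by move=> z; exact: cvg_snd.
    by apply: (c1 (fun s => `|s|)) => s; exact: norm_continuous.
  move=> i; rewrite (_ : (fun z : R * E => _) = (fun z => tcut z.1 * reflect (wi i) z.1 z.2)); last first.
    by apply/funext => z; rewrite (HD_partial (HDZ (tcut z.1) (reflect_HD i z.1))).
  apply: contM; last exact: reflect_cont.
  apply: (@cont_comp R _ _ (fun z : R * E => z.1) tcut); first by move=> z; exact: cvg_fst.
  exact: (DER_continuous DER_tcut).
- exists (t0 + 2 * h) => // s x hs; rewrite /test.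
  by have [-> _] := tcut_far (or_intror hs); rewrite mul0r.
Qed.

(** At positive times the reflection and the second cutoff have disappeared
    from the derivatives. *)
Lemma test_dt s x : 0 < s < T -> (test ^~ x)^`()%classic s = dcutoff t0 h s * w s x + cutoff t0 h s * wt s x.
Proof.
move=> /andP[s0 sT]; rewrite derive1E; have [_ ->] := test_derive s x.
have s0' := ltW s0; rewrite /test_t tcut_ge0// dtcut_ge0// (reflect_ge0 w s0') ger0_norm//.
Qed.

Lemma test_partial i s : 0 <= s -> partial i (test s) = (fun x => cutoff t0 h s * wi i s x).
Proof.
move=> s0; rewrite (HD_partial (HDZ (tcut s) (reflect_HD i s))).
by rewrite (reflect_ge0 (wi i) s0) tcut_ge0.
Qed.

Lemma test_ge0 s : 0 <= s -> test s = (fun x => cutoff t0 h s * w s x).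
Proof. by move=> s0; apply/funext => x; rewrite /test (reflect_ge0 w s0) tcut_ge0. Qed.

Lemma test_0 : test 0 = w 0.
Proof. by rewrite test_ge0//; apply/funext => x; rewrite cutoff_eq1 ?mul1r// ltW. Qed.

End test_functions.

(** * Bounds at a fixed time *)

Section mv_static_bounds.
Context {R : realType} {d : nat}.
Local Notation E := 'rV[R]_d.
Local Notation Y := (R * E)%type.
Local Notation tor := (torus_prob d : probability E R).
Local Notation leb := (@lebesgue_row R d).
Local Opaque lebesgue_row.

Lemma coord_sq_le (x : E) i : x ord0 i ^+ 2 <= enorm x ^+ 2.
Proof.
rewrite sqr_sqrtr; last by apply: sumr_ge0 => j _; exact: sqr_ge0.
by rewrite (bigD1 i)//= lerDl; apply: sumr_ge0 => j _; exact: sqr_ge0.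
Qed.

Lemma coord_mul_le (x : E) i j : `|x ord0 i * x ord0 j| <= enorm x ^+ 2.
Proof.
have := coord_sq_le x i; have := coord_sq_le x j; rewrite normrM.
have := sqr_ge0 (`|x ord0 i| - `|x ord0 j|); rewrite sqrrB !real_normK ?num_real//.
by set p := `|_| * _; rewrite -mulr_natr; lra.
Qed.

Lemma measurable_enorm : measurable_fun setT (enorm : E -> R).
Proof.
apply: (measurableT_comp (@continuous_measurable_fun R Num.sqrt (@sqrt_continuous R))).
by apply: measurable_sum => i; apply: measurable_funX; exact: measurable_coord.
Qed.

Lemma sqrt_sq_le (v : R) : Num.sqrt v ^+ 2 <= 1 + v ^+ 2.
Proof.
have [h|h] := leP 0 v; last by rewrite ler0_sqrtr ?(ltW h)// expr0n /= addr_ge0// sqr_ge0.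
by rewrite sqr_sqrtr//; have := sqr_ge0 (v - 2^-1); rewrite sqrrB; lra.
Qed.

Lemma sqrt_coord_le (l : Y) i (q : R) : 0 <= q ->
  q * `|Num.sqrt l.1 * l.2 ord0 i| <= 1 + l.1 ^+ 2 + q ^+ 2 * enorm l.2 ^+ 2.
Proof.
move=> q0; rewrite normrM (ger0_norm (sqrtr_ge0 _)) mulrCA.
have h1 : (q * `|l.2 ord0 i|) ^+ 2 <= q ^+ 2 * enorm l.2 ^+ 2.
  by rewrite exprMn ler_wpM2l ?sqr_ge0// real_normK ?num_real// coord_sq_le.
have := sqrt_sq_le l.1; have := mulr_ge0 (sqrtr_ge0 l.1) (mulr_ge0 q0 (normr_ge0 (l.2 ord0 i))).
have := sqr_ge0 (Num.sqrt l.1 - q * `|l.2 ord0 i|); rewrite sqrrB.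
by set p := _ * (q * _); rewrite -mulr_natr; lra.
Qed.

Lemma norm3_le (x y z p q c : R) : `|x| <= p -> `|y| <= q -> `|z| <= c -> `|x + y + z| <= p + q + c.
Proof.
move=> h1 h2 h3; apply: (le_trans (ler_normD _ _)); apply: lerD h3.
by apply: (le_trans (ler_normD _ _)); exact: lerD.
Qed.

Lemma sum_sum_cst (n : nat) (c : R) : \sum_(i < n) \sum_(j < n) c = n%:R ^+ 2 * c.
Proof. by rewrite !sumr_const !card_ord -mulrnA -[LHS]mulr_natl natrM expr2. Qed.

Lemma pressure_arith (p A q c x1 x2 z1 z2 : R) : [/\ 0 <= p, 0 <= A, 0 <= q & 0 <= c] ->
  [/\ 0 <= x1, 0 <= x2, 0 <= z1 & 0 <= z2] ->
  p * (z1 + x1) + A * x1 + 2 * A + q * (z2 + x2) + z2 + c * (2 * (x1 + x2) + 2 * A ^+ 2 + x2) <=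
  (p + 3 * A + q + 1 + c * (3 + 2 * A ^+ 2)) * (1 + (x1 + x2) + (z1 + z2)).
Proof.
move=> [p0 A0 q0 c0] [x10 x20 z10 z20].
set W := 1 + (x1 + x2) + (z1 + z2).
have w1 : 1 <= W by rewrite /W; lra.
have h1 : p * (z1 + x1) <= p * W by rewrite ler_wpM2l// /W; lra.
have h2 : A * x1 <= A * W by rewrite ler_wpM2l// /W; lra.
have h3 : 2 * A <= 2 * A * W by rewrite ler_peMr// mulr_ge0.
have h4 : q * (z2 + x2) <= q * W by rewrite ler_wpM2l// /W; lra.
have h5 : z2 <= W by rewrite /W; lra.
have h6 : c * (2 * (x1 + x2) + 2 * A ^+ 2 + x2) <= c * ((3 + 2 * A ^+ 2) * W).
  rewrite ler_wpM2l//; have -> : (3 + 2 * A ^+ 2) * W = 3 * W + 2 * A ^+ 2 * W by ring.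
  have h : 2 * A ^+ 2 <= 2 * A ^+ 2 * W by rewrite ler_peMr// mulr_ge0// sqr_ge0.
  by apply: (le_trans _ (lerD (lexx (3 * W)) h)); rewrite /W; lra.
have -> : (p + 3 * A + q + 1 + c * (3 + 2 * A ^+ 2)) * W = p * W + A * W + 2 * A * W + q * W + W + c * ((3 + 2 * A ^+ 2) * W) by ring.
by rewrite !lerD.
Qed.

Section linear_functionals.
Implicit Types (f g : E -> R) (L : (E -> R) -> R).

Lemma lin_boundedZ c L K : lin_bounded L K -> lin_bounded (fun f => c * L f) (`|c| * K).
Proof.
move=> [l1 l2 l3 l4]; split=> [f g M N mf mg fM gN|q f M mf fM|f M mf fM|].
- by rewrite (l1 _ _ _ _ mf mg fM gN) mulrDr.
- by rewrite (l2 _ _ _ mf fM) mulrCA.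
- by rewrite normrM mulrCA ler_wpM2l//; exact: l3.
- exact: mulr_ge0.
Qed.

Lemma lin_boundedD L1 L2 K1 K2 : lin_bounded L1 K1 -> lin_bounded L2 K2 ->
  lin_bounded (fun f => L1 f + L2 f) (K1 + K2).
Proof.
move=> h1 h2; have := lin_boundedB h1 (lin_boundedZ (-1) h2).
rewrite normrN1 mul1r; congr (lin_bounded _ _).
by apply/funext => f; rewrite mulN1r opprK.
Qed.

Lemma lin_sub L K f g C C' : lin_bounded L K -> measurable_fun setT f -> measurable_fun setT g ->
  (forall x, `|f x| <= C) -> (forall x, `|g x| <= C') -> L (fun x => f x - g x) = L f - L g.
Proof.
move=> [l1 l2 _ _] mf mg fC gC.
have mNg : measurable_fun setT (fun x => -1 * g x) by apply: measurable_funM.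
have NgC x : `|-1 * g x| <= C' by rewrite mulN1r normrN.
have := l1 f (fun x => -1 * g x) C C' mf mNg fC NgC; rewrite (l2 _ _ _ mg gC) mulN1r => <-.
by congr L; apply/funext => x; rewrite mulN1r.
Qed.

Lemma lin_sum L K n (f : 'I_n -> E -> R) C : lin_bounded L K -> (forall i, measurable_fun setT (f i)) ->
  (forall i x, `|f i x| <= C) -> L (fun x => \sum_i f i x) = \sum_i L (f i).
Proof.
move=> [l1 l2 l3 l4] mf fC.
have L0 : L (fun=> 0) = 0.
  have m0 : measurable_fun setT (fun _ : E => 0 : R) by exact: measurable_cst.
  have b0 (x : E) : `|0 : R| <= 0 by rewrite normr0.
  by have := l2 0 (fun=> 0) 0 m0 b0; rewrite !mul0r.
elim: n => [|n IH] in f mf fC *.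
  rewrite big_ord0 -[RHS]L0; congr L; apply/funext => x; by rewrite big_ord0.
rewrite big_ord_recr /= -(IH (fun i => f (widen_ord (leqnSn n) i)))//.
rewrite -(l1 _ _ (\sum_(i < n) C) C) //; first by congr L; apply/funext => x; rewrite big_ord_recr.
- by apply: measurable_sum => i; exact: mf.
- move=> x; apply: (le_trans (ler_norm_sum _ _ _)); by apply: ler_sum => i _.
Qed.

Lemma lin_bounded_ymean (s : mv_data R d) (t : R) (g : Y -> R) : L1 (joint s t) (fun z => g z.2) ->
  lin_bounded (fun f => \int[torus_measure]_x (f x * ymean s g t x)) (\int[joint s t]_z `|g z.2|).
Proof.
move=> hg; split=> [f f' M N mf mf' fM fN|c f M mf fM|f M mf fM|]; rewrite ?torus_measureE.
- have [_ j1 _] := Rint_ymean mf fM hg; have [_ j2 _] := Rint_ymean mf' fN hg.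
  by rewrite -(RintD j1 j2); apply: eq_Rint => x; rewrite mulrDl.
- have [_ j1 _] := Rint_ymean mf fM hg.
  by rewrite -(RintZ _ j1); apply: eq_Rint => x; rewrite mulrA.
- have [j0 _ ->] := Rint_ymean mf fM hg.
  rewrite -(RintZ _ (L1_norm hg)); apply: (le_norm_Rint j0 (L1Z _ (L1_norm hg))) => z.
  by rewrite normrM ler_wpM2r.
- by apply: Rint_ge0 => z.
Qed.

Lemma lin_bounded_L1 (g : E -> R) : L1 tor g ->
  lin_bounded (fun f => \int[torus_measure]_x (f x * g x)) (\int[tor]_x `|g x|).
Proof.
move=> hg; have ig f M : measurable_fun setT f -> (forall x, `|f x| <= M) -> L1 tor (fun x => f x * g x).
  by move=> mf fM; exact: (@L1_mul_bounded _ _ _ tor f g M).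
split=> [f f' M N mf mf' fM fN|c f M mf fM|f M mf fM|]; rewrite ?torus_measureE.
- by rewrite -(RintD (ig _ _ mf fM) (ig _ _ mf' fN)); apply: eq_Rint => x; rewrite mulrDl.
- by rewrite -(RintZ _ (ig _ _ mf fM)); apply: eq_Rint => x; rewrite mulrA.
- rewrite -(RintZ _ (L1_norm hg)); apply: (le_norm_Rint (ig _ _ mf fM) (L1Z _ (L1_norm hg))) => z.
  by rewrite normrM ler_wpM2r.
- by apply: Rint_ge0 => z.
Qed.

End linear_functionals.

Variables (D : R) (omega : E -> R) (hmol : mollifier D omega).
Variables (eta : R) (eta0 : 0 < eta) (T : R) (T0 : 0 < T).
Variables (F F1 F1' F1'' F2 F2' F2'' F''' : R -> R) (M2 B Cp CP : R) (CP0 : 0 < CP).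
Hypothesis hpot : potential_data CP F F1 F1' F1'' F2 F2' F2'' F''' M2 B Cp.
Local Notation F' := (fun u => F1' u + F2' u).
Local Notation F'' := (fun u => F1'' u + F2'' u).
Variables (rho0 : E -> R) (P mu M : R -> E -> R) (a : 'I_d -> R -> E -> R) (b : 'I_d -> 'I_d -> R -> E -> R) (K : R -> R).
Hypothesis href : reference omega eta T F F' F'' rho0 P mu M a b K.
Local Notation k := (scaled omega eta).
Variables (CF : R) (s : mv_data R d).
Local Notation kd := (dkernel omega eta).
Local Notation pr := (pressure F F').
Local Notation pr' := (fun u => u * F'' u).
Local Notation c2 := ((2 * eta ^+ 2)^-1).

Variables (t : R) (gt : good_time omega eta T F CP P CF s t).
Local Notation J := (joint s t).
Local Notation r := (mv_rho s t).
Local Notation X := (devX P s t).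
Local Notation Z := (devZ F1 F1' P s t).
Local Notation r2 := (bar_ru2 s t (cst 1)).

Variables (A : R) (hA : [/\ 0 < A, forall t x, `|P t x| <= A, forall t x, `|pr (P t x)| <= A & forall t x, `|pr' (P t x)| <= A]).

Let mst (f : E -> R) (h : buc (fun=> f)) : measurable_fun setT f := buc_measurable_at 0 h.
Let m21 : measurable_fun setT (fun z : E * Y => z.2.1).
Proof. exact: (measurableT_comp measurable_fst measurable_snd). Qed.
Let m22 i : measurable_fun setT (fun z : E * Y => z.2.2 ord0 i).
Proof. exact: (measurableT_comp (measurable_coord i) (measurableT_comp measurable_snd measurable_snd)). Qed.
Let bPt := buc_static t (ref_bP href).

Lemma r2_ge0 : 0 <= r2.
Proof.
rewrite (bar_ru2_1 gt) addr_ge0 ?mass_ru2_ge0//.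
by apply: Rint_ge0 => z; exact: sqr_ge0.
Qed.

Lemma devX_ge0 : 0 <= X.
Proof. by rewrite addr_ge0 ?dev_ge0 ?mass_rho2_ge0. Qed.

Lemma devZ_ge0 : 0 <= Z.
Proof. by rewrite addr_ge0 ?mass_F_ge0 ?(dev1_ge0 hpot). Qed.

Lemma enorm_le_r2 : \int[J]_z enorm z.2.2 ^+ 2 <= r2.
Proof. by rewrite (bar_ru2_1 gt) lerDl mass_ru2_ge0. Qed.

Lemma bar_ruu_bound i j (f : E -> R) C : measurable_fun setT f -> (forall x, `|f x| <= C) -> 
  `|bar_ruu s i j t f| <= C * r2.
Proof.
move=> mf fC; have C0 : 0 <= C := le_trans (normr_ge0 _) (fC 0).
have i1 : L1 J (fun z => z.2.2 ord0 i * z.2.2 ord0 j).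
  apply: (@L1_le _ _ _ J _ (fun z : E * Y => enorm z.2.2 ^+ 2) _ (gt_u2 gt)).
    by apply: measurable_funM; exact: m22.
  by move=> z; exact: coord_mul_le.
have [j1 _ E1] := @Rint_ymean _ _ s t f (fun l => l.2 ord0 i * l.2 ord0 j) C mf fC i1.
rewrite /bar_ruu torus_measureE E1 (bar_ru2_1 gt) mulrDr.
apply: (le_trans (ler_normD _ _)); apply: lerD.
  rewrite -(RintZ _ (gt_u2 gt)); apply: (le_norm_Rint j1 (L1Z _ (gt_u2 gt))) => z.
  by rewrite normrM ler_pM// coord_mul_le.
apply: (@charge_integral_bound _ _ _ (fun ij => m_ruu s ij.1 ij.2 t) (i, j)) => //.
apply: le_trans (gt_ruu gt) _.
by rewrite /mass_ru2 fineK// fin_num_measure//; exact: measurable_cube.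
Qed.

Lemma L1_sru i : L1 J (fun z => Num.sqrt z.2.1 * z.2.2 ord0 i).
Proof.
have i1 : L1 J (fun z => 1 + z.2.1 ^+ 2 + enorm z.2.2 ^+ 2).
  apply: (L1D (L1D _ (gt_rho2 gt)) (gt_u2 gt)).
  by apply: (@L1_bounded _ _ _ _ _ 1); [exact: joint_lty|exact: measurable_cst|move=> z; rewrite normr1].
apply: (L1_le _ i1).
  apply: measurable_funM; last exact: m22.
  exact: (measurableT_comp (@continuous_measurable_fun R Num.sqrt (@sqrt_continuous R)) m21).
move=> z; have := @sqrt_coord_le z.2 i 1 ler01; by rewrite !mul1r expr1n mul1r.
Qed.

Lemma ru_joint i (f : E -> R) : buc (fun=> f) ->
  \int[tor]_x (f x * mv_ru s t x ord0 i) = \int[J]_z (f z.1 * (Num.sqrt z.2.1 * z.2.2 ord0 i)) /\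
  L1 J (fun z => f z.1 * (Num.sqrt z.2.1 * z.2.2 ord0 i)).
Proof.
move=> hf; split; last exact: (L1_joint_mul hf (L1_sru i)).
rewrite -(joint_snd (g := fun l : Y => Num.sqrt l.1 * l.2 ord0 i) hf (L1_sru i)); apply: eq_Rint => x; by rewrite mxE.
Qed.

Lemma rho2_le : \int[J]_z z.2.1 ^+ 2 <= 2 * X + 2 * A ^+ 2.
Proof.
have [A0 hP _ _] := hA.
have iX := L1_diff2 href gt.
have ic : L1 J (fun=> 2 * A ^+ 2 : R).
  by apply: (@L1_bounded _ _ _ _ _ `|2 * A ^+ 2|); [exact: joint_lty|exact: measurable_cst|].
apply: (@le_trans _ _ (2 * dev P s t + 2 * A ^+ 2)); last by rewrite lerD2r ler_wpM2l// lerDl mass_rho2_ge0.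
rewrite -[2 * A ^+ 2](@Rint_cst_prob _ _ _ J _ (jointT s t)) -(RintZ _ iX) -(RintD (L1Z 2 iX) ic).
apply: (le_Rint (gt_rho2 gt) (L1D (L1Z 2 iX) ic)) => z.
have := sqr_ge0 (z.2.1 - 2 * P t z.1); have : P t z.1 ^+ 2 <= A ^+ 2.
  by rewrite -[leLHS]real_normK ?num_real// lerXn2r ?nnegrE// ltW.
rewrite !sqrrB; lra.
Qed.

(** Young's inequality. The momentum, divided by e, is bounded by the density
    and by the dissipation e^-2 |lambda'|^2. *)
Lemma ru_bound i (f : E -> R) C e : 0 < e -> buc (fun=> f) -> (forall x, `|f x| <= C) ->
  e^-1 * `|\int[tor]_x (f x * mv_ru s t x ord0 i)| <= C * (1 + 2 * X + 2 * A ^+ 2 + e ^- 2 * r2).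
Proof.
move=> e0 hf fC; have C0 : 0 <= C := le_trans (normr_ge0 _) (fC 0).
have [-> iL] := ru_joint i hf.
have e10 : 0 <= e^-1 by rewrite invr_ge0 ltW.
rewrite -(ger0_norm e10) -normrM -(RintZ _ iL).
have i1 : L1 J (fun z => 1 + z.2.1 ^+ 2 + e ^- 2 * enorm z.2.2 ^+ 2).
  apply: (L1D (L1D _ (gt_rho2 gt)) (L1Z _ (gt_u2 gt))).
  by apply: (@L1_bounded _ _ _ _ _ 1); [exact: joint_lty|exact: measurable_cst|move=> z; rewrite normr1].
have ic : L1 J (fun=> 1 : R).
  by apply: (@L1_bounded _ _ _ _ _ 1); [exact: joint_lty|exact: measurable_cst|move=> z; rewrite normr1].
apply: (@le_trans _ _ (C * \int[J]_z (1 + z.2.1 ^+ 2 + e ^- 2 * enorm z.2.2 ^+ 2))).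
  rewrite -(RintZ _ i1); apply: (le_norm_Rint (L1Z _ iL) (L1Z _ i1)) => z.
  rewrite mulrCA normrM; apply: ler_pM => //.
  rewrite normrM (ger0_norm e10); have := @sqrt_coord_le z.2 i e^-1 e10; by rewrite exprVn.
rewrite ler_wpM2l// (RintD (L1D ic (gt_rho2 gt)) (L1Z _ (gt_u2 gt))) (RintD ic (gt_rho2 gt)) (RintZ _ (gt_u2 gt)).
rewrite (@Rint_cst_prob _ _ _ J _ (jointT s t)).
have := ler_wpM2l (_ : 0 <= e ^- 2) enorm_le_r2; rewrite invr_ge0 sqr_ge0 => /(_ isT).
by have := rho2_le; lra.
Qed.

(** The difference of the two sides is at least the integral of the perfect
    square |lambda' / e + sqrt(lambda_1) a|^2. Thus the damping allows the sign
    of the singular cross term to be changed, at the price of int rho |a|^2;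
    the cross term with the new sign is the one that the momentum balance
    computes. *)
Lemma damping_young e : 0 < e ->
  - (e ^- 2 * r2) - e^-1 * (\sum_i \int[tor]_x (a i t x * mv_ru s t x ord0 i)) <=
  e^-1 * (\sum_i \int[tor]_x (a i t x * mv_ru s t x ord0 i)) + \int[tor]_x ((\sum_i a i t x ^+ 2) * r x).
Proof.
move=> e0; have ba i := buc_static t (ref_ba href i).
have basq : buc (fun (_ : R) x => \sum_i a i t x ^+ 2) := buc_sum _ (fun i => bucX 2 (ba i)).
rewrite (joint_rho gt basq).
pose g (z : E * Y) : R := \sum_i (a i t z.1 * (Num.sqrt z.2.1 * z.2.2 ord0 i)).
have ig : L1 J g by apply: L1_sum => i; have [] := ru_joint i (ba i).
have -> : \sum_i \int[tor]_x (a i t x * mv_ru s t x ord0 i) = \int[J]_z g z.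
  rewrite /g Rint_sum; last by move=> i; have [] := ru_joint i (ba i).
  by apply: eq_bigr => i _; have [] := ru_joint i (ba i).
have i1 := L1_l gt basq; have i2 := L1Z (e ^- 2) (gt_u2 gt); have i3 := L1Z (2 * e^-1) ig.
have h0 : 0 <= \int[J]_z (e ^- 2 * enorm z.2.2 ^+ 2 + 2 * e^-1 * g z + (\sum_i a i t z.1 ^+ 2) * z.2.1).
  have := ae_le_Rint (L1_0 J) (L1D (L1D i2 i3) i1); rewrite Rint0; apply.
  (* The square root of the density is a true square root only where the
     density is nonnegative. *)
  move: (gt_pos gt); apply: filterS => z z0.
  rewrite /g sqr_sqrtr; last by apply: sumr_ge0 => j _; exact: sqr_ge0.
  rewrite !mulr_sumr mulr_suml -!big_split /=; apply: sumr_ge0 => i _.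
  rewrite -{2}(sqr_sqrtr z0); set q := Num.sqrt _.
  have -> : e ^- 2 = e^-1 ^+ 2 by rewrite exprVn.
  set p := e^-1.
  have -> : p ^+ 2 * z.2.2 ord0 i ^+ 2 + 2 * p * (a i t z.1 * (q * z.2.2 ord0 i)) + a i t z.1 ^+ 2 * q ^+ 2 = (p * z.2.2 ord0 i + a i t z.1 * q) ^+ 2 by ring.
  exact: sqr_ge0.
rewrite (RintD (L1D i2 i3) i1) (RintD i2 i3) (RintZ _ (gt_u2 gt)) (RintZ _ ig) in h0.
have := ler_wpM2l (_ : 0 <= e ^- 2) enorm_le_r2; rewrite invr_ge0 sqr_ge0 => /(_ isT).
by move: h0; set p := e^-1; set G := \int[J]_z g z; lra.
Qed.

(** The precise values of Kp and Kv are immaterial; what matters is that they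
    do not depend on epsilon. *)
Definition Kp := Cp + 3 * A + `|CF| + 1 + c2 * (3 + 2 * A ^+ 2).

(** The pressure is the sum of its affine approximation at P and of its Bregman
    divergence, all controlled by the deviations. *)
Lemma bar_p_bound (f : E -> R) C : buc (fun=> f) -> (forall x, `|f x| <= C) ->
  `|bar_p F eta s t f| <= C * (Kp * (1 + X + Z)).
Proof.
move=> hf fC; have C0 : 0 <= C := le_trans (normr_ge0 _) (fC 0).
have [A0 hP hpr hpr'] := hA; have mf := mst hf.
have [_ _ _ _ [Cp0 hb]] := hpot.
have c20 : 0 <= c2 by rewrite invr_ge0 mulr_ge0// sqr_ge0.
have X0 : 0 <= dev P s t := dev_ge0 P s t; have Z0 := dev1_ge0 hpot P s t.
have r0 := mass_rho2_ge0 s t; have f0 := mass_F_ge0 s t.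
have [i1 _] := L1_breg1 hpot href gt; have i2 := L1_diff2 href gt.
have ic c : L1 J (fun=> c : R).
  by apply: (@L1_bounded _ _ _ _ _ `|c|); [exact: joint_lty|exact: measurable_cst|].
have t1 : `|\int[J]_z (f z.1 * pr z.2.1)| <= C * (Cp * (dev1 F1 F1' P s t + dev P s t) + A * dev P s t + 2 * A).
  have i3 := L1D (L1D (L1Z Cp (L1D i1 i2)) (L1Z A i2)) (ic (2 * A)).
  have -> : Cp * (dev1 F1 F1' P s t + dev P s t) + A * dev P s t + 2 * A =
    \int[J]_z (Cp * (breg F1 F1' z.2.1 (P t z.1) + (z.2.1 - P t z.1) ^+ 2) + A * (z.2.1 - P t z.1) ^+ 2 + 2 * A).
    rewrite (RintD (L1D (L1Z Cp (L1D i1 i2)) (L1Z A i2)) (ic (2 * A))) (RintD (L1Z Cp (L1D i1 i2)) (L1Z A i2)).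
    by rewrite !(RintZ, RintD i1 i2)//; [rewrite (@Rint_cst_prob _ _ _ J _ (jointT s t))|exact: L1D].
  rewrite -(RintZ _ i3); apply: (le_norm_Rint _ (L1Z _ i3)).
    exact: (L1_joint_mul hf (L1_pressure hpot gt)).
  move=> z; rewrite normrM ler_pM//.
  have h1 := hb (P t z.1) z.2.1; have h2 := hpr t z.1; have h3 := hpr' t z.1.
  have -> : pr z.2.1 = breg pr pr' z.2.1 (P t z.1) + pr (P t z.1) + pr' (P t z.1) * (z.2.1 - P t z.1).
    by rewrite /breg; ring.
  have h1' : `|breg pr pr' z.2.1 (P t z.1)| <= Cp * (breg F1 F1' z.2.1 (P t z.1) + (z.2.1 - P t z.1) ^+ 2).
    by move: h1; rewrite /pressure (FE hpot).
  have h4 : `|pr' (P t z.1) * (z.2.1 - P t z.1)| <= A * (1 + (z.2.1 - P t z.1) ^+ 2).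
    rewrite normrM ler_pM//; set u := z.2.1 - _.
    by have := sqr_ge0 (`|u| - 2^-1); rewrite sqrrB real_normK ?num_real//; lra.
  apply: (le_trans (norm3_le h1' h2 h4)).
  set p := Cp * _; set u := _ ^+ 2; rewrite (_ : p + A + A * (1 + u) = p + A * u + 2 * A)//; ring.
have t2 : `|\int[J]_z (f z.1 * z.2.1 ^+ 2)| <= C * (2 * X + 2 * A ^+ 2).
  apply: (le_trans _ (ler_wpM2l C0 rho2_le)); rewrite -(RintZ _ (gt_rho2 gt)).
  apply: (le_norm_Rint (L1_joint_mul hf (gt_rho2 gt)) (L1Z _ (gt_rho2 gt))) => z.
  by rewrite normrM [`|_ ^+ 2|]ger0_norm ?sqr_ge0// ler_wpM2r ?sqr_ge0.
have t3 := charge_bound gt mf fC.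
have t4 : `|\int[m_F s t]_(x in cube) f x| <= C * mass_F s t := Rint_cube_bound (m_F s t) mf fC.
have t5 : `|\int[m_rho2 s t]_(x in cube) f x| <= C * mass_rho2 s t := Rint_cube_bound (m_rho2 s t) mf fC.
have t9 : CF * mass_F s t + CF * mass_rho2 s t <= `|CF| * (mass_F s t + mass_rho2 s t).
  by rewrite -mulrDr ler_wpM2r ?ler_norm// addr_ge0.
have t10 := ler_wpM2l C0 t9.
rewrite (bar_pE hpot gt hf).
have t6 : `|c2 * (\int[J]_z (f z.1 * z.2.1 ^+ 2) + \int[m_rho2 s t]_(x in cube) f x)| <= C * (c2 * (2 * X + 2 * A ^+ 2 + mass_rho2 s t)).
  rewrite normrM (ger0_norm c20) [leRHS]mulrCA ler_wpM2l// mulrDr.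
  by apply: (le_trans (ler_normD _ _)); exact: lerD.
apply: (le_trans (ler_normD _ _)); apply: (le_trans (lerD (ler_normB _ _) (lexx _))).
apply: (le_trans (lerD (lerD (ler_normD _ _) (lexx _)) (lexx _))).
apply: (le_trans (lerD (lerD (lerD t1 (le_trans t3 t10)) t4) t6)).
rewrite -!mulrDr ler_wpM2l//.
rewrite /Kp (mulrDr 2).
exact: (pressure_arith (And4 Cp0 (ltW A0) (normr_ge0 CF) c20) (And4 X0 r0 Z0 f0)).
Qed.

Lemma lin_bar_ruu i j : exists K, lin_bounded (bar_ruu s i j t) K.
Proof.
have i1 : L1 J (fun z => z.2.2 ord0 i * z.2.2 ord0 j).
  apply: (@L1_le _ _ _ J _ (fun z : E * Y => enorm z.2.2 ^+ 2) _ (gt_u2 gt)).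
    by apply: measurable_funM; exact: m22.
  by move=> z; exact: coord_mul_le.
have [K2 h2] := lin_bounded_charge (m_ruu s i j t).
eexists; exact: (lin_boundedD (lin_bounded_ymean (g := fun l => l.2 ord0 i * l.2 ord0 j) i1) h2).
Qed.

Lemma lin_bar_p : exists K, lin_bounded (bar_p F eta s t) K.
Proof.
have [K1 h1] := lin_bounded_charge (m_rF' s t).
eexists; apply: lin_boundedD; last (apply: lin_boundedZ); last first.
- exact: (lin_boundedD (lin_bounded_ymean (g := fun l => l.1 ^+ 2) (gt_rho2 gt)) (lin_bounded_measure (m_rho2 s t))).
- apply: lin_boundedB.
    exact: (lin_boundedD (lin_bounded_ymean (g := fun l => l.1 * F^`()%classic l.1) (gt_rF gt)) h1).
  exact: (lin_boundedD (lin_bounded_ymean (g := fun l => F l.1) (gt_F gt)) (lin_bounded_measure (m_F s t))).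
Qed.

Lemma lin_ru i : exists K, lin_bounded (fun f => \int[torus_measure]_x (f x * mv_ru s t x ord0 i)) K.
Proof.
eexists; have := lin_bounded_ymean (g := fun l => Num.sqrt l.1 * l.2 ord0 i) (L1_sru i).
congr (lin_bounded _ _); apply/funext => f; apply: eq_Rint => x; by rewrite mxE.
Qed.

Lemma lin_kernel i : exists K, lin_bounded (fun f => \int[torus_measure]_x (f x * (r x * convol (partial i k) r x))) K.
Proof.
have -> : partial i k = kd i := @kernel_partial R d D omega hmol eta i.
have [i1 _] := cform_convol (L1_dkernel hmol eta0 i) (pl2_rho gt) (pl2_rho gt).
by eexists; exact: (lin_bounded_L1 i1).
Qed.

Lemma kernel_bound i (f : E -> R) C : 0 < C -> buc (fun=> f) -> (forall x, `|f x| <= C) ->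
  `|\int[torus_measure]_x (f x * (r x * convol (partial i k) r x))| <= C * (knorm (kd i) * (2 * X + 2 * A ^+ 2)).
Proof.
move=> C0 hf fC; rewrite torus_measureE (cform_rho hmol eta0 gt i hf).
have pr_ := pl2_rho gt; have ikd := L1_dkernel hmol eta0 i; have n0 := knorm_ge0 (kd i).
pose g x := C^-1 * f x; have hg : buc (fun _ : R => g) := bucZ _ hf.
have g1 x : `|g x| <= 1 by rewrite normrM normfV (gtr0_norm C0) ler_pdivrMl// mulr1.
have pg : pl2 (fun x => g x * r x) := pl2_mul 0 hg pr_.
have -> : (fun x => f x * r x) = (fun x => C * (g x * r x)).
  by apply/funext => x; rewrite /g; field; rewrite gt_eqF.
rewrite (@cformZl _ _ _ ikd C _ _ pg pr_) normrM (gtr0_norm C0) ler_pM2l//.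
apply: (le_trans (cform_bound ikd pg pr_)); rewrite ler_wpM2l//.
have [_ _ q1] := pg; have [_ _ q2] := pr_.
have h1 : sq (fun x => g x * r x) <= sq r.
  apply: (le_Rint q1 q2) => x; rewrite exprMn ler_piMl ?sqr_ge0//.
  by rewrite -[leLHS]real_normK ?num_real// expr_le1.
have := sq_rho_le gt; have := rho2_le; lra.
Qed.

(** Epsilon times the time derivative of the i-th component of the momentum
    paired with a static field g of gradient dg. Restricting to static fields
    makes it an exact time derivative without asking for a time derivative of
    grad mu, which is only continuous in time. *)
Definition momentum_rate (e : R) (i : 'I_d) (g : E -> R) (dg : 'I_d -> E -> R) :=
  \sum_j bar_ruu s i j t (dg j) - e^-1 * \int[torus_measure]_x (g x * mv_ru s t x ord0 i)
  + bar_p F eta s t (dg i) + eta ^- 2 * \int[torus_measure]_x (g x * (r x * convol (partial i k) r x)).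

Lemma momentum_rateB e i (g g' : E -> R) (dg dg' : 'I_d -> E -> R) :
  buc (fun=> g) -> buc (fun=> g') -> (forall j, buc (fun=> dg j)) -> (forall j, buc (fun=> dg' j)) ->
  momentum_rate e i (fun x => g x - g' x) (fun j x => dg j x - dg' j x) = momentum_rate e i g dg - momentum_rate e i g' dg'.
Proof.
have bd (f : E -> R) (h : buc (fun=> f)) : exists C, forall x, `|f x| <= C.
  by have [C _ hC] := buc_bounded h; exists C => x; exact: (hC 0).
move=> h1 h2 h3 h4.
have [C1 c1] := bd _ h1; have [C2 c2_] := bd _ h2.
have [C3 c3] := bd _ (h3 i); have [C4 c4] := bd _ (h4 i).
have [? lp] := lin_bar_p; have [? lr] := lin_ru i; have [? lk] := lin_kernel i.
rewrite /momentum_rate (lin_sub lp (mst (h3 i)) (mst (h4 i)) c3 c4).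
rewrite (lin_sub lr (mst h1) (mst h2) c1 c2_) (lin_sub lk (mst h1) (mst h2) c1 c2_).
have -> : \sum_j bar_ruu s i j t (fun x => dg j x - dg' j x) = \sum_j bar_ruu s i j t (dg j) - \sum_j bar_ruu s i j t (dg' j).
  rewrite -sumrB; apply: eq_bigr => j _; have [? lj] := lin_bar_ruu i j.
  have [C5 c5] := bd _ (h3 j); have [C6 c6] := bd _ (h4 j).
  exact: (lin_sub lj (mst (h3 j)) (mst (h4 j)) c5 c6).
ring.
Qed.

Definition Kv := d%:R + (2 + 2 * A ^+ 2) + Kp + eta ^- 2 * \sum_i (knorm (kd i) * (2 + 2 * A ^+ 2)).

Lemma Kp_ge0 : 0 <= Kp.
Proof.
have [A0 _ _ _] := hA; have [_ _ _ _ [Cp0 _]] := hpot.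
have c20 : 0 <= c2 by rewrite invr_ge0 mulr_ge0// sqr_ge0.
have A20 := sqr_ge0 A.
have A30 : 0 <= 3 + 2 * A ^+ 2 by lra.
have h := mulr_ge0 c20 A30; have CF0 := normr_ge0 CF.
by rewrite /Kp; apply: (addr_ge0 _ h); move: A0; lra.
Qed.

Lemma Kv_ge0 : 0 <= Kv.
Proof.
have A20 : 0 <= 2 + 2 * A ^+ 2 by have := sqr_ge0 A; lra.
apply: addr_ge0.
  by apply: (addr_ge0 _ Kp_ge0); exact: addr_ge0.
apply: mulr_ge0; first by rewrite invr_ge0 sqr_ge0.
by apply: sumr_ge0 => i _; apply: (mulr_ge0 _ A20); exact: knorm_ge0.
Qed.

Lemma momentum_rate_bound e i g dg C : 0 < e -> 0 < C -> buc (fun=> g) -> (forall j, buc (fun=> dg j)) ->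
  (forall x, `|g x| <= C) -> (forall j x, `|dg j x| <= C) ->
  `|momentum_rate e i g dg| <= C * (Kv * (1 + X + Z + r2 + e ^- 2 * r2)).
Proof.
move=> e0 C0 hg hdg gC dgC; rewrite /momentum_rate.
have t1 : `|\sum_j bar_ruu s i j t (dg j)| <= C * (d%:R * r2).
  apply: (le_trans (ler_norm_sum _ _ _)); apply: (@le_trans _ _ (\sum_(j < d) C * r2)).
    by apply: ler_sum => j _; apply: bar_ruu_bound => //; exact: mst.
  by rewrite sumr_const card_ord mulr_natl mulrnAr.
have t2 := ru_bound i e0 hg gC.
have t3 := bar_p_bound (hdg i) (dgC i).
have t4 := kernel_bound i C0 hg gC.
have e20 : 0 <= eta ^- 2 by rewrite invr_ge0 sqr_ge0.
have X0 := devX_ge0; have Z0 := devZ_ge0; have r0 := r2_ge0.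
have e2r : 0 <= e ^- 2 * r2 by rewrite mulr_ge0// invr_ge0 sqr_ge0.
have A20 := sqr_ge0 A.
set W := 1 + X + Z + r2 + e ^- 2 * r2.
have hW1 : 1 <= W by rewrite /W; lra.
have kn j : 0 <= knorm (kd j) * (2 + 2 * A ^+ 2) by rewrite mulr_ge0 ?knorm_ge0//; lra.
have t4' : eta ^- 2 * `|\int[torus_measure]_x (g x * (r x * convol (partial i k) r x))| <= C * (eta ^- 2 * (\sum_i (knorm (kd i) * (2 + 2 * A ^+ 2))) * W).
  rewrite -mulrA [leRHS]mulrCA ler_wpM2l//; apply: (le_trans t4); rewrite ler_wpM2l ?(ltW C0)//.
  apply: (@le_trans _ _ (knorm (kd i) * (2 + 2 * A ^+ 2) * W)).
    rewrite -mulrA ler_wpM2l ?knorm_ge0// mulrDl.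
    have := ler_wpM2l A20 hW1; have : X <= W by rewrite /W; lra.
    by lra.
  rewrite ler_wpM2r ?(le_trans ler01 hW1)// (bigD1 i)//= lerDl; apply: sumr_ge0 => j _; exact: kn.
have Kp0 := Kp_ge0.
have u1 : d%:R * r2 <= d%:R * W by rewrite ler_wpM2l// /W; lra.
have u2 : 1 + 2 * X + 2 * A ^+ 2 + e ^- 2 * r2 <= (2 + 2 * A ^+ 2) * W.
  by have := ler_wpM2l A20 hW1; rewrite mulrDl /W; lra.
have u3 : Kp * (1 + X + Z) <= Kp * W by rewrite ler_wpM2l// /W; lra.
have v := lerD (lerD (le_trans t1 (ler_wpM2l (ltW C0) u1)) (le_trans t2 (ler_wpM2l (ltW C0) u2))) (lerD (le_trans t3 (ler_wpM2l (ltW C0) u3)) t4').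
have v' := le_trans v (_ : _ <= C * (Kv * W)).
have {v'} : `|\sum_j bar_ruu s i j t (dg j)| + e^-1 * `|\int[torus_measure]_x (g x * mv_ru s t x ord0 i)| + (`|bar_p F eta s t (dg i)| + eta ^- 2 * `|\int[torus_measure]_x (g x * (r x * convol (partial i k) r x))|) <= C * (Kv * W).
  by apply: v'; rewrite /Kv -!mulrDr ler_wpM2l ?(ltW C0)// -!mulrDl !addrA.
rewrite addrA; apply: le_trans.
apply: (le_trans (ler_normD _ _)); rewrite [`|eta ^- 2 * _|]normrM (ger0_norm e20).
apply: lerD (lexx _); apply: (le_trans (ler_normD _ _)); apply: lerD (lexx _).
by apply: (le_trans (ler_normB _ _)); rewrite [`|e^-1 * _|]normrM [`|e^-1|]ger0_norm ?invr_ge0 ?(ltW e0).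
Qed.

(** After the sign of the cross term has been changed, the momentum balance
    expresses it by the stress, the pressure and the interaction force, up to a
    momentum rate. The stress is at most the kinetic energy, the rest is the
    remainder. The momentum rate is wanted for a field that does not depend on
    time, so grad mu is frozen at a nearby time tau; the error is q times a
    quantity whose integral in time is bounded uniformly in epsilon. *)
Lemma rate_bound e q tau : 0 < e -> 0 < q ->
  (forall i x, `|a i t x - a i tau x| <= q) -> (forall i j x, `|b i j t x - b i j tau x| <= q) ->
  (forall i j x, `|b i j t x| <= A) ->
  - (e ^- 2 * r2) - e^-1 * (\sum_i \int[tor]_x (a i t x * mv_ru s t x ord0 i))
  - \int[tor]_x (M t x * r x) + \int[tor]_x (P t x * M t x) <=
  remainder omega eta F P M a b s t - \sum_i momentum_rate e i (a i tau) (fun j => b i j tau)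
  + A * d%:R ^+ 2 * r2 + q * (d%:R * Kv * (1 + X + Z + r2 + e ^- 2 * r2)).
Proof.
move=> e0 q0 ha hb hbA.
have ba i t' := buc_static t' (ref_ba href i); have bb i j t' := buc_static t' (ref_bb href i j).
have h1 := damping_young e0.
have h2 : \sum_i momentum_rate e i (a i tau) (fun j => b i j tau) - \sum_i momentum_rate e i (a i t) (fun j => b i j t)
    <= q * (d%:R * Kv * (1 + X + Z + r2 + e ^- 2 * r2)).
  rewrite -sumrB -[d%:R * Kv * _]mulrA [leRHS]mulrCA mulr_natl -[X in _ <= _ *+ X](card_ord d) -sumr_const.
  apply: ler_sum => i _; rewrite -momentum_rateB//; apply: (le_trans (ler_norm _)).
  apply: momentum_rate_bound => //.
  - exact: (bucB (ba i tau) (ba i t)).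
  - by move=> j; exact: (bucB (bb i j tau) (bb i j t)).
  - by move=> x; rewrite distrC.
  - by move=> j x; rewrite distrC.
have [? lp] := lin_bar_p.
have mb i : measurable_fun setT (b i i t) by exact: mst.
have hp := lin_sum lp mb (fun i => hbA i i).
have h3 : \sum_i momentum_rate e i (a i t) (fun j => b i j t) = \sum_i \sum_j bar_ruu s i j t (b i j t)
   - e^-1 * (\sum_i \int[tor]_x (a i t x * mv_ru s t x ord0 i)) + bar_p F eta s t (fun x => \sum_i b i i t x)
   + eta ^- 2 * \sum_i \int[tor]_x (a i t x * (r x * convol (partial i k) r x)).
  by rewrite hp /momentum_rate !big_split /= sumrN -!mulr_sumr.
have h4 : \sum_i \sum_j bar_ruu s i j t (b i j t) <= A * d%:R ^+ 2 * r2.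
  apply: (@le_trans _ _ (\sum_(i < d) \sum_(j < d) A * r2)).
    apply: ler_sum => i _; apply: ler_sum => j _; apply: (le_trans (ler_norm _)).
    by apply: bar_ruu_bound => //; exact: mst.
  by rewrite sum_sum_cst mulrA [_ * A]mulrC.
rewrite h3 in h2; rewrite /remainder.
move: h1 h2 h4.
set S1 := e^-1 * _; set S2 := \int[tor]_x (_ * r x); set S3 := bar_p _ _ _ _ _; set S4 := eta ^- 2 * _; set S5 := \sum_i momentum_rate _ _ _ _.
lra.
Qed.

End mv_static_bounds.

(** * Measurability in time *)

Section time_measurability.
Context {R : realType} {d : nat}.
Local Notation E := 'rV[R]_d.
Local Notation Y := (R * E)%type.
Local Notation tor := (torus_prob d : probability E R).
Local Notation leb := (@lebesgue_row R d).
Local Notation RT := (measurableTypeR R).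
Local Opaque lebesgue_row.
Variables (T : R) (T0 : 0 < T) (s : mv_data R d).
Local Notation tm := (time_measure T).
Local Notation I0 := (`]0, T[%classic : set RT).

Let mI0 : measurable I0. Proof. exact: measurable_itv. Qed.

(** Concentration measures are measurable in time on ]0, T[ only; extension by
    0 gives functions to which integration theory over the line applies. *)
Definition on_time (f : RT -> R) : RT -> R := f \_ I0.

Lemma on_timeE f t : 0 < t < T -> on_time f t = f t.
Proof. by move=> tT; rewrite /on_time patchT// inE /= in_itv. Qed.

Lemma tI_on_time t f : tI T t (on_time f) = tI T t f.
Proof.
by apply: eq_integral_mrestr => x /=; rewrite in_itv /= => xT; rewrite on_timeE.
Qed.

(** Truncating at the almost everywhere bound gives a bounded function in the
    same class. *)
Lemma L1_on_time (f : RT -> R) C : measurable_fun I0 f -> {ae tm, forall t : RT, `|f t| <= C} -> L1 tm (on_time f).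
Proof.
move=> mf fC; have mfT : measurable_fun setT (on_time f) by apply/(measurable_restrictT _ mI0).
pose g t := Num.max (- C) (Num.min (on_time f t) C).
have mg : measurable_fun setT (g : RT -> R).
  by apply: measurable_maxr => //; exact: measurable_minr.
apply: (@ae_L1 _ _ _ tm (on_time f) g) => //.
  apply: (@tm_bounded _ _ T0 _ `|C|) => // t; rewrite /g ler_norml.
  have := ler_norm C; have := ler_norm (- C); rewrite normrN => h1 h2.
  by rewrite le_max lerN2 h2 /= ge_max h1 ge_min h2 orbT.
have := ae_tm_itv T; move: fC; apply: filterS2 => t; rewrite ler_norml => /andP[h1 h2] tT.
by rewrite /g on_timeE// min_l// max_r.
Qed.

Lemma ae_L1_joint (g : Y -> R) : measurable_fun setT g -> time_space_integrable T s g ->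
  {ae tm, forall t : RT, L1 (joint s t) (fun z => g z.2)}.
Proof.
move=> mg hg.
have mn : measurable_fun setT (fun l => `|g l|%:E) by apply/measurable_EFinP; exact: measurableT_comp.
have m1 : measurable_fun setT (fun z : R * E => \int[young s z]_l `|g l|%:E)%E.
  by apply: (measurable_fun_integral_kernel (l := young s)) => //; exact: measurable_kernel.
have m2 : measurable_fun setT (fun t : R => \int[tor]_x \int[young s (t, x)]_l `|g l|%:E)%E.
  apply: (@measurable_fun_fubini_tonelli_F _ _ _ _ _ tor (fun z : R * E => \int[young s z]_l `|g l|%:E)%E) => //.
  by move=> z; exact: integral_ge0.
have [_ fin _] := @fine_ge0_L1 _ RT R tm _ m2 (fun t => integral_ge0 _ (fun x _ => integral_ge0 _ (fun l _ => normr_ge0 (g l) : (0 <= `|g l|%:E)%E))) hg.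
move: fin; apply: filterS => t ft; apply: L1P.
  exact: (measurableT_comp mg measurable_snd).
rewrite (@ge0_integral_joint _ _ s t (fun z => `|g z.2|%:E)%E)//; last first.
  by apply/measurable_EFinP; apply: measurableT_comp => //; exact: (measurableT_comp mg measurable_snd).
by rewrite ltey_eq ft.
Qed.

Lemma measurable_pairing (f : R -> E -> R) (g : Y -> R) : measurable_fun setT (fun z : R * E => f z.1 z.2) ->
  measurable_fun setT g -> measurable_fun setT (fun t : RT => \int[tor]_x (f t x * ymean s g t x)).
Proof.
move=> mf mg; apply: (@measurable_Rint_section R _ _ RT _ tor (fun z : R * E => f z.1 z.2 * ymean s g z.1 z.2)).
by apply: measurable_funM => //; exact: measurable_ymean.
Qed.

Lemma measurable_static (f : E -> R) (g : Y -> R) : measurable_fun setT f ->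
  measurable_fun setT g -> measurable_fun I0 (fun t : RT => \int[torus_measure]_x (f x * ymean s g t x)).
Proof.
move=> mf mg; apply: measurable_funTS; apply: (measurable_pairing (f := fun=> f)) => //.
exact: (measurableT_comp mf measurable_snd).
Qed.

Lemma measurable_measure_pairing (m : R -> {finite_measure set E -> \bar R}) (f : E -> R) C :
  weakly_measurable T m -> measurable_fun setT f -> (forall x, `|f x| <= C) ->
  measurable_fun I0 (fun t : RT => \int[m t]_(x in cube) f x).
Proof.
move=> wm mf fC; apply: (@measurable_functional _ _ T (fun t g => \int[m t]_(x in cube) g x) f C) => //.
  by move=> t; exists (fine (m t cube)); exact: lin_bounded_measure.
move=> A mA; rewrite (_ : (fun t : RT => _) = (fun t => fine (m t (cube `&` A)))).
  apply: (measurableT_comp (@fine_measurable R setT measurableT)).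
  by apply: wm; [apply: measurableI => //; exact: measurable_cube|exact: subIsetl].
apply/funext => t; rewrite /Rintegral integral_indic//; last exact: measurable_cube.
by rewrite setIC.
Qed.

Lemma measurable_charge_pairing (m : R -> {charge set E -> \bar R}) (f : E -> R) C :
  weakly_measurable T m -> measurable_fun setT f -> (forall x, `|f x| <= C) ->
  measurable_fun I0 (fun t : RT => charge_integral (m t) f).
Proof.
move=> wm mf fC; apply: (@measurable_functional _ _ T (fun t g => charge_integral (m t) g) f C) => //.
  by move=> t; exact: lin_bounded_charge.
move=> A mA; rewrite (_ : (fun t : RT => _) = (fun t => fine (m t (cube `&` A)))).
  apply: (measurableT_comp (@fine_measurable R setT measurableT)).
  by apply: wm; [apply: measurableI => //; exact: measurable_cube|exact: subIsetl].
by apply/funext => t; rewrite charge_integral_indic.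
Qed.

Lemma measurable_convol_rho (k : E -> R) : measurable_fun setT k ->
  measurable_fun setT (fun z : R * E => convol k (mv_rho s z.1) z.2).
Proof.
move=> mk; apply: (@measurable_Rint_section R _ _ (R * E)%type _ leb (fun z : (R * E) * E => k z.2 * mv_rho s z.1.1 (z.1.2 - z.2))).
apply: measurable_funM; first exact: (measurableT_comp mk measurable_snd).
have mr := measurable_ymean s (@measurable_fst _ _ R E).
have mp : measurable_fun setT (fun z : (R * E)%type * E => (z.1.1, z.1.2 - z.2) : (R * E)%type); last exact: (measurableT_comp mr mp).
apply/measurable_fun_pairP; split; first exact: (measurableT_comp measurable_fst measurable_fst).
apply: measurable_rowP => i; rewrite /comp /=; under eq_fun do rewrite !mxE.
apply: measurable_funB.
  exact: (measurableT_comp (measurable_coord i) (measurableT_comp measurable_snd measurable_fst)).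
exact: (measurableT_comp (measurable_coord i) measurable_snd).
Qed.

Lemma measurable_kernel_pairing (f k : E -> R) : measurable_fun setT f -> measurable_fun setT k ->
  measurable_fun setT (fun t : RT => \int[tor]_x (f x * (mv_rho s t x * convol k (mv_rho s t) x))).
Proof.
move=> mf mk; apply: (@measurable_Rint_section R _ _ RT _ tor (fun z : R * E => f z.2 * (mv_rho s z.1 z.2 * convol k (mv_rho s z.1) z.2))).
apply: measurable_funM; first exact: (measurableT_comp mf measurable_snd).
apply: measurable_funM; last exact: measurable_convol_rho.
exact: (measurable_ymean s (@measurable_fst _ _ R E)).
Qed.

End time_measurability.

(** * Time evolution of the measure-valued solution *)

Section mv_evolution.
Context {R : realType} {d : nat}.
Local Notation E := 'rV[R]_d.
Local Notation Y := (R * E)%type.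
Local Notation tor := (torus_prob d : probability E R).
Local Notation leb := (@lebesgue_row R d).
Local Notation RT := (measurableTypeR R).
Local Opaque lebesgue_row.

Lemma sum_delta (n : nat) (i : 'I_n) (f : 'I_n -> R) : \sum_j (j == i)%:R * f j = f i.
Proof.
by rewrite (bigD1 i)//= eqxx mul1r big1 ?addr0// => j /negPf ->; rewrite mul0r.
Qed.

Lemma ae_and d' (U : measurableType d') (m : {measure set U -> \bar R}) (P Q : U -> Prop) :
  {ae m, forall x, P x} -> {ae m, forall x, Q x} -> {ae m, forall x, P x /\ Q x}.
Proof. by apply: filterS2 => x. Qed.

(** Integrals over ]0, t[ in the dissipation inequality become primitives. *)
Lemma Rint_time_measure (T t : R) (f : R -> R) : 0 < t < T -> measurable_fun `]0, T[%classic (f : RT -> R) ->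
  \int[time_measure t]_s f s = tI T t f.
Proof.
move=> /andP[t0 tT] mf; have T0 := lt_trans t0 tT.
have mg : measurable_fun setT (on_time T f) by apply/(measurable_restrictT _ (measurable_itv _)).
rewrite -tI_on_time; transitivity (\int[time_measure t]_s on_time T f s).
  apply: eq_integral_mrestr => s /=; rewrite in_itv /= => /andP[s0 st].
  by rewrite on_timeE// s0 (lt_trans st tT).
rewrite Rint_tm// /tI Rint_tm//; last by apply: measurable_funM => //; exact: measurable_lt_ind.
rewrite /Rintegral integral_mkcond [in RHS]integral_mkcond; congr fine.
apply: eq_integral => s _; rewrite /patch !mem_setE /= !in_itv /=.
have [s0|] //= := ltP 0 s; have [st|st] := ltP s t; first by rewrite (lt_trans st tT) mul1r.
by rewrite mul0r; case: ifP.
Qed.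

Variables (D : R) (omega : E -> R) (hmol : mollifier D omega).
Variables (eta : R) (eta0 : 0 < eta) (T : R) (T0 : 0 < T).
Variables (F F1 F1' F1'' F2 F2' F2'' F''' : R -> R) (M2 B Cp CP : R) (CP0 : 0 < CP).
Hypothesis hpot : potential_data CP F F1 F1' F1'' F2 F2' F2'' F''' M2 B Cp.
Local Notation F' := (fun u => F1' u + F2' u).
Local Notation F'' := (fun u => F1'' u + F2'' u).
Variables (rho0 : E -> R) (P mu M : R -> E -> R) (a : 'I_d -> R -> E -> R) (b : 'I_d -> 'I_d -> R -> E -> R) (K : R -> R).
Hypothesis href : reference omega eta T F F' F'' rho0 P mu M a b K.
Local Notation k := (scaled omega eta).
Local Notation kd := (dkernel omega eta).
Local Notation pr := (pressure F F').
Local Notation pr' := (fun u => u * F'' u).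

Definition reference_bounds (A : R) : Prop :=
  [/\ [/\ 0 < A, forall t x, `|P t x| <= A, forall t x, `|pr (P t x)| <= A & forall t x, `|pr' (P t x)| <= A],
     [/\ forall t x, `|mu t x| <= A, forall t x, `|M t x| <= A, forall i t x, `|a i t x| <= A &
         forall i j t x, `|b i j t x| <= A],
     forall t x, `|\sum_i b i i t x| <= A & forall t, `|K t| <= A].

Variables (A : R) (hA : reference_bounds A).
Variables (CF : R) (u0 : E -> E) (s : mv_data R d) (eps : R) (eps0 : 0 < eps).
Hypothesis hs : mv_solution omega F T eps eta s CF rho0 u0.
Hypothesis hdiss : dissipative omega F T eps eta s rho0 u0.
Hypothesis hpo : nonlocal_poincare omega T eta s CP rho0.
Variables (e0 : R) (hE0 : E_0 omega F eta rho0 u0 <= e0).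
Local Notation tm := (time_measure T).
Local Notation tI := (tI T).
Local Notation good := (good_time omega eta T F CP P CF s).
Local Notation X := (devX P s).
Local Notation Z := (devZ F1 F1' P s).
Local Notation r2 := (fun t => bar_ru2 s t (cst 1)).
Local Notation I0 := (`]0, T[%classic : set RT).

Lemma ae_good : {ae tm, forall t : RT, good t}.
Proof.
case: hs => -[hper hpos hb1 hb2 [i1 i2 i3 i4]] [_ _ hruu hrF] _ _.
have [_ hP _ _] : [/\ 0 < A, forall t x, `|P t x| <= A, forall t x, `|pr (P t x)| <= A & forall t x, `|pr' (P t x)| <= A] by case: hA.
have mF : measurable_fun setT (F : R -> R) := continuous_measurable_fun (DER_continuous (dF hpot)).
have mF' : measurable_fun setT (F^`()%classic : R -> R).
  by rewrite (F'E hpot); exact: (continuous_measurable_fun (DER_continuous (dF' hpot))).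
have m1 : measurable_fun setT (fst : Y -> R) := measurable_fst.
have j1 := @ae_L1_joint R d T s _ (measurable_funX 2 m1) i1.
have j2 := @ae_L1_joint R d T s _ (measurable_funX 2 (measurableT_comp (@measurable_enorm R d) measurable_snd)) i2.
have j3 := @ae_L1_joint R d T s _ (measurableT_comp mF m1) i3.
have j4 := @ae_L1_joint R d T s _ (measurable_funM m1 (measurableT_comp mF' m1)) i4.
have g1 := ae_and (ae_and (ae_tm_itv T) hpos) (ae_and (ae_and j1 j2) (ae_and j3 j4)).
have := ae_and (ae_and (ae_and hruu hrF) hpo) g1.
apply: filterS => t [[[h1 h2] h3] [[tT h4] [[h5 h6] [h7 h8]]]].
have mc := @measurable_cube R d.
split=> //.
- by move=> B' mB x i; exact: hper.
- have mN : measurable [set z : E * Y | z.2.1 < 0].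
    rewrite (_ : [set z : E * Y | _] = (fun z : E * Y => z.2.1) @^-1` [set` `]-oo, 0[%R]).
      by rewrite -[X in measurable X]setTI; exact: (measurableT_comp m1 measurable_snd).
    by apply/seteqP; split => z /=; rewrite in_itv.
  exists [set z : E * Y | z.2.1 < 0]; split=> //; last first.
    by move=> z /= /negP; rewrite -ltNge.
  rewrite -[N in joint s t N]setIT -(@integral_indic _ _ _ (joint s t))//.
  rewrite (@ge0_integral_joint _ _ s t (fun z => (\1_[set z : E * Y | z.2.1 < 0] z)%:E)%E)//; last first.
    by apply/measurable_EFinP; exact: measurable_indic.
  have [N [mN' N0 sN]] := h4.
  apply/eqP; rewrite eq_le; apply/andP; split; last by apply: integral_ge0 => x _; exact: integral_ge0.
  rewrite -[leRHS](@integral0 _ _ R tor setT).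
  apply: (ge0_integral_le_off (measurableC mN')) => //; [by rewrite setCK| |by move=> x; exact: integral_ge0].
  move=> x nx; rewrite (_ : (fun l : Y => _) = (fun l => (\1_[set l : Y | l.1 < 0] l)%:E)).
    rewrite integral_indic ?setIT//; first by apply: contrapT => h; apply: nx; exact: sN.
    rewrite (_ : [set l : Y | l.1 < 0] = fst @^-1` [set` `]-oo, 0[%R]).
      by rewrite -[X in measurable X]setTI; exact: m1.
    by apply/seteqP; split => z /=; rewrite in_itv.
  by apply/funext => l; rewrite !indicE.
- exact: h1.
- by have := h2 _ mc (@subset_refl _ _).
- apply: h3.
  + exact: (measurable_funTS (buc_measurable (ref_bP href))).
  + exists A => t' x tT'; rewrite (ref_gt0 href)//=; exact: (le_trans (ler_norm _)).
  + by move=> t' _; case: (ref_bP href).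
  + move=> t' /andP[t0 t1]; rewrite /average !torus_measureE.
    by apply: (ref_mass href); rewrite !ltW.
Qed.

Lemma r2_measurable : measurable_fun I0 (r2 : RT -> R).
Proof.
case: hs => _ [[w1 w2 w3 w4 w5] _ _ _] _ _.
apply: measurable_funD.
  apply: (@measurable_static _ _ T s (cst 1) (fun l : Y => enorm l.2 ^+ 2)) => //.
  exact: (measurable_funX 2 (measurableT_comp (@measurable_enorm R d) measurable_snd)).
by apply: (@measurable_measure_pairing _ _ T _ _ 1) => // x; rewrite /cst normr1.
Qed.

Lemma tI_r2_ge0 t : 0 <= tI t r2.
Proof.
have H : {ae tm, forall u : RT, (u < t)%R%:R * r2 u = `|(u < t)%R%:R * r2 u|}.
  by move: (ae_and (ae_tm_itv T) ae_good); apply: filterS => u [_ gu]; rewrite ger0_norm// mulr_ge0// (r2_ge0 gu).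
by rewrite /tI (ae_eq_Rint H); exact: Rint_ge0.
Qed.

Local Notation c0 := (CP^-1 - M2 / 2).
(** From A rho <= c0 / 4 rho^2 + A^2 / c0 and rho^2 <= 2 (rho - P)^2 + 2 A^2.
    Neither this constant nor those derived from it depend on epsilon: the
    whole argument hinges on this uniformity. *)
Definition gap_const := c0 / 2 * A ^+ 2 + A ^+ 2 / c0.
Definition energy_level := e0 + gap_const + A.
Definition energy_const := energy_level * (2 / c0 + 4).

Lemma c0_gt0 : 0 < c0.
Proof.
have [_ _ _ [M20 M2lt _ _] _] := hpot.
have : 0 < CP^-1 by rewrite invr_gt0.
by move: M2lt; set c := CP^-1; lra.
Qed.

Let hA4 : [/\ 0 < A, forall t x, `|P t x| <= A, forall t x, `|pr (P t x)| <= A & forall t x, `|pr' (P t x)| <= A].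
Proof. by case: hA. Qed.

Lemma rho_pairing_bound t (f : E -> R) : good t -> buc (fun=> f) -> (forall x, `|f x| <= A) ->
  `|\int[tor]_x (f x * mv_rho s t x)| <= c0 / 2 * X t + gap_const.
Proof.
move=> gt hf fA; have c00 := c0_gt0; have [A0 _ _ _] := hA4.
rewrite (joint_rho gt hf).
have ic : L1 (joint s t) (fun=> A ^+ 2 / c0 : R).
  by apply: (@L1_bounded _ _ _ _ _ `|A ^+ 2 / c0|); [exact: joint_lty|exact: measurable_cst|].
have i2 := L1Z (c0 / 4) (gt_rho2 gt).
apply: (@le_trans _ _ (\int[joint s t]_z (c0 / 4 * z.2.1 ^+ 2 + A ^+ 2 / c0))).
  apply: (le_norm_Rint (L1_joint_mul hf (L1_rho gt)) (L1D i2 ic)) => z.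
  rewrite normrM; apply: (@le_trans _ _ (A * `|z.2.1|)); first by rewrite ler_wpM2r.
  have := mulr_ge0 (ltW c00) (sqr_ge0 (`|z.2.1| - 2 * A / c0)).
  rewrite -(real_normK (num_real z.2.1)); set y := `|_|; set c := c0 in c00 *.
  have -> : c * (y - 2 * A / c) ^+ 2 = c * y ^+ 2 - 4 * (A * y) + 4 * (A ^+ 2 / c) by field; rewrite gt_eqF.
  lra.
rewrite (RintD i2 ic) (RintZ _ (gt_rho2 gt)) (@Rint_cst_prob _ _ _ (joint s t) _ (jointT s t)).
have := rho2_le href gt hA4 => h.
have := ler_wpM2l (ltW c00) h; rewrite /gap_const; set c := c0; lra.
Qed.

(** Coercivity holds for theta = E - int rho mu - K rather than for E, but the
    linear term is absorbed by half of the quadratic one. The dissipation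
    inequality then bounds the deviations and, with the factor epsilon^-2, the
    integral of the kinetic energy. *)
Lemma energy_bounds : {ae tm, forall t : RT, [/\ good t, X t + Z t + r2 t <= energy_const,
  eps ^- 2 * tI t r2 <= energy_const &
  E_mvs omega F eta s t + eps ^- 2 * tI t r2 <= E_0 omega F eta rho0 u0] }.
Proof.
have c00 := c0_gt0.
move: (ae_and ae_good hdiss); apply: filterS => t [gt].
rewrite (Rint_time_measure (gt_T gt) r2_measurable) => hE.
have h1 := coercive hmol eta0 CP0 hpot href gt.
have [_ [bmu _ _ _] _ bK] := hA.
have h2 := rho_pairing_bound gt (buc_static t (ref_bmu href)) (bmu t).
have h3 := bK t.
have D0 : 0 <= eps ^- 2 * tI t r2 by rewrite mulr_ge0 ?tI_r2_ge0// invr_ge0 sqr_ge0.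
have X0 := devX_ge0 P s t; have Z0 := devZ_ge0 hpot P s t; have r0 := r2_ge0 gt.
have key : devY s t + Z t + c0 / 2 * X t + eps ^- 2 * tI t r2 <= energy_level.
  move: h1 h2 h3; rewrite /theta /energy_level !ler_norml.
  rewrite (@eq_Rint _ _ _ tor (fun x => mv_rho s t x * mu t x) (fun x => mu t x * mv_rho s t x)); last by move=> x; rewrite mulrC.
  move: hE hE0; set c := c0; set N := \int[tor]_x _; set E1 := E_mvs _ _ _ _ _; set E2 := E_0 _ _ _ _ _; set D1 := eps ^- 2 * _.
  by move=> q1 q2 q3 /andP[q4 q5] /andP[q6 q7]; lra.
have hY : r2 t = 2 * devY s t by rewrite /devY; field.
have Y0 : 0 <= devY s t by rewrite /devY mulr_ge0.
have hc : 0 <= c0 / 2 * X t by rewrite mulr_ge0// divr_ge0// ltW.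
have L0 : 0 <= energy_level.
  by apply: le_trans key; apply: addr_ge0 D0; apply: addr_ge0 hc; exact: addr_ge0.
have hX : X t <= energy_level * (2 / c0).
  rewrite mulrA ler_pdivlMr// [_ * c0]mulrC; move: key hc Y0 Z0 D0; set c := c0; lra.
have hx : 0 <= energy_level * (2 / c0) by rewrite mulr_ge0// divr_ge0// ltW.
rewrite /energy_const mulrDr; split => //.
  by rewrite hY; move: hX key hc Y0 Z0 D0 hx; set w := _ * (2 / c0); lra.
by move: key hc Y0 Z0 D0 hx; set w := _ * (2 / c0); lra.
Qed.

Lemma energy_const_ge0 : 0 <= energy_const.
Proof.
have h0T : 0 <= (0 : R) <= T by rewrite lexx ltW.
have [t [_ _ [gt h _ _]]] := ae_tm_dense T0 energy_bounds h0T ltr01.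
apply: le_trans h; apply: addr_ge0 (r2_ge0 gt); apply: addr_ge0; [exact: devX_ge0|exact: (devZ_ge0 hpot)].
Qed.

Lemma L1_ae_bounded (f : RT -> R) C : measurable_fun setT f -> {ae tm, forall t : RT, `|f t| <= C} -> L1 tm f.
Proof.
move=> mf fC; have i1 := L1_on_time T0 (measurable_funTS mf) fC.
apply: (ae_L1 mf i1); move: (ae_tm_itv T); apply: filterS => t tT; by rewrite on_timeE.
Qed.

Lemma L1_rho_pairing (f : R -> E -> R) : buc f -> (forall t x, `|f t x| <= A) ->
  L1 tm (fun t : RT => \int[tor]_x (f t x * mv_rho s t x)).
Proof.
move=> hf fA; apply: (L1_ae_bounded (C := c0 / 2 * energy_const + gap_const)).
  exact: (@measurable_pairing _ _ s f fst (buc_measurable hf) measurable_fst).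
move: energy_bounds; apply: filterS => t [gt h _ _].
apply: (le_trans (rho_pairing_bound gt (buc_static t hf) (fA t))).
rewrite lerD2r ler_wpM2l ?divr_ge0 ?(ltW c0_gt0)//; apply: le_trans h.
by rewrite -addrA lerDl addr_ge0 ?(devZ_ge0 hpot)// (r2_ge0 gt).
Qed.

Definition momentum_const := 1 + 2 * energy_const + 2 * A ^+ 2 + energy_const.

Lemma ru_pairing_bound i t (f : E -> R) C : good t -> X t + Z t + r2 t <= energy_const ->
  buc (fun=> f) -> (forall x, `|f x| <= C) ->
  `|\int[tor]_x (f x * mv_ru s t x ord0 i)| <= C * momentum_const.
Proof.
move=> gt h hf fC; have C0 : 0 <= C := le_trans (normr_ge0 _) (fC 0).
have := ru_bound href gt hA4 i ltr01 hf fC; rewrite invr1 mul1r expr1n invr1 mul1r => hh.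
apply: (le_trans hh); rewrite ler_wpM2l// /momentum_const.
have := devX_ge0 P s t; have := devZ_ge0 hpot P s t; have := r2_ge0 gt; move: h => /=; lra.
Qed.

Lemma measurable_ru_pairing i (f : R -> E -> R) : measurable_fun setT (fun z : R * E => f z.1 z.2) ->
  measurable_fun setT (fun t : RT => \int[tor]_x (f t x * mv_ru s t x ord0 i)).
Proof.
move=> mf; have mg : measurable_fun setT (fun l : Y => Num.sqrt l.1 * l.2 ord0 i).
  apply: measurable_funM; last exact: (measurableT_comp (measurable_coord i) measurable_snd).
  exact: (measurableT_comp (@continuous_measurable_fun R Num.sqrt (@sqrt_continuous R)) measurable_fst).
have := @measurable_pairing _ _ s f _ mf mg; congr (measurable_fun _ _).
by apply/funext => t; apply: eq_Rint => x; rewrite mxE.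
Qed.

Lemma L1_ru_pairing i (f : R -> E -> R) : buc f -> L1 tm (fun t : RT => \int[tor]_x (f t x * mv_ru s t x ord0 i)).
Proof.
move=> hf; have [C C0 fC] := buc_bounded hf; apply: (L1_ae_bounded (C := C * momentum_const)).
  exact: (measurable_ru_pairing i (buc_measurable hf)).
move: energy_bounds; apply: filterS => t [gt h _ _].
exact: (ru_pairing_bound i gt h (buc_static t hf) (fC t)).
Qed.

Lemma L1_cutoff t h (f : RT -> R) : 0 < h -> L1 tm f ->
  L1 tm (fun s : RT => dcutoff t h s * f s) /\ L1 tm (fun s : RT => cutoff t h s * f s).
Proof.
move=> h0 hf; split.
  apply: (@L1_mul_bounded _ _ _ tm (dcutoff t h) f h^-1) => //.
    exact: (continuous_measurable_fun (@cont_dcutoff R t h)).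
  move=> x; have /andP[l1 l2] := dcutoff_le0 t x h0; rewrite ler_norml l1 (le_trans l2)//.
  by rewrite invr_ge0 ltW.
apply: (@L1_mul_bounded _ _ _ tm (cutoff t h) f 1) => //.
  exact: (continuous_measurable_fun (@cont_cutoff R t h)).
by move=> x; have /andP[l1 l2] := cutoff_itv t h x; rewrite ger0_norm.
Qed.

(** The weak continuity equation tested with the chemical potential times a
    cutoff in time. *)
Lemma density_evolution : {ae tm, forall t : RT, \int[tor]_x (mu t x * mv_rho s t x) =
  \int[tor]_x (mu 0 x * rho0 x) + tI t (fun s' => \int[tor]_x (M s' x * mv_rho s s' x)
     + eps^-1 * \sum_i \int[tor]_x (a i s' x * mv_ru s s' x ord0 i))}.
Proof.
have [_ [bmuA bMA baA _] _ _] := hA.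
have bmu := ref_bmu href; have bM := ref_bM href; have ba i := ref_ba href i.
have iu := L1_rho_pairing bmu bmuA.
have i1 := L1_rho_pairing bM bMA.
have i2 : L1 tm (fun t : RT => eps^-1 * \sum_i \int[tor]_x (a i t x * mv_ru s t x ord0 i)).
  by apply: L1Z; apply: L1_sum => i; exact: L1_ru_pairing.
apply: (weak_evolution T0 iu (L1D i1 i2)) => t h t0 h0 th.
case: hs => _ _ hwc _.
have := hwc _ (test_fun T0 bmu bM ba (ref_Dmu href) (ref_mut href) h0 th).
rewrite torus_measureE (test_0 T0 mu t0 h0) => H; rewrite -[RHS]H; congr (_ + _).
have [j1 _] := L1_cutoff t h0 iu; have [_ j2] := L1_cutoff t h0 (L1D i1 i2).
rewrite -(RintD j1 j2); apply: ae_eq_Rint.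
move: (ae_and (ae_tm_itv T) ae_good); apply: filterS => u [_ gu].
have /andP[u0' uT] := gt_T gu; have u0_ := ltW u0'.
rewrite torus_measureE.
have pr_ := pl2_rho gu.
have l1 (f : R -> E -> R) (hf : buc f) : L1 tor (fun x => f u x * mv_rho s u x) := pl2M (pl2_buc u hf) pr_.
have l2 i : L1 tor (fun x => a i u x * mv_ru s u x ord0 i).
  have [C _ fC] := buc_bounded (ba i).
  have [_ h2 _] := @Rint_ymean _ _ s u (a i u) (fun l : Y => Num.sqrt l.1 * l.2 ord0 i) C (buc_measurable_at u (ba i)) (fC u) (L1_sru gu i).
  by move: h2; congr (integrable _ _ _); apply/funext => x; rewrite /= mxE.
set q1 := dcutoff t h u; set q2 := cutoff t h u.
rewrite -(RintZ q1 (l1 _ bmu)) -Rint_sum// -(RintZ _ (L1_sum _ l2)) -(RintD (l1 _ bM) (L1Z _ (L1_sum _ l2))).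
have l3 := L1D (l1 _ bM) (L1Z eps^-1 (L1_sum (index_enum 'I_d) l2)).
rewrite -(RintZ q2 l3) -(RintD (L1Z q1 (l1 _ bmu)) (L1Z q2 l3)).
apply: eq_Rint => x; rewrite (test_dt T0 bmu (ref_mut href) h0 th x (gt_T gu)).
have -> : \sum_i partial i (test T mu t h u) x * mv_ru s u x ord0 i = q2 * \sum_i a i u x * mv_ru s u x ord0 i.
  rewrite mulr_sumr; apply: eq_bigr => i _; by rewrite (test_partial T0 (ref_Dmu href) t h i u0_) mulrA.
by rewrite -/q1 -/q2; ring.
Qed.

Section static_field.
Variables (i : 'I_d) (g : E -> R) (dg : 'I_d -> E -> R).
Hypotheses (bg : buc (fun=> g)) (bdg : forall j, buc (fun=> dg j)) (Dg : forall j, HD j g (dg j)).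
Variables (C : R) (C0 : 0 < C) (gC : forall x, `|g x| <= C) (dgC : forall j x, `|dg j x| <= C).
Local Notation rate := (fun t => momentum_rate omega eta F s t eps i g dg).

Lemma rate_measurable : measurable_fun I0 (rate : RT -> R).
Proof.
case: hs => _ [[w1 w2 w3 w4 w5] _ _ _] _ _.
have ms (f : E -> R) (h : buc (fun=> f)) : measurable_fun setT f := buc_measurable_at 0 h.
have mF : measurable_fun setT (F : R -> R) := continuous_measurable_fun (DER_continuous (dF hpot)).
have mF' : measurable_fun setT (F^`()%classic : R -> R).
  by rewrite (F'E hpot); exact: (continuous_measurable_fun (DER_continuous (dF' hpot))).
have m1 : measurable_fun setT (fst : Y -> R) := measurable_fst.
have m2 j : measurable_fun setT (fun l : Y => l.2 ord0 j) := measurableT_comp (measurable_coord j) measurable_snd.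
have mk : measurable_fun setT (partial i k).
  have -> : partial i k = kd i := @kernel_partial R d D omega hmol eta i.
  exact: L1_measurable (L1_dkernel hmol eta0 i).
apply: measurable_funD; first apply: measurable_funD; first apply: measurable_funB.
- apply: measurable_sum => j.
  apply: measurable_funD; last exact: (measurable_charge_pairing (w2 i j) (ms _ (bdg j)) (dgC j)).
  by apply: (@measurable_static _ _ T s _ (fun l : Y => l.2 ord0 i * l.2 ord0 j)); [exact: ms|exact: measurable_funM].
- apply: measurable_funM => //; apply: measurable_funTS.
  exact: (measurable_ru_pairing i (buc_measurable bg)).
- apply: measurable_funD; first apply: measurable_funB.
  + apply: measurable_funD; last exact: (measurable_charge_pairing w5 (ms _ (bdg i)) (dgC i)).
    apply: (@measurable_static _ _ T s _ (fun l : Y => l.1 * F^`()%classic l.1)); first exact: ms.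
    exact: (measurable_funM m1 (measurableT_comp mF' m1)).
  + apply: measurable_funD; last exact: (measurable_measure_pairing w4 (ms _ (bdg i)) (dgC i)).
    by apply: (@measurable_static _ _ T s _ (fun l : Y => F l.1)); [exact: ms|exact: (measurableT_comp mF m1)].
  + apply: measurable_funM => //; apply: measurable_funD; last exact: (measurable_measure_pairing w1 (ms _ (bdg i)) (dgC i)).
    by apply: (@measurable_static _ _ T s _ (fun l : Y => l.1 ^+ 2)); [exact: ms|exact: (measurable_funX 2 m1)].
- apply: measurable_funM => //; apply: measurable_funTS.
  exact: (measurable_kernel_pairing s (ms _ bg) mk).
Qed.

Lemma ae_rate_bound : {ae tm, forall t : RT,
  `|rate t| <= C * (Kv omega eta Cp CF A * (1 + energy_const + eps ^- 2 * energy_const))}.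
Proof.
move: energy_bounds; apply: filterS => t [gt h _ _].
have hh := momentum_rate_bound hmol eta0 hpot href gt hA4 i eps0 C0 bg bdg gC dgC.
apply: (le_trans hh); rewrite ler_wpM2l ?(ltW C0)//.
have K0 : 0 <= Kv omega eta Cp CF A by apply: (@Kv_ge0 _ _ _ _ _ _ _ _ _ _ _ _ _ _ _ _ hpot _ CF _ hA4).
rewrite ler_wpM2l//.
have e20 : 0 <= eps ^- 2 by rewrite invr_ge0 sqr_ge0.
have q1 : 1 + X t + Z t + r2 t <= 1 + energy_const by move: h => /=; lra.
apply: (lerD q1); rewrite ler_wpM2l//; apply: le_trans h.
by rewrite lerDr addr_ge0 ?devX_ge0// (devZ_ge0 hpot).
Qed.

Lemma L1_rate : L1 tm (on_time T rate).
Proof. exact: (L1_on_time T0 rate_measurable ae_rate_bound). Qed.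

(** The weak momentum balance tested with the static field whose i-th component
    is g and whose other components vanish. *)
Lemma momentum_evolution : {ae tm, forall t : RT, \int[tor]_x (g x * mv_ru s t x ord0 i) =
  \int[tor]_x (g x * (rho0 x * u0 x ord0 i)) + tI t (fun s' => eps^-1 * rate s')}.
Proof.
have iu := L1_ru_pairing i bg; have iv := L1Z eps^-1 L1_rate.
have : {ae tm, forall t : RT, \int[tor]_x (g x * mv_ru s t x ord0 i) =
  \int[tor]_x (g x * (rho0 x * u0 x ord0 i)) + tI t (fun s' => eps^-1 * on_time T rate s')}; last first.
  apply: filterS => t ->; congr (_ + _).
  by apply: eq_integral_mrestr => u /=; rewrite in_itv /= => uT; rewrite on_timeE.
apply: (weak_evolution T0 iu iv) => t h t0 h0 th.
case: hs => _ _ _ hwm.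
pose w (j : 'I_d) (_ : R) (x : E) := (j == i)%:R * g x.
pose wi (j l : 'I_d) (_ : R) (x : E) := (j == i)%:R * dg l x.
have bw j : buc (w j) := bucZ _ bg.
have bwi j l : buc (wi j l) := bucZ _ (bdg l).
have Dw j l u : HD l (w j u) (wi j l u) := HDZ _ (Dg l).
have wexp j e : 0 < e -> exists2 r, 0 < r & forall t t' x, 0 <= t <= T -> 0 <= t' <= T ->
     `|t' - t| < r -> `|w j t' x - w j t x - (t' - t) * (fun _ _ => 0 : R) t x| <= e * `|t' - t|.
  move=> e_gt0; exists 1 => // u u' x _ _ _; by rewrite mulr0 subr0 subrr normr0 mulr_ge0// ltW.
have bz : buc (fun (_ : R) (_ : E) => 0 : R) := buc_cst 0.
have := hwm (fun j => test T (w j) t h) (fun j => test_fun T0 (bw j) bz (bwi j) (Dw j) (wexp j) h0 th).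
rewrite torus_measureE => H; rewrite -[RHS]H; congr (_ + _); last first.
  apply: eq_Rint => x; rewrite -[LHS](sum_delta i (fun j => g x * (rho0 x * u0 x ord0 j))).
  by apply: eq_bigr => j _; rewrite (test_0 T0 (w j) t0 h0) /w mulrA.
have [j1 _] := L1_cutoff t h0 iu; have [_ j2] := L1_cutoff t h0 iv.
rewrite -(RintD j1 j2); apply: ae_eq_Rint.
move: (ae_and (ae_tm_itv T) ae_good); apply: filterS => u [_ gu].
have /andP[u0' uT] := gt_T gu; have u0_ := ltW u0'.
rewrite on_timeE ?(gt_T gu)// /momentum_rate.
have ms (f : E -> R) (hf : buc (fun=> f)) : measurable_fun setT f := buc_measurable_at 0 hf.
set q1 := dcutoff t h u; set q2 := cutoff t h u.
have Et j : test T (w j) t h u = (fun x => q2 * ((j == i)%:R * g x)) := test_ge0 T0 (w j) t h u0_.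
have Ep j l : partial l (test T (w j) t h u) = (fun x => q2 * ((j == i)%:R * dg l x)) := test_partial T0 (Dw j) t h l u0_.
have Ed j x : (test T (w j) t h ^~ x)^`()%classic u = q1 * ((j == i)%:R * g x).
  by rewrite (test_dt T0 (bw j) (wexp j) h0 th x (gt_T gu)) mulr0 addr0.
have [? [_ lr _ _]] := lin_ru gu i; have [? [_ lp _ _]] := lin_bar_p gu; have [? [_ lk _ _]] := lin_kernel hmol eta0 gu i.
have e1 : \int[torus_measure]_x (\sum_j (test T (w j) t h ^~ x)^`()%classic u * mv_ru s u x ord0 j) =
    q1 * \int[torus_measure]_x (g x * mv_ru s u x ord0 i).
  rewrite -(lr q1 _ _ (ms _ bg) gC); apply: eq_Rint => x.
  rewrite -[RHS](sum_delta i (fun j => q1 * g x * mv_ru s u x ord0 j)); apply: eq_bigr => j _.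
  by rewrite Ed; ring.
have e2 : \int[torus_measure]_x (\sum_j test T (w j) t h u x * mv_ru s u x ord0 j) =
    q2 * \int[torus_measure]_x (g x * mv_ru s u x ord0 i).
  rewrite -(lr q2 _ _ (ms _ bg) gC); apply: eq_Rint => x.
  rewrite -[RHS](sum_delta i (fun j => q2 * g x * mv_ru s u x ord0 j)); apply: eq_bigr => j _.
  by rewrite Et; ring.
have e3 : \sum_j \sum_l bar_ruu s j l u (partial l (test T (w j) t h u)) = q2 * \sum_l bar_ruu s i l u (dg l).
  rewrite -[RHS](sum_delta i (fun j => q2 * \sum_l bar_ruu s j l u (dg l))); apply: eq_bigr => j _.
  rewrite !mulr_sumr; apply: eq_bigr => l _; rewrite Ep.
  have [? [_ lj _ _]] := lin_bar_ruu gu j l.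
  rewrite -(lj q2 _ _ (ms _ (bdg l)) (dgC l)) -(lj _ _ _ (ms _ (bucZ q2 (bdg l))) (fun x => _ : _ <= `|q2| * C)); last first.
    by move=> x; rewrite normrM ler_wpM2l.
  by congr (bar_ruu s j l u); apply/funext => x; ring.
have e4 : bar_p F eta s u (fun x => \sum_j partial j (test T (w j) t h u) x) = q2 * bar_p F eta s u (dg i).
  rewrite -(lp q2 _ _ (ms _ (bdg i)) (dgC i)); congr (bar_p F eta s u); apply/funext => x.
  rewrite -[RHS](sum_delta i (fun j => q2 * dg j x)); apply: eq_bigr => j _.
  by rewrite Ep; ring.
have e5 : \int[torus_measure]_x (\sum_j test T (w j) t h u x * (mv_rho s u x * convol (partial j k) (mv_rho s u) x)) =
    q2 * \int[torus_measure]_x (g x * (mv_rho s u x * convol (partial i k) (mv_rho s u) x)).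
  rewrite -(lk q2 _ _ (ms _ bg) gC); apply: eq_Rint => x.
  rewrite -[RHS](sum_delta i (fun j => q2 * g x * (mv_rho s u x * convol (partial j k) (mv_rho s u) x))); apply: eq_bigr => j _.
  by rewrite Et; ring.
rewrite e1 e2 e3 e4 e5 -torus_measureE.
have -> : (eps * eta ^+ 2)^-1 = eps^-1 * eta ^- 2 by rewrite invfM.
have -> : eps ^- 2 = eps^-1 * eps^-1 by rewrite -exprVn expr2.
set c1 := eps^-1; set c2 := eta ^- 2; ring.
Qed.

(** The momentum paired with g is bounded uniformly in epsilon, hence so are
    the increments of epsilon^-1 times the primitive. The rate itself is of
    order epsilon^-2; the gain comes entirely from time integration. *)
Lemma rate_primitive_small t : 0 <= t <= T -> `|tI t rate| <= eps * (2 * (C * momentum_const)).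
Proof.
move=> tT; set Q := C * momentum_const; set c := \int[tor]_x (g x * (rho0 x * u0 x ord0 i)).
have iv := L1Z eps^-1 L1_rate.
pose Bd := eps^-1 * (C * (Kv omega eta Cp CF A * (1 + energy_const + eps ^- 2 * energy_const))).
have hB : {ae tm, forall t : RT, `|eps^-1 * on_time T rate t| <= Bd}.
  move: (ae_and (ae_tm_itv T) ae_rate_bound); apply: filterS => u [uT h].
  by rewrite on_timeE// normrM ger0_norm ?invr_ge0 ?(ltW eps0)// ler_wpM2l// invr_ge0 ltW.
have Bd0 : 0 <= Bd.
  have h0T : 0 <= (0 : R) <= T by rewrite lexx ltW.
  have [u [_ _ h]] := ae_tm_dense T0 hB h0T ltr01; exact: le_trans h.
have tIE u : tI u (fun s' => eps^-1 * rate s') = tI u (fun s' => eps^-1 * on_time T rate s').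
  by apply: eq_integral_mrestr => v /=; rewrite in_itv /= => vT; rewrite on_timeE.
have hQ : {ae tm, forall u : RT, `|c + tI u (fun s' => eps^-1 * on_time T rate s')| <= Q}.
  move: (ae_and momentum_evolution energy_bounds); apply: filterS => u [h [gu hu _ _]].
  by rewrite -tIE -h; exact: (ru_pairing_bound i gu hu bg gC).
have h1 := tI_bound_ae T0 iv Bd0 hB hQ.
have h0T : 0 <= (0 : R) <= T by rewrite lexx ltW.
have := h1 _ h0T; have := h1 _ tT.
have -> : tI 0 (fun s' => eps^-1 * on_time T rate s') = 0.
  rewrite /tI (@eq_integral_mrestr _ _ _ _ _ _ _ (fun=> 0)) ?Rint0// => v /=; rewrite in_itv /= => /andP[v0 _].
  by rewrite ltNge (ltW v0) mul0r.
rewrite (tIZ _ _ L1_rate) tI_on_time addr0 => h2 h3.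
have : `|eps^-1 * tI t rate| <= 2 * Q.
  have -> : eps^-1 * tI t rate = (c + eps^-1 * tI t rate) - c by ring.
  by apply: (le_trans (ler_normB _ _)); lra.
by rewrite normrM ger0_norm ?invr_ge0 ?(ltW eps0)// ler_pdivrMl.
Qed.

End static_field.

Local Notation Theta := (theta omega eta F mu K s).

Lemma Rint_tor_bound (f : E -> R) C : L1 tor f -> (forall x, `|f x| <= C) -> `|\int[tor]_x f x| <= C.
Proof.
move=> hf fC; rewrite -[C in leRHS](@Rint_tor_cst R d); apply: (le_norm_Rint hf) => //.
exact: (@tor_bounded _ _ _ `|C|).
Qed.

Lemma continuous_Rint (f : R -> E -> R) : buc f -> continuous (fun t => \int[tor]_x f t x).
Proof.
move=> hf t; apply/cvgrPdist_le => e e_gt0; have [_ _ uc] := hf.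
have [q q0 h] := uc e e_gt0; exists q => // t' /= tt'.
rewrite -(RintB (tor_buc t hf) (tor_buc t' hf)).
apply: Rint_tor_bound; first exact: (L1B (tor_buc t hf) (tor_buc t' hf)).
by move=> x; apply: h => //; rewrite subrr normr0.
Qed.

Let PM_bound : exists C, forall t, `|\int[tor]_x (P t x * M t x)| <= C.
Proof.
have bPM := bucM (ref_bP href) (ref_bM href); have [C _ hC] := buc_bounded bPM.
exists C => t; exact: (Rint_tor_bound (tor_buc t bPM) (hC t)).
Qed.

Lemma L1_PM : L1 tm (fun s' : RT => \int[tor]_x (P s' x * M s' x)).
Proof.
have [C hC] := PM_bound.
exact: (tm_cont (M := C) T0 (continuous_Rint (bucM (ref_bP href) (ref_bM href)))).
Qed.

Lemma K_expand t : 0 <= t <= T -> K t = K 0 - tI t (fun s' => \int[tor]_x (P s' x * M s' x)).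
Proof.
move=> tT; have [C hC] := PM_bound.
have : tI t (fun u => - \int[tor]_x (P u x * M u x)) = K t - K 0.
  apply: (@tI_FTC_expand R T T0 (fun u => - \int[tor]_x (P u x * M u x)) K C t tT).
  - by apply: contN; exact: (continuous_Rint (bucM (ref_bP href) (ref_bM href))).
  - by move=> u; rewrite normrN.
  - move=> e e_gt0; have [q q0 h] := ref_Kt href e_gt0; exists q => // u u' uT u'T uu'.
    by rewrite mulrN opprK; exact: h.
have -> : tI t (fun u => - \int[tor]_x (P u x * M u x)) = - tI t (fun u => \int[tor]_x (P u x * M u x)).
  rewrite -mulN1r -(tIZ _ _ L1_PM); congr tI; apply/funext => u; by rewrite mulN1r.
by lra.
Qed.

(** The upper bound for the time derivative of theta that results from the
    dissipation inequality, the continuity equation and the evolution of K. *)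
Definition production (t : R) := - (eps ^- 2 * r2 t) - eps^-1 * (\sum_i \int[tor]_x (a i t x * mv_ru s t x ord0 i))
  - \int[tor]_x (M t x * mv_rho s t x) + \int[tor]_x (P t x * M t x).

Definition initial_gap := E_0 omega F eta rho0 u0 - \int[tor]_x (mu 0 x * rho0 x) - K 0.

Lemma L1_r2 : L1 tm (on_time T r2).
Proof.
apply: (L1_on_time (C := energy_const) T0 r2_measurable); move: energy_bounds; apply: filterS => t [gt h _ _].
rewrite ger0_norm ?(r2_ge0 gt)//; apply: le_trans h.
by rewrite lerDr addr_ge0 ?devX_ge0// (devZ_ge0 hpot).
Qed.

Let L1_au : L1 tm (fun t : RT => eps^-1 * \sum_i \int[tor]_x (a i t x * mv_ru s t x ord0 i)).
Proof. by apply: L1Z; apply: L1_sum => i; exact: (L1_ru_pairing i (ref_ba href i)). Qed.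

Let L1_Mr : L1 tm (fun t : RT => \int[tor]_x (M t x * mv_rho s t x)).
Proof. by have [_ [_ bMA _ _] _ _] := hA; exact: (L1_rho_pairing (ref_bM href) bMA). Qed.

Lemma L1_production : L1 tm (on_time T production).
Proof.
have i1 := L1D (L1B (L1B (L1Z (- 1) (L1Z (eps ^- 2) L1_r2)) L1_au) L1_Mr) L1_PM.
have -> : on_time T production = on_time T (fun t => -1 * (eps ^- 2 * on_time T r2 t) - eps^-1 * (\sum_i \int[tor]_x (a i t x * mv_ru s t x ord0 i))
  - \int[tor]_x (M t x * mv_rho s t x) + \int[tor]_x (P t x * M t x)).
  apply/funext => t; rewrite /on_time /patch; case: ifP => // h.
  by rewrite /production mulN1r.
move: i1; set f := (X in L1 _ X) => i1.
have mf := L1_measurable i1.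
apply: (ae_L1 _ i1); first by apply/(measurable_restrictT _ (measurable_itv _)); exact: measurable_funTS.
by move: (ae_tm_itv T); apply: filterS => t tT; rewrite on_timeE.
Qed.

(** The three ingredients of theta are treated separately: the energy by the
    dissipation inequality, the linear term by the continuity equation, K by
    the classical equation. *)
Lemma theta_evolution : {ae tm, forall t : RT, Theta t <= initial_gap + tI t production}.
Proof.
move: (ae_and energy_bounds density_evolution); apply: filterS => t [[gt _ _ hE] hd].
have tT : 0 <= t <= T by have /andP[h1 h2] := gt_T gt; rewrite !ltW.
rewrite /theta (K_expand tT) /initial_gap.
rewrite (@eq_Rint _ _ _ tor (fun x => mv_rho s t x * mu t x) (fun x => mu t x * mv_rho s t x)); last by move=> x; rewrite mulrC.
rewrite hd (tID _ L1_Mr L1_au).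
have -> : tI t production = - (eps ^- 2 * tI t r2) - tI t (fun t => eps^-1 * \sum_i \int[tor]_x (a i t x * mv_ru s t x ord0 i))
   - tI t (fun t => \int[tor]_x (M t x * mv_rho s t x)) + tI t (fun t => \int[tor]_x (P t x * M t x)).
  rewrite -(tI_on_time T t r2) -(tIZ _ _ L1_r2).
  have i0 := L1Z (eps ^- 2) L1_r2.
  rewrite -mulN1r -(tIZ _ _ i0) -(tIB _ (L1Z (-1) i0) L1_au) -(tIB _ (L1B (L1Z (-1) i0) L1_au) L1_Mr).
  rewrite -(tID _ (L1B (L1B (L1Z (-1) i0) L1_au) L1_Mr) L1_PM).
  by apply: eq_integral_mrestr => v /=; rewrite in_itv /= => vT; rewrite on_timeE// /production mulN1r.
move: hE; set q1 := tI t _; set q2 := tI t _; set q3 := tI t _; set q4 := tI t _; set q5 := E_mvs _ _ _ _ _; set q6 := E_0 _ _ _ _ _.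
lra.
Qed.

(** An a priori bound, needed to start the iteration in the Gronwall argument.
    *)
Lemma theta_bounds : {ae tm, forall t : RT, 0 <= Theta t /\ `|Theta t| <= e0 + (c0 / 2 * energy_const + gap_const) + A}.
Proof.
move: energy_bounds; apply: filterS => t [gt h hD hE].
have h1 := coercive hmol eta0 CP0 hpot href gt.
have [_ [bmu _ _ _] _ bK] := hA.
have h2 := rho_pairing_bound gt (buc_static t (ref_bmu href)) (bmu t).
have h3 := bK t; have c00 := c0_gt0.
have D0 : 0 <= eps ^- 2 * tI t r2 by rewrite mulr_ge0 ?tI_r2_ge0// invr_ge0 sqr_ge0.
have X0 := devX_ge0 P s t; have Z0 := devZ_ge0 hpot P s t; have r0 := r2_ge0 gt.
have Y0 : 0 <= devY s t by rewrite /devY mulr_ge0.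
have th0 : 0 <= Theta t by apply: le_trans h1; apply: addr_ge0; [exact: addr_ge0|rewrite mulr_ge0// ltW].
split => //; rewrite ger0_norm//.
have XS : X t <= energy_const by apply: le_trans h; rewrite -addrA lerDl addr_ge0.
have hX : c0 / 2 * X t <= c0 / 2 * energy_const by rewrite ler_wpM2l ?divr_ge0 ?(ltW c00).
move: h2 h3; rewrite /theta !ler_norml.
rewrite (@eq_Rint _ _ _ tor (fun x => mv_rho s t x * mu t x) (fun x => mu t x * mv_rho s t x)); last by move=> x; rewrite mulrC.
move: hE hE0 hX; set c := c0; set N := \int[tor]_x _; set E1 := E_mvs _ _ _ _ _; set E2 := E_0 _ _ _ _ _; set D1 := eps ^- 2 * _ in D0 *.
by move=> q1 q2 q3 /andP[q4 q5] /andP[q6 q7]; lra.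
Qed.

Lemma theta_measurable : measurable_fun I0 (Theta : RT -> R).
Proof.
case: hs => _ [[w1 w2 w3 w4 w5] _ _ _] _ _.
have mF : measurable_fun setT (F : R -> R) := continuous_measurable_fun (DER_continuous (dF hpot)).
have m1 : measurable_fun setT (fst : Y -> R) := measurable_fst.
have n1 (x : E) : `|cst 1 x : R| <= 1 by rewrite /cst normr1.
have mr2 : measurable_fun I0 (fun t : RT => bar_rho2 s t (cst 1)).
  apply: measurable_funD; last exact: (measurable_measure_pairing w1 _ n1).
  by apply: (@measurable_static _ _ T s _ (fun l : Y => l.1 ^+ 2)) => //; exact: (measurable_funX 2 m1).
have mk : measurable_fun setT k := L1_measurable (L1_kernel hmol eta0).
have cP0 := DER_continuous (dF hpot); have cP1 := DER_continuous (dF' hpot).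
apply: measurable_funB; first apply: measurable_funB; first apply: measurable_funD; first apply: measurable_funD.
- by apply: measurable_funM => //; exact: r2_measurable.
- apply: measurable_funD; last exact: (measurable_measure_pairing w4 _ n1).
  by apply: (@measurable_static _ _ T s _ (fun l : Y => F l.1)) => //; exact: (measurableT_comp mF m1).
- apply: measurable_funM => //; apply: measurable_funB.
    apply: measurable_funD => //.
    rewrite (_ : (fun t : RT => _) = (fun t : RT => bar_rho2 s t (cst 1)))//.
    by apply/funext => t; rewrite (bar_rho2_conv_1 hmol eta0).
  apply: measurable_funM => //; apply: measurable_funTS.
  by apply: (measurable_kernel_pairing s).
- apply: measurable_funTS.
  have := @measurable_pairing _ _ s mu fst (buc_measurable (ref_bmu href)) measurable_fst; congr (measurable_fun _ _).
  by apply/funext => t; apply: eq_Rint => x; rewrite mulrC.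
- apply: measurable_funTS; rewrite (_ : (K : RT -> R) = (fun t => \int[tor]_x (F (P t x) - P t x * F' (P t x) - 2^-1 * (P t x * cB omega eta (P t) x)))); last first.
    by apply/funext => t; exact: (ref_K href).
  have bP := ref_bP href.
  apply: (continuous_measurable_fun (continuous_Rint _)).
  apply: bucB; first by apply: bucB; [exact: (buc_comp cP0)|apply: bucM => //; exact: (buc_comp cP1)].
  by apply: bucZ; apply: bucM => //; exact: (buc_cB hmol eta0).
Qed.

Lemma L1_theta : L1 tm (on_time T Theta).
Proof.
by apply: (L1_on_time T0 theta_measurable); move: theta_bounds; apply: filterS => t [_ h]; exact: h.
Qed.


End mv_evolution.

(** * The Gronwall argument *)

Section grid.
Context {R : realType}.
Variables (T : R) (T0 : 0 < T).
Local Notation tm := (time_measure T).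
Local Notation RT := (measurableTypeR R).
Local Notation tI := (tI T).

Lemma tI_0 (f : R -> R) : tI 0 f = 0.
Proof.
rewrite /tI (@eq_integral_mrestr _ _ _ _ _ _ _ (fun=> 0)) ?Rint0// => v /=; rewrite in_itv /= => /andP[v0 _].
by rewrite ltNge (ltW v0) mul0r.
Qed.

(** W is dominated near each time tau by a function V tau with small primitive,
    but tau must be frozen while integrating. On a grid of mesh less than
    delta, freeze tau at the left end of each cell; each cell contributes at
    most two values of a primitive. The number of cells is fixed before epsilon
    tends to 0, so the factor N.+1 does no harm. *)
Lemma grid_bound (W : RT -> R) (V : R -> RT -> R) (delta Q : R) (N : nat) :
  L1 tm W -> (forall tau, L1 tm (V tau)) -> T / N.+1%:R < delta ->
  (forall tau t, 0 <= tau <= T -> 0 <= t <= T -> `|tI t (V tau)| <= Q) ->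
  (forall tau, 0 <= tau <= T -> {ae tm, forall s : RT, `|s - tau| < delta -> W s <= V tau s}) ->
  forall t, 0 <= t <= T -> tI t W <= N.+1%:R * (2 * Q).
Proof.
move=> iW iV hd hQ hW.
have N0 : 0 < N.+1%:R :> R by rewrite ltr0n.
pose h := T / N.+1%:R; have h0 : 0 < h by rewrite divr_gt0.
have h0T : 0 <= (0 : R) <= T by rewrite lexx ltW.
have Q0 : 0 <= Q := le_trans (normr_ge0 _) (hQ 0 0 h0T h0T).
have key n t : 0 <= t <= T -> t <= n%:R * h -> tI t W <= n%:R * (2 * Q).
  elim: n t => [|n IH] t /andP[t0 tT] tn.
    have -> : t = 0 by apply/eqP; rewrite eq_le t0 andbT; move: tn; rewrite mul0r.
    by rewrite tI_0 mul0r.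
  have Sn : n.+1%:R = n%:R + 1 :> R by rewrite -addn1 natrD.
  have [tn'|tn'] := leP t (n%:R * h).
    have := IH t _ tn'; rewrite t0 tT => /(_ isT); rewrite Sn mulrDl mul1r; lra.
  set tau := n%:R * h in tn'.
  have tau0 : 0 <= tau by rewrite mulr_ge0// ltW.
  have tauT : 0 <= tau <= T by rewrite tau0 (le_trans (ltW tn')).
  have tt : 0 <= t <= T by rewrite t0 tT.
  have step : tI t W - tI tau W <= tI t (V tau) - tI tau (V tau).
    rewrite /tI -(RintB (L1_tI t iW) (L1_tI tau iW)) -(RintB (L1_tI t (iV tau)) (L1_tI tau (iV tau))).
    apply: (ae_le_Rint (L1B (L1_tI t iW) (L1_tI tau iW)) (L1B (L1_tI t (iV tau)) (L1_tI tau (iV tau)))).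
    move: (hW tau tauT); apply: filterS => u hu.
    have [ut|ut] := ltP u t; have [us|us] := ltP u tau; rewrite ?mul1r ?mul0r ?subrr ?subr0//.
      apply: hu; rewrite ger0_norm ?subr_ge0//; apply: lt_trans hd; rewrite -/h.
      by move: tn; rewrite Sn mulrDl mul1r -/tau => tn; rewrite ltrBlDl; exact: lt_le_trans tn.
    by have := le_lt_trans ut (lt_trans us tn'); rewrite ltxx.
  have := hQ tau t tauT tt; have := hQ tau tau tauT tauT; rewrite !ler_norml => /andP[q1 q2] /andP[q3 q4].
  have := IH tau tauT (lexx _); rewrite Sn mulrDl mul1r; lra.
move=> t tT; apply: (key N.+1 t tT); rewrite /h mulrC divfK ?gt_eqF//; by case/andP: tT.
Qed.

End grid.

Section mv_convergence.
Context {R : realType} {d : nat}.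
Local Notation E := 'rV[R]_d.
Local Notation Y := (R * E)%type.
Local Notation tor := (torus_prob d : probability E R).
Local Notation leb := (@lebesgue_row R d).
Local Notation RT := (measurableTypeR R).
Local Opaque lebesgue_row.
Variables (D : R) (omega : E -> R) (hmol : mollifier D omega).
Variables (eta : R) (eta0 : 0 < eta) (T : R) (T0 : 0 < T).
Variables (F F1 F1' F1'' F2 F2' F2'' F''' : R -> R) (M2 B Cp CP : R) (CP0 : 0 < CP).
Hypothesis hpot : potential_data CP F F1 F1' F1'' F2 F2' F2'' F''' M2 B Cp.
Local Notation F' := (fun u => F1' u + F2' u).
Local Notation F'' := (fun u => F1'' u + F2'' u).
Variables (rho0 : E -> R) (P mu M : R -> E -> R) (a : 'I_d -> R -> E -> R) (b : 'I_d -> 'I_d -> R -> E -> R) (K : R -> R).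
Hypothesis href : reference omega eta T F F' F'' rho0 P mu M a b K.
Local Notation k := (scaled omega eta).
Local Notation kd := (dkernel omega eta).
Variables (A : R) (hA : reference_bounds F F1' F1'' F2' F2'' P mu M a b K A).
Variables (CF : R) (u0 : E -> E) (s : mv_data R d) (eps : R) (eps0 : 0 < eps).
Hypothesis hs : mv_solution omega F T eps eta s CF rho0 u0.
Hypothesis hdiss : dissipative omega F T eps eta s rho0 u0.
Hypothesis hpo : nonlocal_poincare omega T eta s CP rho0.
Variables (e0 : R) (hE0 : E_0 omega F eta rho0 u0 <= e0).
Local Notation tm := (time_measure T).
Local Notation tI := (tI T).
Local Notation good := (good_time omega eta T F CP P CF s).
Local Notation X := (devX P s).
Local Notation Z := (devZ F1 F1' P s).
Local Notation r2 := (fun t => bar_ru2 s t (cst 1)).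
Local Notation Theta := (theta omega eta F mu K s).
Local Notation c0 := (CP^-1 - M2 / 2).
Local Notation S := (energy_const M2 CP A e0).
Local Notation Q0 := (momentum_const M2 CP A e0).
Local Notation KV := (Kv omega eta Cp CF A).

(** The factor 1 + c0^-1 converts a bound by the deviations into a bound by
    theta; the final 1 makes the constant positive. *)
Definition gronwall_const := (A * (Cp + `|CF| + 1 + (2 * eta ^+ 2)^-1) + eta ^- 2 * \sum_i (knorm (kd i) * ((A ^+ 2 + 1) / 2))) * (1 + c0^-1) + 1.
Local Notation C := gronwall_const.

Let hA4 : [/\ 0 < A, forall t x, `|P t x| <= A, forall t x, `|pressure F F' (P t x)| <= A & forall t x, `|P t x * F'' (P t x)| <= A].
Proof. by case: hA. Qed.

Let hE := energy_bounds hmol eta0 CP0 hpot href hA hs hdiss hpo hE0.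

Lemma gronwall_const_gt0 : 0 < C.
Proof.
have [A0 _ _ _] := hA4; have [_ _ _ _ [Cp0 _]] := hpot; have c00 := c0_gt0 CP0 hpot.
rewrite ltr_wpDl//; apply: mulr_ge0; last by rewrite addr_ge0// invr_ge0 ltW.
apply: addr_ge0.
  rewrite mulr_ge0 ?(ltW A0)//; apply: addr_ge0; first by rewrite !addr_ge0.
  by rewrite invr_ge0 mulr_ge0// sqr_ge0.
apply: mulr_ge0; first by rewrite invr_ge0 sqr_ge0.
apply: sumr_ge0 => i _; apply: mulr_ge0; first exact: knorm_ge0.
by rewrite divr_ge0// addr_ge0// sqr_ge0.
Qed.

Lemma remainder_le_theta t : good t -> remainder omega eta F P M a b s t <= C * Theta t.
Proof.
move=> gt; have [A0 _ _ _] := hA4; have c00 := c0_gt0 CP0 hpot.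
have [_ [_ _ ba _] bL _] := hA.
have h1 := remainder_bound hmol eta0 hpot href gt (bL t) (fun i x => ba i t x).
apply: (le_trans h1); have h2 := coercive hmol eta0 CP0 hpot href gt.
have X0 := devX_ge0 P s t; have Z0 := devZ_ge0 hpot P s t; have r0 := r2_ge0 gt.
have Y0 : 0 <= devY s t by rewrite /devY mulr_ge0.
have th0 : 0 <= Theta t by apply: le_trans h2; apply: addr_ge0; [exact: addr_ge0|rewrite mulr_ge0// ltW].
have h3 : X t + Z t <= (1 + c0^-1) * Theta t.
  rewrite mulrDl mul1r [_ + Z t]addrC; apply: lerD.
    have := mulr_ge0 (ltW c00) X0; move: h2; set q := c0 * X t; lra.
  rewrite ler_pdivlMl//; move: h2; set q := c0 * X t; lra.
have := gronwall_const_gt0; rewrite /gronwall_const; set G := A * _ + _ => C0.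
have G0 : 0 <= G.
  have [_ _ _ _ [Cp0 _]] := hpot.
  apply: addr_ge0.
    rewrite mulr_ge0 ?(ltW A0)//; apply: addr_ge0; first by rewrite !addr_ge0.
    by rewrite invr_ge0 mulr_ge0// sqr_ge0.
  apply: mulr_ge0; first by rewrite invr_ge0 sqr_ge0.
  apply: sumr_ge0 => i _; apply: mulr_ge0; first exact: knorm_ge0.
  by rewrite divr_ge0// addr_ge0// sqr_ge0.
apply: (le_trans (ler_wpM2l G0 h3)); set p := 1 + c0^-1.
have -> : (G * p + 1) * Theta t = G * (p * Theta t) + Theta t by ring.
by rewrite lerDl.
Qed.

Variables (q delta : R) (N : nat) (q0 : 0 < q) (hN : T / N.+1%:R < delta).
Hypothesis osc_a : forall i t t' x, `|t - t'| < delta -> `|a i t x - a i t' x| <= q.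
Hypothesis osc_b : forall i j t t' x, `|t - t'| < delta -> `|b i j t x - b i j t' x| <= q.

(** The three errors: the kinetic energy in the stress, of order epsilon^2 once
    integrated by the dissipation bound; the freezing of grad mu, of order q
    uniformly in epsilon; the primitives of the momentum rates on the grid, of
    order epsilon for fixed N. *)
Definition residual := A * d%:R ^+ 2 * (eps ^+ 2 * S) + q * (d%:R * KV * ((1 + S) * T + S))
  + N.+1%:R * (2 * (d%:R * (eps * (2 * (A * Q0))))).

(** The production rate, minus what is to be kept on the right-hand side, is
    locally dominated by momentum rates of frozen fields; the grid estimate
    applies to the difference. *)
Lemma theta_gronwall : {ae tm, forall t : RT, Theta t <= initial_gap omega eta F rho0 mu K u0 + residual + C * tI t Theta}.
Proof.
have [A0 _ _ _] := hA4; have [_ [_ _ baA bbA] _ _] := hA.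
have iTh := L1_theta hmol eta0 T0 CP0 hpot href hA hs hdiss hpo hE0.
have ir2 := L1_r2 hmol eta0 T0 CP0 hpot href hA hs hdiss hpo hE0.
have ipr := L1_production hmol eta0 T0 CP0 hpot href hA hs hdiss hpo hE0.
have ba i := ref_ba href i; have bb i j := ref_bb href i j.
have irate i tau := L1_rate hmol eta0 T0 CP0 hpot href hA eps0 hs hdiss hpo hE0 i
   (buc_static tau (ba i)) (fun j => buc_static tau (bb i j)) A0 (baA i tau) (fun j => bbA i j tau).
pose V tau (u : RT) := \sum_i - on_time T (fun t => momentum_rate omega eta F s t eps i (a i tau) (fun j => b i j tau)) u.
have c1 : L1 tm (fun _ : RT => 1 : R) by apply: (@tm_bounded _ _ _ 1) => // x; rewrite normr1.
have KV0 : 0 <= KV := Kv_ge0 omega eta hpot CF hA4.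
have e20 : 0 <= eps ^- 2 by rewrite invr_ge0 sqr_ge0.
have dKV0 : 0 <= q * (d%:R * KV) by rewrite mulr_ge0 ?(ltW q0)// mulr_ge0.
have S0 : 0 <= S := energy_const_ge0 hmol eta0 T0 CP0 hpot href hA hs hdiss hpo hE0.
have iV tau : L1 tm (V tau).
  apply: L1_sum => i; have := L1Z (-1) (irate i tau); congr (integrable _ _ _).
  by apply/funext => u /=; rewrite mulN1r.
pose f1 := on_time T (production P M a s eps).
pose f2 := on_time T Theta; pose f3 := on_time T r2.
have j2 := L1Z C iTh; have j3 := L1Z (A * d%:R ^+ 2) ir2; have j4 := L1D (L1Z (1 + S) c1) (L1Z (eps ^- 2) ir2).
have j5 := L1Z (q * (d%:R * KV)) j4.
pose W (u : RT) := f1 u - C * f2 u - A * d%:R ^+ 2 * f3 u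
   - q * (d%:R * KV) * ((1 + S) * 1 + eps ^- 2 * f3 u).
have iW : L1 tm W := L1B (L1B (L1B ipr j2) j3) j5.
have hV tau t : 0 <= tau <= T -> 0 <= t <= T -> `|tI t (V tau)| <= d%:R * (eps * (2 * (A * Q0))).
  move=> tauT tT; have -> : tI t (V tau) = \sum_i - tI t (fun t => momentum_rate omega eta F s t eps i (a i tau) (fun j => b i j tau)).
    rewrite {1}/tI /V (@eq_Rint _ _ _ _ _ (fun u : RT => \sum_i (-1) * ((u < t)%R%:R * on_time T (fun t => momentum_rate omega eta F s t eps i (a i tau) (fun j => b i j tau)) u))).
      rewrite Rint_sum; last by move=> i; exact: (L1Z _ (L1_tI t (irate i tau))).
      apply: eq_bigr => i _; rewrite (RintZ _ (L1_tI t (irate i tau))) mulN1r; congr (- _).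
      exact: tI_on_time.
    by move=> u; rewrite mulr_sumr; apply: eq_bigr => i _; rewrite mulN1r mulrN.
  apply: (le_trans (ler_norm_sum _ _ _)); apply: (@le_trans _ _ (\sum_(i < d) eps * (2 * (A * Q0)))).
    apply: ler_sum => i _; rewrite normrN.
    exact: (rate_primitive_small hmol eta0 T0 CP0 hpot href hA eps0 hs hdiss hpo hE0 i (buc_static tau (ba i))
      (fun j => buc_static tau (bb i j)) (fun j => ref_Da href i j tau) A0 (baA i tau) (fun j => bbA i j tau) tT).
  by rewrite sumr_const card_ord -[leLHS]mulr_natl.
have hW tau : 0 <= tau <= T -> {ae tm, forall u : RT, `|u - tau| < delta -> W u <= V tau u}.
  move=> tauT; move: hE; apply: filterS => u [gu hu _ _] hd.
  have uT := gt_T gu; rewrite /W /V /f1 /f2 /f3 !on_timeE//.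
  rewrite (eq_bigr (fun i => - momentum_rate omega eta F s u eps i (a i tau) (fun j => b i j tau))); last first.
    by move=> i _; rewrite on_timeE.
  rewrite sumrN.
  have h1 := rate_bound hmol eta0 hpot href gu hA4 eps0 q0 (fun i x => osc_a i x hd) (fun i j x => osc_b i j x hd) (fun i j x => bbA i j u x).
  have h2 := remainder_le_theta gu.
  have h3 : q * (d%:R * KV * (1 + X u + Z u + r2 u + eps ^- 2 * r2 u)) <= q * (d%:R * KV) * ((1 + S) * 1 + eps ^- 2 * r2 u).
    by rewrite mulrA ler_wpM2l// lerD2r mulr1; move: hu => /=; lra.
  move: h1 h2 h3; rewrite /production /=.
  set w1 := q * (_ * _ * (_ + _)); set w2 := q * _ * _; set w3 := remainder _ _ _ _ _ _ _ _ _; set w4 := \sum_i momentum_rate _ _ _ _ _ _ _ _ _.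
  set w5 := eps^-1 * _; set w6 := C * _; set w7 := _ * _ * bar_ru2 _ _ _; set w8 := eps ^- 2 * _; lra.
have hG := grid_bound T0 iW iV hN hV hW.
move: (ae_and hE (theta_evolution hmol eta0 T0 CP0 hpot href hA hs hdiss hpo hE0)); apply: filterS => t [[gt _ hr _] ht].
have tT : 0 <= t <= T by have /andP[h1 h2] := gt_T gt; rewrite !ltW.
have := hG t tT.
rewrite /W (tIB _ (L1B (L1B ipr j2) j3) j5) (tIB _ (L1B ipr j2) j3) (tIB _ ipr j2) (tIZ _ _ j4) (tIZ _ _ ir2) (tIZ _ _ iTh).
rewrite (tID _ (L1Z (1 + S) c1) (L1Z (eps ^- 2) ir2)) (tIZ _ _ c1) (tIZ _ _ ir2) !tI_on_time => hG'.
have h1T : tI t (fun=> 1) <= T.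
  rewrite -[leRHS]mul1r -(Rint_tm_cst T0); apply: le_Rint => //; first exact: L1_tI.
  by move=> u; rewrite mulr1; case: (_ < _).
have hr2 : tI t r2 <= eps ^+ 2 * S by move: hr; rewrite ler_pdivrMl// exprn_gt0.
have h4 : A * d%:R ^+ 2 * tI t r2 <= A * d%:R ^+ 2 * (eps ^+ 2 * S).
  by rewrite ler_wpM2l// mulr_ge0 ?(ltW A0)// sqr_ge0.
have h5 : q * (d%:R * KV) * ((1 + S) * tI t (fun=> 1) + eps ^- 2 * tI t r2) <= q * (d%:R * KV * ((1 + S) * T + S)).
  rewrite [leRHS]mulrA ler_wpM2l//; apply: lerD hr; by rewrite ler_wpM2l// addr_ge0.
rewrite /residual; apply: (le_trans ht).
move: hG' h4 h5; set w1 := q * _; set w2 := q * _ * _; set w3 := A * _ * tI t r2; set w4 := A * _ * (_ * _); set w5 := C * _; lra.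
Qed.

Lemma theta_small : 0 <= initial_gap omega eta F rho0 mu K u0 ->
  {ae tm, forall t : RT, Theta t <= 2 * (initial_gap omega eta F rho0 mu K u0 + residual) * expR (2 * C * T)}.
Proof.
move=> g0; have [A0 _ _ _] := hA4.
have iTh := L1_theta hmol eta0 T0 CP0 hpot href hA hs hdiss hpo hE0.
have S0 : 0 <= S := energy_const_ge0 hmol eta0 T0 CP0 hpot href hA hs hdiss hpo hE0.
have KV0 : 0 <= KV := Kv_ge0 omega eta hpot CF hA4.
have R0 : 0 <= residual.
  rewrite /residual; apply: addr_ge0; first apply: addr_ge0.
  - by apply: mulr_ge0; [rewrite mulr_ge0 ?(ltW A0)// sqr_ge0|rewrite mulr_ge0// sqr_ge0].
  - apply: mulr_ge0; first exact: ltW.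
    apply: mulr_ge0; first exact: mulr_ge0.
    by apply: addr_ge0 => //; apply: mulr_ge0; [exact: addr_ge0|exact: ltW].
  - apply: mulr_ge0 => //; apply: mulr_ge0 => //; apply: mulr_ge0 => //; apply: mulr_ge0; first exact: ltW.
    apply: mulr_ge0 => //; apply: mulr_ge0; first exact: ltW.
    rewrite /momentum_const; have := sqr_ge0 A; lra.
have tb := theta_bounds hmol eta0 CP0 hpot href hA hs hdiss hpo hE0.
have h1 : {ae tm, forall t : RT, on_time T Theta t <= (initial_gap omega eta F rho0 mu K u0 + residual) + C * tI t (on_time T Theta)}.
  move: (ae_and (ae_tm_itv T) theta_gronwall); apply: filterS => t [tT h].
  by rewrite on_timeE// tI_on_time.
have h2 : {ae tm, forall t : RT, on_time T Theta t <= e0 + (c0 / 2 * S + gap_const M2 CP A) + A}.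
  move: (ae_and (ae_tm_itv T) tb); apply: filterS => t [tT [_ h]].
  by rewrite on_timeE// (le_trans (ler_norm _)).
have := gronwall_ae T0 iTh (addr_ge0 g0 R0) gronwall_const_gt0 h1 h2.
move=> h3; move: (ae_and (ae_tm_itv T) h3); apply: filterS => t [tT].
rewrite on_timeE// => h; apply: (le_trans h).
apply: ler_wpM2l; first by apply: mulr_ge0 => //; exact: addr_ge0 g0 R0.
rewrite ler_expR; apply: ler_wpM2l; first by apply: mulr_ge0 => //; exact: (ltW gronwall_const_gt0).
by case/andP: tT => _ /ltW.
Qed.

End mv_convergence.

(** * The relaxation limit *)

Section limits_at_zero.
Context {R : realType}.
Local Notation RT := (measurableTypeR R).

Lemma small_cvg0 (f : R -> \bar R) : (forall eps, 0 < eps -> (0 <= f eps)%E) ->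
  (forall e, 0 < e -> \forall eps \near 0^'+, (f eps <= e%:E)%E) ->
  f eps @[eps --> 0^'+] --> 0%E.
Proof.
move=> f0 fs A [q /= q0 hA]; have q20 : 0 < q / 2 by rewrite divr_gt0.
change (\forall eps \near 0^'+, A (f eps)).
move: (fs _ q20); apply: filterS2 (nbhs_right_gt 0) => eps eps0.
have := f0 eps eps0; case: (f eps) => [r| |]//; rewrite !lee_fin => h1 h2; apply: hA.
by rewrite /ball /= sub0r normrN ger0_norm//; lra.
Qed.

Lemma ess_sup_cvg0 (T : R) (f : R -> RT -> \bar R) : 0 < T -> (forall eps t, (0 <= f eps t)%E) ->
  (forall e, 0 < e -> \forall eps \near 0^'+, {ae time_measure T, forall t : RT, (f eps t <= e%:E)%E}) ->
  ess_sup (time_measure T) (f eps) @[eps --> 0^'+] --> 0%E.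
Proof.
move=> T0 f0 fs; apply: small_cvg0.
  move=> eps _; apply: ess_sup_gee; last by apply: nearW => t; exact: f0.
  by rewrite tm_setT// lte_fin.
move=> e e0; move: (fs e e0); apply: filterS => eps h; exact/ess_supP.
Qed.

End limits_at_zero.

Lemma coercive_arith (R : realType) (x y z c th : R) : 0 < c -> [/\ 0 <= x, 0 <= y & 0 <= z] ->
  y + z + c * x <= th -> x + z + 2 * y <= (3 + c^-1) * th.
Proof.
move=> c0 [x0 y0 z0] h; have cx := mulr_ge0 (ltW c0) x0.
have hx : x <= c^-1 * th by rewrite ler_pdivlMl//; lra.
by rewrite mulrDl; lra.
Qed.

Section mv_limit.
Context {R : realType} {d : nat}.
Local Notation E := 'rV[R]_d.
Local Notation Y := (R * E)%type.
Local Notation tor := (torus_prob d : probability E R).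
Local Notation leb := (@lebesgue_row R d).
Local Notation RT := (measurableTypeR R).
Local Opaque lebesgue_row.

Lemma uniform_oscillation (I : finType) (f : I -> R -> E -> R) q : (forall i, buc (f i)) -> 0 < q ->
  exists2 delta, 0 < delta & forall i t t' x, `|t - t'| < delta -> `|f i t x - f i t' x| <= q.
Proof.
move=> bf q0; suff: forall l : seq I, exists2 delta, 0 < delta & forall i, i \in l -> forall t t' x,
    `|t - t'| < delta -> `|f i t x - f i t' x| <= q.
  by move=> /(_ (enum I)) [dl dl0 h]; exists dl => // i; apply: h; rewrite mem_enum.
elim=> [|i l [d1 d10 h1]]; first by exists 1.
have [_ _ uc] := bf i; have [d2 d20 h2] := uc q q0.
exists (Num.min d1 d2); first by rewrite lt_min d10.
move=> j; rewrite inE => jl t t' x; rewrite lt_min => /andP[l1 l2].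
case/predU1P: jl => [->|jl]; last exact: h1.
by apply: h2 => //; rewrite subrr normr0.
Qed.

Variables (D : R) (omega : E -> R) (hmol : mollifier D omega).
Variables (eta : R) (eta0 : 0 < eta) (T : R) (T0 : 0 < T).
Variables (F F1 F1' F1'' F2 F2' F2'' F''' : R -> R) (M2 B Cp CP : R) (CP0 : 0 < CP).
Hypothesis hpot : potential_data CP F F1 F1' F1'' F2 F2' F2'' F''' M2 B Cp.
Local Notation F' := (fun u => F1' u + F2' u).
Local Notation F'' := (fun u => F1'' u + F2'' u).
Variables (rho0 : E -> R) (P mu M : R -> E -> R) (a : 'I_d -> R -> E -> R) (b : 'I_d -> 'I_d -> R -> E -> R) (K : R -> R).
Hypothesis href : reference omega eta T F F' F'' rho0 P mu M a b K.
Local Notation k := (scaled omega eta).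
Local Notation tm := (time_measure T).

Lemma reference_bounded : exists A, reference_bounds F F1' F1'' F2' F2'' P mu M a b K A.
Proof.
have cF := DER_continuous (dF hpot); have cF' := DER_continuous (dF' hpot).
have [_ [_ h1 h2 _] _ _ _] := hpot.
have cid' : continuous (fun u : R => u) by move=> u; exact: cvg_id.
have cp := DER_continuous (DER_pressure (dF hpot) (dF' hpot)).
have cp' : continuous (fun u : R => u * F'' u) by apply: contM => //; exact: contD.
have bP := ref_bP href.
have bad n (f : 'I_n -> R -> E -> R) : (forall i, buc (f i)) -> exists2 C, 0 <= C & forall i t x, `|f i t x| <= C.
  move=> bf; have [C hC] : {C : 'I_n -> R & forall i, 0 < C i /\ forall t x, `|f i t x| <= C i}.
    apply: (@choice _ _ (fun i (C : R) => 0 < C /\ forall t x, `|f i t x| <= C)) => i; by have [C C0 h] := buc_bounded (bf i); exists C.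
  exists (\sum_i C i) => [|i t x]; first by apply: sumr_ge0 => i _; have [/ltW] := hC i.
  apply: (le_trans ((hC i).2 t x)); rewrite (bigD1 i)//= lerDl; apply: sumr_ge0 => j _.
  by have [/ltW] := hC j.
have [A1 A10 hA1] := buc_bounded bP.
have [A2 A20 hA2] := buc_bounded (buc_comp cp bP).
have [A3 A30 hA3] := buc_bounded (buc_comp cp' bP).
have [A4 A40 hA4] := buc_bounded (ref_bmu href).
have [A5 A50 hA5] := buc_bounded (ref_bM href).
have [A6 A60 hA6] := bad _ _ (ref_ba href).
have [A7 hA7'] : {A7 : 'I_d -> R & forall i, 0 <= A7 i /\ forall j t x, `|b i j t x| <= A7 i}.
  apply: (@choice _ _ (fun i (C : R) => 0 <= C /\ forall j t x, `|b i j t x| <= C)) => i; by have [C C0 h] := bad _ _ (ref_bb href i); exists C.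
have [A8 A80 hA8] := buc_bounded (buc_sum (index_enum 'I_d) (fun i => ref_bb href i i)).
have bK := bucB (bucB (buc_comp cF bP) (bucM bP (buc_comp cF' bP))) (bucZ 2^-1 (bucM bP (buc_cB hmol eta0 bP))).
have [A9 A90 hA9] := buc_bounded bK.
have S7 : 0 <= \sum_i A7 i by apply: sumr_ge0 => i _; have [] := hA7' i.
have hA7 i j t x : `|b i j t x| <= \sum_i A7 i.
  apply: (le_trans ((hA7' i).2 j t x)); rewrite (bigD1 i)//= lerDl; apply: sumr_ge0 => l _.
  by have [] := hA7' l.
have hK t : `|K t| <= A9 by rewrite (ref_K href); apply: Rint_tor_bound; [exact: (tor_buc t bK)|exact: (hA9 t)].
pose A := Num.max A1 (Num.max A2 (Num.max A3 (Num.max A4 (Num.max A5 (Num.max A6 (Num.max (\sum_i A7 i) (Num.max A8 A9))))))).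
exists A.
have l1 : A1 <= A by rewrite /A !le_max lexx ?orbT.
have l2 : A2 <= A by rewrite /A !le_max lexx ?orbT.
have l3 : A3 <= A by rewrite /A !le_max lexx ?orbT.
have l4 : A4 <= A by rewrite /A !le_max lexx ?orbT.
have l5 : A5 <= A by rewrite /A !le_max lexx ?orbT.
have l6 : A6 <= A by rewrite /A !le_max lexx ?orbT.
have l7 : (\sum_i A7 i) <= A by rewrite /A !le_max lexx ?orbT.
have l8 : A8 <= A by rewrite /A !le_max lexx ?orbT.
have l9 : A9 <= A by rewrite /A !le_max lexx ?orbT.
split; [split|split| |].
- exact: lt_le_trans l1.
- by move=> t x; exact: le_trans l1.
- by move=> t x; exact: le_trans l2.
- by move=> t x; exact: le_trans l3.
- by move=> t x; exact: le_trans l4.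
- by move=> t x; exact: le_trans l5.
- by move=> i t x; exact: le_trans l6.
- by move=> i j t x; exact: le_trans l7.
- by move=> t x; exact: le_trans l8.
- by move=> t; exact: le_trans l9.
Qed.

(** At the initial time theta is evaluated at P itself, so that all that
    depends on the density cancels and the kinetic energy remains: the initial
    data are well prepared. *)
Lemma initial_gapE (u0 : E -> E) : L1 tor (fun x => enorm (u0 x) ^+ 2) ->
  initial_gap omega eta F rho0 mu K u0 = 2^-1 * \int[tor]_x (rho0 x * enorm (u0 x) ^+ 2).
Proof.
move=> hu; have cF := DER_continuous (dF hpot); have cF' := DER_continuous (dF' hpot).
have ik : L1 leb k := L1_kernel hmol eta0.
have b0 : buc (fun=> rho0) by rewrite -(ref_init href); exact: (buc_static 0 (ref_bP href)).
have [A A0 hr] := buc_bounded b0; have p0 := pl2_buc 0 b0.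
have i1 : L1 tor (fun x => rho0 x * enorm (u0 x) ^+ 2).
  exact: (@L1_mul_bounded _ _ _ tor rho0 (fun x => enorm (u0 x) ^+ 2) A (buc_measurable_at 0 b0) (hr 0) hu).
have b1 := buc_comp cF b0; have b2 := buc_comp cF' b0; have bB := buc_cB hmol eta0 b0.
have j1 := tor_buc 0 b1; have j2 := tor_buc 0 (bucM b0 b2); have j3 := tor_buc 0 (bucM b0 bB).
rewrite /initial_gap /E_0 (ref_K href) (ref_init href) !torus_measureE.
have -> : \int[tor]_x (2^-1 * (rho0 x * enorm (u0 x) ^+ 2) + F (rho0 x)) =
   2^-1 * \int[tor]_x (rho0 x * enorm (u0 x) ^+ 2) + \int[tor]_x F (rho0 x).
  by rewrite (RintD (L1Z _ i1) j1) (RintZ _ i1).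
have -> : \int[tor]_x (F (rho0 x) - rho0 x * F' (rho0 x) - 2^-1 * (rho0 x * cB omega eta rho0 x)) =
   \int[tor]_x F (rho0 x) - \int[tor]_x (rho0 x * F' (rho0 x)) - 2^-1 * \int[tor]_x (rho0 x * cB omega eta rho0 x).
  by rewrite (RintB (L1B j1 j2) (L1Z _ j3)) (RintB j1 j2) (RintZ _ j3).
have -> : \int[tor]_x (mu 0 x * rho0 x) = \int[tor]_x (rho0 x * cB omega eta rho0 x) + \int[tor]_x (rho0 x * F' (rho0 x)).
  by rewrite -(RintD j3 j2); apply: eq_Rint => x; rewrite (ref_mu href) (ref_init href); ring.
have -> : \int[tor]_x \int[leb]_y (k y * `|rho0 x - rho0 (x - y)| ^+ 2) = 2 * (\int[tor]_x (rho0 x * rho0 x) - cform k rho0 rho0).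
  rewrite -(Rint_double_diff hmol eta0 p0 p0 (pl2_mul 0 b0 p0)); apply: eq_Rint => x; apply: eq_Rint => y.
  by rewrite real_normK ?num_real// expr2 mulrA.
have -> : \int[tor]_x (rho0 x * cB omega eta rho0 x) = eta ^- 2 * (\int[tor]_x (rho0 x * rho0 x) - cform k rho0 rho0).
  have [l1 ->] := cform_convol ik p0 p0.
  rewrite -(RintB (pl2M p0 p0) l1) -(RintZ _ (L1B (pl2M p0 p0) l1)).
  by apply: eq_Rint => x; rewrite /cB; set c := eta ^- 2; ring.
have -> : (4 * eta ^+ 2)^-1 = eta ^- 2 / 4 by rewrite invfM mulrC.
by set c := eta ^- 2; field.
Qed.

Hypothesis hr0 : forall x, 0 <= rho0 x.
Variables (CF : R) (u0 : R -> E -> E) (s : R -> mv_data R d).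
Hypothesis hu : forall eps, 0 < eps -> L1 tor (fun x => enorm (u0 eps x) ^+ 2).
Hypothesis hu0 : forall e, 0 < e -> \forall eps \near 0^'+, \int[tor]_x enorm (u0 eps x) ^+ 2 <= e.
Hypothesis hs : forall eps, 0 < eps -> mv_solution omega F T eps eta (s eps) CF rho0 (u0 eps).
Hypothesis hdiss : forall eps, 0 < eps -> dissipative omega F T eps eta (s eps) rho0 (u0 eps).
Hypothesis hpo : forall eps, 0 < eps -> nonlocal_poincare omega T eta (s eps) CP rho0.

Lemma gap_small e : 0 < e -> \forall eps \near 0^'+, 0 <= initial_gap omega eta F rho0 mu K (u0 eps) <= e.
Proof.
move=> e_gt0.
have b0 : buc (fun=> rho0) by rewrite -(ref_init href); exact: (buc_static 0 (ref_bP href)).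
have [A A0 hr] := buc_bounded b0.
have eA : 0 < 2 * e / A by rewrite divr_gt0// mulr_gt0.
move: (hu0 eA); apply: filterS2 (nbhs_right_gt 0) => eps eps0 h.
have i0 := hu eps0; rewrite (initial_gapE i0).
have i1 : L1 tor (fun x => rho0 x * enorm (u0 eps x) ^+ 2).
  exact: (@L1_mul_bounded _ _ _ tor rho0 (fun x => enorm (u0 eps x) ^+ 2) A (buc_measurable_at 0 b0) (hr 0) i0).
have h1 : 0 <= \int[tor]_x (rho0 x * enorm (u0 eps x) ^+ 2).
  by apply: Rint_ge0 => x; rewrite mulr_ge0// sqr_ge0.
have h2 : \int[tor]_x (rho0 x * enorm (u0 eps x) ^+ 2) <= A * \int[tor]_x enorm (u0 eps x) ^+ 2.
  rewrite -(RintZ _ i0); apply: (le_Rint i1 (L1Z _ i0)) => x.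
  by rewrite ler_wpM2r ?sqr_ge0// (le_trans (ler_norm _))// (hr 0).
rewrite mulr_ge0//=; move: h; rewrite ler_pdivlMr// mulrC => h.
by move: h2 h; set q := A * _; lra.
Qed.

(** The order of choices matters: first q, so that the freezing error is small,
    then the mesh and the number N of grid cells, given by the modulus of
    continuity of grad mu and of its gradient, and only then epsilon, depending
    on N and on the initial velocities. *)
Theorem deviation_small e : 0 < e -> \forall eps \near 0^'+, {ae tm, forall t : RT,
  good_time omega eta T F CP P CF (s eps) t /\
  devX P (s eps) t + devZ F1 F1' P (s eps) t + bar_ru2 (s eps) t (cst 1) <= e}.
Proof.
move=> e_gt0; have [A hA] := reference_bounded.
have [[A0 hA1 hA2 hA3] [_ _ baA bbA] _ _] := hA.
pose base := \int[tor]_x (mu 0 x * rho0 x) + K 0.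
(* The initial energy is at most this number as soon as the initial kinetic
   energy is at most 1; all constants below are computed from it and do not
   depend on epsilon. *)
pose e0 := base + 1.
have c00 := c0_gt0 CP0 hpot; set c0 := CP^-1 - M2 / 2 in c00.
pose S := energy_const M2 CP A e0; pose Q0 := momentum_const M2 CP A e0.
pose KV := Kv omega eta Cp CF A.
have KV0 : 0 <= KV := Kv_ge0 omega eta hpot CF (And4 A0 hA1 hA2 hA3).
pose C := gronwall_const omega eta M2 Cp CP A CF.
pose C1 := 2 * expR (2 * C * T); have C10 : 0 < C1 by rewrite mulr_gt0// expR_gt0.
pose c3 := 3 + c0^-1; have c30 : 0 < c3 by rewrite addr_gt0// invr_gt0.
(* m is the budget for the initial gap and the three residual terms, a quarter
   each. *)
pose m := e / c3 / C1; have m0 : 0 < m by rewrite !divr_gt0.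
have hgap1 := gap_small ltr01; have m40 : 0 < m / 4 by rewrite divr_gt0.
have hgap2 := gap_small m40.
have S0 : 0 <= S.
  have hh : \forall eps \near (0 : R)^'+, 0 <= S.
    move: hgap1; apply: filterS2 (nbhs_right_gt 0) => eps eps0 /andP[_ g1].
    apply: (energy_const_ge0 hmol eta0 T0 CP0 hpot href hA (hs eps0) (hdiss eps0) (hpo eps0)).
    by move: g1; rewrite /initial_gap /e0 /base; lra.
  by have [eps h] := filter_ex hh.
have Q00 : 0 <= Q0.
  rewrite /Q0 /momentum_const -/S; have := sqr_ge0 A; lra.
pose Kq := d%:R * KV * ((1 + S) * T + S).
have Kq0 : 0 <= Kq.
  apply: mulr_ge0; first exact: mulr_ge0.
  by apply: addr_ge0 => //; apply: mulr_ge0; [exact: addr_ge0|exact: ltW].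
pose q := m / 4 / (Kq + 1); have q0 : 0 < q by rewrite divr_gt0// ltr_wpDl.
have [d1 d10 osc_a] := uniform_oscillation (ref_ba href) q0.
have bb2 (ij : 'I_d * 'I_d) : buc (b ij.1 ij.2) := ref_bb href ij.1 ij.2.
have [d2 d20 osc_b] := uniform_oscillation bb2 q0.
pose delta := Num.min d1 d2; have delta0 : 0 < delta by rewrite lt_min d10.
pose N := Num.bound (T / delta).
have hN : T / N.+1%:R < delta.
  rewrite ltr_pdivrMr ?ltr0n// mulrC -ltr_pdivrMr//.
  apply: (lt_trans (archi_boundP _)); first by rewrite divr_ge0// ltW.
  by rewrite ltr_nat.
pose L1_ := A * d%:R ^+ 2 * S; have L10 : 0 <= L1_.
  by apply: mulr_ge0 => //; apply: mulr_ge0; [exact: ltW|exact: sqr_ge0].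
pose L2_ := N.+1%:R * (2 * (d%:R * (2 * (A * Q0)))); have L20 : 0 <= L2_.
  by apply: mulr_ge0 => //; apply: mulr_ge0 => //; apply: mulr_ge0 => //; apply: mulr_ge0 => //; apply: mulr_ge0 => //; exact: ltW.
have r1 : 0 < m / 4 / (L1_ + 1) by rewrite divr_gt0// ltr_wpDl.
have r2_ : 0 < m / 4 / (L2_ + 1) by rewrite divr_gt0// ltr_wpDl.
have h1 := nbhs_right_lt ltr01; have h2 := nbhs_right_lt r1; have h3 := nbhs_right_lt r2_.
near=> eps.
have eps0 : 0 < eps by near: eps; exact: nbhs_right_gt.
have eps1 : eps < 1 by near: eps; exact: h1.
have eps2 : eps < m / 4 / (L1_ + 1) by near: eps; exact: h2.
have eps3 : eps < m / 4 / (L2_ + 1) by near: eps; exact: h3.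
have /andP[g0 g1] : 0 <= initial_gap omega eta F rho0 mu K (u0 eps) <= 1 by near: eps; exact: hgap1.
have /andP[_ g2] : 0 <= initial_gap omega eta F rho0 mu K (u0 eps) <= m / 4 by near: eps; exact: hgap2.
have hE0 : E_0 omega F eta rho0 (u0 eps) <= e0.
  by move: g1; rewrite /initial_gap /e0 /base; lra.
have oa i t t' x : `|t - t'| < delta -> `|a i t x - a i t' x| <= q.
  by rewrite lt_min => /andP[l1 _]; exact: osc_a.
have ob i j t t' x : `|t - t'| < delta -> `|b i j t x - b i j t' x| <= q.
  by rewrite lt_min => /andP[_ l2]; exact: (osc_b (i, j)).
have hth := theta_small hmol eta0 T0 CP0 hpot href hA eps0 (hs eps0) (hdiss eps0) (hpo eps0) hE0 q0 hN oa ob g0.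
have hE := energy_bounds hmol eta0 CP0 hpot href hA (hs eps0) (hdiss eps0) (hpo eps0) hE0.
have hres : residual omega eta T M2 Cp CP A CF eps e0 q N <= m / 4 + m / 4 + m / 4.
  rewrite /residual -/S -/Q0 -/KV -/Kq; apply: lerD; first apply: lerD.
  - have -> : A * d%:R ^+ 2 * (eps ^+ 2 * S) = eps ^+ 2 * L1_ by rewrite /L1_; ring.
    apply: (@le_trans _ _ (eps * (L1_ + 1))); last by rewrite -ler_pdivlMr ?ltr_wpDl// ltW.
    apply: ler_pM => //; [exact: sqr_ge0| |by rewrite lerDl].
    by rewrite expr2 ler_piMr ?ltW.
  - apply: (@le_trans _ _ (q * (Kq + 1))); first by rewrite ler_wpM2l ?(ltW q0)// lerDl.
    by rewrite /q divfK// gt_eqF// ltr_wpDl.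
  - have -> : N.+1%:R * (2 * (d%:R * (eps * (2 * (A * Q0))))) = eps * L2_ by rewrite /L2_; ring.
    apply: (@le_trans _ _ (eps * (L2_ + 1))); first by rewrite ler_wpM2l ?(ltW eps0)// lerDl.
    by rewrite -ler_pdivlMr ?ltr_wpDl// ltW.
move: (ae_and hth hE); apply: filterS => t [ht [gt _ _ _]]; split => //.
have th : theta omega eta F mu K (s eps) t <= e / c3.
  apply: (le_trans ht); rewrite mulrAC -/C1 mulrC -ler_pdivlMr//.
  apply: (le_trans (lerD g2 hres)); rewrite -/m [leRHS](_ : m = m / 4 + (m / 4 + m / 4 + m / 4))//; by field.
have hc := coercive hmol eta0 CP0 hpot href gt; rewrite -/c0 in hc.
have X0 := devX_ge0 P (s eps) t; have Z0 := devZ_ge0 hpot P (s eps) t; have rr0 := r2_ge0 gt.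
have hY : bar_ru2 (s eps) t (cst 1) = 2 * devY (s eps) t by rewrite /devY; field.
have Y0 : 0 <= devY (s eps) t by rewrite /devY mulr_ge0.
apply: (@le_trans _ _ (c3 * theta omega eta F mu K (s eps) t)); last by rewrite mulrC -ler_pdivlMr.
by rewrite hY; exact: (coercive_arith c00 (And3 X0 Y0 Z0) hc).
Unshelve. all: by end_near. Qed.

End mv_limit.

(** * Wasserstein distance to a point mass and total variation *)

Section point_coupling.
Context {R : realType} {d : nat}.
Local Notation E := 'rV[R]_d.
Local Notation Y := (R * E)%type.
Local Opaque lebesgue_row.
Variables (s : mv_data R d) (z : R * E) (p : Y).

Let mgraph : measurable_fun setT (fun l : Y => (l, p)).
Proof. by apply/measurable_fun_pairP; split; [exact: measurable_id|exact: (@measurable_cst _ _ Y Y setT p)]. Qed.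

Let graph_measure : {measure set (Y * Y) -> \bar R} :=
  measure_function_pushforward__canonical__measure_function_Measure (young s z) mgraph.

(** The image of the Young measure by l |-> (l, p), the only coupling with a
    Dirac mass at p. *)
Definition point_coupling : set (Y * Y) -> \bar R := pushforward (young s z) (fun l : Y => (l, p)).

HB.instance Definition _ := isMeasure.Build _ _ _ point_coupling
  (measure0 graph_measure) (measure_ge0 graph_measure) (@measure_semi_sigma_additive _ _ _ graph_measure).

Let point_coupling_setT : point_coupling setT = 1%E.
Proof. by rewrite /point_coupling /pushforward preimage_setT prob_kernel. Qed.

HB.instance Definition _ := @Measure_isProbability.Build _ _ R point_coupling point_coupling_setT.

Lemma dirac_prod (A : set Y) : measurable A -> (\d_p.1 \x \d_p.2 : set Y -> \bar R)%E A = (\d_p A : \bar R).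
Proof.
move=> mA; rewrite /product_measure1 /= integral_dirac//; last exact: measurable_fun_xsection.
rewrite diracT mul1e !diracE; congr (_%:R%:E); congr nat_of_bool.
by rewrite mem_xsection -surjective_pairing.
Qed.

Lemma point_couplingP : coupling (young s z) (\d_p.1 \x \d_p.2)%E point_coupling.
Proof.
move=> A mA; split.
  change (young s z [set l | A l /\ True] = young s z A); congr (young s z _).
  by apply/seteqP; split => l /= => [[]|].
rewrite (dirac_prod mA) diracE; change (young s z [set l | True /\ A p] = (p \in A)%:R%:E).
have [pA|pA] := pselect (A p).
  rewrite mem_set// (_ : [set l | _] = setT) ?prob_kernel//; by apply/seteqP; split.
by rewrite memNset// (_ : [set l | _] = set0) ?measure0//; apply/seteqP; split => l //= [].
Qed.

(** The cost of the coupling with a point is the second moment around this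
    point. *)
Lemma W2_point : (W2 (young s z) (\d_p.1 \x \d_p.2) ^+ 2 <=
  \int[young s z]_l (`|l.1 - p.1| ^+ 2 + enorm (l.2 - p.2) ^+ 2)%:E)%E.
Proof.
rewrite /W2 sqr_sqrte; last first.
  by apply: le_ereal_inf_tmp => _ [pi _ <-]; apply: integral_ge0 => w _; rewrite lee_fin addr_ge0// sqr_ge0.
apply: ereal_inf_lbound; exists point_coupling; first exact: point_couplingP.
have msub : measurable_fun setT (fun w : Y * Y => w.1.2 - w.2.2).
  apply: measurable_rowP => i; rewrite /comp /=; under eq_fun do rewrite !mxE.
  apply: measurable_funB.
    exact: (measurableT_comp (measurable_coord i) (measurableT_comp measurable_snd measurable_fst)).
  exact: (measurableT_comp (measurable_coord i) (measurableT_comp measurable_snd measurable_snd)).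
have m1 : measurable_fun setT (fun w : Y * Y => `|w.1.1 - w.2.1|).
  apply: measurableT_comp => //; apply: measurable_funB.
    exact: (measurableT_comp measurable_fst measurable_fst).
  exact: (measurableT_comp measurable_fst measurable_snd).
rewrite (@ge0_integral_pushforward _ _ _ _ _ _ mgraph)//.
  apply/measurable_EFinP; apply: measurable_funD; first exact: measurable_funX.
  by apply: measurable_funX; exact: (measurableT_comp (@measurable_enorm R d) msub).
by move=> w _; rewrite lee_fin addr_ge0// sqr_ge0.
Qed.

End point_coupling.

Section monotone.
Context d (U : measurableType d) (R : realType) (m : {measure set U -> \bar R}).
Import HBNNSimple.

(** The distance W2 is not known to be measurable in x, so monotonicity is
    needed without measurability; integrals of nonnegative functions are
    suprema over simple functions. *)
Lemma ge0_le_integral_all (f g : U -> \bar R) : (forall x, 0 <= f x)%E -> (forall x, f x <= g x)%E ->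
  (\int[m]_x f x <= \int[m]_x g x)%E.
Proof.
move=> f0 fg; have g0 x : (0 <= g x)%E := le_trans (f0 x) (fg x).
rewrite !ge0_integralTE//; apply: ge_ereal_sup => _ [h /= hf <-].
by apply: ereal_sup_ubound; exists h => //= x; exact: le_trans (hf x) (fg x).
Qed.

End monotone.

Section total_variation.
Context {R : realType} {d : nat}.
Local Notation E := 'rV[R]_d.

Lemma vec_variation_ge0 (I : finType) (mu : I -> set E -> \bar R) : (0 <= vec_variation mu cube)%E.
Proof.
apply: (@le_trans _ _ (\sum_(k < 1) (Num.sqrt (\sum_i fine (mu i cube) ^+ 2))%:E)%E).
  by apply: sume_ge0 => k _; rewrite lee_fin sqrtr_ge0.
apply: ereal_sup_ubound; exists 1%N, (fun=> cube); split => //.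
- by move=> k; exact: measurable_cube.
- by move=> i j _ _ _; rewrite [i]ord1 [j]ord1.
- by apply/seteqP; split => [x [i _]|x Cx]//; exists ord0.
Qed.

(** For a nonnegative measure every partition gives the same sum. *)
Lemma tv_norm_measure (m : {finite_measure set E -> \bar R}) : (tv_norm m <= m cube)%E.
Proof.
apply: ub_ereal_sup => _ [n [B [mB tB UB ->]]].
have -> : m cube = (\sum_(k < n) m (B k))%E.
  rewrite -UB -(@measure_bigsetU_ord _ _ _ m n xpredT B mB tB) -bigcup_seq; congr (m _).
  by apply/seteqP; split => x [i _ Bx]; exists i => //=; rewrite mem_index_enum.
apply: lee_sum => k _; rewrite big_const card_unit /= addr0 sqrtr_sqr ger0_norm ?fine_ge0//.
by rewrite fineK// fin_num_measure.
Qed.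

End total_variation.

(** * Convergence to the classical solution *)

Section conclusions.
Context {R : realType} {d : nat}.
Local Notation E := 'rV[R]_d.
Local Notation Y := (R * E)%type.
Local Notation tor := (torus_prob d : probability E R).
Local Notation RT := (measurableTypeR R).
Local Opaque lebesgue_row.
Variables (omega : E -> R) (eta T : R) (F : R -> R) (CP CF : R) (P : R -> E -> R) (s : mv_data R d) (t : R).
Hypothesis gt : good_time omega eta T F CP P CF s t.
Local Notation J := (joint s t).
Local Notation r2 := (bar_ru2 s t (cst 1)).

(** Jensen's inequality, component by component. *)
Lemma sru_le : (\int[torus_measure]_x (enorm (mv_sru s t x) ^+ 2)%:E <= r2%:E)%E.
Proof.
pose g i (l : Y) := l.2 ord0 i.
have mg i : measurable_fun setT (g i) := measurableT_comp (measurable_coord i) measurable_snd.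
have i0 i : L1 J (fun z => g i z.2 ^+ 2).
  apply: (@L1_le _ _ _ J _ (fun z : E * Y => enorm z.2.2 ^+ 2) _ (gt_u2 gt)).
    by apply: measurable_funX; exact: (measurableT_comp (mg i) measurable_snd).
  by move=> z; rewrite ger0_norm ?sqr_ge0// coord_sq_le.
have i1 i : L1 tor (fun x => ymean s (g i) t x ^+ 2) by have [] := ymean_sq_le (mg i) (i0 i).
have h1 i : \int[tor]_x ymean s (g i) t x ^+ 2 <= \int[J]_z g i z.2 ^+ 2.
  have [_ _ h] := ymean_sq_le (mg i) (i0 i); have [_ k2 ->] := Rint_joint (i0 i).
  exact: (ae_le_Rint (i1 i) k2 h).
have EE x : enorm (mv_sru s t x) ^+ 2 = \sum_i ymean s (g i) t x ^+ 2.
  rewrite sqr_sqrtr; last by apply: sumr_ge0 => i _; exact: sqr_ge0.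
  by apply: eq_bigr => i _; rewrite mxE.
have i2 : L1 tor (fun x => \sum_i ymean s (g i) t x ^+ 2) := L1_sum _ i1.
have -> : (\int[torus_measure]_x (enorm (mv_sru s t x) ^+ 2)%:E = (\int[tor]_x \sum_i ymean s (g i) t x ^+ 2)%:E)%E.
  by rewrite (EFin_Rint i2); apply: eq_integral => x _; rewrite EE.
rewrite lee_fin (Rint_sum _ i1); apply: le_trans (enorm_le_r2 gt).
have -> : \int[J]_z enorm z.2.2 ^+ 2 = \sum_i \int[J]_z g i z.2 ^+ 2.
  rewrite -(Rint_sum _ i0); apply: eq_Rint => z; rewrite sqr_sqrtr//.
  by apply: sumr_ge0 => i _; exact: sqr_ge0.
by apply: ler_sum => i _.
Qed.

(** The second moment around (P, 0), integrated over the torus, is the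
    quadratic deviation plus the kinetic energy. *)
Lemma W2_le (bP : buc P) : L1 J (fun z => (z.2.1 - P t z.1) ^+ 2) ->
  (\int[torus_measure]_x W2 (young s (t, x)) (\d_(P t x) \x \d_(0%R : E)) ^+ 2 <= (dev P s t + r2)%:E)%E.
Proof.
move=> i1; have i2 := gt_u2 gt.
apply: (@le_trans _ _ (\int[tor]_x \int[young s (t, x)]_l (`|l.1 - P t x| ^+ 2 + enorm (l.2 - 0) ^+ 2)%:E)%E).
  apply: ge0_le_integral_all => x; first by rewrite expe2 mule_ge0 ?sqrte_ge0.
  exact: (@W2_point R d s (t, x) (P t x, 0)).
have i3 := L1D i1 i2.
rewrite -(@ge0_integral_joint _ _ s t (fun z => (`|z.2.1 - P t z.1| ^+ 2 + enorm (z.2.2 - 0) ^+ 2)%:E)%E); last 2 first.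
- have := L1_measurable i3 => /measurable_EFinP; congr (measurable_fun _ _).
  by apply/funext => z /=; rewrite subr0 real_normK ?num_real.
- by move=> z; rewrite lee_fin addr_ge0// sqr_ge0.
have -> : (\int[J]_z (`|z.2.1 - P t z.1| ^+ 2 + enorm (z.2.2 - 0) ^+ 2)%:E = (\int[J]_z ((z.2.1 - P t z.1) ^+ 2 + enorm z.2.2 ^+ 2))%:E)%E.
  rewrite (EFin_Rint i3); apply: eq_integral => z _.
  by rewrite subr0 real_normK ?num_real.
by rewrite lee_fin (RintD i1 i2) lerD2l; exact: enorm_le_r2 gt.
Qed.

Lemma mass_rF_le : (tv_norm (m_rF' s t) <= (`|CF| * (mass_F s t + mass_rho2 s t))%:E)%E.
Proof.
apply: (le_trans (gt_rFv gt)).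
rewrite (finite_cube (m_F s t)) (finite_cube (m_rho2 s t)) -!EFinM -EFinD lee_fin -mulrDr ler_wpM2r ?ler_norm//.
by rewrite addr_ge0 ?fine_ge0.
Qed.

End conclusions.

Theorem theorem7p1 (R : realType) (d : nat) (hd : (0 < d)%N) (T : R) (hT : 0 < T)
    (D : R) (omega : 'rV[R]_d -> R) (homega : mollifier D omega)
    (eta0 CP : R) (heta0 : 0 < eta0) (hCP : 0 < CP)
    (hP : poincare_constants omega eta0 CP)
    (F : R -> R) (hF : potential_assumption CP F)
    (CF : R) (hCF : CF_bound F CF)
    (eta : R) (heta : 0 < eta < eta0)
    (rho0 : 'rV[R]_d -> R) (hrho0 : Zd_periodic rho0) (hrho0C : Ck 3 rho0)
    (sigma : R) (hsigma : 0 < sigma) (hrho0s : forall x, sigma <= rho0 x)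
    (u0 : R -> 'rV[R]_d -> 'rV[R]_d)
    (hu0 : forall eps : R, 0 < eps -> Zd_periodic (u0 eps) /\
       measurable_fun setT (u0 eps) /\
       (L2norm (fun x => enorm (u0 eps x)) < +oo)%E)
    (hu0lim : L2norm (fun x => enorm (u0 eps x)) @[eps --> 0^'+] --> 0%E)
    (s : R -> mv_data R d)
    (hs : forall eps : R, 0 < eps ->
       mv_solution omega F T eps eta (s eps) CF rho0 (u0 eps))
    (hdiss : forall eps : R, 0 < eps ->
       dissipative omega F T eps eta (s eps) rho0 (u0 eps))
    (hpoinc : forall eps : R, 0 < eps ->
       nonlocal_poincare omega T eta (s eps) CP rho0)
    (rho : R -> 'rV[R]_d -> R)
    (hrho : classical_solution omega F T eta rho0 rho) :
  [/\ ess_sup (time_measure T) (fun t =>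
        \int[torus_measure]_x (enorm (mv_sru (s eps) t x) ^+ 2)%:E)%E
        @[eps --> 0^'+] --> 0%E,
      ess_sup (time_measure T) (fun t =>
        \int[torus_measure]_x
          W2 (young (s eps) (t, x)) (\d_(rho t x) \x \d_(0%R : 'rV[R]_d)) ^+ 2)%E
        @[eps --> 0^'+] --> 0%E &
      [/\ ess_sup (time_measure T) (fun t => tv_norm (m_rho2 (s eps) t))
            @[eps --> 0^'+] --> 0%E,
          ess_sup (time_measure T)
            (fun t => tv_norm_mx (fun i j => m_ruu (s eps) i j t))
            @[eps --> 0^'+] --> 0%E,
          ess_sup (time_measure T) (fun t => tv_norm (m_ru2 (s eps) t))
            @[eps --> 0^'+] --> 0%E,
          ess_sup (time_measure T) (fun t => tv_norm (m_F (s eps) t))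
            @[eps --> 0^'+] --> 0%E &
          ess_sup (time_measure T) (fun t => tv_norm (m_rF' (s eps) t))
            @[eps --> 0^'+] --> 0%E]].
Proof.
have /andP[eta_gt0 eta_lt] := heta.
have [F1 [F1' [F1'' [F2 [F2' [F2'' [F''' [M2 [B [Cp hpot]]]]]]]]]] := potential_facts hF.
have [[FE0 _ _ _ _] [dF'' _ _ cF'''] [F1p _ _] [_ M2lt hM2 _] _] := hpot.
have etaCP := poincare_constant_ge homega eta_gt0 hd hCP hP eta_lt.
(* Parabolicity of the classical equation, from the lower bound on the Poincare
   constant. *)
have coef u : 0 <= (F1'' u + F2'' u) + eta ^- 2.
  have h1 := F1p u; have := hM2 u; rewrite ler_norml => /andP[h2 _].
  have h3 : CP^-1 <= eta ^- 2 by rewrite lef_pV2// ?posrE// exprn_gt0.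
  by move: h1 h2 h3 M2lt; set p := eta ^- 2; set c := CP^-1; lra.
have href := classical_reference homega eta_gt0 hT (dF hpot) (dF' hpot) dF'' cF''' hrho coef hsigma hrho0s.
have hr0 x : 0 <= rho0 x := le_trans (ltW hsigma) (hrho0s x).
have intE eps : (L2norm (fun x => enorm (u0 eps x)) ^+ 2 = \int[torus_prob d : probability 'rV[R]_d R]_x (enorm (u0 eps x) ^+ 2)%:E)%E.
  exact: L2norm_sq.
have hu eps : 0 < eps -> L1 (torus_prob d : probability 'rV[R]_d R) (fun x => enorm (u0 eps x) ^+ 2).
  move=> eps0; have [_ [mu hfin]] := hu0 eps eps0; apply: L1P.
    by apply: measurable_funX; exact: (measurableT_comp (@measurable_enorm R d) mu).
  rewrite (eq_integral (fun x => (enorm (u0 eps x) ^+ 2)%:E)); last by move=> x _; rewrite ger0_norm ?sqr_ge0.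
  rewrite -intE expe2 lte_mul_pinfty ?Lnorm_ge0//.
  by rewrite ge0_fin_numE ?Lnorm_ge0.
have hu0' e : 0 < e -> \forall eps \near 0^'+, \int[torus_prob d : probability 'rV[R]_d R]_x enorm (u0 eps x) ^+ 2 <= e.
  move=> e_gt0; pose q := Num.min 1 e; have q0 : 0 < q by rewrite lt_min ltr01.
  have hq : \forall eps \near 0^'+, (L2norm (fun x => enorm (u0 eps x)) < q%:E)%E.
    have h0q : (0%E < q%:E)%E by rewrite lte_fin.
    exact: (hu0lim _ (open_ereal_lt' h0q)).
  move: hq; apply: filterS2 (nbhs_right_gt 0) => eps eps0 h.
  rewrite -lee_fin (EFin_Rint (hu eps eps0)) -intE expe2.
  apply: (@le_trans _ _ (q%:E * q%:E)%E).
    by apply: lee_pmul; rewrite ?Lnorm_ge0// ltW.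
  rewrite -EFinM lee_fin; apply: (@le_trans _ _ (1 * e)); last by rewrite mul1r.
  by apply: ler_pM; [exact: ltW|exact: ltW| |]; rewrite /q ge_min lexx ?orbT.
have key e (e_gt0 : 0 < e) := deviation_small homega eta_gt0 hT hCP hpot href hr0 hu hu0' hs hdiss hpoinc e_gt0.
(* Each of the seven quantities is at most a constant times the total
   deviation, for almost every time. *)
have conv (f : R -> measurableTypeR R -> \bar R) (C : R) : 0 < C -> (forall eps t, (0 <= f eps t)%E) ->
   (forall eps t, 0 < t < T -> good_time omega eta T F CP (cP T rho) CF (s eps) t ->
      (f eps t <= (C * (devX (cP T rho) (s eps) t + devZ F1 F1' (cP T rho) (s eps) t + bar_ru2 (s eps) t (cst 1)))%:E)%E) ->
   ess_sup (time_measure T) (f eps) @[eps --> 0^'+] --> 0%E.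
  move=> C0 f0 hf; apply: ess_sup_cvg0 => // e e_gt0.
  have eC : 0 < e / C by rewrite divr_gt0.
  move: (key _ eC); apply: filterS => eps; apply: filterS => t [gt h].
  by apply: (le_trans (hf eps t (gt_T gt) gt)); rewrite lee_fin mulrC -ler_pdivlMr.
have X0 eps t := devX_ge0 (cP T rho) (s eps) t; have Z0 eps t := devZ_ge0 hpot (cP T rho) (s eps) t.
have tvr (eps t : R) : (0 <= tv_norm (m_rho2 (s eps) t))%E := vec_variation_ge0 _.
split; [| |split].
- apply: (conv _ 1) => //; first by move=> eps t; apply: integral_ge0 => x _; rewrite lee_fin sqr_ge0.
  move=> eps t tT gt; apply: (le_trans (sru_le gt)); rewrite lee_fin mul1r lerDr.
  by rewrite addr_ge0.
- apply: (conv _ 1) => //.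
    by move=> eps t; apply: integral_ge0 => x _; rewrite expe2 mule_ge0 ?sqrte_ge0.
  move=> eps t tT gt; have tT' : 0 <= t <= T by case/andP: tT => /ltW -> /ltW ->.
  have := W2_le gt (ref_bP href) (L1_diff2 href gt); rewrite (cP_in _ tT') => h; apply: (le_trans h).
  rewrite lee_fin mul1r lerD2r; apply: (@le_trans _ _ (devX (cP T rho) (s eps) t)); last by rewrite lerDl.
  by rewrite lerDl mass_rho2_ge0.
- apply: (conv _ 1) => // eps t tT gt.
  apply: (le_trans (tv_norm_measure _)); rewrite finite_cube lee_fin mul1r -addrA.
  apply: (@le_trans _ _ (devX (cP T rho) (s eps) t)); first by rewrite lerDr dev_ge0.
  by rewrite lerDl addr_ge0// (r2_ge0 gt).
- apply: (conv _ 1) => //; first by move=> eps t; exact: vec_variation_ge0.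
  move=> eps t tT gt; apply: (le_trans (gt_ruu gt)); rewrite finite_cube lee_fin mul1r.
  apply: (@le_trans _ _ (bar_ru2 (s eps) t (cst 1))); last by rewrite lerDr addr_ge0.
  by rewrite (bar_ru2_1 gt) lerDr; apply: Rint_ge0 => z; exact: sqr_ge0.
- apply: (conv _ 1) => //; first by move=> eps t; exact: vec_variation_ge0.
  move=> eps t tT gt; apply: (le_trans (tv_norm_measure _)); rewrite finite_cube lee_fin mul1r.
  apply: (@le_trans _ _ (bar_ru2 (s eps) t (cst 1))); last by rewrite lerDr addr_ge0.
  by rewrite (bar_ru2_1 gt) lerDr; apply: Rint_ge0 => z; exact: sqr_ge0.
- apply: (conv _ 1) => //; first by move=> eps t; exact: vec_variation_ge0.
  move=> eps t tT gt; apply: (le_trans (tv_norm_measure _)); rewrite finite_cube lee_fin mul1r.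
  apply: (@le_trans _ _ (devZ F1 F1' (cP T rho) (s eps) t)); first by rewrite lerDr (dev1_ge0 hpot).
  by rewrite addrAC lerDr addr_ge0// (r2_ge0 gt).
- have CF1 : 0 < `|CF| + 1 by rewrite ltr_wpDl.
  apply: (conv _ (`|CF| + 1) CF1); first by move=> eps t; exact: vec_variation_ge0.
  move=> eps t tT gt; apply: (le_trans (mass_rF_le gt)); rewrite lee_fin.
  have r0 := r2_ge0 gt; have x0 := dev_ge0 (cP T rho) (s eps) t; have z0 := dev1_ge0 hpot (cP T rho) (s eps) t.
  apply: ler_pM => //; [by rewrite addr_ge0 ?mass_F_ge0 ?mass_rho2_ge0|by rewrite lerDl|].
  by rewrite /devX /devZ; lra.
Qed.
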